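(* Let $L_{a_0}=D_t+(a_0+ib(t))P(x,D_x)$. Each of the following conditions is sufficient for $L_{a_0}$ to be $\mathcal S_\mu$-globally solvable: (a) $b\equiv0$ and $a_0$ satisfies condition $(\mathscr A)$; (b) $b\not\equiv0$ and $b$ does not change sign; (c) $b$ changes sign, $\mathcal Z^C=\mathbb N\setminus\mathcal Z$ is finite, and $\Omega_r$ is connected for every $r\in\mathbb R$.
   Context: Let $\mathbb T=\mathbb R/2\pi\mathbb Z$, $n\ge1$, $\mu\ge1/2$. Let $P=\sum_{|\alpha|+|\beta|\le m}c_{\alpha,\beta}x^\beta\partial_x^\alpha$, $c_{\alpha,\beta}\in\mathbb R$, order $m\ge2$, be self-adjoint and globally elliptic on $\mathbb R^n$ ($\sum_{|\alpha|+|\beta|=m}c_{\alpha,\beta}x^\beta(i\xi)^\alpha\ne0$ for $(x,\xi)\ne(0,0)$), with real eigenvalues $\lambda_j$ ($|\lambda_j|\sim\rho j^{m/(2n)}$) and orthonormal eigenfunctions $\varphi_j$. For $\sigma>1$, $\mathcal S_{\sigma,\mu}$ is the space of smooth $u$ on $\mathbb T\times\mathbb R^n$ with $\sup_{\alpha,\beta,\gamma}C^{-|\alpha+\beta|-\gamma}\gamma!^{-\sigma}(\alpha!\beta!)^{-\mu}\sup|x^\alpha\partial_x^\beta\partial_t^\gamma u|<\infty$ for some $C>0$; $\mathscr F_\mu=\bigcup_{\sigma>1}\mathcal S_{\sigma,\mu}$; $u=\sum u_j(t)\varphi_j(x)$. $D_t=i^{-1}\partial_t$; $a_0\in\mathbb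 R$, $b$ real Gevrey on $\mathbb T$, $b_0=\frac1{2\pi}\int_0^{2\pi}b$, $c_0=a_0+ib_0$, $\mathcal Z=\{j:\lambda_jc_0\in\mathbb Z\}$, $\Omega_r=\{t\in\mathbb T:\int_0^tb(s)ds>r\}$. The admissible space $\mathscr E_{L_{a_0},\mu}$ is the set of $f\in\mathscr F_\mu$ with $\int_0^{2\pi}\exp(i\lambda_j\int_0^t(a_0+ib(s))ds)f_j(t)dt=0$ for all $j\in\mathcal Z$; $L_{a_0}$ is $\mathcal S_\mu$-globally solvable if for every such $f$ there is $u\in\mathscr F_\mu$ with $L_{a_0}u=f$. Condition $(\mathscr A)$ for $\omega\in\mathbb C$: for every $\epsilon>0$ there is $C_\epsilon>0$ with $|\tau-\omega\lambda_j|\ge C_\epsilon\exp(-\epsilon j^{1/(2n\mu)})$ for all $(\tau,j)\in\mathbb Z\times\mathbb N$ with $\tau-\omega\lambda_j\ne0$. *)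

(* Defs.v *)
From Stdlib Require Import Reals ZArith.
From Coquelicot Require Import Coquelicot.
From mathcomp Require Import ssreflect ssrbool ssrfun eqtype ssrnat seq choice fintype finfun.

Set Implicit Arguments.
Unset Strict Implicit.
Unset Printing Implicit Defensive.

Local Open Scope R_scope.

Definition Pt (k : nat) := 'I_k -> R.
Definition mindex (k : nat) := 'I_k -> nat.

Definition upd {k} (x : Pt k) (i : 'I_k) (s : R) : Pt k :=
  fun j => if j == i then s else x j.

Definition mlen {k} (a : mindex k) : nat := sumn [seq a i | i <- enum 'I_k].
Definition mfact {k} (a : mindex k) : nat :=
  foldr Nat.mul 1%nat [seq fact (a i) | i <- enum 'I_k].
Definition xpow {k} (x : Pt k) (a : mindex k) : R :=
  foldr Rmult 1 [seq pow (x i) (a i) | i <- enum 'I_k].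

Definition cexp (z : C) : C := (exp (Re z) * cos (Im z), exp (Re z) * sin (Im z)).
Definition Csum (l : seq C) : C := foldr Cplus (RtoC 0) l.

Definition pd {k} (i : 'I_k) (g : Pt k -> C) (x : Pt k) : C :=
  (Derive (fun s => Re (g (upd x i s))) (x i),
   Derive (fun s => Im (g (upd x i s))) (x i)).
Definition has_pd {k} (i : 'I_k) (g : Pt k -> C) (x : Pt k) : Prop :=
  ex_derive (fun s => Re (g (upd x i s))) (x i) /\
  ex_derive (fun s => Im (g (upd x i s))) (x i).

Fixpoint dw {k} (w : seq 'I_k) (g : Pt k -> C) : Pt k -> C :=
  match w with [::] => g | i :: w' => pd i (dw w' g) end.
Definition dmi {k} (b : mindex k) (g : Pt k -> C) : Pt k -> C :=
  dw (flatten [seq nseq (b i) i | i <- enum 'I_k]) g.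

Definition contC {k} (g : Pt k -> C) : Prop :=
  forall x eps, 0 < eps -> exists delta, 0 < delta /\
    forall y, (forall i, Rabs (y i - x i) < delta) -> Cmod (Cminus (g y) (g x)) < eps.

Definition smooth {k} (g : Pt k -> C) : Prop :=
  forall w : seq 'I_k, contC (dw w g) /\ forall i x, has_pd i (dw w g) x.

Definition schwartz {k} (g : Pt k -> C) : Prop :=
  smooth g /\ forall a b : mindex k, exists K, forall x,
    Cmod (Cmult (RtoC (xpow x a)) (dmi b g x)) <= K.

(** Integral over R^k: iterated improper Riemann integral, coordinate by coordinate
    (used only for Schwartz-class integrands, where it is the Lebesgue integral). *)
Definition int_coord {k} (i : 'I_k) (h : Pt k -> R) : Pt k -> R :=
  fun x => RInt_gen (fun s => h (upd x i s)) (Rbar_locally m_infty) (Rbar_locally p_infty).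
Definition intR {k} (h : Pt k -> R) : R :=
  (foldr (fun i h' => int_coord i h') h (enum 'I_k)) (fun _ => 0).
Definition intC {k} (g : Pt k -> C) : C :=
  (intR (fun x => Re (g x)), intR (fun x => Im (g x))).
Definition inner {k} (g h : Pt k -> C) : C := intC (fun x => Cmult (g x) (Cconj (h x))).

Definition mindices (k m : nat) : seq (mindex k) :=
  [seq (fun i => nat_of_ord (a i)) | a : {ffun 'I_k -> 'I_m.+1} <- enum {ffun 'I_k -> 'I_m.+1}].

Definition Pop {n} (c : mindex n -> mindex n -> R) (m : nat) (v : Pt n -> C) : Pt n -> C :=
  fun x => Csum [seq Csum [seq (if (mlen a + mlen b <= m)%N
                               then Cmult (RtoC (c a b * xpow x b)) (dmi a v x)
                               else RtoC 0) | b <- mindices n m]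
                | a <- mindices n m].

Definition psymbol {n} (c : mindex n -> mindex n -> R) (m : nat) (x xi : Pt n) : C :=
  Csum [seq Csum [seq (if (mlen a + mlen b == m)%N
                       then Cmult (RtoC (c a b * xpow x b * xpow xi a)) (Cpow Ci (mlen a))
                       else RtoC 0) | b <- mindices n m]
        | a <- mindices n m].

Definition globally_elliptic {n} (c : mindex n -> mindex n -> R) (m : nat) : Prop :=
  forall x xi : Pt n, (exists i, x i <> 0 \/ xi i <> 0) -> psymbol c m x xi <> RtoC 0.

Definition self_adjoint {n} (c : mindex n -> mindex n -> R) (m : nat) : Prop :=
  forall g h : Pt n -> C, schwartz g -> schwartz h ->
    inner (Pop c m g) h = inner g (Pop c m h).

(** Functions on T x R^n: u : R -> Pt n -> C, 2pi-periodic in t.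
    flat u is the corresponding function on R^(1+n), coordinate 0 being t. *)
Definition flat {n} (u : R -> Pt n -> C) : Pt n.+1 -> C :=
  fun y => u (y ord0) (fun i => y (lift ord0 i)).
Definition tx {n} (t : R) (x : Pt n) : Pt n.+1 :=
  fun j => match unlift ord0 j with None => t | Some i => x i end.
Definition txindex {n} (g : nat) (b : mindex n) : mindex n.+1 :=
  fun j => match unlift ord0 j with None => g | Some i => b i end.

Definition periodicT {n} (u : R -> Pt n -> C) : Prop :=
  forall t x, u (t + 2 * PI) x = u t x.

Definition S_sm (n : nat) (sigma mu : R) (u : R -> Pt n -> C) : Prop :=
  smooth (flat u) /\ periodicT u /\
  exists Cc K, 0 < Cc /\
    forall (a b : mindex n) (g : nat) (t : R) (x : Pt n),
      Cmod (Cmult (RtoC (xpow x a)) (dmi (txindex g b) (flat u) (tx t x)))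
      <= K * pow Cc (mlen a + mlen b + g)
           * Rpower (INR (fact g)) sigma
           * Rpower (INR (mfact a * mfact b)) mu.

Definition F_mu (n : nat) (mu : R) (u : R -> Pt n -> C) : Prop :=
  exists sigma, 1 < sigma /\ @S_sm n sigma mu u.

Definition coef {n} (phi : nat -> Pt n -> C) (u : R -> Pt n -> C) (j : nat) (t : R) : C :=
  inner (u t) (phi j).

Definition gevrey_T (b : R -> R) : Prop :=
  (forall k t, ex_derive (Derive_n b k) t) /\
  (forall t, b (t + 2 * PI) = b t) /\
  exists s Cc K, 1 <= s /\ 0 < Cc /\
    forall k t, Rabs (Derive_n b k t) <= K * pow Cc k * Rpower (INR (fact k)) s.

Definition mean (b : R -> R) : R := / (2 * PI) * RInt b 0 (2 * PI).

Definition Lop {n} (c : mindex n -> mindex n -> R) (m : nat) (a0 : R) (b : R -> R)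
  (u : R -> Pt n -> C) : R -> Pt n -> C :=
  fun t x => Cplus (Cmult (Copp Ci) (pd ord0 (flat u) (tx t x)))
                   (Cmult (a0, b t) (Pop c m (u t) x)).

Definition inZset (lam : nat -> R) (a0 : R) (b : R -> R) (j : nat) : Prop :=
  exists k : Z, Cmult (RtoC (lam j)) (a0, mean b) = RtoC (IZR k).

Definition admissible {n} (mu : R) (lam : nat -> R) (phi : nat -> Pt n -> C)
  (a0 : R) (b : R -> R) (f : R -> Pt n -> C) : Prop :=
  @F_mu n mu f /\
  forall j, inZset lam a0 b j ->
    let g := fun t => Cmult (cexp (Cmult (Cmult Ci (RtoC (lam j))) (a0 * t, RInt b 0 t))) (coef phi f j t) in
    (RInt (fun t => Re (g t)) 0 (2 * PI), RInt (fun t => Im (g t)) 0 (2 * PI)) = RtoC 0.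

Definition globally_solvable {n} (c : mindex n -> mindex n -> R) (m : nat) (mu : R)
  (lam : nat -> R) (phi : nat -> Pt n -> C) (a0 : R) (b : R -> R) : Prop :=
  forall f, admissible mu lam phi a0 b f ->
    exists u, @F_mu n mu u /\ forall t x, Lop c m a0 b u t x = f t x.

(** Condition (A) for omega (eigenvalue indices j are shifted: j : nat stands for j+1) *)
Definition condA (n : nat) (mu : R) (lam : nat -> R) (omega : C) : Prop :=
  forall eps, 0 < eps -> exists Ce, 0 < Ce /\
    forall (tau : Z) (j : nat), Cminus (RtoC (IZR tau)) (Cmult omega (RtoC (lam j))) <> RtoC 0 ->
      Cmod (Cminus (RtoC (IZR tau)) (Cmult omega (RtoC (lam j))))
      >= Ce * exp (- eps * Rpower (INR j.+1) (/ (2 * INR n * mu))).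

(** Subsets of T are 2pi-periodic predicates on R; open sets of T are periodic open sets of R. *)
Definition openR (U : R -> Prop) : Prop :=
  forall t, U t -> exists delta, 0 < delta /\ forall s, Rabs (s - t) < delta -> U s.
Definition periodicP (U : R -> Prop) : Prop := forall t, U (t + 2 * PI) <-> U t.
Definition connectedT (A : R -> Prop) : Prop :=
  ~ exists U V : R -> Prop, openR U /\ openR V /\ periodicP U /\ periodicP V /\
      (exists t, A t /\ U t) /\ (exists t, A t /\ V t) /\
      (forall t, A t -> U t \/ V t) /\ (forall t, A t -> ~ (U t /\ V t)).

Definition rep (t : R) : R := t - 2 * PI * IZR (Int_part (t / (2 * PI))).
Definition Omega (b : R -> R) (r : R) : R -> Prop := fun t => RInt b 0 (rep t) > r.

(* Main.v *)
(** Expanding in eigenfunctions reduces [L u = f] to the equations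
    [U' + i lambda (a0 + i b) U = i f_j] on the circle.  If [j] is not in Z, the periodic solution
    is unique, and its size is governed by the distance to [1] of the period factor
    [exp (2 pi i lambda c0)] and by the exponential growth of [exp (lambda (B t - B s))], where
    [B' = b]: under (A) the first is subexponentially small and there is no growth, and when [b] has
    a constant sign both compensate uniformly in [lambda].  If [j] is in Z and [b] changes sign,
    [B] is periodic, and the solution is integrated from a maximum (or minimum, according to the
    sign of [lambda]) of [B]: connectedness of the superlevel sets means that every point is
    reached from there, on one side or the other, along an arc with [lambda (B t - B s) <= 0].

    Passing between functions and coefficients costs factors [exp (eps |lambda|^(1/(m mu)))].
    The coefficients of [f] decay at this rate because [P] is self-adjoint, so that
    [lambda^M f_j] is a coefficient of [P^M f].  For the eigenfunctions one needs the elliptic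
    estimate: the norm of a word of length [r + m] in the letters [x_i], [D_i] applied to [v] is
    bounded by the norms of [w P v], [|w| = r], and of shorter words.  It follows, without
    pseudodifferential calculus, from averaging
    [(|p_m(a)|^2 - delta |a|^(2m)) |(a.Z)^s v|^2 >= 0] over a Gaussian vector [a]: up to
    commutators, and to a relative error [O(1/s)], Stein's identity turns the average into a
    multiple of the sum of [|w p_m(Z) v|^2 - delta |w z v|^2] over the words [w] of length [s - m]
    and [z] of length [m]. *)
Require Import Defs.
From HB Require Import structures.
From Stdlib Require Import Reals ZArith Lra FunctionalExtensionality PropExtensionality ClassicalEpsilon.
From Coquelicot Require Import Coquelicot.
From mathcomp Require Import ssreflect ssrbool ssrfun eqtype ssrnat seq fintype finfun bigop path.
From mathcomp Require Import zify.

Local Open Scope R_scope.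

(** * Finite sums and partial derivatives *)

(** The elliptic estimate has to survive unlimited iteration: its constants may depend on P but not
    on the length of a word, because it consumes only the first letters of a word and treats the
    rest, applied to the eigenfunction, as a new function v. Moving P past a word of length l
    produces about l words with two letters fewer, so two letters cost a factor l, and words of
    length l are bounded by A^l (Lam + sqrt l)^l with |lambda| <= Lam^m. As sqrt(l)^l is at most C^l
    l!^(1/2), this is where mu >= 1/2 enters. The power Lam^l is exchanged for l!^mu exp(eps
    Lam^(1/mu)) with eps as small as desired, whereas f brings a fixed exponential decay; every loss
    is paid from a fraction of that decay. In time the equation turns each derivative into a factor
    lambda, and lambda^g is exchanged for g!^(m mu): the Gevrey order of the solution may exceed
    that of f, which is allowed because F_mu is the union over all orders. In case (c), finiteness
    of the complement of Z and |lambda_j| -> infinity force b_0 = 0; this is why the primitive of b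
    is periodic there. *)

Lemma Rplus_A : associative Rplus. Proof. by move=> x y z; ring. Qed.
Lemma Rplus_C : commutative Rplus. Proof. by move=> x y; ring. Qed.
Lemma Rplus_0 : left_id 0 Rplus. Proof. by move=> x; ring. Qed.
HB.instance Definition _ := Monoid.isComLaw.Build R 0 Rplus Rplus_A Rplus_C Rplus_0.
Lemma Rmult_Z : left_zero 0 Rmult. Proof. by move=> x; ring. Qed.
Lemma Rmult_ZR : right_zero 0 Rmult. Proof. by move=> x; ring. Qed.
HB.instance Definition _ := Monoid.isMulLaw.Build R 0 Rmult Rmult_Z Rmult_ZR.
Lemma Rmult_DL : left_distributive Rmult Rplus. Proof. by move=> x y z; ring. Qed.
Lemma Rmult_DR : right_distributive Rmult Rplus. Proof. by move=> x y z; ring. Qed.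
HB.instance Definition _ := Monoid.isAddLaw.Build R Rmult Rplus Rmult_DL Rmult_DR.

Lemma Cplus_A : associative Cplus. Proof. by move=> x y z; ring. Qed.
Lemma Cplus_C : commutative Cplus. Proof. by move=> x y; ring. Qed.
Lemma Cplus_0 : left_id (RtoC 0) Cplus. Proof. by move=> x; ring. Qed.
HB.instance Definition _ := Monoid.isComLaw.Build C (RtoC 0) Cplus Cplus_A Cplus_C Cplus_0.
Lemma Cmult_Z : left_zero (RtoC 0) Cmult. Proof. by move=> x; ring. Qed.
Lemma Cmult_ZR : right_zero (RtoC 0) Cmult. Proof. by move=> x; ring. Qed.
HB.instance Definition _ := Monoid.isMulLaw.Build C (RtoC 0) Cmult Cmult_Z Cmult_ZR.
Lemma Cmult_DL : left_distributive Cmult Cplus. Proof. by move=> x y z; ring. Qed.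
Lemma Cmult_DR : right_distributive Cmult Cplus. Proof. by move=> x y z; ring. Qed.
HB.instance Definition _ := Monoid.isAddLaw.Build C Cmult Cplus Cmult_DL Cmult_DR.

Notation "'\rsum_' ( i <- r ) F" := (\big[Rplus/0%R]_(i <- r) F%R)
  (at level 34, F at level 34, i at level 50).
Notation "'\csum_' ( i <- r ) F" := (\big[Cplus/RtoC 0]_(i <- r) F%C)
  (at level 34, F at level 34, i at level 50).

Section Sums.
Context {T : Type}.
Implicit Types (r : seq T) (F G : T -> R).

Lemma rsum_le r F G : (forall x, F x <= G x) -> \rsum_(x <- r) F x <= \rsum_(x <- r) G x.
Proof.
move=> h; elim: r => [|x r IH]; rewrite ?big_nil ?big_cons; first lra.
by have := h x; lra.
Qed.

Lemma rsum_ge0 r F : (forall x, 0 <= F x) -> 0 <= \rsum_(x <- r) F x.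
Proof.
move=> h; elim: r => [|x r IH]; rewrite ?big_nil ?big_cons; first lra.
by have := h x; lra.
Qed.

Lemma rsum_abs r F : Rabs (\rsum_(x <- r) F x) <= \rsum_(x <- r) Rabs (F x).
Proof.
elim: r => [|x r IH]; rewrite ?big_nil ?big_cons; first by rewrite Rabs_R0; lra.
by have := Rabs_triang (F x) (\rsum_(x <- r) F x); lra.
Qed.

Lemma csum_mod r (F : T -> C) : Cmod (\csum_(x <- r) F x) <= \rsum_(x <- r) Cmod (F x).
Proof.
elim: r => [|x r IH]; rewrite ?big_nil ?big_cons; first by rewrite Cmod_0; lra.
by have := Cmod_triangle (F x) (\csum_(x <- r) F x); lra.
Qed.

Lemma rsum_const r c : \rsum_(x <- r) c = INR (size r) * c.
Proof.
elim: r => [|x r IH]; first by rewrite big_nil /=; ring.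
by rewrite big_cons IH (_ : size (x :: r) = (size r).+1) // S_INR; ring.
Qed.

Lemma rsum_minus r F G :
  \rsum_(x <- r) F x - \rsum_(x <- r) G x = \rsum_(x <- r) (F x - G x).
Proof.
elim: r => [|x r IH]; rewrite ?big_nil ?big_cons; first ring.
by rewrite -IH; ring.
Qed.

Lemma csum_re r (F : T -> C) : Re (\csum_(x <- r) F x) = \rsum_(x <- r) Re (F x).
Proof. by elim: r => [|x r IH]; rewrite ?big_nil // !big_cons -IH. Qed.
End Sums.

Lemma rsum_mem_le {T : eqType} (r : seq T) (F : T -> R) x :
  (forall x, 0 <= F x) -> x \in r -> F x <= \rsum_(y <- r) F y.
Proof.
move=> F0; elim: r => [//|y r IH]; rewrite inE big_cons => /orP[/eqP <-|/IH].
  by have := @rsum_ge0 _ r F F0; lra.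
by have := F0 y; lra.
Qed.

Lemma rsum_le_in {T : eqType} (r : seq T) (F G : T -> R) :
  (forall x, x \in r -> F x <= G x) -> \rsum_(x <- r) F x <= \rsum_(x <- r) G x.
Proof.
elim: r => [|x r IH] h; rewrite ?big_nil ?big_cons; first lra.
have := h x (mem_head _ _); have := IH (fun y hy => h y (mem_behead (s := x :: r) hy)); lra.
Qed.

Lemma Csum_big {T} (F : T -> C) (r : seq T) : Csum [seq F x | x <- r] = \csum_(x <- r) F x.
Proof. by elim: r => [|x r IH]; rewrite ?big_nil ?big_cons //= -IH. Qed.

Lemma C_ext (z w : C) : Re z = Re w -> Im z = Im w -> z = w.
Proof. by case: z w => [a b] [c d] /= -> ->. Qed.

Lemma Cmod_le_abs (z : C) : Cmod z <= Rabs (Re z) + Rabs (Im z).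
Proof.
apply: Rsqr_incr_0_var; last by have := Rabs_pos (Re z); have := Rabs_pos (Im z); lra.
rewrite /Rsqr /Cmod sqrt_sqrt; last by nra.
have h1 := Rabs_pos (Re z); have h2 := Rabs_pos (Im z).
have e1 : z.1 ^ 2 = Rabs (Re z) ^ 2 by rewrite pow2_abs.
have e2 : z.2 ^ 2 = Rabs (Im z) ^ 2 by rewrite pow2_abs.
by rewrite e1 e2; nra.
Qed.
Lemma Re_le_Cmod (z : C) : Rabs (Re z) <= Cmod z.
Proof. exact: Rle_trans (Rmax_l _ _) (Rmax_Cmod z). Qed.
Lemma Im_le_Cmod (z : C) : Rabs (Im z) <= Cmod z.
Proof. exact: Rle_trans (Rmax_r _ _) (Rmax_Cmod z). Qed.

(** * Calculus of smooth functions on R^k *)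

Section Points.
Context {k : nat}.
Implicit Types (x y : Pt k) (i j : 'I_k).

Lemma upd_id x i : upd x i (x i) = x.
Proof. by apply: functional_extensionality => j; rewrite /upd; case: eqP => [->|]. Qed.
Lemma upd_same x i s : upd x i s i = s.
Proof. by rewrite /upd eqxx. Qed.
Lemma upd_neq x i j s : j != i -> upd x i s j = x j.
Proof. by rewrite /upd => /negbTE ->. Qed.
Lemma upd_upd x i s t : upd (upd x i s) i t = upd x i t.
Proof. by apply: functional_extensionality => j; rewrite /upd; case: eqP. Qed.
Lemma upd_comm x i j s t : i != j -> upd (upd x i s) j t = upd (upd x j t) i s.
Proof.
move=> ij; apply: functional_extensionality => l; rewrite /upd.
by case: (l =P j) => [->|//]; rewrite eq_sym (negbTE ij).
Qed.

Definition is_pd i (g : Pt k -> C) x (l : C) : Prop :=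
  is_derive (fun s => Re (g (upd x i s))) (x i) (Re l) /\
  is_derive (fun s => Im (g (upd x i s))) (x i) (Im l).

Lemma is_pd_unique i g x l : is_pd i g x l -> pd i g x = l.
Proof. by case=> h1 h2; apply: C_ext => /=; apply: is_derive_unique. Qed.
Lemma is_pd_has i g x l : is_pd i g x l -> has_pd i g x.
Proof. by case=> h1 h2; split; eexists; eassumption. Qed.
Lemma has_pd_is i g x : has_pd i g x -> is_pd i g x (pd i g x).
Proof. by case=> h1 h2; split; apply: Derive_correct. Qed.

Lemma is_pd_const i c x : is_pd i (fun _ => c) x (RtoC 0).
Proof. by split; apply: is_derive_const. Qed.
Lemma is_pd_coord i j x :
  is_pd i (fun y => RtoC (y j)) x (RtoC (if j == i then 1 else 0)).
Proof.
split; last by apply: is_derive_const.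
rewrite /upd /=; case: (j == i); first exact: is_derive_id.
exact: is_derive_const.
Qed.
Lemma is_pd_plus i g h x lg lh : is_pd i g x lg -> is_pd i h x lh ->
  is_pd i (fun y => Cplus (g y) (h y)) x (Cplus lg lh).
Proof.
case=> a1 a2 [b1 b2]; split.
  exact: (is_derive_plus (V := R_NormedModule) _ _ _ _ _ a1 b1).
exact: (is_derive_plus (V := R_NormedModule) _ _ _ _ _ a2 b2).
Qed.
Lemma is_pd_mult i g h x lg lh : is_pd i g x lg -> is_pd i h x lh ->
  is_pd i (fun y => Cmult (g y) (h y)) x (Cplus (Cmult lg (h x)) (Cmult (g x) lh)).
Proof.
case=> a1 a2 [b1 b2].
have e (f : Pt k -> R) : f (upd x i (x i)) = f x by rewrite upd_id.
split; rewrite /=.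
  have H := is_derive_minus (V := R_NormedModule) _ _ _ _ _
    (is_derive_mult _ _ _ _ _ a1 b1 Rmult_comm) (is_derive_mult _ _ _ _ _ a2 b2 Rmult_comm).
  evar_last; first exact: H.
  by rewrite /minus /plus /opp /mult /= !upd_id /Re /Im; ring.
have H := is_derive_plus (V := R_NormedModule) _ _ _ _ _
  (is_derive_mult _ _ _ _ _ a1 b2 Rmult_comm) (is_derive_mult _ _ _ _ _ a2 b1 Rmult_comm).
evar_last; first exact: H.
by rewrite /plus /mult /= !upd_id /Re /Im; ring.
Qed.
Lemma is_pd_conj i g x l : is_pd i g x l -> is_pd i (fun y => Cconj (g y)) x (Cconj l).
Proof. by case=> a b; split => //=; apply: (is_derive_opp (V := R_NormedModule)). Qed.
Lemma is_pd_RtoC i (g : Pt k -> R) x l :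
  is_derive (fun s => g (upd x i s)) (x i) l -> is_pd i (fun y => RtoC (g y)) x (RtoC l).
Proof. by move=> h; split => //=; apply: is_derive_const. Qed.

Lemma contC_const c : @contC k (fun _ => c).
Proof.
move=> x e he; exists 1; split; first lra.
by move=> y _; rewrite (_ : Cminus c c = RtoC 0) ?Cmod_0 //; rewrite /Cminus; ring.
Qed.
Lemma contC_coord j : @contC k (fun y => RtoC (y j)).
Proof.
move=> x e he; exists e; split=> // y h.
by rewrite -RtoC_minus Cmod_R; apply: h.
Qed.
Lemma contC_plus (g h : Pt k -> C) : contC g -> contC h -> contC (fun y => Cplus (g y) (h y)).
Proof.
move=> cg ch x e he; have he2 : 0 < e / 2 by lra.
have [d1 [d1p H1]] := cg x _ he2; have [d2 [d2p H2]] := ch x _ he2.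
exists (Rmin d1 d2); split; first exact: Rmin_glb_lt.
move=> y hy.
have a1 := H1 y (fun i => Rlt_le_trans _ _ _ (hy i) (Rmin_l _ _)).
have a2 := H2 y (fun i => Rlt_le_trans _ _ _ (hy i) (Rmin_r _ _)).
have -> : Cminus (Cplus (g y) (h y)) (Cplus (g x) (h x))
  = Cplus (Cminus (g y) (g x)) (Cminus (h y) (h x)) by rewrite /Cminus; ring.
by have := Cmod_triangle (Cminus (g y) (g x)) (Cminus (h y) (h x)); lra.
Qed.
Lemma contC_mult (g h : Pt k -> C) : contC g -> contC h -> contC (fun y => Cmult (g y) (h y)).
Proof.
move=> cg ch x e he.
set A := Cmod (g x) + 1; set B := Cmod (h x) + 1.
have Ap : 1 <= A by rewrite /A; have := Cmod_ge_0 (g x); lra.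
have primitive : 1 <= B by rewrite /B; have := Cmod_ge_0 (h x); lra.
have eA : 0 < e / (2 * A) by apply: Rdiv_lt_0_compat; lra.
have eB : 0 < Rmin 1 (e / (2 * B)).
  by apply: Rmin_glb_lt; [lra | apply: Rdiv_lt_0_compat; lra].
have [d1 [d1p H1]] := cg x _ eB; have [d2 [d2p H2]] := ch x _ eA.
exists (Rmin d1 d2); split; first exact: Rmin_glb_lt.
move=> y hy.
have a1 := H1 y (fun i => Rlt_le_trans _ _ _ (hy i) (Rmin_l _ _)).
have a2 := H2 y (fun i => Rlt_le_trans _ _ _ (hy i) (Rmin_r _ _)).
have -> : Cminus (Cmult (g y) (h y)) (Cmult (g x) (h x))
  = Cplus (Cmult (g y) (Cminus (h y) (h x))) (Cmult (Cminus (g y) (g x)) (h x))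
  by rewrite /Cminus; ring.
apply: Rle_lt_trans (Cmod_triangle _ _) _; rewrite !Cmod_mult.
have gy : Cmod (g y) <= A.
  have -> : g y = Cplus (g x) (Cminus (g y) (g x)) by rewrite /Cminus; ring.
  apply: Rle_trans (Cmod_triangle _ _) _; rewrite /A.
  by have := Rmin_l 1 (e / (2 * B)); lra.
have b1 : Cmod (Cminus (g y) (g x)) < e / (2 * B).
  by have := Rmin_r 1 (e / (2 * B)); lra.
have p1 : Cmod (g y) * Cmod (Cminus (h y) (h x)) <= A * (e / (2 * A)).
  by apply: Rmult_le_compat; [apply: Cmod_ge_0 | apply: Cmod_ge_0 | | lra].
have p2 : Cmod (Cminus (g y) (g x)) * Cmod (h x) < e / (2 * B) * B.
  apply: Rle_lt_trans (Rmult_le_compat_r _ _ _ (Cmod_ge_0 _) (Rlt_le _ _ b1)) _.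
  by apply: Rmult_lt_compat_l; [apply: Rdiv_lt_0_compat; lra | rewrite /B; lra].
have q1 : A * (e / (2 * A)) = e / 2 by field; lra.
have q2 : e / (2 * B) * B = e / 2 by field; lra.
lra.
Qed.
Lemma contC_conj (g : Pt k -> C) : contC g -> contC (fun y => Cconj (g y)).
Proof.
move=> cg x e he; have [d [dp H]] := cg x e he; exists d; split=> // y hy.
have -> : Cminus (Cconj (g y)) (Cconj (g x)) = Cconj (Cminus (g y) (g x)).
  by apply: C_ext => /=; rewrite /Re /Im; ring.
by rewrite Cmod_conj; apply: H.
Qed.

Lemma dw_rcons (w : seq 'I_k) i (g : Pt k -> C) : dw (rcons w i) g = dw w (pd i g).
Proof. by elim: w => [|j w IH] //=; rewrite IH. Qed.
Lemma dw_cat (w w' : seq 'I_k) (g : Pt k -> C) : dw (w ++ w') g = dw w (dw w' g).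
Proof. by elim: w => [|j w IH] //=; rewrite IH. Qed.

Lemma smooth_cont (g : Pt k -> C) : smooth g -> contC g.
Proof. by move=> h; case: (h [::]). Qed.
Lemma smooth_has_pd (g : Pt k -> C) i x : smooth g -> has_pd i g x.
Proof. by move=> h; case: (h [::]) => _; apply. Qed.
Lemma smooth_is_pd (g : Pt k -> C) i x : smooth g -> is_pd i g x (pd i g x).
Proof. by move=> h; apply: has_pd_is; apply: smooth_has_pd. Qed.
Lemma smooth_pd (g : Pt k -> C) i : smooth g -> smooth (pd i g).
Proof. by move=> h w; rewrite -dw_rcons; apply: h. Qed.
Lemma smooth_dw (g : Pt k -> C) w : smooth g -> smooth (dw w g).
Proof. by move=> h w'; rewrite -dw_cat; apply: h. Qed.

(** Coinduction principle: smoothness is proved by exhibiting a class stable under all partial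
    derivatives, with no formula for the iterated ones. The word is peeled from its right end,
    because that derivative acts first and keeps the function in the class. *)
Lemma smooth_coind (Q : (Pt k -> C) -> Prop) :
  (forall g, Q g -> contC g /\ forall i, (forall x, has_pd i g x) /\ Q (pd i g)) ->
  forall g, Q g -> smooth g.
Proof.
move=> H g Qg w.
elim/last_ind: w g Qg => [|w i IH] g Qg; first by case: (H g Qg) => ? h; split=> // i x; case: (h i).
by rewrite dw_rcons; apply: IH; case: (H g Qg) => _ /(_ i) [].
Qed.

(** The product rule leaves the class of products, so the class fed to the coinduction is the whole
    algebra generated by [B]. *)
Inductive galg (B : (Pt k -> C) -> Prop) : (Pt k -> C) -> Prop :=
| galg_base g : B g -> galg B g
| galg_plus g h : galg B g -> galg B h -> galg B (fun x => Cplus (g x) (h x))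
| galg_mult g h : galg B g -> galg B h -> galg B (fun x => Cmult (g x) (h x)).

Lemma galg_smooth (B : (Pt k -> C) -> Prop) :
  (forall g, B g -> contC g /\ forall i, (forall x, has_pd i g x) /\ galg B (pd i g)) ->
  forall g, galg B g -> smooth g.
Proof.
move=> H; apply: smooth_coind => g; elim=> {g} [g /H //|g h Ag [cg IHg] Ah [ch IHh]|g h Ag [cg IHg] Ah [ch IHh]].
- split; first exact: contC_plus.
  move=> i; have [pg qg] := IHg i; have [ph qh] := IHh i.
  have E x := is_pd_plus i g h x _ _ (has_pd_is _ _ _ (pg x)) (has_pd_is _ _ _ (ph x)).
  split=> [x|]; first exact: is_pd_has (E x).
  have -> : pd i (fun x => Cplus (g x) (h x)) = (fun x => Cplus (pd i g x) (pd i h x)).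
    by apply: functional_extensionality => x; apply: is_pd_unique (E x).
  exact: galg_plus.
- split; first exact: contC_mult.
  move=> i; have [pg qg] := IHg i; have [ph qh] := IHh i.
  have E x := is_pd_mult i g h x _ _ (has_pd_is _ _ _ (pg x)) (has_pd_is _ _ _ (ph x)).
  split=> [x|]; first exact: is_pd_has (E x).
  have -> : pd i (fun x => Cmult (g x) (h x))
      = (fun x => Cplus (Cmult (pd i g x) (h x)) (Cmult (g x) (pd i h x))).
    by apply: functional_extensionality => x; apply: is_pd_unique (E x).
  by apply: galg_plus; apply: galg_mult.
Qed.

Lemma galg_smooth_smooth g : galg smooth g -> smooth g.
Proof.
apply: galg_smooth => h sh; split; first exact: smooth_cont.
by move=> i; split=> [x|]; [apply: smooth_has_pd | apply: galg_base; apply: smooth_pd].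
Qed.
Lemma smooth_plus (g h : Pt k -> C) : smooth g -> smooth h -> smooth (fun x => Cplus (g x) (h x)).
Proof. by move=> sg sh; apply: galg_smooth_smooth; apply: galg_plus; apply: galg_base. Qed.
Lemma smooth_mult (g h : Pt k -> C) : smooth g -> smooth h -> smooth (fun x => Cmult (g x) (h x)).
Proof. by move=> sg sh; apply: galg_smooth_smooth; apply: galg_mult; apply: galg_base. Qed.
Lemma smooth_const c : smooth (fun _ : Pt k => c).
Proof.
apply: (smooth_coind (fun g => exists c, g = fun _ => c)); last by exists c.
move=> g [d ->]; split; first exact: contC_const.
move=> i; split=> [x|]; first exact: is_pd_has (is_pd_const _ _ _).
by exists (RtoC 0); apply: functional_extensionality => x; apply: is_pd_unique (is_pd_const _ _ _).
Qed.
Lemma smooth_coord j : smooth (fun x : Pt k => RtoC (x j)).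
Proof.
apply: (smooth_coind (fun g => (exists j, g = fun x => RtoC (x j)) \/ smooth g)); last by left; exists j.
move=> g [[l ->]|sg]; last first.
  split; first exact: smooth_cont.
  by move=> i; split=> [x|]; [apply: smooth_has_pd | right; apply: smooth_pd].
split; first exact: contC_coord.
move=> i; split=> [x|]; first exact: is_pd_has (is_pd_coord _ _ _).
right; have -> : pd i (fun x : Pt k => RtoC (x l)) = fun _ => RtoC (if l == i then 1 else 0).
  by apply: functional_extensionality => x; apply: is_pd_unique (is_pd_coord _ _ _).
exact: smooth_const.
Qed.
Lemma smooth_conj (g : Pt k -> C) : smooth g -> smooth (fun x => Cconj (g x)).
Proof.
move=> sg; apply: (smooth_coind (fun f => exists2 g, smooth g & f = fun x => Cconj (g x))); last by exists g.
move=> f [h sh ->]; split; first by apply: contC_conj; apply: smooth_cont.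
have E i x := is_pd_conj i h x _ (smooth_is_pd h i x sh).
move=> i; split=> [x|]; first exact: is_pd_has (E i x).
exists (pd i h); first exact: smooth_pd.
by apply: functional_extensionality => x; apply: is_pd_unique (E i x).
Qed.

Lemma pd_plus i (g h : Pt k -> C) : smooth g -> smooth h ->
  pd i (fun x => Cplus (g x) (h x)) = fun x => Cplus (pd i g x) (pd i h x).
Proof.
move=> sg sh; apply: functional_extensionality => x; apply: is_pd_unique.
by apply: is_pd_plus; apply: smooth_is_pd.
Qed.
Lemma pd_mult i (g h : Pt k -> C) : smooth g -> smooth h ->
  pd i (fun x => Cmult (g x) (h x)) = fun x => Cplus (Cmult (pd i g x) (h x)) (Cmult (g x) (pd i h x)).
Proof.
move=> sg sh; apply: functional_extensionality => x; apply: is_pd_unique.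
by apply: is_pd_mult; apply: smooth_is_pd.
Qed.
Lemma pd_scal i c (g : Pt k -> C) : smooth g ->
  pd i (fun x => Cmult c (g x)) = fun x => Cmult c (pd i g x).
Proof.
move=> sg; apply: functional_extensionality => x; apply: is_pd_unique.
have := is_pd_mult i (fun _ => c) g x _ _ (is_pd_const i c x) (smooth_is_pd g i x sg).
by rewrite (_ : Cplus _ _ = Cmult c (pd i g x)) //; ring.
Qed.
Lemma pd_coord i j : pd i (fun x : Pt k => RtoC (x j)) = fun _ => RtoC (if j == i then 1 else 0).
Proof. by apply: functional_extensionality => x; apply: is_pd_unique; apply: is_pd_coord. Qed.
Lemma pd_conj i (g : Pt k -> C) : smooth g ->
  pd i (fun x => Cconj (g x)) = fun x => Cconj (pd i g x).
Proof.
move=> sg; apply: functional_extensionality => x; apply: is_pd_unique.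
by apply: is_pd_conj; apply: smooth_is_pd.
Qed.

Lemma contC_2d (P : C -> R) (g : Pt k -> C) x i j s t :
  (forall z w, Rabs (P z - P w) <= Cmod (Cminus z w)) -> contC g ->
  continuity_2d_pt (fun u v => P (g (upd (upd x i u) j v))) s t.
Proof.
move=> HP cg eps; have [d [dp H]] := cg (upd (upd x i s) j t) eps (cond_pos eps).
exists (mkposreal d dp) => u v hu hv.
apply: Rle_lt_trans (HP _ _) _; apply: H => l; rewrite /upd.
case: (l == j) => //; case: (l == i) => //.
by rewrite Rminus_diag Rabs_R0.
Qed.

Lemma pd_comm i j (g : Pt k -> C) : smooth g -> pd i (pd j g) = pd j (pd i g).
Proof.
case: (i =P j) => [->//|/eqP ij] sg; apply: functional_extensionality => x.
(* [P] stands for [Re] and then for [Im], so that Schwarz's theorem on real functions of two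
   variables serves both parts of [g]. *)
have key (P : C -> R) :
  (forall z w, Rabs (P z - P w) <= Cmod (Cminus z w)) ->
  (forall g : Pt k -> C, smooth g -> forall i x s, ex_derive (fun s => P (g (upd x i s))) s) ->
  (forall (g : Pt k -> C) i x, smooth g -> Derive (fun s => P (g (upd x i s))) (x i) = P (pd i g x)) ->
  P (pd i (pd j g) x) = P (pd j (pd i g) x).
  move=> Pl Pex Pd.
  have Dj u v : Derive (fun t => P (g (upd (upd x i u) j t))) v = P (pd j g (upd (upd x i u) j v)).
    have := Pd g j (upd (upd x i u) j v) sg; rewrite upd_same => <-.
    by apply: Derive_ext => t; rewrite upd_upd.
  have Di u v : Derive (fun t => P (g (upd (upd x i t) j v))) u = P (pd i g (upd (upd x i u) j v)).
    have := Pd g i (upd (upd x j v) i u) sg; rewrite upd_same.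
    rewrite -upd_comm // => <-.
    by apply: Derive_ext => t; rewrite !(upd_comm x i j _ _ ij) upd_upd.
  have Dij u v : Derive (fun s => Derive (fun t => P (g (upd (upd x i s) j t))) v) u
      = P (pd i (pd j g) (upd (upd x i u) j v)).
    rewrite (Derive_ext _ (fun s => P (pd j g (upd (upd x i s) j v)))) //.
    have := Pd (pd j g) i (upd (upd x j v) i u) (smooth_pd _ _ sg); rewrite upd_same.
    rewrite -upd_comm // => <-.
    by apply: Derive_ext => t; rewrite !(upd_comm x i j _ _ ij) upd_upd.
  have Dji u v : Derive (fun t => Derive (fun s => P (g (upd (upd x i s) j t))) u) v
      = P (pd j (pd i g) (upd (upd x i u) j v)).
    rewrite (Derive_ext _ (fun t => P (pd i g (upd (upd x i u) j t)))) //.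
    have := Pd (pd i g) j (upd (upd x i u) j v) (smooth_pd _ _ sg); rewrite upd_same => <-.
    by apply: Derive_ext => t; rewrite upd_upd.
  have S := Schwarz (fun u v => P (g (upd (upd x i u) j v))) (x i) (x j).
  rewrite Dij Dji !upd_id in S; apply: S.
  - exists (mkposreal 1 Rlt_0_1) => u v _ _; split; last split; last split.
    + apply: ex_derive_ext (Pex g sg i (upd x j v) u) => t.
      by rewrite (upd_comm x i j _ _ ij).
    + exact: Pex.
    + apply: ex_derive_ext (Pex _ (smooth_pd _ j sg) i (upd x j v) u) => t.
      by rewrite Dj (upd_comm x i j _ _ ij).
    + by apply: ex_derive_ext (Pex _ (smooth_pd _ i sg) j (upd x i u) v) => t; rewrite Di.
  - apply: continuity_2d_pt_ext (fun u v => esym (Dij u v)) _.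
    by apply: contC_2d => //; apply: smooth_cont; do 2 apply: smooth_pd.
  - apply: continuity_2d_pt_ext (fun u v => esym (Dji u v)) _.
    by apply: contC_2d => //; apply: smooth_cont; do 2 apply: smooth_pd.
apply: C_ext; apply: key.
- by move=> z w; apply: Re_le_Cmod (Cminus z w).
- move=> h sh l y s; have [a _] := smooth_has_pd h l (upd y l s) sh.
  rewrite upd_same in a; apply: ex_derive_ext a => t; by rewrite upd_upd.
- by [].
- by move=> z w; apply: Im_le_Cmod (Cminus z w).
- move=> h sh l y s; have [_ a] := smooth_has_pd h l (upd y l s) sh.
  rewrite upd_same in a; apply: ex_derive_ext a => t; by rewrite upd_upd.
- by [].
Qed.
End Points.

(** Adjacent transpositions generate all permutations: the first letter of [y] is brought to the
    front of [y'], and the induction goes on with that letter absorbed into [F]. Hence [F] is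
    arbitrary and the swap is assumed behind any prefix. *)
Lemma perm_swap_inv {T : eqType} {U} (F : seq T -> U) :
  (forall p i j q, F (p ++ i :: j :: q) = F (p ++ j :: i :: q)) ->
  forall y y', perm_eq y y' -> F y = F y'.
Proof.
move=> H y; elim: y F H => [|i y IH] F H y' pe.
  by case: y' pe => // a l /perm_size.
have iy' : i \in y' by rewrite -(perm_mem pe) mem_head.
case/splitPr: y' / iy' pe => p q pe.
have front : F (p ++ i :: q) = F (i :: p ++ q).
  elim/last_ind: p q {pe} => [//|p j IHp] q.
  by rewrite cat_rcons -H IHp cat_rcons.
rewrite front; apply: (IH (fun z => F (i :: z))).
  by move=> p' a b q'; apply: (H (i :: p')).
by rewrite -(perm_cons i) (perm_trans pe) // -cat1s perm_catCA.
Qed.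

Lemma dw_perm {k} (w w' : seq 'I_k) (g : Pt k -> C) :
  smooth g -> perm_eq w w' -> dw w g = dw w' g.
Proof.
move=> sg; apply: (perm_swap_inv (fun w => dw w g)) => p i j q.
by rewrite !dw_cat /= pd_comm //; apply: smooth_dw.
Qed.

Lemma count_flatten_nseq {T : finType} (c : T -> nat) x :
  count_mem x (flatten [seq nseq (c i) i | i <- enum T]) = c x.
Proof.
rewrite count_flatten -map_comp.
have : x \in enum T by rewrite mem_enum.
elim: (enum T) (enum_uniq T) => [//|i l IH] /= /andP[il ul]; rewrite inE count_nseq /=.
case: (i =P x) il => [<- il _|ni il]; last first.
  rewrite eq_sym; case: eqP => [/esym //|_] /= xl; rewrite mul0n add0n; exact: IH.
rewrite mul1n -[RHS]addn0; congr addn.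
elim: l il {ul IH} => [//|j l IH] /=; rewrite inE negb_or => /andP[xj xl].
by rewrite count_nseq /= eq_sym (negbTE xj) mul0n add0n; apply: IH.
Qed.

Lemma perm_flatten_count {T : finType} (w : seq T) :
  perm_eq (flatten [seq nseq (count_mem i w) i | i <- enum T]) w.
Proof. by apply/allP => x _ /=; rewrite count_flatten_nseq. Qed.

Lemma dw_dmi {k} (w : seq 'I_k) (g : Pt k -> C) :
  smooth g -> dw w g = dmi (fun i => count_mem i w) g.
Proof. by move=> sg; apply: dw_perm => //; rewrite perm_sym perm_flatten_count. Qed.

(** * Improper integrals on the line *)

Lemma mvt_le (f df : R -> R) (a t M : R) :
  (forall s, is_derive f s (df s)) -> (forall s, Rabs (s - a) <= Rabs t -> Rabs (df s) <= M) ->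
  Rabs (f (a + t) - f a) <= M * Rabs t.
Proof.
move=> H B.
have [c [hc ->]] : exists c, Rmin a (a + t) <= c <= Rmax a (a + t) /\ f (a + t) - f a = df c * (a + t - a).
  apply: MVT_gen => [x _|x _]; first exact: H.
  by apply/continuity_pt_filterlim/(ex_derive_continuous (V := R_NormedModule)); exists (df x).
rewrite Rabs_mult (_ : a + t - a = t); last ring.
apply: Rmult_le_compat_r; first exact: Rabs_pos.
apply: B; move: hc; rewrite /Rmin /Rmax; case: Rle_dec => h [h1 h2].
  by rewrite !Rabs_pos_eq; lra.
by rewrite !Rabs_left1; lra.
Qed.

(** The mean value inequality is applied twice, to the remainder and to its derivative, at the price
    of the factor 1/2. *)
Lemma taylor_le (f df ddf : R -> R) (a t M : R) :
  (forall s, is_derive f s (df s)) -> (forall s, is_derive df s (ddf s)) ->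
  (forall s, Rabs (s - a) <= Rabs t -> Rabs (ddf s) <= M) ->
  Rabs (f (a + t) - f a - t * df a) <= M * t ^ 2.
Proof.
move=> H1 H2 B.
have D s : is_derive (fun s => f s - s * df a) s (df s - df a).
  have d1 := is_derive_minus (V := R_NormedModule) f (fun s => s * df a) s _ _ (H1 s)
    (is_derive_scal_l (V := R_NormedModule) (fun s => s) s 1 (df a) (is_derive_id s)).
  by evar_last; [exact: d1 | rewrite /minus /plus /opp /scal /= /mult /=; ring].
have := mvt_le _ _ a t (M * Rabs t) D.
rewrite (_ : f (a + t) - (a + t) * df a - (f a - a * df a) = f (a + t) - f a - t * df a); last ring.
rewrite Rmult_assoc -Rabs_mult (Rabs_pos_eq (t * t)); last nra.
rewrite (_ : t ^ 2 = t * t); last ring.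
apply=> s hs; have {1}-> : s = a + (s - a) by ring.
apply: Rle_trans (mvt_le _ _ a (s - a) M H2 _) _ => [u hu|]; first by apply: B; lra.
apply: Rmult_le_compat_l => //; apply: Rle_trans (Rabs_pos _) (B a _).
by rewrite Rminus_diag Rabs_R0; apply: Rabs_pos.
Qed.

(** A quadratic remainder is stable under integration and summation, whereas a bare limit is not.
    Coefficients of f and eigenfunction series are differentiated through this criterion. *)
Lemma derive_quadratic (f : R -> R) (a l M : R) :
  (forall t, Rabs t <= 1 -> Rabs (f (a + t) - f a - t * l) <= M * t ^ 2) -> is_derive f a l.
Proof.
move=> H; apply/is_derive_Reals => e he.
have Mp : 0 <= M by have := H 1; rewrite Rabs_R1 => /(_ (Rle_refl _)); have := Rabs_pos (f (a + 1) - f a - 1 * l); lra.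
have dp : 0 < Rmin 1 (e / (M + 1)) by apply: Rmin_glb_lt; [lra|apply: Rdiv_lt_0_compat; lra].
exists (mkposreal _ dp) => h h0 /= hd.
have h1 : Rabs h <= 1 by have := Rmin_l 1 (e / (M + 1)); lra.
have h2 : Rabs h < e / (M + 1) by have := Rmin_r 1 (e / (M + 1)); lra.
have hp : 0 < Rabs h by apply: Rabs_pos_lt.
have -> : (f (a + h) - f a) / h - l = (f (a + h) - f a - h * l) / h by field.
rewrite /Rdiv Rabs_mult Rabs_inv.
apply: (Rmult_lt_reg_r (Rabs h)) => //.
rewrite Rmult_assoc Rinv_l ?Rmult_1_r; last lra.
apply: Rle_lt_trans (H h h1) _.
rewrite (_ : h ^ 2 = Rabs h * Rabs h); last by rewrite -Rabs_mult Rabs_pos_eq; nra.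
have : M * Rabs h < e; last nra.
apply: Rle_lt_trans (_ : M * (e / (M + 1)) < e); first by apply: Rmult_le_compat_l; lra.
apply: (Rmult_lt_reg_r (M + 1)); first lra.
have -> : M * (e / (M + 1)) * (M + 1) = M * e by field; lra.
lra.
Qed.

(** The reference weight in one variable; its primitive [atan] makes tails and total mass
    explicit. *)
Definition w1 (s : R) : R := / (1 + s²).
Lemma w1_pos s : 0 < w1 s.
Proof. by apply: Rinv_0_lt_compat; have := Rle_0_sqr s; lra. Qed.
Lemma w1_le1 s : w1 s <= 1.
Proof. by rewrite -Rinv_1; apply: Rinv_le_contravar; have := Rle_0_sqr s; lra. Qed.
(** From s^2 <= 2 (s + t)^2 + 2 t^2 and |t| <= 1. Comparability at nearby points is what turns
    weighted bounds on derivatives into weighted bounds on increments. *)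
Lemma w1_shift s t : Rabs t <= 1 -> w1 (s + t) <= 3 * w1 s.
Proof.
move=> ht; have t1 : t * t <= 1.
  by rewrite -(Rabs_pos_eq (t * t)) ?Rabs_mult; have := Rabs_pos t; nra.
rewrite /w1; apply: (Rmult_le_reg_l ((1 + (s + t)²) * (1 + s²))).
  by apply: Rmult_lt_0_compat; have := Rle_0_sqr s; have := Rle_0_sqr (s + t); lra.
have -> : (1 + (s + t)²) * (1 + s²) * / (1 + (s + t)²) = 1 + s².
  by field; have := Rle_0_sqr (s + t); lra.
have -> : (1 + (s + t)²) * (1 + s²) * (3 * / (1 + s²)) = 3 * (1 + (s + t)²).
  by field; have := Rle_0_sqr s; lra.
have := Rle_0_sqr (s + 2 * t); have := Rle_0_sqr (s + t); rewrite /Rsqr => p1 p2.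
have -> : s * s = 2 * ((s + t) * (s + t)) + 2 * (t * t) - (s + 2 * t) * (s + 2 * t) by ring.
lra.
Qed.

Definition dom1 (f : R -> R) (K : R) := (forall s, continuous f s) /\ forall s, Rabs (f s) <= K * w1 s.
Definition int1 (f : R -> R) := RInt_gen f (Rbar_locally m_infty) (Rbar_locally p_infty).

Lemma int1_unique (f : R -> R) (l : R) :
  is_RInt_gen f (Rbar_locally m_infty) (Rbar_locally p_infty) l -> int1 f = l.
Proof. intros H; unfold int1; apply (is_RInt_gen_unique (V := R_CompleteNormedModule) f l H). Qed.

Lemma cont_ex_RInt (f : R -> R) a b : (forall s, continuous f s) -> ex_RInt f a b.
Proof. by move=> c; apply: (ex_RInt_continuous (V := R_CompleteNormedModule)) => z _. Qed.

Lemma is_RInt_w1 a b : is_RInt w1 a b (atan b - atan a).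
Proof.
apply: (is_RInt_derive (V := R_CompleteNormedModule)) => x _; first exact: is_derive_atan.
apply: (ex_derive_continuous (V := R_NormedModule)); rewrite /w1; auto_derive.
by have := Rle_0_sqr x; rewrite /Rsqr; lra.
Qed.

Lemma dom1_RInt_le f K a b : dom1 f K -> a <= b -> Rabs (RInt f a b) <= K * (atan b - atan a).
Proof.
move=> [c B] ab.
have := norm_RInt_le (V := R_NormedModule) f (fun s => K * w1 s) a b (RInt f a b)
  (K * (atan b - atan a)) ab (fun x _ => B x).
apply; first by apply: (RInt_correct (V := R_CompleteNormedModule)); apply: cont_ex_RInt.
exact: (is_RInt_scal (V := R_NormedModule)) (is_RInt_w1 a b).
Qed.

Lemma dom1_RInt_abs f K a b : dom1 f K -> Rabs (RInt f a b) <= K * Rabs (atan b - atan a).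
Proof.
move=> d; case: (Rle_lt_dec a b) => ab.
  have : atan a <= atan b by case: ab => [h|->]; [left; apply: atan_increasing | right].
  by move=> h; rewrite (Rabs_pos_eq (_ - _)); [apply: dom1_RInt_le | lra].
have h := atan_increasing _ _ ab.
rewrite -opp_RInt_swap; last by apply: cont_ex_RInt; case: d.
by rewrite Rabs_Ropp Rabs_minus_sym (Rabs_pos_eq (_ - _)); [apply: dom1_RInt_le; [|lra] | lra].
Qed.

Lemma dom1_K0 f K : dom1 f K -> 0 <= K.
Proof. by case=> _ /(_ 0); have := Rabs_pos (f 0); have := w1_pos 0; nra. Qed.

Lemma atan_tail M : 0 < M -> PI / 2 - atan M <= / M.
Proof.
move=> Mp; rewrite -atan_inv //.
have := mvt_le atan w1 0 (/ M) 1 is_derive_atan.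
rewrite atan_0 Rplus_0_l Rminus_0_r Rmult_1_l (Rabs_pos_eq (/ M)); last by left; apply: Rinv_0_lt_compat.
move=> H; apply: Rle_trans (Rle_abs _) (H _) => s _.
by rewrite Rabs_pos_eq; [apply: w1_le1 | left; apply: w1_pos].
Qed.

Lemma dom1_is f K : dom1 f K ->
  is_RInt_gen f (Rbar_locally m_infty) (Rbar_locally p_infty) (int1 f) /\
  filterlim (fun ab : R * R => RInt f ab.1 ab.2)
    (filter_prod (Rbar_locally m_infty) (Rbar_locally p_infty)) (locally (int1 f)).
Proof.
move=> d; have K0 := dom1_K0 _ _ d.
have [l L] : exists l : R, filterlim (fun ab : R * R => RInt f ab.1 ab.2)
    (filter_prod (Rbar_locally m_infty) (Rbar_locally p_infty)) (locally l).
  apply/(filterlim_locally_cauchy (U := R_CompleteSpace)) => eps.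
  (* Two tails, each at most K / M, must add up to less than [eps]; K + 1 keeps the inequality
     strict and covers K = 0. *)
  pose M := 2 * (K + 1) / eps.
  have Mp : 0 < M by apply: Rdiv_lt_0_compat; [lra | apply: cond_pos].
  have KM : 2 * (K * / M) < eps.
    have -> : 2 * (K * / M) = K / (K + 1) * eps.
      by rewrite /M; field; split; [lra | have := cond_pos eps; lra].
    rewrite -{2}(Rmult_1_l eps); apply: Rmult_lt_compat_r; first exact: cond_pos.
    by apply: (Rmult_lt_reg_r (K + 1)); [lra | rewrite /Rdiv Rmult_assoc Rinv_l; lra].
  exists (fun ab => ab.1 < - M /\ M < ab.2); split.
    apply: (Filter_prod _ _ _ (fun a => a < - M) (fun b => M < b)) => //; by [exists (- M)|exists M].
  move=> [a b] [a' b'] /= [ha hb] [ha' hb'].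
  rewrite /ball /= /AbsRing_ball /abs /minus /plus /opp /=.
  have E x y := cont_ex_RInt f x y (proj1 d).
  have c1 := RInt_Chasles (V := R_CompleteNormedModule) f a' a b (E _ _) (E _ _).
  have c2 := RInt_Chasles (V := R_CompleteNormedModule) f a' b b' (E _ _) (E _ _).
  rewrite /plus /= in c1 c2.
  have -> : RInt f a' b' + - RInt f a b = RInt f a' a + RInt f b b' by lra.
  apply: Rle_lt_trans (Rabs_triang _ _) _.
  have t1 := dom1_RInt_abs _ _ a' a d; have t2 := dom1_RInt_abs _ _ b b' d.
  have T := atan_tail M Mp.
  have near x y : M < x -> M < y -> Rabs (atan x - atan y) <= / M.
    move=> /atan_increasing hx /atan_increasing hy.
    by have := atan_bound x; have := atan_bound y => ? ?; apply: Rabs_le; lra.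
  have nb : Rabs (atan b' - atan b) <= / M by apply: near.
  have na : Rabs (atan a - atan a') <= / M.
    rewrite (_ : atan a - atan a' = atan (- a') - atan (- a)); last by rewrite !atan_opp; ring.
    by apply: near; lra.
  have := Rmult_le_compat_l _ _ _ K0 nb; have := Rmult_le_compat_l _ _ _ K0 na; lra.
have I : is_RInt_gen f (Rbar_locally m_infty) (Rbar_locally p_infty) l.
  move=> P /L; rewrite /filtermap /filtermapi; apply: filter_imp => ab hab.
  exists (RInt f ab.1 ab.2); split=> //.
  by apply: (RInt_correct (V := R_CompleteNormedModule)); apply: cont_ex_RInt; case: d.
by rewrite (int1_unique _ _ I).
Qed.

Lemma filter_prod_big (P : R * R -> Prop) M : (forall a b, a < - M -> M < b -> P (a, b)) ->
  filter_prod (Rbar_locally m_infty) (Rbar_locally p_infty) P.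
Proof.
move=> H; apply: (Filter_prod _ _ _ (fun a => a < - M) (fun b => M < b)); last exact: H.
- by exists (- M).
- by exists M.
Qed.

Lemma int1_le f K c M : dom1 f K -> (forall a b, a < - M -> M < b -> RInt f a b <= c) -> int1 f <= c.
Proof.
move=> /dom1_is[_ L] H.
apply: (filterlim_le (F := filter_prod (Rbar_locally m_infty) (Rbar_locally p_infty))
   (fun ab : R * R => RInt f ab.1 ab.2) (fun _ => c) (Rbar.Finite _) (Rbar.Finite c)).
- by apply: (filter_prod_big _ M).
- exact: L.
- exact: filterlim_const.
Qed.
Lemma int1_ge f K c M : dom1 f K -> (forall a b, a < - M -> M < b -> c <= RInt f a b) -> c <= int1 f.
Proof.
move=> /dom1_is[_ L] H.
apply: (filterlim_le (F := filter_prod (Rbar_locally m_infty) (Rbar_locally p_infty))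
   (fun _ => c) (fun ab : R * R => RInt f ab.1 ab.2) (Rbar.Finite c) (Rbar.Finite _)).
- by apply: (filter_prod_big _ M).
- exact: filterlim_const.
- exact: L.
Qed.

Lemma int1_plus f g K K' : dom1 f K -> dom1 g K' -> int1 (fun s => f s + g s) = int1 f + int1 g.
Proof.
move=> /dom1_is[a _] /dom1_is[b _]; apply: int1_unique.
exact: (is_RInt_gen_plus (V := R_NormedModule) f g _ _ a b).
Qed.
Lemma int1_scal f K c : dom1 f K -> int1 (fun s => c * f s) = c * int1 f.
Proof.
by move=> /dom1_is[a _]; apply: int1_unique; apply: (is_RInt_gen_scal (V := R_NormedModule) f c _ a).
Qed.
Lemma int1_abs f K : dom1 f K -> Rabs (int1 f) <= K * PI.
Proof.
move=> d; have K0 := dom1_K0 _ _ d.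
have B a b : a < - 1 -> 1 < b -> Rabs (RInt f a b) <= K * PI.
  move=> ha hb; apply: Rle_trans (dom1_RInt_abs _ _ a b d) _; apply: Rmult_le_compat_l => //.
  by apply: Rabs_le; have := atan_bound a; have := atan_bound b; lra.
apply: Rabs_le; split.
  by apply: (int1_ge f K _ 1 d) => a b ha hb; have /Rabs_le_between := B a b ha hb; lra.
by apply: (int1_le f K _ 1 d) => a b ha hb; have /Rabs_le_between := B a b ha hb; lra.
Qed.
Lemma int1_mono f g K K' : dom1 f K -> dom1 g K' -> (forall s, f s <= g s) -> int1 f <= int1 g.
Proof.
move=> df dg H.
have dg' : dom1 (fun s => g s + (-1) * f s) (K' + K).
  case: df dg => cf bf [cg bg]; split=> s.
    by apply: (continuous_plus (V := R_NormedModule)) => //; apply: (continuous_scal_r (V := R_NormedModule)).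
  apply: Rle_trans (Rabs_triang _ _) _; have := bf s; have := bg s.
  by rewrite Rabs_mult Rabs_Ropp Rabs_R1; lra.
have dm : dom1 (fun s => (-1) * f s) K.
  case: df => cf bf; split=> s; first exact: (continuous_scal_r (V := R_NormedModule)).
  by rewrite Rabs_mult Rabs_Ropp Rabs_R1 Rmult_1_l.
have : 0 <= int1 (fun s => g s + (-1) * f s).
  apply: (int1_ge _ _ _ 1 dg') => a b ha hb; apply: RInt_ge_0 => [||x _]; first lra.
    by apply: cont_ex_RInt; case: dg'.
  by have := H x; lra.
rewrite (int1_plus _ _ _ _ dg dm) (int1_scal _ _ _ df); lra.
Qed.
Lemma int1_ge_RInt f K a b : dom1 f K -> (forall s, 0 <= f s) -> a <= b -> RInt f a b <= int1 f.
Proof.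
move=> d p ab; have E x y := cont_ex_RInt f x y (proj1 d).
apply: (int1_ge f K _ (Rabs a + Rabs b) d) => a' b' ha hb.
have := Rle_abs a; have := Rle_abs b; have := Rle_abs (- a); have := Rle_abs (- b).
rewrite !Rabs_Ropp => ? ? ? ?.
have c1 := RInt_Chasles (V := R_CompleteNormedModule) f a' a b' (E _ _) (E _ _).
have c2 := RInt_Chasles (V := R_CompleteNormedModule) f a b b' (E _ _) (E _ _).
rewrite /plus /= in c1 c2.
have p1 : 0 <= RInt f a' a by apply: RInt_ge_0 => //; lra.
have p2 : 0 <= RInt f b b' by apply: RInt_ge_0 => //; lra.
lra.
Qed.
Lemma int1_shift f K t : dom1 f K -> int1 (fun s => f (s + t)) = int1 f.
Proof.
move=> d; have [_ L] := dom1_is _ _ d.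
have cs s : continuous (fun s => f (s + t)) s.
  apply: (continuous_comp (fun s => s + t) f); last by case: d.
  by apply: (ex_derive_continuous (V := R_NormedModule)); auto_derive.
have R1 a b : RInt (fun s => f (s + t)) a b = RInt f (a + t) (b + t).
  have := RInt_comp_lin (V := R_CompleteNormedModule) f 1 t a b.
  rewrite !Rmult_1_l => <-; last by apply: cont_ex_RInt; case: d.
  by apply: RInt_ext => x _; rewrite /scal /= /mult /= !Rmult_1_l.
apply: int1_unique => P /L [Q1 Q2 [m1 h1] [m2 h2] HQ].
exists (fun a => Q1 (a + t)) (fun b => Q2 (b + t)).
- by exists (m1 - t) => x hx; apply: h1; lra.
- by exists (m2 - t) => x hx; apply: h2; lra.
- move=> a b q1 q2; exists (RInt f (a + t) (b + t)); split; last exact: HQ.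
  by rewrite -R1; apply: (RInt_correct (V := R_CompleteNormedModule)); apply: cont_ex_RInt.
Qed.

(** * Iterated integrals *)

Section Iterated.
Context {k : nat}.
Implicit Types (x y : Pt k) (i j : 'I_k) (l : seq 'I_k) (h : Pt k -> R).

Definition Wt l x : R := foldr (fun i r => w1 (x i) * r) 1 l.
Definition cshift i t x : Pt k := upd x i (x i + t).
(* Lipschitz in each coordinate separately, with the same weight: this is stable under
   integration in one coordinate, and avoids any uniform continuity argument. *)
Definition decay l h : Prop := exists K, forall x, Rabs (h x) <= K * Wt l x /\
  forall i t, Rabs t <= 1 -> Rabs (h (cshift i t x) - h x) <= K * Rabs t * Wt l x.

Lemma Wt_pos l x : 0 < Wt l x.
Proof. by elim: l => [|i l IH] /=; [lra | apply: Rmult_lt_0_compat => //; apply: w1_pos]. Qed.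
Lemma Wt_le1 l x : Wt l x <= 1.
Proof.
elim: l => [|i l IH] /=; first lra.
by have := w1_le1 (x i); have := w1_pos (x i); have := Wt_pos l x; nra.
Qed.
Lemma Wt_upd l x i t : i \notin l -> Wt l (upd x i t) = Wt l x.
Proof.
elim: l => [//|j l IH]; rewrite inE negb_or => /andP[ij il] /=.
by rewrite upd_neq 1?eq_sym // IH.
Qed.
Lemma Wt_shift l x i t : Rabs t <= 1 -> Wt l (cshift i t x) <= 3 ^ size l * Wt l x.
Proof.
move=> ht; elim: l => [|j l IH] /=; first lra.
have W0 := Wt_pos l x; have W1 := Wt_pos l (cshift i t x).
have p0 := w1_pos (x j); have p1 := w1_pos (cshift i t x j).
have : w1 (cshift i t x j) <= 3 * w1 (x j).
  rewrite /cshift /upd; case: eqP => [<-|_]; first exact: w1_shift.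
  by have := w1_pos (x j); lra.
move=> H; apply: Rle_trans (Rmult_le_compat _ _ _ _ (Rlt_le _ _ p1) (Rlt_le _ _ W1) H IH) _.
by right; ring.
Qed.

Lemma decay_K0 l h K : (forall x, Rabs (h x) <= K * Wt l x) -> 0 <= K.
Proof. by move=> /(_ (fun _ => 0)); have := Rabs_pos (h (fun _ => 0)); have := Wt_pos l (fun _ => 0); nra. Qed.

Lemma decay_plus l h h' : decay l h -> decay l h' -> decay l (fun x => h x + h' x).
Proof.
move=> [K H] [K' H']; exists (K + K') => x; have [a b] := H x; have [a' b'] := H' x; split.
  by have := Rabs_triang (h x) (h' x); lra.
move=> i t ht; have := b i t ht; have := b' i t ht.
have := Rabs_triang (h (cshift i t x) - h x) (h' (cshift i t x) - h' x).
rewrite (_ : h (cshift i t x) + h' (cshift i t x) - (h x + h' x)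
  = h (cshift i t x) - h x + (h' (cshift i t x) - h' x)); [lra|ring].
Qed.
Lemma decay_scal l h c : decay l h -> decay l (fun x => c * h x).
Proof.
move=> [K H]; exists (Rabs c * K) => x; have [a b] := H x; split.
  by rewrite Rabs_mult Rmult_assoc; apply: Rmult_le_compat_l => //; apply: Rabs_pos.
move=> i t ht; rewrite -Rmult_minus_distr_l Rabs_mult !Rmult_assoc -Rmult_assoc.
rewrite Rmult_assoc; apply: Rmult_le_compat_l; first exact: Rabs_pos.
by rewrite -Rmult_assoc; apply: b.
Qed.
Lemma shift_comm i j t u x : i != j -> cshift i t (cshift j u x) = cshift j u (cshift i t x).
Proof.
move=> ij; rewrite /cshift !upd_neq // 1?eq_sym // upd_comm // eq_sym //.
Qed.
Lemma shift_add i t u x : cshift i t (cshift i u x) = cshift i (u + t) x.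
Proof. by rewrite /cshift upd_same upd_upd Rplus_assoc. Qed.
Lemma decay_shift l h i t : Rabs t <= 1 -> decay l h -> decay l (fun x => h (cshift i t x)).
Proof.
move=> ht [K H]; have K0 := decay_K0 l h K (fun x => proj1 (H x)).
exists (K * 3 ^ size l) => x; have [a b] := H (cshift i t x).
have W := Wt_shift l x i t ht; split.
  by apply: Rle_trans a _; rewrite Rmult_assoc; apply: Rmult_le_compat_l.
move=> j u hu; have -> : cshift i t (cshift j u x) = cshift j u (cshift i t x).
  by case: (i =P j) => [<-|/eqP]; [rewrite !shift_add Rplus_comm | apply: shift_comm].
apply: Rle_trans (b j u hu) _; have := Rabs_pos u => u0.
have : K * Rabs u * Wt l (cshift i t x) <= K * Rabs u * (3 ^ size l * Wt l x).
  by apply: Rmult_le_compat_l => //; apply: Rmult_le_pos.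
lra.
Qed.

Lemma decay_dom1 i l h : i \notin l -> decay (i :: l) h -> forall K x,
  (forall y, Rabs (h y) <= K * Wt (i :: l) y) -> dom1 (fun s => h (upd x i s)) (K * Wt l x).
Proof.
move=> il [K H] K' x H'; split=> s; last first.
  apply: Rle_trans (H' _) _ => /=; rewrite upd_same Wt_upd //; lra.
have K0 := decay_K0 _ h K (fun x => proj1 (H x)).
apply/continuity_pt_filterlim => e he.
exists (Rmin 1 (e / (K + 1))); split.
  by apply: Rmin_glb_lt; [lra | apply: Rdiv_lt_0_compat; lra].
move=> t [_ /= ht]; rewrite /R_dist in ht |- *.
have t1 : Rabs (t - s) <= 1 by have := Rmin_l 1 (e / (K + 1)); lra.
have t2 : Rabs (t - s) < e / (K + 1) by have := Rmin_r 1 (e / (K + 1)); lra.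
have [_ /(_ i (t - s) t1)] := H (upd x i s).
rewrite /cshift upd_same upd_upd (_ : s + (t - s) = t); last ring.
move=> B; apply: Rle_lt_trans B _.
apply: (Rle_lt_trans _ (K * Rabs (t - s) * 1)).
  by apply: Rmult_le_compat_l; [apply: Rmult_le_pos => //; apply: Rabs_pos | apply: Wt_le1].
have : (K + 1) * Rabs (t - s) < e.
  have -> : e = (K + 1) * (e / (K + 1)) by field; lra.
  by apply: Rmult_lt_compat_l; lra.
by have := Rabs_pos (t - s); lra.
Qed.

Lemma int_coord_abs i l h K : i \notin l -> decay (i :: l) h ->
  (forall x, Rabs (h x) <= K * Wt (i :: l) x) -> forall x, Rabs (int_coord i h x) <= K * PI * Wt l x.
Proof.
move=> il d H x; have := int1_abs _ _ (decay_dom1 i l h il d K x H).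
by rewrite -/(int1 _) /int_coord -/(int1 _); lra.
Qed.

Lemma decay_int i l h : i \notin l -> decay (i :: l) h -> decay l (int_coord i h).
Proof.
move=> il d; have [K H] := d.
have B := decay_dom1 i l h il d K _ (fun x => proj1 (H x)).
exists (K * PI) => x; split.
  by apply: int_coord_abs => // y; case: (H y).
move=> j t ht; case: (j =P i) => [->|/eqP ji].
  have -> : int_coord i h (cshift i t x) = int_coord i h x.
    by rewrite /int_coord /cshift; congr (RInt_gen _ _ _); apply: functional_extensionality => s; rewrite upd_upd.
  rewrite Rminus_diag Rabs_R0; apply: Rmult_le_pos; last by left; apply: Wt_pos.
  apply: Rmult_le_pos (Rabs_pos _); apply: Rmult_le_pos; last by have := PI_RGT_0; lra.
  exact: (decay_K0 _ _ _ (fun x => proj1 (H x))).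
rewrite /int_coord -!/(int1 _).
pose f s := h (upd (cshift j t x) i s); pose g s := h (upd x i s).
have df : dom1 f (K * Wt l (cshift j t x)) by apply: B.
have dg : dom1 g (K * Wt l x) by apply: B.
have dgm : dom1 (fun s => (-1) * g s) (K * Wt l x).
  case: dg => cg bg; split=> s; first exact: (continuous_scal_r (V := R_NormedModule)).
  by rewrite Rabs_mult Rabs_Ropp Rabs_R1 Rmult_1_l.
have dd : dom1 (fun s => f s + (-1) * g s) (K * Rabs t * Wt l x).
  split=> s.
    by apply: (continuous_plus (V := R_NormedModule)); [case: df | case: dgm].
  have [_ /(_ j t ht)] := H (upd x i s).
  rewrite /cshift upd_neq // (upd_comm x i) 1?eq_sym //= upd_same Wt_upd // /f /g /cshift => b.
  by rewrite (_ : _ + -1 * _ = h (upd (upd x j (x j + t)) i s) - h (upd x i s)); [lra | ring].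
have := int1_abs _ _ dd.
rewrite (int1_plus _ _ _ _ df dgm) (int1_scal _ _ _ dg) /f /g => h1.
by rewrite /Rminus (_ : - int1 _ = -1 * int1 (fun s => h (upd x i s))); [lra | ring].
Qed.

Definition Fint l h : Pt k -> R := foldr (fun i h' => int_coord i h') h l.

Lemma catrev_notin l s i : uniq (catrev l (i :: s)) -> i \notin s.
Proof. by rewrite catrevE cat_uniq => /and3P[_ _ /= /andP[]]. Qed.

(** [catrev l s] lists the coordinates in which [h] decays, [s] those that remain after integration.
    Since [catrev (i :: l) s] computes to [catrev l (i :: s)], the weight in the coordinate
    integrated last stands at the head of the list exactly when [decay_int] asks for it. *)
Lemma Fint_decay l s h : uniq (catrev l s) -> decay (catrev l s) h -> decay s (Fint l h).
Proof.
elim: l s => [//|i l IH] s /= u d; apply: decay_int; first exact: catrev_notin u.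
exact: IH.
Qed.
Lemma Fint_abs l s h K : uniq (catrev l s) -> decay (catrev l s) h ->
  (forall x, Rabs (h x) <= K * Wt (catrev l s) x) ->
  forall x, Rabs (Fint l h x) <= K * PI ^ size l * Wt s x.
Proof.
elim: l s => [|i l IH] s /= u d H x; first by rewrite Rmult_1_r.
have := int_coord_abs i s (Fint l h) (K * PI ^ size l) (catrev_notin _ _ _ u)
  (Fint_decay _ _ _ u d) (IH _ u d H) x; lra.
Qed.
Lemma int_coord_plus i l h h' x : i \notin l -> decay (i :: l) h -> decay (i :: l) h' ->
  int_coord i (fun x => h x + h' x) x = int_coord i h x + int_coord i h' x.
Proof.
move=> il d d'; have [K H] := d; have [K' H'] := d'.
exact: (int1_plus _ _ _ _ (decay_dom1 i l h il d K x (fun x => proj1 (H x)))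
  (decay_dom1 i l h' il d' K' x (fun x => proj1 (H' x)))).
Qed.
Lemma int_coord_scal i l h c x : i \notin l -> decay (i :: l) h ->
  int_coord i (fun x => c * h x) x = c * int_coord i h x.
Proof.
move=> il d; have [K H] := d.
exact: (int1_scal _ _ _ (decay_dom1 i l h il d K x (fun x => proj1 (H x)))).
Qed.
Lemma int_coord_mono i l h h' x : i \notin l -> decay (i :: l) h -> decay (i :: l) h' ->
  (forall x, h x <= h' x) -> int_coord i h x <= int_coord i h' x.
Proof.
move=> il d d' le; have [K H] := d; have [K' H'] := d'.
by apply: (int1_mono _ _ _ _ (decay_dom1 i l h il d K x (fun x => proj1 (H x)))
  (decay_dom1 i l h' il d' K' x (fun x => proj1 (H' x)))) => s; apply: le.
Qed.
Lemma Fint_plus l s h h' : uniq (catrev l s) -> decay (catrev l s) h -> decay (catrev l s) h' ->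
  Fint l (fun x => h x + h' x) = fun x => Fint l h x + Fint l h' x.
Proof.
elim: l s => [//|i l IH] s /= u d d'; rewrite (IH _ u d d').
apply: functional_extensionality => x.
apply: int_coord_plus (catrev_notin _ _ _ u) _ _; exact: Fint_decay.
Qed.
Lemma Fint_scal l s h c : uniq (catrev l s) -> decay (catrev l s) h ->
  Fint l (fun x => c * h x) = fun x => c * Fint l h x.
Proof.
elim: l s => [//|i l IH] s /= u d; rewrite (IH _ u d).
apply: functional_extensionality => x.
apply: int_coord_scal (catrev_notin _ _ _ u) _; exact: Fint_decay.
Qed.
Lemma Fint_mono l s h h' : uniq (catrev l s) -> decay (catrev l s) h -> decay (catrev l s) h' ->
  (forall x, h x <= h' x) -> forall x, Fint l h x <= Fint l h' x.
Proof.
elim: l s => [//|i l IH] s /= u d d' le x.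
apply: int_coord_mono (catrev_notin _ _ _ u) _ _ _; [exact: Fint_decay|exact: Fint_decay|].
exact: (IH _ u).
Qed.
Lemma Fint_pos l s h : uniq (catrev l s) -> decay (catrev l s) h ->
  (forall x, 0 < h x) -> forall x, 0 < Fint l h x.
Proof.
elim: l s => [//|i l IH] s /= u d p x.
have d' := Fint_decay _ _ _ u d; have [K H] := d'.
have D := decay_dom1 i s _ (catrev_notin _ _ _ u) d' K x (fun x => proj1 (H x)).
apply: Rlt_le_trans (int1_ge_RInt _ _ 0 1 D _ Rle_0_1); last by move=> t; left; apply: (IH _ u).
apply: RInt_gt_0 => [|t _|t _]; [lra | exact: (IH _ u) | by case: D].
Qed.
Lemma Fint_indep l h i x t : i \in l -> Fint l h (upd x i t) = Fint l h x.
Proof.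
elim: l x => [//|j l IH] x il /=; rewrite /int_coord; congr (RInt_gen _ _ _).
apply: functional_extensionality => s.
case: (i =P j) il => [->|/eqP ij]; first by rewrite upd_upd.
by rewrite inE (negbTE ij) /= => il; rewrite upd_comm // IH.
Qed.
Lemma Fint_shift l s h i t : uniq (catrev l s) -> decay (catrev l s) h ->
  Fint l (fun x => h (cshift i t x)) = fun x => Fint l h (cshift i t x).
Proof.
elim: l s => [//|j l IH] s /= u d; rewrite (IH _ u d).
apply: functional_extensionality => x; rewrite /int_coord.
case: (i =P j) => [->|/eqP ij].
  have d' := Fint_decay _ _ _ u d; have [K H] := d'.
  have D := decay_dom1 j s _ (catrev_notin _ _ _ u) d' K x (fun x => proj1 (H x)).
  have := int1_shift _ _ t D; rewrite /int1 /cshift => E.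
  transitivity (RInt_gen (fun s => Fint l h (upd x j (s + t))) (Rbar_locally m_infty) (Rbar_locally p_infty)).
    by congr (RInt_gen _ _ _); apply: functional_extensionality => z; rewrite upd_same upd_upd.
  by rewrite E; congr (RInt_gen _ _ _); apply: functional_extensionality => z; rewrite upd_upd.
congr (RInt_gen _ _ _); apply: functional_extensionality => z.
by rewrite /cshift upd_neq // upd_comm // eq_sym.
Qed.

Definition Wf : Pt k -> R := Wt (catrev (enum 'I_k) [::]).
Definition dec h := decay (catrev (enum 'I_k) [::]) h.
Let ue : uniq (catrev (enum 'I_k) [::]).
Proof. by rewrite catrevE cats0 rev_uniq enum_uniq. Qed.

Lemma intR_plus h h' : dec h -> dec h' -> intR (fun x => h x + h' x) = intR h + intR h'.
Proof. by move=> d d'; rewrite /intR -!/(Fint _ _) (Fint_plus _ _ _ _ ue d d'). Qed.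
Lemma intR_scal h c : dec h -> intR (fun x => c * h x) = c * intR h.
Proof. by move=> d; rewrite /intR -!/(Fint _ _) (Fint_scal _ _ _ _ ue d). Qed.
Lemma intR_mono h h' : dec h -> dec h' -> (forall x, h x <= h' x) -> intR h <= intR h'.
Proof. by move=> d d' le; apply: (Fint_mono _ _ _ _ ue d d' le). Qed.
Lemma intR_pos h : dec h -> (forall x, 0 < h x) -> 0 < intR h.
Proof. by move=> d p; apply: (Fint_pos _ _ _ ue d p). Qed.
Lemma intR_abs h K : dec h -> (forall x, Rabs (h x) <= K * Wf x) -> Rabs (intR h) <= K * PI ^ k.
Proof. by move=> d H; have := Fint_abs _ _ _ _ ue d H (fun _ => 0); rewrite size_enum_ord /= Rmult_1_r. Qed.
Lemma intR_shift h i t : dec h -> intR (fun x => h (cshift i t x)) = intR h.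
Proof.
move=> d; rewrite /intR -!/(Fint _ _) (Fint_shift _ _ _ _ _ ue d) /cshift Fint_indep //.
by rewrite mem_enum.
Qed.
Lemma intR_const_Fint h x : Fint (enum 'I_k) h x = intR h.
Proof.
rewrite /intR -/(Fint _ _).
(* [l] lists the coordinates that may still differ from 0; they are reset one at a time, each of
   them being integrated out. *)
suff H l : (forall i, i \in enum 'I_k -> i \notin l -> x i = 0) -> Fint (enum 'I_k) h x = Fint (enum 'I_k) h (fun _ => 0).
  by apply: (H (enum 'I_k)) => i ->.
elim: l x => [|j l IH] x H.
  by congr Fint; apply: functional_extensionality => i; apply: H; rewrite ?mem_enum.
rewrite -(Fint_indep _ h j x 0) ?mem_enum //; apply: IH => i ie il; rewrite /upd.
by case: eqP => // /eqP ij; apply: H => //; rewrite inE negb_or ij.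
Qed.

(* Translation invariance replaces Fubini: a difference quotient has integral 0. *)
Lemma intR_deriv0 h h' i K : dec h -> dec h' ->
  (forall x t, Rabs t <= 1 -> Rabs (h (cshift i t x) - h x - t * h' x) <= K * t ^ 2 * Wf x) ->
  intR h' = 0.
Proof.
move=> d d' H.
have B t : 0 < t <= 1 -> Rabs (intR h') <= K * PI ^ k * t.
  move=> ht; have ta : Rabs t <= 1 by rewrite Rabs_pos_eq; lra.
  have ds := decay_shift _ _ i t ta d.
  have dm := decay_scal _ _ (-1) d; have dt := decay_scal _ _ (- t) d'.
  have := intR_abs (fun x => h (cshift i t x) + (-1 * h x + - t * h' x)) (K * t ^ 2)
    (decay_plus _ _ _ ds (decay_plus _ _ _ dm dt)).
  rewrite (intR_plus _ _ ds (decay_plus _ _ _ dm dt)) (intR_plus _ _ dm dt) intR_shift //.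
  rewrite !intR_scal // (_ : _ + (_ + _) = - t * intR h'); last ring.
  rewrite Rabs_mult Rabs_Ropp (Rabs_pos_eq t); last lra.
  move=> b; apply: (Rmult_le_reg_l t); first lra.
  apply: Rle_trans (b _) _; last by right; ring.
  move=> x; rewrite (_ : _ + (_ + _) = h (cshift i t x) - h x - t * h' x); last ring.
  exact: H.
case: (Req_dec (intR h') 0) => // /Rabs_pos_lt p.
pose M := K * PI ^ k.
have M0 : 0 <= M by have := B 1 (conj Rlt_0_1 (Rle_refl _)); rewrite -/M; lra.
pose t := Rmin 1 (Rabs (intR h') / (2 * (M + 1))).
have tp : 0 < t by apply: Rmin_glb_lt; [lra | apply: Rdiv_lt_0_compat; lra].
have := B t (conj tp (Rmin_l _ _)); rewrite -/M.
have t2 : t <= Rabs (intR h') / (2 * (M + 1)) by apply: Rmin_r.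
have : M * t <= (M + 1) * (Rabs (intR h') / (2 * (M + 1))) by apply: Rmult_le_compat; lra.
have -> : (M + 1) * (Rabs (intR h') / (2 * (M + 1))) = Rabs (intR h') / 2 by field; lra.
lra.
Qed.
End Iterated.

(** * Words in the coordinates and derivatives *)

Lemma Cmult_1l (z : C) : Cmult (RtoC 1) z = z. Proof. by ring. Qed.
Lemma Cmod_Ci : Cmod Ci = 1.
Proof. by rewrite /Cmod /= (_ : 0 * (0 * 1) + 1 * (1 * 1) = 1) ?sqrt_1 //; ring. Qed.
Lemma Cconj_mult (z w : C) : Cconj (Cmult z w) = Cmult (Cconj z) (Cconj w).
Proof. by apply: C_ext; rewrite /= /Re /Im; ring. Qed.
Lemma Cconj_plus (z w : C) : Cconj (Cplus z w) = Cplus (Cconj z) (Cconj w).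
Proof. by apply: C_ext; rewrite /= /Re /Im; ring. Qed.
Lemma Cconj_conj (z : C) : Cconj (Cconj z) = z.
Proof. by apply: C_ext; rewrite /= /Re /Im; ring. Qed.
Lemma Cconj_R (r : R) : Cconj (RtoC r) = RtoC r.
Proof. by apply: C_ext; rewrite /= /Re /Im; ring. Qed.
Lemma Ci2 : Cmult Ci Ci = RtoC (-1).
Proof. by apply: C_ext; rewrite /= /Re /Im; ring. Qed.
Lemma fext {A B : Type} (f g : A -> B) : (forall x, f x = g x) -> f = g.
Proof. exact: functional_extensionality. Qed.

Section Nice.
Context {k : nat}.
Local Notation F := (Pt k -> C).
Implicit Types (g h : F) (w : seq 'I_(k + k)).

(* Letters [i < k] are multiplications by the coordinates, letters [k + i] are [D_i = -i d_i]:
   all of them are symmetric, so a word moves across the inner product by reversal. *)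
Definition Zop (i : 'I_(k + k)) (g : F) : F :=
  match fintype.split i with
  | inl j => fun x => Cmult (RtoC (x j)) (g x)
  | inr j => fun x => Cmult (Copp Ci) (pd j g x)
  end.
Definition zw w (g : F) : F := foldr Zop g w.
Definition cplus g h : F := fun x => Cplus (g x) (h x).
Definition cscal (c : C) g : F := fun x => Cmult c (g x).
Definition cmul g h : F := fun x => Cmult (g x) (h x).
Definition cconj g : F := fun x => Cconj (g x).
Definition cbounded g := exists K, forall x, Cmod (g x) <= K.
(** The Schwartz class phrased with words in arbitrary order, so that stability under a letter is
    immediate. The equivalence with [schwartz] is the content of normal ordering, in [schwartz_nice]
    and [nice_schwartz]. *)
Definition nice g := smooth g /\ forall w, cbounded (zw w g).

Lemma zw_cat w w' g : zw (w ++ w') g = zw w (zw w' g).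
Proof. by rewrite /zw foldr_cat. Qed.
Lemma zw_rcons w i g : zw (rcons w i) g = zw w (Zop i g).
Proof. by rewrite -cats1 zw_cat. Qed.
Lemma Zop_l j g : Zop (lshift k j) g = fun x => Cmult (RtoC (x j)) (g x).
Proof. by rewrite /Zop (unsplitK (inl j)). Qed.
Lemma Zop_r j g : Zop (rshift k j) g = fun x => Cmult (Copp Ci) (pd j g x).
Proof. by rewrite /Zop (unsplitK (inr j)). Qed.
Lemma letterP (P : 'I_(k + k) -> Prop) :
  (forall j, P (lshift k j)) -> (forall j, P (rshift k j)) -> forall i, P i.
Proof. by move=> H1 H2 i; rewrite -(splitK i); case: (fintype.split i). Qed.

Lemma smooth_cscal c g : smooth g -> smooth (cscal c g).
Proof. by move=> sg; apply: smooth_mult => //; apply: smooth_const. Qed.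
Lemma smooth_Z i g : smooth g -> smooth (Zop i g).
Proof.
move=> sg; elim/letterP: i => j; rewrite ?Zop_l ?Zop_r.
  by apply: smooth_mult => //; apply: smooth_coord.
by apply: smooth_cscal; apply: smooth_pd.
Qed.
Lemma smooth_zw w g : smooth g -> smooth (zw w g).
Proof. by move=> sg; elim: w => [//|i w IH]; apply: smooth_Z. Qed.

Lemma Zop_plus i g h : smooth g -> smooth h -> Zop i (cplus g h) = cplus (Zop i g) (Zop i h).
Proof.
move=> sg sh; elim/letterP: i => j; rewrite ?Zop_l ?Zop_r /cplus ?pd_plus //; apply: fext => x; ring.
Qed.
Lemma Zop_scal i c g : smooth g -> Zop i (cscal c g) = cscal c (Zop i g).
Proof.
move=> sg; elim/letterP: i => j; rewrite ?Zop_l ?Zop_r /cscal ?pd_scal //; apply: fext => x; ring.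
Qed.
Lemma zw_plus w g h : smooth g -> smooth h -> zw w (cplus g h) = cplus (zw w g) (zw w h).
Proof. by move=> sg sh; elim: w => [//|i w IH] /=; rewrite IH Zop_plus //; apply: smooth_zw. Qed.
Lemma zw_scal w c g : smooth g -> zw w (cscal c g) = cscal c (zw w g).
Proof. by move=> sg; elim: w => [//|i w IH] /=; rewrite IH Zop_scal //; apply: smooth_zw. Qed.

Lemma cbounded_plus g h : cbounded g -> cbounded h -> cbounded (cplus g h).
Proof.
move=> [K H] [K' H']; exists (K + K') => x; apply: Rle_trans (Cmod_triangle _ _) _.
by have := H x; have := H' x; lra.
Qed.
Lemma cbounded_mul g h : cbounded g -> cbounded h -> cbounded (cmul g h).
Proof.
move=> [K H] [K' H']; exists (K * K') => x; rewrite Cmod_mult.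
by apply: Rmult_le_compat => //; apply: Cmod_ge_0.
Qed.
Lemma cbounded_scal c g : cbounded g -> cbounded (cscal c g).
Proof. by move=> b; apply: (cbounded_mul (fun _ => c)) => //; exists (Cmod c) => _; lra. Qed.

Inductive lin (B : F -> Prop) : F -> Prop :=
| lin_base g : B g -> lin B g
| lin_plus g h : lin B g -> lin B h -> lin B (cplus g h)
| lin_scal c g : lin B g -> lin B (cscal c g).

(** The analogue of [smooth_coind] for [nice]. One letter may send the class into its linear span,
    which is what the Leibniz rule and commutators produce. *)
Lemma lin_nice (B : F -> Prop) :
  (forall g, B g -> smooth g /\ cbounded g /\ forall i, lin B (Zop i g)) ->
  forall g, lin B g -> nice g.
Proof.
move=> H.
have A g : lin B g -> smooth g /\ cbounded g /\ forall i, lin B (Zop i g).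
  elim=> {g} [g /H //|g h _ [sg [bg zg]] _ [sh [bh zh]]|c g _ [sg [bg zg]]].
    split; first exact: smooth_plus.
    split; first exact: cbounded_plus.
    by move=> i; rewrite Zop_plus //; apply: lin_plus.
  split; first exact: smooth_cscal.
  split; first exact: cbounded_scal.
  by move=> i; rewrite Zop_scal //; apply: lin_scal.
move=> g lg; split; first by case: (A g lg).
move=> w; elim/last_ind: w g lg => [|w i IH] g lg; first by case: (A g lg) => _ [].
by rewrite zw_rcons; apply: IH; case: (A g lg) => _ [].
Qed.

Lemma nice_smooth g : nice g -> smooth g. Proof. by case. Qed.
Lemma nice_bounded g : nice g -> cbounded g. Proof. by case=> _ /(_ [::]). Qed.
Lemma nice_Z i g : nice g -> nice (Zop i g).
Proof. by case=> sg H; split; [apply: smooth_Z | move=> w; rewrite -zw_rcons]. Qed.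
Lemma nice_zw w g : nice g -> nice (zw w g).
Proof. by move=> ng; elim: w => [//|i w IH]; apply: nice_Z. Qed.
Lemma nice_lin g : lin nice g -> nice g.
Proof.
apply: lin_nice => h nh; split; [exact: nice_smooth | split; first exact: nice_bounded].
by move=> i; apply: lin_base; apply: nice_Z.
Qed.
Lemma nice_plus g h : nice g -> nice h -> nice (cplus g h).
Proof. by move=> ng nh; apply: nice_lin; apply: lin_plus; apply: lin_base. Qed.
Lemma nice_scal c g : nice g -> nice (cscal c g).
Proof. by move=> ng; apply: nice_lin; apply: lin_scal; apply: lin_base. Qed.
Lemma pd_Z j g : pd j g = cscal Ci (Zop (rshift k j) g).
Proof.
apply: fext => x; rewrite Zop_r /cscal Cmult_assoc (_ : Cmult Ci (Copp Ci) = RtoC 1) ?Cmult_1l //.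
by apply: C_ext; rewrite /= /Re /Im; ring.
Qed.
Lemma nice_pd j g : nice g -> nice (pd j g).
Proof. by move=> ng; rewrite pd_Z; apply: nice_scal; apply: nice_Z. Qed.
Lemma nice_mul g h : nice g -> nice h -> nice (cmul g h).
Proof.
move=> ng nh; apply: (lin_nice (fun f => exists g h, nice g /\ nice h /\ f = cmul g h)); last first.
  by apply: lin_base; exists g, h.
move=> {g h ng nh} f [g [h [ng [nh ->]]]]; split.
  by apply: smooth_mult; apply: nice_smooth.
split; first by apply: cbounded_mul; apply: nice_bounded.
elim/letterP => j.
  apply: lin_base; exists (Zop (lshift k j) g), h; split; first exact: nice_Z.
  by split=> //; rewrite !Zop_l; apply: fext => x; rewrite /cmul; ring.
have -> : Zop (rshift k j) (cmul g h) = cplus (cmul (Zop (rshift k j) g) h) (cmul g (Zop (rshift k j) h)).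
  rewrite !Zop_r /cmul pd_mult; [|exact: nice_smooth|exact: nice_smooth].
  by apply: fext => x; rewrite /cplus; ring.
apply: lin_plus; apply: lin_base.
  by exists (Zop (rshift k j) g), h; split=> //; apply: nice_Z.
by exists g, (Zop (rshift k j) h); do 2 split=> //; apply: nice_Z.
Qed.
Lemma nice_conj g : nice g -> nice (cconj g).
Proof.
move=> ng; apply: (lin_nice (fun f => exists g, nice g /\ f = cconj g)); last first.
  by apply: lin_base; exists g.
move=> {g ng} f [g [ng ->]]; split; first by apply: smooth_conj; apply: nice_smooth.
split; first by have [K H] := nice_bounded _ ng; exists K => x; rewrite /cconj Cmod_conj.
elim/letterP => j.
  apply: lin_base; exists (Zop (lshift k j) g); split; first exact: nice_Z.
  by rewrite !Zop_l; apply: fext => x; rewrite /cconj Cconj_mult Cconj_R.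
have -> : Zop (rshift k j) (cconj g) = cscal (RtoC (-1)) (cconj (Zop (rshift k j) g)).
  rewrite !Zop_r /cconj pd_conj; last exact: nice_smooth.
  apply: fext => x; rewrite /cscal; apply: C_ext; rewrite /= /Re /Im; ring.
by apply: lin_scal; apply: lin_base; exists (Zop (rshift k j) g); split=> //; apply: nice_Z.
Qed.

(** Dividing by the weight is multiplying by the polynomials 1 + x_i^2, which preserves [nice]; so
    mere boundedness of all words contains integrable decay. *)
Lemma nice_weight (l : seq 'I_k) g : nice g ->
  exists2 h, nice h & forall x, Cmult (RtoC (Wt l x)) (h x) = g x.
Proof.
move=> ng; elim: l => [|i l [h nh H]]; first by exists g => // x; rewrite /= Cmult_1l.
exists (cplus h (Zop (lshift k i) (Zop (lshift k i) h))); first by apply: nice_plus => //; do 2 apply: nice_Z.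
move=> x; rewrite -H !Zop_l /cplus /=.
have -> : Cplus (h x) (Cmult (RtoC (x i)) (Cmult (RtoC (x i)) (h x))) = Cmult (RtoC (1 + x i * x i)) (h x).
  by rewrite RtoC_plus RtoC_mult; ring.
rewrite Cmult_assoc -RtoC_mult; congr Cmult; congr RtoC.
rewrite /w1 /Rsqr; field; by have := Rle_0_sqr (x i); rewrite /Rsqr; lra.
Qed.
Lemma nice_decayl (l : seq 'I_k) g : nice g -> exists2 K, 0 <= K & forall x, Cmod (g x) <= K * Wt l x.
Proof.
move=> ng; have [h nh H] := nice_weight l g ng.
have [K B] := nice_bounded _ nh; exists K; first exact: Rle_trans (Cmod_ge_0 _) (B (fun _ => 0)).
move=> x; rewrite -H Cmod_mult Cmod_R Rabs_pos_eq; last by left; apply: Wt_pos.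
by rewrite Rmult_comm; apply: Rmult_le_compat_r => //; left; apply: Wt_pos.
Qed.
Lemma nice_decay g : nice g -> exists2 K, 0 <= K & forall x, Cmod (g x) <= K * Wf x.
Proof. exact: nice_decayl. Qed.

Lemma smooth_section g i (x : Pt k) : smooth g -> forall s,
  is_derive (fun s => Re (g (upd x i s))) s (Re (pd i g (upd x i s))) /\
  is_derive (fun s => Im (g (upd x i s))) s (Im (pd i g (upd x i s))).
Proof.
move=> sg s; have [a b] := smooth_is_pd g i (upd x i s) sg.
rewrite upd_same in a b; split; [apply: is_derive_ext a|apply: is_derive_ext b] => t; by rewrite upd_upd.
Qed.

Lemma Wt_section l (x : Pt k) i s t K : 0 <= K -> Rabs t <= 1 -> Rabs (s - x i) <= Rabs t ->
  K * Wt l (upd x i s) <= K * 3 ^ size l * Wt l x.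
Proof.
move=> K0 ht hs; rewrite Rmult_assoc; apply: Rmult_le_compat_l => //.
have := Wt_shift l x i (s - x i); rewrite /cshift (_ : x i + (s - x i) = s); last ring.
apply; lra.
Qed.

Lemma nice_taylor g i : nice g -> exists K,
  forall (x : Pt k) t, Rabs t <= 1 ->
   Rabs (Re (g (cshift i t x)) - Re (g x) - t * Re (pd i g x)) <= K * t ^ 2 * Wf x /\
   Rabs (Im (g (cshift i t x)) - Im (g x) - t * Im (pd i g x)) <= K * t ^ 2 * Wf x.
Proof.
move=> ng; have [K K0 H] := nice_decay _ (nice_pd i _ (nice_pd i _ ng)).
exists (K * 3 ^ size (catrev (enum 'I_k) [::])) => x t ht.
have sg := nice_smooth _ ng; have sp := smooth_pd _ i sg.
have D1 := smooth_section g i x sg; have D2 := smooth_section _ i x sp.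
have B s : Rabs (s - x i) <= Rabs t -> Cmod (pd i (pd i g) (upd x i s))
   <= K * 3 ^ size (catrev (enum 'I_k) [::]) * Wf x.
  by move=> hs; apply: Rle_trans (H _) _; apply: (Wt_section _ x i s t).
split.
- have := taylor_le _ _ _ (x i) t _ (fun s => proj1 (D1 s)) (fun s => proj1 (D2 s))
    (fun s hs => Rle_trans _ _ _ (Re_le_Cmod _) (B s hs)).
  by rewrite !upd_id -/(cshift i t x) => T; apply: Rle_trans T _; lra.
- have := taylor_le _ _ _ (x i) t _ (fun s => proj2 (D1 s)) (fun s => proj2 (D2 s))
    (fun s hs => Rle_trans _ _ _ (Im_le_Cmod _) (B s hs)).
  by rewrite !upd_id -/(cshift i t x) => T; apply: Rle_trans T _; lra.
Qed.

Lemma nice_decl (l : seq 'I_k) g : nice g -> decay l (fun x => Re (g x)) /\ decay l (fun x => Im (g x)).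
Proof.
move=> ng; have [K K0 H] := nice_decayl l _ ng.
have sg := nice_smooth _ ng.
have [K' H'] : exists K', forall i (x : Pt k) t, Rabs t <= 1 ->
    Rabs (Re (g (cshift i t x)) - Re (g x)) <= K' * Rabs t * Wt l x /\
    Rabs (Im (g (cshift i t x)) - Im (g x)) <= K' * Rabs t * Wt l x.
  suff [K' HK'] : exists K', forall i, i \in enum 'I_k -> forall x, Cmod (pd i g x) <= K' * Wt l x.
    have K'0 (i : 'I_k) : 0 <= K'.
      by have := HK' i (mem_enum _ i) (fun _ => 0); have := Cmod_ge_0 (pd i g (fun _ => 0));
         have := Wt_pos l (fun _ => 0); nra.
    exists (K' * 3 ^ size l) => i x t ht.
    have D1 := smooth_section g i x sg.
    have B s : Rabs (s - x i) <= Rabs t -> Cmod (pd i g (upd x i s))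
        <= K' * 3 ^ size l * Wt l x.
      move=> hs; apply: Rle_trans (HK' i _ _) _; first by rewrite mem_enum.
      by apply: (Wt_section _ x i s t) => //; apply: K'0 i.
    split.
    - have := mvt_le _ _ (x i) t _ (fun s => proj1 (D1 s)) (fun s hs => Rle_trans _ _ _ (Re_le_Cmod _) (B s hs)).
      by rewrite !upd_id -/(cshift i t x) => T; apply: Rle_trans T _; lra.
    - have := mvt_le _ _ (x i) t _ (fun s => proj2 (D1 s)) (fun s hs => Rle_trans _ _ _ (Im_le_Cmod _) (B s hs)).
      by rewrite !upd_id -/(cshift i t x) => T; apply: Rle_trans T _; lra.
  elim: (enum 'I_k) => [|i e [K' IH]]; first by exists 0.
  have [K2 K20 H2] := nice_decayl l _ (nice_pd i _ ng).
  exists (Rmax K' K2) => j; rewrite inE => /orP[/eqP ->|jl] x.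
    apply: Rle_trans (H2 x) _; apply: Rmult_le_compat_r; [by left; apply: Wt_pos | exact: Rmax_r].
  apply: Rle_trans (IH j jl x) _; apply: Rmult_le_compat_r; [by left; apply: Wt_pos | exact: Rmax_l].
have W0 (x : Pt k) : 0 < Wt l x by apply: Wt_pos.
split; exists (Rmax K K') => x; (split; last (move=> i t ht)).
- apply: Rle_trans (Re_le_Cmod _) _; apply: Rle_trans (H x) _; apply: Rmult_le_compat_r; [exact: Rlt_le|exact: Rmax_l].
- apply: Rle_trans (proj1 (H' i x t ht)) _; apply: Rmult_le_compat_r; first exact: Rlt_le.
  apply: Rmult_le_compat_r; [exact: Rabs_pos|exact: Rmax_r].
- apply: Rle_trans (Im_le_Cmod _) _; apply: Rle_trans (H x) _; apply: Rmult_le_compat_r; [exact: Rlt_le|exact: Rmax_l].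
- apply: Rle_trans (proj2 (H' i x t ht)) _; apply: Rmult_le_compat_r; first exact: Rlt_le.
  apply: Rmult_le_compat_r; [exact: Rabs_pos|exact: Rmax_r].
Qed.

Lemma nice_dec g : nice g -> dec (fun x => Re (g x)) /\ dec (fun x => Im (g x)).
Proof. exact: nice_decl. Qed.

Lemma intC_plus g h : nice g -> nice h -> intC (cplus g h) = Cplus (intC g) (intC h).
Proof.
move=> /nice_dec[a b] /nice_dec[c d]; apply: C_ext; rewrite /=; [exact: (intR_plus _ _ a c)|exact: (intR_plus _ _ b d)].
Qed.
Lemma intC_scal c g : nice g -> intC (cscal c g) = Cmult c (intC g).
Proof.
move=> /nice_dec[a b]; apply: C_ext; rewrite /= /cscal /=.
  rewrite -(intR_scal _ (Re c) a) -(intR_scal _ (Im c) b).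
  rewrite (_ : _ - _ = intR (fun x => Re c * Re (g x)) + -1 * intR (fun x => Im c * Im (g x))); last ring.
  rewrite -intR_scal; last exact: decay_scal.
  rewrite -intR_plus; [|exact: decay_scal|by do 2 apply: decay_scal].
  by congr intR; apply: fext => x; rewrite /Re /Im; ring.
rewrite -(intR_scal _ (Re c) b) -(intR_scal _ (Im c) a) -intR_plus; [|exact: decay_scal|exact: decay_scal].
by congr intR; apply: fext => x; rewrite /Re /Im; ring.
Qed.
Lemma intC_abs g K : nice g -> (forall x, Cmod (g x) <= K * Wf x) -> Cmod (intC g) <= 2 * K * PI ^ k.
Proof.
move=> /nice_dec[a b] H; apply: Rle_trans (Cmod_le_abs _) _.
have := intR_abs _ K a (fun x => Rle_trans _ _ _ (Re_le_Cmod _) (H x)).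
have := intR_abs _ K b (fun x => Rle_trans _ _ _ (Im_le_Cmod _) (H x)).
by rewrite /=; lra.
Qed.
Lemma intC_pd i g : nice g -> intC (pd i g) = RtoC 0.
Proof.
move=> ng; have [a b] := nice_dec _ ng; have [a' b'] := nice_dec _ (nice_pd i _ ng).
have [K H] := nice_taylor g i ng.
apply: C_ext => /=; [apply: (intR_deriv0 _ _ i K a a')|apply: (intR_deriv0 _ _ i K b b')] => x t ht.
  by case: (H x t ht).
by case: (H x t ht).
Qed.

(** * Inner product and norm *)

Lemma innerE g h : inner g h = intC (cmul g (cconj h)). Proof. by []. Qed.
Lemma nice_inner g h : nice g -> nice h -> nice (cmul g (cconj h)).
Proof. by move=> ng nh; apply: nice_mul => //; apply: nice_conj. Qed.
Lemma inner_plusl g g' h : nice g -> nice g' -> nice h ->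
  inner (cplus g g') h = Cplus (inner g h) (inner g' h).
Proof.
move=> ng ng' nh; rewrite !innerE -intC_plus; [|exact: nice_inner|exact: nice_inner].
by congr intC; apply: fext => x; rewrite /cmul /cplus; ring.
Qed.
Lemma inner_scall c g h : nice g -> nice h -> inner (cscal c g) h = Cmult c (inner g h).
Proof.
move=> ng nh; rewrite !innerE -intC_scal; last exact: nice_inner.
by congr intC; apply: fext => x; rewrite /cmul /cscal; ring.
Qed.
Lemma inner_conj g h : nice g -> nice h -> inner h g = Cconj (inner g h).
Proof.
move=> ng nh; have [a b] := nice_dec _ (nice_inner _ _ ng nh).
apply: C_ext; rewrite /= /inner /intC /=.
  by congr intR; apply: fext => x; rewrite /Re /Im; ring.
rewrite (_ : - _ = -1 * intR (fun x => Im (cmul g (cconj h) x))); last by ring_simplify; congr (- _).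
rewrite -intR_scal //; congr intR; apply: fext => x; rewrite /cmul /cconj /= /Re /Im; ring.
Qed.
Lemma inner_plusr g h h' : nice g -> nice h -> nice h' ->
  inner g (cplus h h') = Cplus (inner g h) (inner g h').
Proof.
move=> ng nh nh'; rewrite (inner_conj (cplus h h') g) ?inner_plusl //; last exact: nice_plus.
by rewrite Cconj_plus -!inner_conj.
Qed.
Lemma inner_scalr c g h : nice g -> nice h -> inner g (cscal c h) = Cmult (Cconj c) (inner g h).
Proof.
move=> ng nh; rewrite (inner_conj (cscal c h) g) ?inner_scall //; last exact: nice_scal.
by rewrite Cconj_mult -inner_conj.
Qed.

Lemma Zop_sym i g h : nice g -> nice h -> inner (Zop i g) h = inner g (Zop i h).
Proof.
move=> ng nh; elim/letterP: i => j.
  rewrite !innerE; congr intC; apply: fext => x; rewrite /cmul /cconj !Zop_l Cconj_mult Cconj_R; ring.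
have n1 := nice_inner _ _ (nice_Z (rshift k j) _ ng) nh.
have n2 := nice_inner _ _ ng (nice_Z (rshift k j) _ nh).
(* Integration by parts: the two integrands differ by a total derivative, whose integral vanishes by
   [intC_pd]. *)
have E : cplus (cmul (Zop (rshift k j) g) (cconj h)) (cscal (RtoC (-1)) (cmul g (cconj (Zop (rshift k j) h))))
   = cscal (Copp Ci) (pd j (cmul g (cconj h))).
  rewrite /cmul pd_mult ?pd_conj; [|exact: nice_smooth..|by apply: smooth_conj; apply: nice_smooth].
  apply: fext => x; rewrite /cplus /cscal /cconj !Zop_r; apply: C_ext; rewrite /= /Re /Im; ring.
have := intC_plus _ _ n1 (nice_scal (RtoC (-1)) _ n2).
rewrite E (intC_scal _ _ n2) intC_scal; last by apply: nice_pd; apply: nice_inner.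
rewrite intC_pd ?Cmult_0_r; last exact: nice_inner.
rewrite -!innerE => H.
have -> : inner g (Zop (rshift k j) h) = Cplus (inner g (Zop (rshift k j) h)) (RtoC 0) by ring.
by rewrite H; ring.
Qed.

Lemma zw_sym w g h : nice g -> nice h -> inner (zw w g) h = inner g (zw (rev w) h).
Proof.
move=> ng; elim: w h => [//|i w IH] h nh /=.
by rewrite Zop_sym ?IH ?rev_cons ?zw_rcons //; [apply: nice_Z | apply: nice_zw].
Qed.

Definition nrm2 g : R := intR (fun x => Re (g x) * Re (g x) + Im (g x) * Im (g x)).
Definition nrm g : R := sqrt (nrm2 g).

Definition dens g (x : Pt k) : R := Re (g x) * Re (g x) + Im (g x) * Im (g x).
Lemma dens_decl (l : seq 'I_k) g : nice g -> decay l (dens g).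
Proof.
move=> ng; have [a _] := nice_decl l _ (nice_inner _ _ ng ng).
suff <- : (fun x => Re (cmul g (cconj g) x)) = dens g by [].
by apply: fext => x; rewrite /cmul /cconj /dens /= /Re /Im; ring.
Qed.
Lemma nrm2_dec g : nice g -> dec (fun x => Re (g x) * Re (g x) + Im (g x) * Im (g x)).
Proof. exact: dens_decl. Qed.
Lemma inner_self g : nice g -> inner g g = RtoC (nrm2 g).
Proof.
move=> ng; apply: C_ext; rewrite /inner /intC /nrm2 /=.
  by congr intR; apply: fext => x; rewrite /Re /Im; ring.
have [_ b] := nice_dec _ (nice_inner _ _ ng ng).
rewrite -[RHS](Rmult_0_l (intR (fun x => Im (cmul g (cconj g) x)))) -intR_scal //.
by congr intR; apply: fext => x; rewrite /Re /Im; ring.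
Qed.
Lemma intR_ge0 (h : Pt k -> R) : dec h -> (forall x, 0 <= h x) -> 0 <= intR h.
Proof.
move=> d H; rewrite -(Rmult_0_l (intR h)) -intR_scal //; apply: intR_mono => //; first exact: decay_scal.
by move=> x; rewrite Rmult_0_l.
Qed.
Lemma nrm2_ge0 g : nice g -> 0 <= nrm2 g.
Proof. by move=> ng; apply: intR_ge0; [apply: nrm2_dec | move=> x; nra]. Qed.
Lemma nrm_ge0 g : 0 <= nrm g. Proof. exact: sqrt_pos. Qed.
Lemma nrm_sq g : nice g -> nrm g * nrm g = nrm2 g.
Proof. by move=> ng; apply: sqrt_sqrt; apply: nrm2_ge0. Qed.

Lemma quad_disc a b c : 0 <= a -> 0 <= c -> (forall t, 0 <= a * t * t + 2 * b * t + c) -> b * b <= a * c.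
Proof.
move=> a0 c0 H; case: (Req_dec a 0) => [az|an]; last first.
  have := H (- b / a).
  have -> : a * (- b / a) * (- b / a) + 2 * b * (- b / a) + c = (a * c - b * b) / a by field.
  move=> h; have : 0 <= (a * c - b * b) / a * a by apply: Rmult_le_pos.
  by rewrite /Rdiv Rmult_assoc Rinv_l // Rmult_1_r; lra.
subst a; case: (Req_dec b 0) => [->|pascal]; first lra.
(* With a = 0 the polynomial is affine and not constant; at this point it takes the value -1. *)
have := H (- (c + 1) / (2 * b)).
have -> : 0 * (- (c + 1) / (2 * b)) * (- (c + 1) / (2 * b)) + 2 * b * (- (c + 1) / (2 * b)) + c = -1 by field.
lra.
Qed.

Lemma cauchy_schwarz g h : nice g -> nice h -> Cmod (inner g h) <= nrm g * nrm h.
Proof.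
move=> ng nh; set z := inner g h.
have a0 := nrm2_ge0 _ ng; have c0 := nrm2_ge0 _ nh.
set m := Cmod z; have m0 : 0 <= m := Cmod_ge_0 z.
(* expand [|m h + t z g|^2 >= 0], whose middle coefficient is [2 m |z|^2] *)
have zz : Cmult z (Cconj z) = RtoC (m * m).
  have e : m * m = Re z * Re z + Im z * Im z.
    by rewrite /m /Cmod sqrt_sqrt; [rewrite /Re /Im; ring | nra].
  by rewrite e; apply: C_ext; rewrite /= /Re /Im; ring.
have Q t : 0 <= (m * m * nrm2 g) * t * t + 2 * (m * (m * m)) * t + m * m * nrm2 h.
  pose f := cplus (cscal (RtoC m) h) (cscal (Cmult (RtoC t) (Cconj z)) g).
  have ngs c := nice_scal c _ ng; have nhs c := nice_scal c _ nh.
  have nf : nice f by apply: nice_plus.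
  have := nrm2_ge0 _ nf.
  have : RtoC (nrm2 f) = RtoC (m * m * nrm2 g * t * t + 2 * (m * (m * m)) * t + m * m * nrm2 h).
    rewrite -inner_self // /f inner_plusl ?inner_plusr ?inner_scall ?inner_scalr //.
    rewrite !inner_self // (inner_conj g h) // -/z !Cconj_mult !Cconj_R Cconj_conj.
    transitivity (Cplus (Cmult (RtoC (m * m)) (RtoC (nrm2 h))) (Cplus (Cmult (RtoC (2 * m * t)) (Cmult z (Cconj z)))
          (Cmult (RtoC (t * t)) (Cmult (Cmult z (Cconj z)) (RtoC (nrm2 g)))))).
      by rewrite !RtoC_mult; ring.
    by rewrite zz -!RtoC_mult -!RtoC_plus; congr RtoC; ring.
  by move=> /RtoC_inj ->.
case: (Req_dec m 0) => [->|mn]; first by apply: Rmult_le_pos; apply: nrm_ge0.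
have mp : 0 < m by lra.
have := quad_disc _ _ _ (Rmult_le_pos _ _ (Rmult_le_pos _ _ m0 m0) a0) (Rmult_le_pos _ _ (Rmult_le_pos _ _ m0 m0) c0) Q.
rewrite -!nrm_sq // => H.
apply: Rsqr_incr_0_var; last by apply: Rmult_le_pos; apply: nrm_ge0.
apply: (Rmult_le_reg_l (m * m * (m * m))); first by do 2 apply: Rmult_lt_0_compat.
by rewrite /Rsqr; lra.
Qed.

Lemma nrm_plus g h : nice g -> nice h -> nrm (cplus g h) <= nrm g + nrm h.
Proof.
move=> ng nh; have n0 := nrm_ge0 g; have n1 := nrm_ge0 h.
apply: Rsqr_incr_0_var; last lra.
rewrite /Rsqr nrm_sq; last exact: nice_plus.
have : RtoC (nrm2 (cplus g h)) = Cplus (Cplus (RtoC (nrm2 g)) (RtoC (nrm2 h))) (Cplus (inner g h) (Cconj (inner g h))).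
  rewrite -inner_self; last exact: nice_plus.
  rewrite (inner_plusl _ _ _ ng nh (nice_plus _ _ ng nh)).
  rewrite (inner_plusr _ _ _ ng ng nh) (inner_plusr _ _ _ nh ng nh).
  by rewrite !inner_self // (inner_conj g h) //; ring.
have := cauchy_schwarz g h ng nh; move: (inner g h) => z cs.
move=> /(f_equal Re) /= ->; rewrite -(nrm_sq g) // -(nrm_sq h) //=.
have := Re_le_Cmod z; have := Rle_abs (Re z); rewrite /Re; nra.
Qed.
Lemma nrm_scal c g : nice g -> nrm (cscal c g) = Cmod c * nrm g.
Proof.
move=> ng; apply: Rsqr_inj; [exact: nrm_ge0 | by apply: Rmult_le_pos; [apply: Cmod_ge_0 | apply: nrm_ge0] | ].
rewrite /Rsqr nrm_sq; last exact: nice_scal.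
have E : Cmod c * Cmod c = Re c * Re c + Im c * Im c.
  by rewrite /Cmod sqrt_sqrt; [rewrite /Re /Im; ring | nra].
have -> : Cmod c * nrm g * (Cmod c * nrm g) = (Cmod c * Cmod c) * (nrm g * nrm g) by ring.
rewrite nrm_sq // E /nrm2 -intR_scal; last exact: nrm2_dec.
by congr intR; apply: fext => x; rewrite /cscal /= /Re /Im; ring.
Qed.
Lemma nrm_decay g K : nice g -> 0 <= K -> (forall x, Cmod (g x) <= K * Wf x) -> nrm g <= K * sqrt (PI ^ k).
Proof.
move=> ng K0 H; have p0 : 0 <= PI ^ k by apply: pow_le; have := PI_RGT_0; lra.
have -> : K * sqrt (PI ^ k) = sqrt (K * K * PI ^ k) by rewrite sqrt_mult ?sqrt_square //; nra.
apply: sqrt_le_1_alt; apply: Rle_trans (Rle_abs _) _; apply: intR_abs; first exact: nrm2_dec.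
move=> x; have W0 : 0 < Wf x by apply: Wt_pos.
have W1 : Wf x <= 1 by apply: Wt_le1.
have E : Cmod (g x) * Cmod (g x) = Re (g x) * Re (g x) + Im (g x) * Im (g x).
  by rewrite /Cmod sqrt_sqrt; [rewrite /Re /Im; ring | nra].
rewrite -E Rabs_pos_eq; last by apply: Rmult_le_pos; apply: Cmod_ge_0.
apply: Rle_trans (Rmult_le_compat _ _ _ _ (Cmod_ge_0 _) (Cmod_ge_0 _) (H x) (H x)) _.
have : 0 <= K * K * Wf x * (1 - Wf x) by apply: Rmult_le_pos; [apply: Rmult_le_pos; nra | lra].
lra.
Qed.

(** Canonical commutation relations: only x_a and D_a fail to commute, with commutator i or -i. What
    later estimates use is that a swap costs a scalar of modulus at most 1 times the word without
    the two letters. *)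
Lemma Zop_comm i j : exists2 c : C, Cmod c <= 1 &
  forall g, smooth g -> Zop i (Zop j g) = cplus (Zop j (Zop i g)) (cscal c g).
Proof.
have D a b g : smooth g -> Zop (rshift k b) (Zop (lshift k a) g) =
    cplus (Zop (lshift k a) (Zop (rshift k b) g)) (cscal (Copp (Cmult Ci (RtoC (if a == b then 1 else 0)))) g).
  move=> sg; rewrite !Zop_l !Zop_r pd_mult //; last exact: smooth_coord.
  by rewrite pd_coord; apply: fext => x; rewrite /cplus /cscal; case: (a == b); ring.
have m1 (a b : 'I_k) : Cmod (Cmult Ci (RtoC (if a == b then 1 else 0))) <= 1.
  by rewrite Cmod_mult Cmod_Ci Cmod_R; case: (a == b); rewrite ?Rabs_R1 ?Rabs_R0; lra.
elim/letterP: i => a; elim/letterP: j => b.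
- exists (RtoC 0); first by rewrite Cmod_0; lra.
  by move=> g sg; rewrite !Zop_l; apply: fext => x; rewrite /cplus /cscal; ring.
- exists (Cmult Ci (RtoC (if a == b then 1 else 0))) => // g sg.
  by rewrite D //; apply: fext => x; rewrite /cplus /cscal; ring.
- by exists (Copp (Cmult Ci (RtoC (if b == a then 1 else 0)))); [rewrite Cmod_opp | exact: D].
- exists (RtoC 0); first by rewrite Cmod_0; lra.
  move=> g sg; rewrite !Zop_r !(pd_scal _ (Copp Ci)) ?(pd_comm a b) //; try exact: smooth_pd.
  by apply: fext => x; rewrite /cplus /cscal; ring.
Qed.

(** * The Sobolev inequality *)

Lemma dens_Cmod g x : Cmod (g x) * Cmod (g x) = dens g x.
Proof. by rewrite /Cmod sqrt_sqrt; [rewrite /dens /Re /Im; ring | nra]. Qed.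

Lemma dens_int1 i g x : nice g ->
  dens g x <= int_coord i (fun y => 2 * dens g y + dens (pd i g) y) x.
Proof.
move=> ng; have sg := nice_smooth _ ng.
pose h y := 2 * dens g y + dens (pd i g) y.
have dh : decay [:: i] h.
  apply: decay_plus; last by apply: dens_decl; apply: nice_pd.
  by apply: decay_scal; apply: dens_decl.
have [K HK] := dh.
have D := decay_dom1 i [::] h isT dh K x (fun y => proj1 (HK y)).
have h0 y : 0 <= h y by rewrite /h /dens; nra.
apply: Rle_trans (int1_ge_RInt _ _ (x i) (x i + 1) D (fun s => h0 _) _); last lra.
pose phi s := dens g (upd x i s).
pose dphi s := 2 * (Re (g (upd x i s)) * Re (pd i g (upd x i s)) + Im (g (upd x i s)) * Im (pd i g (upd x i s))).
have S1 := smooth_section g i x sg; have S2 := smooth_section _ i x (smooth_pd _ i sg).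
have dd s : is_derive phi s (dphi s).
  have [a b] := S1 s.
  have H := is_derive_plus (V := R_NormedModule) _ _ _ _ _
    (is_derive_mult _ _ _ _ _ a a Rmult_comm) (is_derive_mult _ _ _ _ _ b b Rmult_comm).
  by evar_last; [exact: H | rewrite /dphi /plus /mult /=; ring].
have cphi s : continuous phi s by apply: (ex_derive_continuous (V := R_NormedModule)); exists (dphi s).
have c1 s : continuous (fun s => Re (g (upd x i s))) s.
  by apply: (ex_derive_continuous (V := R_NormedModule)); eexists; exact: (proj1 (S1 s)).
have c2 s : continuous (fun s => Im (g (upd x i s))) s.
  by apply: (ex_derive_continuous (V := R_NormedModule)); eexists; exact: (proj2 (S1 s)).
have c3 s : continuous (fun s => Re (pd i g (upd x i s))) s.
  by apply: (ex_derive_continuous (V := R_NormedModule)); eexists; exact: (proj1 (S2 s)).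
have c4 s : continuous (fun s => Im (pd i g (upd x i s))) s.
  by apply: (ex_derive_continuous (V := R_NormedModule)); eexists; exact: (proj2 (S2 s)).
have cdphi s : continuous dphi s.
  apply: (continuous_scal_r (V := R_NormedModule) 2).
  by apply: (continuous_plus (V := R_NormedModule)); apply: (continuous_mult (K := R_AbsRing)).
(* the derivative of [(x_i + 1 - s) phi s], which vanishes at the right end *)
pose psi s := - phi s + (x i + 1 - s) * dphi s.
have I : is_RInt psi (x i) (x i + 1) (- dens g x).
  have := is_RInt_derive (V := R_CompleteNormedModule) (fun s => (x i + 1 - s) * phi s) psi (x i) (x i + 1).
  rewrite /minus /plus /opp /= (_ : (x i + 1 - (x i + 1)) * phi (x i + 1) + - ((x i + 1 - x i) * phi (x i)) = - dens g x); last first.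
    by rewrite /phi upd_id; ring.
  apply=> s _.
    have H := is_derive_mult (fun s => x i + 1 - s) phi s (-1) (dphi s) _ (dd s) Rmult_comm.
    evar_last; first by apply: H; auto_derive=> //; ring.
    by rewrite /psi /plus /mult /=; ring.
  apply: (continuous_plus (V := R_NormedModule)); first by apply: (continuous_opp (V := R_NormedModule)).
  apply: (continuous_mult (K := R_AbsRing)) => //.
  by apply: (ex_derive_continuous (V := R_NormedModule)); auto_derive.
have I2 := is_RInt_opp (V := R_NormedModule) _ _ _ _ I.
have := RInt_le (fun s => opp (psi s)) (fun s => h (upd x i s)) (x i) (x i + 1).
rewrite (is_RInt_unique (V := R_CompleteNormedModule) _ _ _ _ I2) /opp /= Ropp_involutive.
apply; [lra | by eexists; exact: I2 | by apply: cont_ex_RInt; case: D | ].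
move=> s hs; rewrite /psi /h /phi.
have q1 : Rabs (dphi s) <= dens g (upd x i s) + dens (pd i g) (upd x i s).
  rewrite /dphi /dens; move: (Re (g _)) (Im (g _)) (Re (pd i g _)) (Im (pd i g _)) => a b c d.
  have := Rle_0_sqr (a - c); have := Rle_0_sqr (a + c); have := Rle_0_sqr (b - d); have := Rle_0_sqr (b + d).
  by rewrite /Rsqr => *; apply: Rabs_le; lra.
have : - ((x i + 1 - s) * dphi s) <= Rabs (dphi s).
  apply: Rle_trans (Rle_abs _) _; rewrite Rabs_Ropp Rabs_mult Rabs_pos_eq; last lra.
  by have := Rabs_pos (dphi s); nra.
lra.
Qed.

(** Iterating the one-coordinate inequality [dens_int1] produces the mixed derivatives in which each
    coordinate is differentiated at most once, with a factor 2 for every coordinate left alone. *)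
Fixpoint Qd (l : seq 'I_k) g (x : Pt k) : R :=
  match l with [::] => dens g x | i :: l' => 2 * Qd l' g x + Qd l' (pd i g) x end.
Lemma Qd_decl l' (l : seq 'I_k) g : nice g -> decay l (Qd l' g).
Proof.
elim: l' g => [|i l' IH] g ng /=; first exact: dens_decl.
by apply: decay_plus; [apply: decay_scal; apply: IH | apply: IH; apply: nice_pd].
Qed.
Lemma dens_le_Fint l s g x : uniq (catrev l s) -> nice g -> dens g x <= Fint l (Qd l g) x.
Proof.
elim: l s g x => [|i l IH] s g x; first by move=> _ _; apply: Rle_refl.
move=> u ng /=; have u' : uniq (catrev l (i :: s)) := u.
apply: Rle_trans (dens_int1 i g x ng) _.
have d1 := decay_scal _ _ 2 (Qd_decl l (catrev l (i :: s)) g ng).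
have d2 := Qd_decl l (catrev l (i :: s)) _ (nice_pd i _ ng).
apply: (int_coord_mono i s _ _ _ (catrev_notin _ _ _ u)).
- apply: decay_plus; last by apply: dens_decl; apply: nice_pd.
  by apply: decay_scal; apply: dens_decl.
- by apply: Fint_decay => //; apply: decay_plus.
move=> y; rewrite (Fint_plus _ _ _ _ u' d1 d2) (Fint_scal _ _ _ _ u'); last exact: Qd_decl.
have := IH _ g y u' ng; have := IH _ _ y u' (nice_pd i _ ng); lra.
Qed.
Lemma Qd_int l g B : nice g -> (forall w, (size w <= size l)%N -> nrm (zw w g) <= B) ->
  intR (Qd l g) <= 3 ^ size l * (B * B).
Proof.
elim: l g => [|i l IH] g ng H /=.
  rewrite Rmult_1_l; have := H [::] isT; have := nrm_ge0 g => p1 p2.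
  by rewrite -/(nrm2 g) -nrm_sq //; apply: Rmult_le_compat.
rewrite intR_plus ?intR_scal; [|exact: Qd_decl|by apply: decay_scal; apply: Qd_decl|by apply: Qd_decl; apply: nice_pd].
have h1 := IH g ng (fun w hw => H w (leqW hw)).
have h2 : intR (Qd l (pd i g)) <= 3 ^ size l * (B * B).
  apply: IH => [|w hw]; first exact: nice_pd.
  rewrite pd_Z zw_scal; last by apply: smooth_Z; apply: nice_smooth.
  rewrite nrm_scal ?Cmod_Ci ?Rmult_1_l -?zw_rcons; last by apply: nice_zw; exact: ng.
  by apply: H; rewrite size_rcons.
lra.
Qed.

(** Each coordinate is differentiated at most once, so words of length at most k suffice. The
    coefficients of [Qd] add up to 3^k, which is at most 4^k, and the square root leaves 2^k. *)
Lemma sobolev g B : nice g -> (forall w, (size w <= k)%N -> nrm (zw w g) <= B) ->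
  forall x, Cmod (g x) <= 2 ^ k * B.
Proof.
move=> ng H x; have B0 : 0 <= B := Rle_trans _ _ _ (nrm_ge0 _) (H [::] isT).
have p2 : 0 < 2 ^ k by apply: pow_lt; lra.
apply: Rsqr_incr_0_var; last nra.
rewrite /Rsqr dens_Cmod.
have u : uniq (catrev (enum 'I_k) [::]) by rewrite catrevE cats0 rev_uniq enum_uniq.
apply: Rle_trans (dens_le_Fint _ _ g x u ng) _; rewrite intR_const_Fint.
apply: Rle_trans (Qd_int _ _ B ng _) _; rewrite size_enum_ord //.
have : 3 ^ k <= 2 ^ k * 2 ^ k by rewrite -Rpow_mult_distr; apply: pow_incr; lra.
by move=> h3; have : 3 ^ k * (B * B) <= 2 ^ k * 2 ^ k * (B * B); [apply: Rmult_le_compat_r; nra | lra].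
Qed.
End Nice.

(** * Gaussian moments of words *)

Lemma series_term_le (a : nat -> R) (s : R) l : (forall m, 0 <= a m) -> is_series a s -> a l <= s.
Proof.
move=> a0 S.
have := is_lim_seq_le_loc (fun _ => a l) (sum_n a) (Rbar.Finite (a l)) (Rbar.Finite s) _ (is_lim_seq_const _) S.
apply; exists l => N hN; have {hN} hN : (l <= N)%N by apply/leP.
have pos M : 0 <= sum_n a M.
  elim: M => [|M IH]; first by rewrite sum_O.
  by rewrite sum_Sn; apply: Rplus_le_le_0_compat.
rewrite -(subnKC hN); elim: (N - l)%N => [|j IH].
  rewrite addn0; case: (l) => [|l']; first by rewrite sum_O; apply: Rle_refl.
  by rewrite sum_Sn /plus /=; have := pos l'; lra.
by rewrite addnS sum_Sn /plus /=; have := a0 (l + j).+1; lra.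
Qed.

Lemma pow_le_fact_exp (y : R) (l : nat) : 0 <= y -> y ^ l <= INR (fact l) * exp y.
Proof.
move=> y0; have fp : 0 < INR (fact l) by apply: INR_fact_lt_0.
have S : is_series (fun m => / INR (fact m) * y ^ m) (exp y).
  apply: is_series_ext (is_exp_Reals y) => m; rewrite pow_n_pow /scal /= /mult /=; ring.
have H : / INR (fact l) * y ^ l <= exp y.
  apply: (series_term_le _ _ l _ S) => m.
  by apply: Rmult_le_pos; [left; apply/Rinv_0_lt_compat/INR_fact_lt_0 | apply: pow_le].
have := Rmult_le_compat_l _ _ _ (Rlt_le _ _ fp) H.
by rewrite -Rmult_assoc Rinv_r ?Rmult_1_l //; lra.
Qed.

Lemma contC_comp {k} (r : Pt k -> R) (f : R -> R) :
  contC (fun x => RtoC (r x)) -> (forall y, continuous f y) -> contC (fun x => RtoC (f (r x))).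
Proof.
move=> cr cf x e he.
have [a [ap Ha]] := (proj2 (continuity_pt_filterlim f (r x)) (cf (r x))) e he.
have [d [dp H]] := cr x a ap; exists d; split=> // y hy.
rewrite -RtoC_minus Cmod_R; case: (Req_dec (r y) (r x)) => [->|ne].
  by rewrite Rminus_diag Rabs_R0.
apply: Ha; split; first by split=> // E; apply: ne.
by have := H y hy; rewrite -RtoC_minus Cmod_R.
Qed.

Section Gauss.
Context {k : nat}.
Implicit Types (u w : seq 'I_k).

Definition amon u (a : Pt k) : R := foldr (fun i r => a i * r) 1 u.
Definition hsq (l : seq 'I_k) (a : Pt k) : R := \rsum_(i <- l) (a i * a i / 2).
(** The unnormalised Gaussian density: its total mass is carried along as [gaussian_moment [::]] and
    divided out at the end, so only its positivity enters. *)
Definition gauss (a : Pt k) : R := exp (- hsq (enum 'I_k) a).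

Lemma amon_cat u w a : amon (u ++ w) a = amon u a * amon w a.
Proof. by elim: u => [|i u IH] /=; rewrite ?IH; ring. Qed.
Lemma amon_perm u w a : perm_eq u w -> amon u a = amon w a.
Proof.
by apply: (perm_swap_inv (fun u => amon u a)) => p i j q; rewrite !amon_cat /=; ring.
Qed.

Lemma smooth_amon u : smooth (fun a => RtoC (amon u a)).
Proof.
elim: u => [|i u IH] /=; first exact: smooth_const.
have -> : (fun a : Pt k => RtoC (a i * amon u a)) = fun a => Cmult (RtoC (a i)) (RtoC (amon u a)).
  by apply: fext => a; rewrite RtoC_mult.
by apply: smooth_mult => //; apply: smooth_coord.
Qed.
Lemma hsq_deriv l i a s : is_derive (fun s => hsq l (upd a i s)) s (INR (count_mem i l) * s).
Proof.
elim: l => [|j l IH].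
  rewrite /= Rmult_0_l; apply: (is_derive_ext (fun _ => 0)); last exact: is_derive_const.
  by move=> t; rewrite /hsq big_nil.
apply: (is_derive_ext (fun t => upd a i t j * upd a i t j / 2 + hsq l (upd a i t))).
  by move=> t; rewrite /hsq big_cons.
have D : is_derive (fun t => upd a i t j * upd a i t j / 2) s (INR (j == i) * s).
  case: (j =P i) => [->|/eqP ne].
    apply: (is_derive_ext (fun t => t * t / 2)); first by move=> t; rewrite upd_same.
    by auto_derive => //=; field.
  apply: (is_derive_ext (fun _ => a j * a j / 2)); first by move=> t; rewrite upd_neq.
  by rewrite /= Rmult_0_l; apply: is_derive_const.
have := is_derive_plus (V := R_NormedModule) _ _ _ _ _ D IH.
by rewrite /plus /= plus_INR Rmult_plus_distr_r.
Qed.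
Lemma pd_gauss i a : is_pd i (fun a => RtoC (gauss a)) a (RtoC (- a i * gauss a)).
Proof.
apply: is_pd_RtoC; have := hsq_deriv (enum 'I_k) i a (a i).
rewrite count_uniq_mem ?enum_uniq // mem_enum /= Rmult_1_l => D.
have := is_derive_comp exp _ _ _ _ (is_derive_exp _) (is_derive_opp (V := R_NormedModule) _ _ _ D).
by rewrite /scal /= /mult /= /opp /= upd_id.
Qed.
Lemma smooth_gauss : smooth (fun a => RtoC (gauss a)).
Proof.
pose B g := smooth g \/ g = fun a : Pt k => RtoC (gauss a).
apply: (galg_smooth B); last by apply: galg_base; right.
move=> g [sg|->].
  split; first exact: smooth_cont.
  by move=> i; split=> [x|]; [apply: smooth_has_pd | apply: galg_base; left; apply: smooth_pd].
split.
  apply: (contC_comp _ (fun y => exp (- y))); last first.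
    by move=> y; apply: (ex_derive_continuous (V := R_NormedModule)); auto_derive.
  apply: smooth_cont; rewrite /hsq; elim: (enum 'I_k) => [|i l IH].
    have -> : (fun a : Pt k => RtoC (\rsum_(i <- [::]) (a i * a i / 2))) = fun _ => RtoC 0.
      by apply: fext => a; rewrite big_nil.
    exact: smooth_const.
  have -> : (fun a : Pt k => RtoC (\rsum_(j <- i :: l) (a j * a j / 2))) =
     fun a => Cplus (Cmult (RtoC (a i)) (Cmult (RtoC (a i)) (RtoC (/2)))) (RtoC (\rsum_(j <- l) (a j * a j / 2))).
    by apply: fext => a; rewrite big_cons RtoC_plus /Rdiv !RtoC_mult; ring.
  apply: smooth_plus => //; apply: smooth_mult; first exact: smooth_coord.
  by apply: smooth_mult; [exact: smooth_coord | exact: smooth_const].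
move=> i; split=> [x|]; first exact: is_pd_has (pd_gauss i x).
have -> : pd i (fun a : Pt k => RtoC (gauss a)) =
   fun a => Cmult (Cmult (RtoC (-1)) (RtoC (a i))) (RtoC (gauss a)).
  apply: fext => a; rewrite (is_pd_unique _ _ _ _ (pd_gauss i a)) -!RtoC_mult; congr RtoC; ring.
apply: galg_mult; apply: galg_base; last by right.
by left; apply: smooth_mult; [exact: smooth_const | exact: smooth_coord].
Qed.

Definition gmon u : Pt k -> C := fun a => RtoC (amon u a * gauss a).
Lemma gmonE u : gmon u = cmul (fun a => RtoC (amon u a)) (fun a => RtoC (gauss a)).
Proof. by apply: fext => a; rewrite /gmon RtoC_mult. Qed.
Lemma smooth_gmon u : smooth (gmon u).
Proof. by rewrite gmonE; apply: smooth_mult; [apply: smooth_amon | apply: smooth_gauss]. Qed.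

Lemma pd_amon i u : pd i (fun a => RtoC (amon u a)) =
  fun a => RtoC (INR (count_mem i u) * amon (rem i u) a).
Proof.
elim: u => [|j u IH].
  apply: fext => a; apply: is_pd_unique; rewrite /= Rmult_0_l; exact: is_pd_const.
have -> : (fun a : Pt k => RtoC (amon (j :: u) a)) = fun a => Cmult (RtoC (a j)) (RtoC (amon u a)).
  by apply: fext => a; rewrite RtoC_mult.
rewrite pd_mult; [|exact: smooth_coord|exact: smooth_amon].
rewrite IH pd_coord; apply: fext => a; rewrite -!RtoC_mult -RtoC_plus; congr RtoC.
rewrite (_ : count_mem i (j :: u) = (j == i) + count_mem i u)%N // plus_INR /=.
case: (j =P i) => [->|_]; last by rewrite /=; ring.
case: (boolP (i \in u)) => iu.
  by rewrite (amon_perm _ _ a (perm_to_rem iu)) /=; ring.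
by rewrite (count_memPn iu) /=; ring.
Qed.

Lemma pd_gmon i u : pd i (gmon u) =
  cplus (cscal (RtoC (INR (count_mem i u))) (gmon (rem i u))) (cscal (RtoC (-1)) (gmon (i :: u))).
Proof.
rewrite gmonE /cmul pd_mult; [|exact: smooth_amon|exact: smooth_gauss].
rewrite pd_amon; apply: fext => a.
rewrite (is_pd_unique _ _ _ _ (pd_gauss i a)) /cplus /cscal /gmon -!RtoC_mult -!RtoC_plus; congr RtoC.
by rewrite /=; ring.
Qed.

Lemma cbounded_gmon u : cbounded (gmon u).
Proof.
exists (2 ^ size u * (INR (fact (size u)) * exp (/ 2))) => a.
have g0 : 0 < gauss a by apply: exp_pos.
rewrite Cmod_R Rabs_mult (Rabs_pos_eq (gauss a)); last lra.
set q := hsq (enum 'I_k) a.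
have hi i : a i * a i <= 2 * q.
  have : a i * a i / 2 <= q.
    apply: (@rsum_mem_le _ (enum 'I_k) (fun j => a j * a j / 2)); last by rewrite mem_enum.
    by move=> j /=; nra.
  lra.
have q0 : 0 <= q by apply: rsum_ge0 => i; nra.
have hu : Rabs (amon u a) <= (1 + 2 * q) ^ size u.
  elim: u => [|i u IH] /=; first by rewrite Rabs_R1; lra.
  rewrite Rabs_mult; apply: Rmult_le_compat; [exact: Rabs_pos|exact: Rabs_pos| |exact: IH].
  have := hi i; rewrite -(Rabs_pos_eq (a i * a i)) ?Rabs_mult; last nra.
  by have := Rabs_pos (a i); nra.
(* Writing 1 + 2 q = 2 (1/2 + q) brings in y^l <= l! exp y at y = 1/2 + q, and exp q is exactly what
   the Gaussian cancels. *)
have E : (1 + 2 * q) ^ size u <= 2 ^ size u * (INR (fact (size u)) * exp (/ 2 + q)).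
  have -> : 1 + 2 * q = 2 * (/ 2 + q) by field.
  rewrite Rpow_mult_distr; apply: Rmult_le_compat_l; first by apply: pow_le; lra.
  by apply: pow_le_fact_exp; lra.
apply: Rle_trans (Rmult_le_compat_r _ _ _ (Rlt_le _ _ g0) (Rle_trans _ _ _ hu E)) _.
rewrite exp_plus /gauss -/q exp_Ropp; right; field.
by have := exp_pos q; lra.
Qed.

Lemma nice_gmon u : nice (gmon u).
Proof.
apply: (lin_nice (fun f => exists u, f = gmon u)); last by apply: lin_base; exists u.
move=> f [{}u ->]; split; first exact: smooth_gmon.
split; first exact: cbounded_gmon.
elim/(@letterP k) => j.
  apply: lin_base; exists (j :: u); rewrite Zop_l; apply: fext => a.
  by rewrite /gmon /= -RtoC_mult; congr RtoC; ring.
have -> : Zop (rshift k j) (gmon u) = cscal (Copp Ci) (pd j (gmon u)) by rewrite Zop_r.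
apply: lin_scal; rewrite pd_gmon; apply: lin_plus; apply: lin_scal; apply: lin_base; by eexists.
Qed.

Definition gaussian_moment u : R := intR (fun a => amon u a * gauss a).
Lemma dec_mon u : dec (fun a => amon u a * gauss a).
Proof. by have [] := nice_dec _ (nice_gmon u). Qed.
Lemma Emom_perm u w : perm_eq u w -> gaussian_moment u = gaussian_moment w.
Proof. by move=> p; congr intR; apply: fext => a; rewrite (amon_perm _ _ a p). Qed.
Lemma Emom0_pos : 0 < gaussian_moment [::].
Proof.
by apply: intR_pos; [exact: dec_mon | move=> a /=; rewrite Rmult_1_l; apply: exp_pos].
Qed.
(* Stein's identity: Gaussian integration by parts. *)
Lemma Emom_stein i u : gaussian_moment (i :: u) = INR (count_mem i u) * gaussian_moment (rem i u).
Proof.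
have := intC_pd i _ (nice_gmon u).
rewrite pd_gmon intC_plus ?intC_scal; try by [exact: nice_gmon | apply: nice_scal; exact: nice_gmon].
move=> /(f_equal Re).
have re w : Re (intC (gmon w)) = gaussian_moment w by [].
move: (intC (gmon (rem i u))) (re (rem i u)) (intC (gmon (i :: u))) (re (i :: u)) => z1 <- z2 <- /=.
rewrite /Re; lra.
Qed.

(** Gaussian expectation as a relation that carries the decay of the integrand, so that polynomials
    in [a] are averaged by following their syntax. *)
Definition Elin (f : Pt k -> R) (e : R) : Prop :=
  dec (fun a => f a * gauss a) /\ intR (fun a => f a * gauss a) = e.
Lemma Elin_mon u : Elin (amon u) (gaussian_moment u). Proof. by split=> //; apply: dec_mon. Qed.
Lemma Elin_scal f e c : Elin f e -> Elin (fun a => c * f a) (c * e).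
Proof.
move=> [d <-]; rewrite -intR_scal // /Elin.
have -> : (fun a => c * f a * gauss a) = fun a => c * (f a * gauss a) by apply: fext => a; ring.
by split=> //; apply: decay_scal.
Qed.
Lemma Elin_plus f e f' e' : Elin f e -> Elin f' e' -> Elin (fun a => f a + f' a) (e + e').
Proof.
move=> [d <-] [d' <-]; rewrite -intR_plus // /Elin.
have -> : (fun a => (f a + f' a) * gauss a) = fun a => f a * gauss a + f' a * gauss a by apply: fext => a; ring.
by split=> //; apply: decay_plus.
Qed.
Lemma Elin_sum {T} (l : seq T) (f : T -> Pt k -> R) e : (forall z, Elin (f z) (e z)) ->
  Elin (fun a => \rsum_(z <- l) f z a) (\rsum_(z <- l) e z).
Proof.
move=> H; elim: l => [|z l IH].
  have := Elin_scal _ _ 0 (Elin_mon [::]); rewrite Rmult_0_l big_nil.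
  by have -> : (fun a : Pt k => 0 * amon [::] a) = fun a => \rsum_(z <- [::]) f z a
    by apply: fext => a; rewrite big_nil Rmult_0_l.
rewrite big_cons; have := Elin_plus _ _ _ _ (H z) IH.
by have -> : (fun a => f z a + \rsum_(z <- l) f z a) = fun a => \rsum_(z <- z :: l) f z a
  by apply: fext => a; rewrite big_cons.
Qed.
Lemma Elin_ge0 f e : Elin f e -> (forall a, 0 <= f a) -> 0 <= e.
Proof.
move=> [d <-] H; apply: intR_ge0 => // a; apply: Rmult_le_pos => //; left; exact: exp_pos.
Qed.
End Gauss.

(** * Words of fixed length and the combinatorics of Stein's identity *)

Fixpoint words (T : finType) (r : nat) : seq (seq T) :=
  if r is r'.+1 then [seq i :: w | i <- enum T, w <- words T r'] else [:: [::]].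

Lemma rsum_words_S {T : finType} r (f : seq T -> R) :
  \rsum_(w <- words T r.+1) f w = \rsum_(i <- enum T) \rsum_(w <- words T r) f (i :: w).
Proof. by rewrite /= big_allpairs_dep. Qed.
Lemma rsum_words_0 {T : finType} (f : seq T -> R) : \rsum_(w <- words T 0) f w = f [::].
Proof. by rewrite /= big_seq1. Qed.
Lemma rsum_words_add {T : finType} r q (f : seq T -> R) :
  \rsum_(w <- words T (r + q)) f w = \rsum_(w <- words T r) \rsum_(w' <- words T q) f (w ++ w').
Proof.
elim: r f => [|r IH] f; first by rewrite rsum_words_0.
by rewrite addSn !rsum_words_S; apply: eq_bigr => i _; rewrite IH.
Qed.
Lemma mem_words {T : finType} r (w : seq T) : (w \in words T r) = (size w == r).
Proof.
elim: r w => [|r IH] w; first by rewrite /= inE; case: w.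
apply/allpairsP/eqP => [[[i v] /= [_ hv ->]]|].
  by move: hv; rewrite IH => /eqP /= ->.
by case: w => [//|i v] [sv]; exists (i, v); rewrite /= mem_enum IH sv eqxx.
Qed.

Section Combinatorics.
Context {k : nat}.
Local Notation T := 'I_k.
Implicit Types (u w y : seq T).
Definition perm_inv (h : seq T -> R) := forall y y', perm_eq y y' -> h y = h y'.

(** Counts pairs of a word and a marked occurrence of [i]: deleting the mark gives a word of length
    r, and conversely there are r + 1 places for inserting [i]. *)
Lemma rsum_rem r i (h : seq T -> R) : perm_inv h ->
  \rsum_(w <- words T r.+1) (INR (count_mem i w) * h (rem i w))
  = INR r.+1 * \rsum_(w <- words T r) h w.
Proof.
elim: r h => [|r IH] h hp; rewrite rsum_words_S.
  under eq_bigr => c _ do rewrite rsum_words_0.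
  rewrite rsum_words_0 (bigD1_seq i) ?mem_enum ?enum_uniq //= eqxx.
  rewrite big1 /=; first ring.
  by move=> c /negbTE -> /=; ring.
have E c w : INR (count_mem i (c :: w)) * h (rem i (c :: w)) =
   INR (c == i) * h w + INR (count_mem i w) * h (c :: rem i w).
  rewrite (_ : count_mem i (c :: w) = (c == i) + count_mem i w)%N // plus_INR /=.
  case: (c =P i) => [->|_] /=; last ring.
  case: (boolP (i \in w)) => iw; last by rewrite (count_memPn iw) /=; ring.
  by rewrite -(hp _ _ (perm_to_rem iw)); ring.
transitivity (\rsum_(c <- enum T) (INR (c == i) * \rsum_(w <- words T r.+1) h w
     + INR r.+1 * \rsum_(w <- words T r) h (c :: w))).
  apply: eq_bigr => c _; rewrite -(IH (fun w => h (c :: w))); last first.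
    by move=> y y' p; apply: hp; rewrite perm_cons.
  by rewrite big_distrr -big_split; apply: eq_bigr => w _; apply: E.
rewrite (S_INR r.+1); set c1 := INR r.+1.
rewrite big_split -big_distrr -rsum_words_S -big_distrl.
have -> : \rsum_(c <- enum T) INR (c == i) = 1.
  rewrite (bigD1_seq i) ?mem_enum ?enum_uniq //= eqxx big1 /=; first ring.
  by move=> c /negbTE ->.
by set X := \rsum_(w <- words T r.+1) h w; change (1 * X + c1 * X = (c1 + 1) * X); ring.
Qed.

(** If [mu y] is read as a commuting monomial z_y, then [moment_sum mu u r y] is E(a_u (a.z)^r) z_y
    and [diag_sum mu r y] is |z|^(2r) z_y. Since [mu] is only assumed invariant under permutations,
    it can later be a moment of v, which is not multiplicative. *)
Definition moment_sum (mu : seq T -> R) u r y : R := \rsum_(w <- words T r) (gaussian_moment (u ++ w) * mu (w ++ y)).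
Definition diag_sum (mu : seq T -> R) r y : R := \rsum_(w <- words T r) mu (w ++ w ++ y).

(** Stein's identity differentiates a_u (a.z)^(r+1) with respect to a_i: the derivative falls on
    a_u, which loses one letter [i], or on the power, which releases the factor r + 1 and one
    z_i. *)
Lemma moment_sum_stein mu u r y i : perm_inv mu -> moment_sum mu (i :: u) r.+1 y =
  INR (count_mem i u) * moment_sum mu (rem i u) r.+1 y + INR r.+1 * moment_sum mu u r (i :: y).
Proof.
move=> hp.
have hq : perm_inv (fun w => gaussian_moment (u ++ w) * mu (w ++ i :: y)).
  move=> w w' p; rewrite (Emom_perm (u ++ w) (u ++ w')) ?perm_cat2l //.
  by rewrite (hp (w ++ i :: y) (w' ++ i :: y)) // perm_cat2r.
rewrite /moment_sum -(rsum_rem _ i _ hq) big_distrr -big_split.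
apply: eq_bigr => w _ /=.
rewrite Emom_stein count_cat plus_INR Rmult_plus_distr_r.
have e1 : INR (count_mem i u) * gaussian_moment (rem i (u ++ w)) = INR (count_mem i u) * gaussian_moment (rem i u ++ w).
  case: (boolP (i \in u)) => iu; last by rewrite (count_memPn iu) /=; ring.
  congr Rmult; apply: Emom_perm; rewrite -(perm_cons i).
  rewrite (perm_trans _ (_ : perm_eq (u ++ w) _)) ?perm_to_rem ?mem_cat ?iu //.
    by rewrite perm_sym perm_to_rem // mem_cat iu.
  by rewrite -cat_cons perm_cat2r perm_to_rem.
have e2 : INR (count_mem i w) * gaussian_moment (rem i (u ++ w)) * mu (w ++ y)
    = INR (count_mem i w) * (gaussian_moment (u ++ rem i w) * mu (rem i w ++ i :: y)).
  case: (boolP (i \in w)) => iw; last by rewrite (count_memPn iw) /=; ring.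
  rewrite (Emom_perm (rem i (u ++ w)) (u ++ rem i w)); last first.
    rewrite -(perm_cons i) (perm_trans (_ : perm_eq _ (u ++ w))) //.
      by rewrite perm_sym perm_to_rem // mem_cat iw orbT.
    rewrite (perm_trans (y := u ++ i :: rem i w)) ?perm_cat2l ?perm_to_rem //.
    by rewrite -cat1s perm_catCA.
  rewrite (hp (w ++ y) (rem i w ++ i :: y)); first ring.
  rewrite (perm_trans (y := (i :: rem i w) ++ y)) ?perm_cat2r ?perm_to_rem //.
  by rewrite /= -cat1s perm_catCA.
by rewrite Rmult_plus_distr_r e1 e2 Rmult_assoc.
Qed.

(** The double factorial (2p - 1)!!, the moment of order 2p of a standard Gaussian variable. *)
Fixpoint dfact (p : nat) : R := if p is p'.+1 then (2 * INR p' + 1) * dfact p' else 1.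
Lemma moment_sum_0 mu p y : perm_inv mu -> moment_sum mu [::] (p.*2) y = dfact p * gaussian_moment ([::] : seq T) * diag_sum mu p y.
Proof.
move=> hp; elim: p y => [|p IH] y; first by rewrite /moment_sum /diag_sum !rsum_words_0 /=; ring.
have -> : moment_sum mu [::] p.+1.*2 y = \rsum_(i <- enum T) moment_sum mu [:: i] p.*2.+1 (i :: y).
  rewrite /moment_sum doubleS rsum_words_S; apply: eq_bigr => i _; apply: eq_bigr => w _ /=.
  rewrite (hp (i :: w ++ y) (w ++ i :: y)) //.
  by rewrite -cat1s -(cat1s i y) perm_catCA.
have -> : diag_sum mu p.+1 y = \rsum_(i <- enum T) diag_sum mu p (i :: i :: y).
  rewrite /diag_sum rsum_words_S; apply: eq_bigr => i _; apply: eq_bigr => w _ /=.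
  by apply: hp; apply/permP => a; rewrite /= !count_cat /= !count_cat /=; lia.
rewrite big_distrr; apply: eq_bigr => i _.
rewrite moment_sum_stein // IH (_ : count_mem i [::] = 0)%N // (_ : INR p.*2.+1 = 2 * INR p + 1).
  by rewrite /=; ring.
by rewrite S_INR -addnn plus_INR; ring.
Qed.

(** The product (d + 2p) ... (1 + 2p) (2p - 1)!!: each letter of a_u that hits the power by Stein's
    identity contributes the current exponent. *)
Fixpoint stein_const (d p : nat) : R := if d is d'.+1 then (INR d + 2 * INR p) * stein_const d' p else dfact p.
Lemma dfact_ge1 p : 1 <= dfact p.
Proof. by elim: p => [|p IH] /=; [lra | have := pos_INR p; nra]. Qed.
Lemma Gmag_ge1 d p : 1 <= stein_const d p.
Proof.
elim: d => [|d IH]; first exact: dfact_ge1.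
rewrite (_ : stein_const d.+1 p = (INR d.+1 + 2 * INR p) * stein_const d p) // S_INR.
by have := pos_INR d; have := pos_INR p; nra.
Qed.
(** The source of the small factor in the asymptotics: pairing two letters of a_u with each other
    leaves d letters and p + 1 pairs, hence a constant smaller by 2p + 2 than when both hit the
    power. *)
Lemma Gmag_SS d p : stein_const d.+2 p = (2 * INR p + 2) * stein_const d p.+1.
Proof.
elim: d => [|d IH].
  rewrite (_ : stein_const 2 p = (INR 2 + 2 * INR p) * ((INR 1 + 2 * INR p) * dfact p)) //.
  by rewrite (_ : stein_const 0 p.+1 = (2 * INR p + 1) * dfact p) //= ; ring.
rewrite (_ : stein_const d.+3 p = (INR d.+3 + 2 * INR p) * stein_const d.+2 p) // IH.
rewrite (_ : stein_const d.+1 p.+1 = (INR d.+1 + 2 * INR p.+1) * stein_const d p.+1) // !S_INR; ring.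
Qed.

(* Iterating Stein's identity, the leading term of [E(a_u (a.z)^(d+2p))] is [G d p |z|^(2p) z_u];
   the point is that the relative error is [O(1/p)], with a constant depending only on [d = |u|]. *)
Lemma moment_sum_asympt d : exists2 c, 0 <= c & forall mu S0 (s : nat), perm_inv mu ->
  (forall p y, (p.*2 + size y = s.*2)%N -> Rabs (diag_sum mu p y) <= S0) ->
  forall u p y, size u = d -> (d + p.*2 + size y = s.*2)%N ->
  Rabs (moment_sum mu u (d + p.*2) y - stein_const d p * gaussian_moment ([::] : seq T) * diag_sum mu p (u ++ y))
    <= c * stein_const d p * gaussian_moment ([::] : seq T) * S0 / (2 * INR p + 1).
Proof.
have int_factor_0 := @Emom0_pos k.
elim/ltn_ind: d => [[_|d IH]].
  exists 0; first lra.
  move=> mu S0 s hp H u p y /size0nil -> _; rewrite add0n moment_sum_0 // Rminus_diag Rabs_R0.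
  by rewrite !Rmult_0_l /Rdiv Rmult_0_l; lra.
have [c c0 Hc] := IH d (ltnSn d).
have [c' c'0 Hc'] := IH d.-1 (leq_ltn_trans (leq_pred d) (ltnSn d)).
(* [c] is the inherited error of the term where the letter hits the power (d letters left, same p).
   The other term pairs it with one of at most d letters of [u]; there d - 1 letters and p + 1 pairs
   remain, and its main part 1 counts as error together with c'. *)
exists (c + INR d * (1 + c')).
  by apply: Rplus_le_le_0_compat => //; apply: Rmult_le_pos; [exact: pos_INR|lra].
move=> mu S0 s hp H [//|i u] p y [su] sz.
have P0 := pos_INR p; have D0 := pos_INR d.
have G1 := Gmag_ge1 d p; have G2 := Gmag_ge1 d.+1 p.
have Gd : stein_const d.+1 p = (INR d.+1 + 2 * INR p) * stein_const d p by [].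
have S00 : 0 <= S0.
  have := H p ((i :: u) ++ y); rewrite size_cat /= su => h.
  apply: Rle_trans (Rabs_pos _) (h _); rewrite -sz; lia.
have A : Rabs (INR (d + p.*2).+1 * moment_sum mu u (d + p.*2) (i :: y)
     - stein_const d.+1 p * gaussian_moment ([::] : seq T) * diag_sum mu p ((i :: u) ++ y))
   <= c * stein_const d.+1 p * gaussian_moment ([::] : seq T) * S0 / (2 * INR p + 1).
  have szi : (d + p.*2 + size (i :: y) = s.*2)%N by rewrite /=; lia.
  have := Hc mu S0 s hp H u p (i :: y) su szi.
  have -> : diag_sum mu p (u ++ i :: y) = diag_sum mu p (i :: u ++ y).
    rewrite /diag_sum; apply: eq_bigr => w _; apply: hp; rewrite !perm_cat2l.
    by rewrite -cat1s -(cat1s i (u ++ y)) perm_catCA.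
  have -> : INR (d + p.*2).+1 = INR d.+1 + 2 * INR p by rewrite !S_INR plus_INR -addnn plus_INR; ring.
  set a := moment_sum _ _ _ _; set b := diag_sum _ _ _; set e := gaussian_moment _.
  have -> : (INR d.+1 + 2 * INR p) * a - (INR d.+1 + 2 * INR p) * stein_const d p * e * b
     = (INR d.+1 + 2 * INR p) * (a - stein_const d p * e * b) by ring.
  have q0 : 0 <= INR d.+1 + 2 * INR p by rewrite S_INR; lra.
  rewrite Rabs_mult (Rabs_pos_eq (INR d.+1 + _)) // => h.
  apply: Rle_trans (Rmult_le_compat_l _ _ _ q0 h) _; rewrite Gd; right; field; lra.
have B : Rabs (INR (count_mem i u) * moment_sum mu (rem i u) (d + p.*2).+1 y)
   <= INR d * (1 + c') * stein_const d.+1 p * gaussian_moment ([::] : seq T) * S0 / (2 * INR p + 1).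
  case: (boolP (i \in u)) => iu; last first.
    rewrite (count_memPn iu) /= Rmult_0_l Rabs_R0.
    apply: Rmult_le_pos; last by left; apply: Rinv_0_lt_compat; lra.
    apply: Rmult_le_pos => //; apply: Rmult_le_pos; last lra.
    apply: Rmult_le_pos; last by rewrite -Gd; lra.
    by apply: Rmult_le_pos; lra.
  have sr : size (rem i u) = d.-1 by rewrite size_rem // su.
  case: d {IH Hc A} su sr sz Hc' D0 G1 G2 Gd => [|d] su sr sz Hc' D0 G1 G2 Gd; first by rewrite (size0nil su) in iu.
  have szr : (d + p.+1.*2 + size y = s.*2)%N by lia.
  have := Hc' mu S0 s hp H (rem i u) p.+1 y sr szr.
  have -> : (d + p.+1.*2 = (d.+1 + p.*2).+1)%N by lia.
  have R1 : Rabs (diag_sum mu p.+1 (rem i u ++ y)) <= S0 by apply: H; rewrite size_cat sr /=; lia.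
  have GG := Gmag_SS d p; have Gp := Gmag_ge1 d p.+1.
  set a := moment_sum _ _ _ _; set b := diag_sum _ _ _ in R1 *; set e := gaussian_moment _; set g := stein_const d p.+1 in GG Gp *.
  move=> h.
  have P1 : 0 <= INR p.+1 by exact: pos_INR.
  have ge : 0 <= g * e by apply: Rmult_le_pos; [lra | rewrite /e; lra].
  have h1 : Rabs a <= (1 + c') * (g * e) * S0.
    have : Rabs (g * e * b) <= g * e * S0 by rewrite Rabs_mult (Rabs_pos_eq (g * e)) //; apply: Rmult_le_compat_l.
    have : c' * g * e * S0 / (2 * INR p.+1 + 1) <= c' * g * e * S0.
      rewrite -{2}(Rmult_1_r (c' * g * e * S0)); apply: Rmult_le_compat_l.
        by apply: Rmult_le_pos => //; rewrite Rmult_assoc; apply: Rmult_le_pos.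
      by rewrite -{2}Rinv_1; apply: Rinv_le_contravar; lra.
    have := Rabs_triang (a - g * e * b) (g * e * b).
    rewrite (_ : a - g * e * b + g * e * b = a); last ring.
    lra.
  have cnt : INR (count_mem i u) <= INR d.+1 by apply: le_INR; apply/leP; rewrite -su; apply: count_size.
  rewrite Rabs_mult (Rabs_pos_eq (INR _)); last exact: pos_INR.
  apply: Rle_trans (Rmult_le_compat _ _ _ _ (pos_INR _) (Rabs_pos _) cnt h1) _.
  rewrite GG.
  have -> : INR d.+1 * (1 + c') * ((2 * INR p + 2) * g) * e * S0 / (2 * INR p + 1) =
     INR d.+1 * ((1 + c') * (g * e) * S0) * ((2 * INR p + 2) / (2 * INR p + 1)) by field; lra.
  rewrite -{1}(Rmult_1_r (INR d.+1 * _)); apply: Rmult_le_compat_l.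
    apply: Rmult_le_pos => //; apply: Rmult_le_pos => //; apply: Rmult_le_pos => //; lra.
  by apply: (Rmult_le_reg_r (2 * INR p + 1)); [lra | rewrite /Rdiv Rmult_assoc Rinv_l; lra].
rewrite addSn moment_sum_stein //.
set a := INR (count_mem i u) * _ in B *; set b := INR _.+1 * _ in A *.
set t := _ * diag_sum _ _ _ in A *.
have -> : a + b - t = a + (b - t) by ring.
apply: Rle_trans (Rabs_triang _ _) _.
by apply: Rle_trans (Rplus_le_compat _ _ _ _ B A) _; right; field; lra.
Qed.
End Combinatorics.

(** * The elliptic estimate *)

Lemma rsum_opp {Z} (l : seq Z) (f : Z -> R) : \rsum_(z <- l) (- f z) = - \rsum_(z <- l) f z.
Proof. by elim: l => [|z l IH]; rewrite ?big_nil ?big_cons ?IH; ring. Qed.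
Lemma rsum_distl {Z} (l : seq Z) (f : Z -> R) c : \rsum_(z <- l) (c * f z) = c * \rsum_(z <- l) f z.
Proof. by elim: l => [|z l IH]; rewrite ?big_nil ?big_cons ?IH; ring. Qed.
Lemma rsum_distr {Z} (l : seq Z) (f : Z -> R) c : \rsum_(z <- l) (f z * c) = \rsum_(z <- l) f z * c.
Proof. by elim: l => [|z l IH]; rewrite ?big_nil ?big_cons ?IH; ring. Qed.
Lemma csum_distl {Z} (l : seq Z) (f : Z -> C) c : \csum_(z <- l) (Cmult c (f z)) = Cmult c (\csum_(z <- l) f z).
Proof. by elim: l => [|z l IH]; rewrite ?big_nil ?big_cons ?IH; ring. Qed.
Lemma csum_distr {Z} (l : seq Z) (f : Z -> C) c : \csum_(z <- l) (Cmult (f z) c) = Cmult (\csum_(z <- l) f z) c.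
Proof. by elim: l => [|z l IH]; rewrite ?big_nil ?big_cons ?IH; ring. Qed.
Lemma rsum_add {Z} (l : seq Z) (f g : Z -> R) :
  \rsum_(z <- l) (f z + g z) = \rsum_(z <- l) f z + \rsum_(z <- l) g z.
Proof. by elim: l => [|z l IH]; rewrite ?big_nil ?big_cons ?IH; ring. Qed.
Lemma csum_minus {Z} (l : seq Z) (f g : Z -> C) :
  Cminus (\csum_(z <- l) f z) (\csum_(z <- l) g z) = \csum_(z <- l) (Cminus (f z) (g z)).
Proof. by elim: l => [|z l IH]; rewrite ?big_nil ?big_cons -?IH; ring. Qed.
(** Quantitative form of [perm_swap_inv]: at most |y|^2 adjacent swaps reorder y, each costing
    [eta]. The cap [L] on the length is needed because swaps are cheap only for words of controlled
    length. *)
Lemma perm_swap_approx {T : eqType} (F : seq T -> C) (eta : R) L : 0 <= eta ->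
  (forall p i j q, (size (p ++ i :: j :: q) <= L)%N ->
     Cmod (Cminus (F (p ++ i :: j :: q)) (F (p ++ j :: i :: q))) <= eta) ->
  forall y y', perm_eq y y' -> (size y <= L)%N ->
    Cmod (Cminus (F y) (F y')) <= INR (size y) * INR (size y) * eta.
Proof.
move=> e0 H y; elim: y F L H => [|i y IH] F L H y' pe.
  case: y' pe => [_ _|a l /perm_size] //=.
  by rewrite (_ : Cminus (F [::]) (F [::]) = RtoC 0) ?Cmod_0; [lra | rewrite /Cminus; ring].
have iy' : i \in y' by rewrite -(perm_mem pe) mem_head.
have sz := perm_size pe.
case/splitPr: y' / iy' pe sz => p q pe sz yL.
have tri (a b c : C) : Cmod (Cminus a c) <= Cmod (Cminus a b) + Cmod (Cminus b c).
  have -> : Cminus a c = Cplus (Cminus a b) (Cminus b c) by rewrite /Cminus; ring.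
  exact: Cmod_triangle.
have front : Cmod (Cminus (F (i :: p ++ q)) (F (p ++ i :: q))) <= INR (size p) * eta.
  have : (size (p ++ i :: q) <= L)%N by rewrite -sz.
  elim/last_ind: p q {pe sz} => [|p j IHp] q hs.
    by rewrite (_ : Cminus _ _ = RtoC 0) ?Cmod_0 /=; [lra | rewrite /Cminus; ring].
  rewrite cat_rcons in hs; rewrite !cat_rcons.
  apply: Rle_trans (tri _ (F (p ++ i :: j :: q)) _) _.
  have h1 := IHp (j :: q); rewrite size_rcons S_INR.
  have h2 : (size (p ++ i :: j :: q) <= L)%N by move: hs; rewrite !size_cat.
  have := h1 h2; have := H p i j q h2; lra.
have step : Cmod (Cminus (F (i :: y)) (F (i :: p ++ q))) <= INR (size y) * INR (size y) * eta.
  apply: (IH (fun z => F (i :: z)) L.-1).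
  - by move=> p' a b q' hs; apply: (H (i :: p')); move: yL; rewrite /=; lia.
  - by rewrite -(perm_cons i) (perm_trans pe) // -cat1s perm_catCA.
  - by move: yL => /=; lia.
apply: Rle_trans (tri _ (F (i :: p ++ q)) _) _.
have : INR (size p) <= INR (size y) by apply: le_INR; move: sz; rewrite size_cat /=; lia.
rewrite (_ : size (i :: y) = (size y).+1) // S_INR => hp.
have := Rmult_le_compat_r _ _ _ e0 hp; have := pos_INR (size y); nra.
Qed.

Definition canon {T : finType} (y : seq T) : seq T :=
  flatten [seq nseq (count_mem i y) i | i <- enum T].
Lemma canon_perm {T : finType} (y : seq T) : perm_eq (canon y) y.
Proof. exact: perm_flatten_count. Qed.
Lemma canon_eq {T : finType} (y y' : seq T) : perm_eq y y' -> canon y = canon y'.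
Proof. by move=> /permP p; rewrite /canon; congr flatten; apply: eq_map => i; rewrite p. Qed.

Section Elliptic.
Context {n : nat}.
Local Notation T := 'I_(n + n).
Local Notation F := (Pt n -> C).
Implicit Types (w y : seq T) (v g : F).

Lemma nice_zero : nice (fun _ : Pt n => RtoC 0).
Proof.
apply: (lin_nice (fun f => f = fun _ => RtoC 0)); last exact: lin_base.
move=> f ->; split; first exact: smooth_const.
split; first by exists 0 => x; rewrite Cmod_0; lra.
move=> i; apply: lin_base.
have -> : (fun _ : Pt n => RtoC 0) = cscal (RtoC 0) (fun _ => RtoC 0) by apply: fext => x; rewrite /cscal; ring.
rewrite Zop_scal; last exact: smooth_const.
by apply: fext => x; rewrite /cscal; ring.
Qed.

Definition lsum {Z : Type} (l : seq Z) (c : Z -> C) (f : Z -> F) : F :=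
  foldr (fun z g => cplus (cscal (c z) (f z)) g) (fun _ => RtoC 0) l.
Lemma lsumE {Z} (l : seq Z) c f x : lsum l c f x = \csum_(z <- l) Cmult (c z) (f z x).
Proof. by elim: l => [|z l IH]; rewrite ?big_nil ?big_cons -?IH. Qed.
Lemma nice_lsum {Z} (l : seq Z) c f : (forall z, nice (f z)) -> nice (lsum l c f).
Proof.
move=> nf; elim: l => [|z l IH]; first exact: nice_zero.
by apply: nice_plus => //; apply: nice_scal.
Qed.
Lemma inner_lsuml {Z} (l : seq Z) c f h : (forall z, nice (f z)) -> nice h ->
  inner (lsum l c f) h = \csum_(z <- l) Cmult (c z) (inner (f z) h).
Proof.
move=> nf nh; elim: l => [|z l IH].
  rewrite big_nil -[RHS](Cmult_0_l (inner h h)) -inner_scall //; congr inner.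
  by apply: fext => x; rewrite /cscal /=; ring.
rewrite big_cons -IH -inner_scall // -inner_plusl //; first exact: nice_scal.
exact: nice_lsum.
Qed.
Lemma inner_lsum {Z} (l : seq Z) c f : (forall z, nice (f z)) ->
  RtoC (nrm2 (lsum l c f)) =
  \csum_(z <- l) \csum_(z' <- l) Cmult (Cmult (c z) (Cconj (c z'))) (inner (f z) (f z')).
Proof.
move=> nf; have nl : nice (lsum l c f) by apply: nice_lsum.
rewrite -inner_self // inner_lsuml //; apply: eq_bigr => z _.
rewrite (inner_conj (lsum l c f) (f z)) // inner_lsuml //.
have -> : Cconj (\csum_(z0 <- l) Cmult (c z0) (inner (f z0) (f z))) =
    \csum_(z' <- l) Cmult (Cconj (c z')) (inner (f z) (f z')).
  elim: (l) => [|z' l' IH]; rewrite ?big_nil ?big_cons; first by rewrite Cconj_R.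
  by rewrite Cconj_plus Cconj_mult IH -inner_conj.
by rewrite -csum_distl; apply: eq_bigr => z' _; ring.
Qed.
Lemma nrm_lsum_le {Z} (l : seq Z) c f : (forall z, nice (f z)) ->
  nrm (lsum l c f) <= \rsum_(z <- l) (Cmod (c z) * nrm (f z)).
Proof.
move=> nf; elim: l => [|z l IH].
  rewrite big_nil (_ : lsum [::] c f = cscal (RtoC 0) (fun _ => RtoC 0)).
    by rewrite nrm_scal ?Cmod_0 ?Rmult_0_l; [lra | exact: nice_zero].
  by apply: fext => x; rewrite /cscal /=; ring.
rewrite big_cons; apply: Rle_trans (nrm_plus _ _ _ _) _; [exact: nice_scal | exact: nice_lsum |].
by rewrite -/(lsum l c f) nrm_scal //; apply: Rplus_le_compat_l.
Qed.

(** * Inner products of words, up to commutators *)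

Section Gram.
Variables (v : F) (s : nat) (B : R).
Hypotheses (nv : nice v) (HB : forall y, (size y < s)%N -> nrm (zw y v) <= B).
Let br y : C := inner (zw y v) v.
(* Commutators lower the degree, so up to [B ^ 2] the inner product of [zw w v] and [zw w' v]
   depends only on the multiset [w ++ w']; [sym_moment] picks a canonical representative. *)
Definition sym_moment y : R := Re (br (canon y)).
Let Eta : R := 2 * (INR s.*2 * INR s.*2) * (B * B).

Lemma sym_moment_perm : perm_inv sym_moment.
Proof. by move=> y y' p; rewrite /sym_moment (canon_eq _ _ p). Qed.
Let B20 : 0 <= B * B. Proof. by nra. Qed.

(** With at least two letters missing, the word splits into two halves that are both shorter than s,
    one on each side of the inner product; Cauchy-Schwarz and [HB] do the rest. *)
Lemma br_split y : (size y + 2 <= s.*2)%N -> Cmod (br y) <= B * B.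
Proof.
move=> hs; have [h h1 h2] : exists2 h, (h < s)%N & (size y < s + h)%N by exists s.-1; lia.
have -> : br y = inner (zw (drop h y) v) (zw (rev (take h y)) v).
  by rewrite /br -{1}(cat_take_drop h y) zw_cat zw_sym //; apply: nice_zw.
apply: Rle_trans (cauchy_schwarz _ _ (nice_zw _ _ nv) (nice_zw _ _ nv)) _.
apply: Rmult_le_compat; [exact: nrm_ge0|exact: nrm_ge0| |]; apply: HB.
  by rewrite size_drop; lia.
by rewrite size_rev size_take; case: (ltnP h (size y)); lia.
Qed.
Lemma br_swap p i j q : (size (p ++ i :: j :: q) <= s.*2)%N ->
  Cmod (Cminus (br (p ++ i :: j :: q)) (br (p ++ j :: i :: q))) <= B * B.
Proof.
move=> hs; have [c c1 H] := Zop_comm (k := n) i j.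
have nq := nice_zw q _ nv; have sq := nice_smooth _ nq.
have E : zw (p ++ i :: j :: q) v = cplus (zw (p ++ j :: i :: q) v) (cscal c (zw (p ++ q) v)).
  rewrite !zw_cat /= H // zw_plus ?zw_scal //; last exact: smooth_cscal.
  by do 2 apply: smooth_Z.
rewrite /br E inner_plusl ?inner_scall //; try by [exact: nice_zw | apply: nice_scal; exact: nice_zw].
have -> : forall a b : C, Cminus (Cplus a b) a = b by move=> a b; rewrite /Cminus; ring.
rewrite Cmod_mult -[X in _ <= X]Rmult_1_l.
apply: Rmult_le_compat; [exact: Cmod_ge_0 | exact: Cmod_ge_0 | exact: c1 |].
by apply: br_split; move: hs; rewrite !size_cat /=; lia.
Qed.
Lemma br_perm y y' : perm_eq y y' -> size y = s.*2 ->
  Cmod (Cminus (br y) (br y')) <= INR s.*2 * INR s.*2 * (B * B).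
Proof.
move=> pe sy; rewrite -sy.
by apply: (perm_swap_approx br (B * B) (s.*2)) => //; [exact: br_swap | rewrite sy].
Qed.
Lemma br_rev y : br (rev y) = Cconj (br y).
Proof. by rewrite /br -inner_conj ?zw_sym ?revK //; apply: nice_zw. Qed.
(** Two errors of the same size make the factor 2 in [Eta]: bringing [rev w' ++ w] to canonical
    order, and discarding the imaginary part. The latter is half the difference between a word and
    its reversal, because reversing a word conjugates its bracket. *)
Lemma gram w w' : size w = s -> size w' = s ->
  Cmod (Cminus (inner (zw w v) (zw w' v)) (RtoC (sym_moment (w ++ w')))) <= Eta.
Proof.
move=> sw sw'.
have -> : inner (zw w v) (zw w' v) = br (rev w' ++ w).
  by rewrite /br zw_cat (zw_sym (rev w')) ?revK //; apply: nice_zw.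
have pe : perm_eq (rev w' ++ w) (canon (w ++ w')).
  rewrite perm_sym (perm_trans (canon_perm _)) // perm_catC perm_cat2r perm_sym.
  by rewrite perm_rev.
have sz : size (rev w' ++ w) = s.*2 by rewrite size_cat size_rev sw sw' addnn.
have h1 := br_perm _ _ pe sz.
set z := canon (w ++ w') in pe h1 *.
have sz' : size z = s.*2 by rewrite -(perm_size pe).
have h2 : Cmod (Cminus (br z) (RtoC (sym_moment (w ++ w')))) <= INR s.*2 * INR s.*2 * (B * B).
  have pr : perm_eq z (rev z) by rewrite perm_sym perm_rev.
  have := br_perm _ _ pr sz'; rewrite br_rev.
  rewrite /sym_moment -/z.
  have -> : Cminus (br z) (Cconj (br z)) = Cmult (RtoC 2) (Cminus (br z) (RtoC (Re (br z)))).
    by apply: C_ext; rewrite /= /Re /Im; ring.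
  rewrite Cmod_mult Cmod_R Rabs_pos_eq; last lra.
  have := Cmod_ge_0 (Cminus (br z) (RtoC (Re (br z)))); lra.
have -> : Cminus (br (rev w' ++ w)) (RtoC (sym_moment (w ++ w'))) =
   Cplus (Cminus (br (rev w' ++ w)) (br z)) (Cminus (br z) (RtoC (sym_moment (w ++ w')))) by rewrite /Cminus; ring.
by apply: Rle_trans (Cmod_triangle _ _) _; rewrite /Eta; lra.
Qed.

Let S2 : R := \rsum_(w <- words T s) nrm2 (zw w v).

Lemma sub_words p (y : seq T) (f : seq T -> R) : (forall w, 0 <= f w) ->
  \rsum_(w <- words T p) f (w ++ y) <= \rsum_(w <- words T (p + size y)) f w.
Proof.
move=> f0; rewrite rsum_words_add; apply: rsum_le => w.
by apply: (rsum_mem_le _ (fun y => f (w ++ y))) => //; rewrite mem_words.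
Qed.

(** As |y| = 2 (s - p), the word y splits into two halves, and w with either half has length s.
    Cauchy-Schwarz and the arithmetic-geometric inequality bound the diagonal sum by [S2]; this is
    the a priori bound fed to [moment_sum_asympt]. *)
Lemma Rsq_bound p y : (p.*2 + size y = s.*2)%N ->
  Rabs (diag_sum sym_moment p y) <= S2 + INR (size (words T p)) * Eta.
Proof.
move=> sy; set h := (s - p)%N.
pose y1 := take h y; pose y2 := drop h y.
have s1 : size y1 = h by rewrite size_takel /h; lia.
have s2 : size y2 = h by rewrite size_drop /h; lia.
have N w : nrm2 (zw w v) >= 0 by apply/Rle_ge/nrm2_ge0/nice_zw.
have B1 w : w \in words T p -> Rabs (sym_moment (w ++ w ++ y)) <=
    / 2 * nrm2 (zw (w ++ y1) v) + / 2 * nrm2 (zw (w ++ y2) v) + Eta.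
  rewrite mem_words => /eqP sw.
  have -> : sym_moment (w ++ w ++ y) = sym_moment ((w ++ y1) ++ (w ++ y2)).
    apply: sym_moment_perm; rewrite -(cat_take_drop h y) -/y1 -/y2 -!catA perm_cat2l.
    by rewrite perm_catCA.
  have g := gram (w ++ y1) (w ++ y2) (ltac:(by rewrite size_cat sw s1 /h; lia))
    (ltac:(by rewrite size_cat sw s2 /h; lia)).
  have cs := cauchy_schwarz _ _ (nice_zw (w ++ y1) _ nv) (nice_zw (w ++ y2) _ nv).
  have q1 := nrm_sq _ (nice_zw (w ++ y1) _ nv); have q2 := nrm_sq _ (nice_zw (w ++ y2) _ nv).
  set z := inner _ _ in g cs; set r := sym_moment _ in g *.
  have : Rabs r <= Cmod (Cminus z (RtoC r)) + Cmod z.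
    rewrite -Cmod_R -(Cmod_opp (Cminus z (RtoC r))).
    have {1}-> : RtoC r = Cplus (Copp (Cminus z (RtoC r))) z by rewrite /Cminus; ring.
    exact: Cmod_triangle.
  have := Rle_0_sqr (nrm (zw (w ++ y1) v) - nrm (zw (w ++ y2) v)); rewrite /Rsqr; nra.
apply: Rle_trans (rsum_abs _ _) _; apply: Rle_trans (rsum_le_in _ _ _ B1) _.
rewrite !rsum_add rsum_const !rsum_distl.
have f0 w : 0 <= nrm2 (zw w v) by apply: Rge_le.
have := sub_words p y1 (fun w => nrm2 (zw w v)) f0; have := sub_words p y2 (fun w => nrm2 (zw w v)) f0.
have -> : (p + size y1)%N = s by rewrite s1 /h; lia.
have -> : (p + size y2)%N = s by rewrite s2 /h; lia.
rewrite -/S2 => a b; apply: Rplus_le_compat_r.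
have h2 : 0 <= / 2 by lra.
by apply: Rle_trans (Rplus_le_compat _ _ _ _ (Rmult_le_compat_l _ _ _ h2 b) (Rmult_le_compat_l _ _ _ h2 a)) _; lra.
Qed.

Lemma gram_ge0 (a : Pt (n + n)) :
  0 <= \rsum_(w <- words T s) \rsum_(w' <- words T s) (amon w a * amon w' a * Re (inner (zw w v) (zw w' v))).
Proof.
have nz w : nice (zw w v) by apply: nice_zw.
have := inner_lsum (words T s) (fun w => RtoC (amon w a)) (fun w => zw w v) nz.
move=> /(f_equal Re) /= E; have := nrm2_ge0 _ (nice_lsum (words T s) (fun w => RtoC (amon w a)) _ nz).
rewrite E csum_re => h; apply: Rle_trans h _; right; apply: eq_bigr => w _.
by rewrite csum_re; apply: eq_bigr => w' _; rewrite Cconj_R -RtoC_mult /=; ring.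
Qed.

(* The Gaussian average over [a] of [q(a) * |(a.Z)^s v|^2 >= 0]. *)
Lemma moment_sum_lower {J : Type} (q : seq J) (kq : J -> R) (wq : J -> seq T) :
  (forall a, 0 <= \rsum_(z <- q) (kq z * amon (wq z) a)) ->
  - ((\rsum_(z <- q) \rsum_(w <- words T s) \rsum_(w' <- words T s)
      (Rabs (kq z) * Rabs (gaussian_moment (wq z ++ w ++ w')))) * Eta)
    <= \rsum_(z <- q) (kq z * moment_sum sym_moment (wq z) s.*2 [::]).
Proof.
move=> Hq.
pose ip w w' := Re (inner (zw w v) (zw w' v)).
have A : 0 <= \rsum_(z <- q) \rsum_(w <- words T s) \rsum_(w' <- words T s)
     (kq z * (ip w w' * gaussian_moment (wq z ++ w ++ w'))).
  pose f (a : Pt (n + n)) := \rsum_(z <- q) \rsum_(w <- words T s) \rsum_(w' <- words T s)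
     (kq z * (ip w w' * amon (wq z ++ w ++ w') a)).
  apply: (Elin_ge0 f).
    apply: Elin_sum => z; apply: Elin_sum => w; apply: Elin_sum => w'.
    by do 2 apply: Elin_scal; apply: Elin_mon.
  move=> a; rewrite /f.
  suff -> : \rsum_(z <- q) \rsum_(w <- words T s) \rsum_(w' <- words T s)
     (kq z * (ip w w' * amon (wq z ++ w ++ w') a)) =
     \rsum_(z <- q) (kq z * amon (wq z) a) *
     \rsum_(w <- words T s) \rsum_(w' <- words T s) (amon w a * amon w' a * ip w w').
    by apply: Rmult_le_pos => //; apply: gram_ge0.
  rewrite -rsum_distr; apply: eq_bigr => z _; rewrite -rsum_distl; apply: eq_bigr => w _.
  by rewrite -rsum_distl; apply: eq_bigr => w' _; rewrite !amon_cat; ring.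
have D : \rsum_(z <- q) (kq z * moment_sum sym_moment (wq z) s.*2 [::]) =
   \rsum_(z <- q) \rsum_(w <- words T s) \rsum_(w' <- words T s) (kq z * (sym_moment (w ++ w') * gaussian_moment (wq z ++ w ++ w'))).
  apply: eq_bigr => z _; rewrite /moment_sum -addnn rsum_words_add -rsum_distl; apply: eq_bigr => w _.
  by rewrite -rsum_distl; apply: eq_bigr => w' _; rewrite cats0; ring.
rewrite D.
suff : \rsum_(z <- q) \rsum_(w <- words T s) \rsum_(w' <- words T s)
     (kq z * (ip w w' * gaussian_moment (wq z ++ w ++ w'))) -
   \rsum_(z <- q) \rsum_(w <- words T s) \rsum_(w' <- words T s) (kq z * (sym_moment (w ++ w') * gaussian_moment (wq z ++ w ++ w')))
   <= \rsum_(z <- q) \rsum_(w <- words T s) \rsum_(w' <- words T s)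
      (Rabs (kq z) * Rabs (gaussian_moment (wq z ++ w ++ w'))) * Eta by lra.
rewrite rsum_minus -rsum_distr; apply: rsum_le => z.
rewrite rsum_minus -rsum_distr; apply: rsum_le_in => w; rewrite mem_words => /eqP sw.
rewrite rsum_minus -rsum_distr; apply: rsum_le_in => w'; rewrite mem_words => /eqP sw'.
have := gram w w' sw sw'; rewrite /ip; set x := inner _ _; set r := sym_moment _; set e := gaussian_moment _ => g.
have : Rabs (Re x - r) <= Eta by apply: Rle_trans g; exact: (Re_le_Cmod (Cminus x (RtoC r))).
move=> g'; have -> : kq z * (Re x * e) - kq z * (r * e) = kq z * e * (Re x - r) by ring.
apply: Rle_trans (Rle_abs _) _; rewrite !Rabs_mult; apply: Rmult_le_compat_l => //.
by apply: Rmult_le_pos; apply: Rabs_pos.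
Qed.

(** The positive half of the averaged polynomial: |symbol|^2 |z|^(2p), evaluated through
    [sym_moment], is regrouped over the words y of length p into squared norms of the symbol in the
    letters Z applied to [zw y v]. *)
Lemma symbol_upper {I : eqType} (Z : seq I) (kp : I -> C) (wd : I -> seq T) m p : (p + m = s)%N -> (forall z, z \in Z -> size (wd z) = m) ->
  \rsum_(z <- Z) \rsum_(z' <- Z) (Re (Cmult (kp z) (Cconj (kp z'))) * diag_sum sym_moment p ((wd z) ++ (wd z')))
  <= \rsum_(y <- words T p) nrm2 (lsum Z kp (fun z => zw (wd z) (zw y v)))
     + INR (size (words T p)) * ((\rsum_(z <- Z) \rsum_(z' <- Z) (Cmod (kp z) * Cmod (kp z'))) * Eta).
Proof.
move=> pm sZ; rewrite /diag_sum.
have -> : \rsum_(z <- Z) \rsum_(z' <- Z) (Re (Cmult (kp z) (Cconj (kp z'))) * \rsum_(y <- words T p) sym_moment (y ++ y ++ (wd z) ++ (wd z')))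
   = \rsum_(y <- words T p) \rsum_(z <- Z) \rsum_(z' <- Z) (Re (Cmult (kp z) (Cconj (kp z'))) * sym_moment (((wd z) ++ y) ++ ((wd z') ++ y))).
  rewrite [RHS]exchange_big; apply: eq_bigr => z _; rewrite [RHS]exchange_big; apply: eq_bigr => z' _.
  rewrite -rsum_distl; apply: eq_bigr => y _; congr Rmult; apply: sym_moment_perm.
  by apply/permP => a; rewrite !count_cat; lia.
rewrite -rsum_const -rsum_add; apply: rsum_le_in => y; rewrite mem_words => /eqP sy.
have ny := nice_zw y _ nv.
have := inner_lsum Z kp (fun z => zw (wd z) (zw y v)) (fun z => nice_zw (wd z) _ ny).
move=> /(f_equal Re); rewrite [Re (RtoC _)]/= => ->.
have X : \rsum_(z <- Z) \rsum_(z' <- Z) (Re (Cmult (kp z) (Cconj (kp z'))) * sym_moment (((wd z) ++ y) ++ ((wd z') ++ y)))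
  = Re (\csum_(z <- Z) \csum_(z' <- Z) Cmult (Cmult (kp z) (Cconj (kp z'))) (RtoC (sym_moment (((wd z) ++ y) ++ ((wd z') ++ y))))).
  rewrite csum_re; apply: eq_bigr => z _; rewrite csum_re; apply: eq_bigr => z' _.
  by rewrite /= /Re /Im; ring.
rewrite X; set a := Re _; set b := Re _.
suff : a - b <= \rsum_(z <- Z) \rsum_(z' <- Z) (Cmod (kp z) * Cmod (kp z')) * Eta by lra.
rewrite /a /b (_ : Re _ - Re _ = Re (Cminus (\csum_(z <- Z) \csum_(z' <- Z) Cmult (Cmult (kp z) (Cconj (kp z'))) (RtoC (sym_moment (((wd z) ++ y) ++ ((wd z') ++ y)))))
   (\csum_(z <- Z) \csum_(z' <- Z) Cmult (Cmult (kp z) (Cconj (kp z'))) (inner (zw (wd z) (zw y v)) (zw (wd z') (zw y v)))))) //.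
rewrite csum_minus; apply: Rle_trans (Rle_abs _) _; apply: Rle_trans (Re_le_Cmod _) _.
apply: Rle_trans (csum_mod _ _) _; rewrite -rsum_distr; apply: rsum_le_in => z zZ.
rewrite csum_minus; apply: Rle_trans (csum_mod _ _) _; rewrite -rsum_distr; apply: rsum_le_in => z' zZ'.
rewrite -!zw_cat.
have -> : forall c x r : C, Cminus (Cmult c r) (Cmult c x) = Copp (Cmult c (Cminus x r)) by move=> *; rewrite /Cminus; ring.
rewrite Cmod_opp !Cmod_mult Cmod_conj; apply: Rmult_le_compat_l.
  by apply: Rmult_le_pos; apply: Cmod_ge_0.
by apply: gram; rewrite size_cat sZ // sy -pm addnC.
Qed.

(** The negative half: |z|^(2m) |z|^(2p) is the sum over all words of length s = p + m, that is
    [S2], the quantity to be estimated. *)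
Lemma square_lower m p : (p + m = s)%N ->
  S2 - INR (size (words T p)) * (INR (size (words T m)) * Eta) <= \rsum_(w <- words T m) diag_sum sym_moment p (w ++ w).
Proof.
move=> pm; rewrite /S2 -pm rsum_words_add -rsum_const.
have -> : \rsum_(w <- words T m) diag_sum sym_moment p (w ++ w) = \rsum_(y <- words T p) \rsum_(w <- words T m) sym_moment ((y ++ w) ++ (y ++ w)).
  rewrite [RHS]exchange_big; apply: eq_bigr => w _; apply: eq_bigr => y _.
  by apply: sym_moment_perm; apply/permP => a; rewrite !count_cat; lia.
rewrite rsum_minus; apply: rsum_le_in => y; rewrite mem_words => /eqP sy.
rewrite -rsum_const rsum_minus; apply: rsum_le_in => w; rewrite mem_words => /eqP sw.
have sz : size (y ++ w) = s by rewrite size_cat sy sw.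
have := gram _ _ sz sz; rewrite inner_self; last exact: nice_zw.
rewrite -RtoC_minus Cmod_R => /Rabs_le_between g.
have low (x r : R) : - Eta <= x - r <= Eta -> x - Eta <= r by lra.
exact: low g.
Qed.
End Gram.

Lemma elliptic_estimate {I : eqType} (Z : seq I) (kp : I -> C) (wd : I -> seq T) (m : nat) (delta : R) :
  (0 < m)%N -> 0 < delta ->
  (forall z, z \in Z -> size (wd z) = m) ->
  (forall a : Pt (n + n), delta * \rsum_(w <- words T m) (amon w a * amon w a)
     <= Cmod (\csum_(z <- Z) Cmult (kp z) (RtoC (amon (wd z) a)))
        * Cmod (\csum_(z <- Z) Cmult (kp z) (RtoC (amon (wd z) a)))) ->
  exists p C0, 0 <= C0 /\ forall v, nice v -> forall B1 B2,
    (forall y, size y = p -> nrm (lsum Z kp (fun z => zw (wd z) (zw y v))) <= B1) ->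
    (forall y, (size y < p + m)%N -> nrm (zw y v) <= B2) ->
    forall w, size w = (p + m)%N -> nrm (zw w v) <= C0 * (B1 + B2).
Proof.
move=> m0 d0 sZ Hd.
(* [q] indexes the monomials of |symbol|^2 - delta |a|^(2m): pairs of symbol terms, then words of
   length m, squared. *)
pose q : seq (I * I + seq T) := [seq inl (z, z') | z <- Z, z' <- Z] ++ [seq inr w | w <- words T m].
pose kq (z : I * I + seq T) : R := match z with inl zz => Re (Cmult (kp zz.1) (Cconj (kp zz.2))) | inr _ => - delta end.
pose wq (z : I * I + seq T) : seq T := match z with inl zz => wd zz.1 ++ wd zz.2 | inr w => w ++ w end.
have qE (X : seq T -> R) : \rsum_(z <- q) (kq z * X (wq z)) =
   \rsum_(z <- Z) \rsum_(z' <- Z) (Re (Cmult (kp z) (Cconj (kp z'))) * X (wd z ++ wd z'))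
   - delta * \rsum_(w <- words T m) X (w ++ w).
  rewrite big_cat big_allpairs_dep big_map rsum_distl /Rminus Ropp_mult_distr_l; congr Rplus.
have qpos (a : Pt (n + n)) : 0 <= \rsum_(z <- q) (kq z * amon (wq z) a).
  rewrite (qE (fun u => amon u a)).
  have -> : \rsum_(w <- words T m) amon (w ++ w) a = \rsum_(w <- words T m) (amon w a * amon w a).
    by apply: eq_bigr => w _; rewrite amon_cat.
  suff -> : \rsum_(z <- Z) \rsum_(z' <- Z) (Re (Cmult (kp z) (Cconj (kp z'))) * amon (wd z ++ wd z') a)
     = Cmod (\csum_(z <- Z) Cmult (kp z) (RtoC (amon (wd z) a))) * Cmod (\csum_(z <- Z) Cmult (kp z) (RtoC (amon (wd z) a))).
    by have := Hd a; lra.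
  set S := \csum_(z <- Z) _.
  have -> : Cmod S * Cmod S = Re (Cmult S (Cconj S)).
    by rewrite /Cmod sqrt_sqrt; [rewrite /= /Re /Im; ring | nra].
  have cS : Cconj S = \csum_(z <- Z) Cmult (Cconj (kp z)) (RtoC (amon (wd z) a)).
    rewrite /S; elim: (Z) => [|z l IH]; rewrite ?big_nil ?big_cons; first by rewrite Cconj_R.
    by rewrite Cconj_plus Cconj_mult IH Cconj_R.
  rewrite cS /S -csum_distr csum_re; apply: eq_bigr => z _.
  rewrite -csum_distl csum_re; apply: eq_bigr => z' _; rewrite amon_cat /= /Re /Im; ring.
have qsz z : z \in q -> size (wq z) = m.*2.
  rewrite mem_cat => /orP[/allpairsP[[a b] /= [ha hb ->]]|/mapP[w hw ->]] /=.
    by rewrite size_cat sZ // sZ // addnn.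
  by move: hw; rewrite mem_words size_cat => /eqP ->; rewrite addnn.
have [c c0 Hc] := moment_sum_asympt (k := n + n) m.*2.
pose Cq := c * \rsum_(z <- q) Rabs (kq z).
have Cq0 : 0 <= Cq by apply: Rmult_le_pos => //; apply: rsum_ge0 => z; apply: Rabs_pos.
(* The relative error of Stein's expansion is [Cq / (2 p + 1)]; p is taken so large that it is at
   most [delta / 2]. It depends only on the symbol, never on v, so the final estimate has a fixed
   length p + m. *)
have [p hp] := INR_unbounded (Cq / delta).
have P0 := pos_INR p.
have small : Cq / (2 * INR p + 1) <= delta / 2.
  have : Cq <= INR p * delta.
    have : Cq / delta * delta <= INR p * delta by apply: Rmult_le_compat_r; lra.
    by rewrite /Rdiv Rmult_assoc Rinv_l; lra.
  move=> h; apply: (Rmult_le_reg_r (2 * INR p + 1)); first lra.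
  rewrite /Rdiv Rmult_assoc Rinv_l; nra.
set s := (p + m)%N.
pose kap := 2 * (INR s.*2 * INR s.*2).
pose N1 := INR (size (words T p)); pose N0 := \rsum_(p' <- iota 0 s.+1) INR (size (words T p')); pose N2 := INR (size (words T m)).
pose M := \rsum_(z <- q) \rsum_(w <- words T s) \rsum_(w' <- words T s)
      (Rabs (kq z) * Rabs (gaussian_moment (wq z ++ w ++ w'))).
pose M2 := \rsum_(z <- Z) \rsum_(z' <- Z) (Cmod (kp z) * Cmod (kp z')).
have M0 : 0 <= M.
  by do 3 (apply: rsum_ge0 => ?); apply: Rmult_le_pos; apply: Rabs_pos.
have M20 : 0 <= M2 by do 2 (apply: rsum_ge0 => ?); apply: Rmult_le_pos; apply: Cmod_ge_0.
have N10 : 0 <= N1 := pos_INR _.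
have N00 : 0 <= N0 by apply: rsum_ge0 => p'; apply: pos_INR.
have N20 : 0 <= N2 := pos_INR _.
have kap0 : 0 <= kap by rewrite /kap; have := pos_INR s.*2; nra.
have int_factor_0 := @Emom0_pos (n + n); set e0 := gaussian_moment [::] in int_factor_0.
have G1 := Gmag_ge1 m.*2 p; set G := stein_const m.*2 p in G1.
have Ge : 0 < G * e0 by apply: Rmult_lt_0_compat; lra.
(* One term per commutator error: from [symbol_upper], from [square_lower], from the a priori bound
   [S0] multiplied by the Stein error, and from replacing inner products by [sym_moment] under the
   average. *)
pose A := (N1 * M2 + delta * (N1 * N2) + delta / 2 * N0 + M / (G * e0)) * kap.
have A0 : 0 <= A.
  apply: Rmult_le_pos => //.
  have : 0 <= M / (G * e0) by apply: Rmult_le_pos => //; left; apply: Rinv_0_lt_compat.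
  have : 0 <= N1 * M2 by apply: Rmult_le_pos.
  have : 0 <= delta * (N1 * N2) by apply: Rmult_le_pos; [lra | apply: Rmult_le_pos].
  have : 0 <= delta / 2 * N0 by apply: Rmult_le_pos; lra.
  lra.
pose K := 2 / delta * (N1 + A).
have K0 : 0 <= K.
  by apply: Rmult_le_pos; [apply: Rmult_le_pos; [lra | left; apply: Rinv_0_lt_compat] | lra].
exists p, (sqrt K); split; first exact: sqrt_pos.
move=> v nv B1 B2 H1 H2 w sw.
have B20 : 0 <= B2 by apply: Rle_trans (nrm_ge0 _) (H2 [::] _); rewrite /= addn_gt0 m0 orbT.
have B10 : 0 <= B1 by apply: Rle_trans (nrm_ge0 _) (H1 (take p w) _); rewrite size_takel // sw leq_addr.
have nz w' : 0 <= nrm2 (zw w' v) by apply/nrm2_ge0/nice_zw.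
set S2 := \rsum_(w <- words T s) nrm2 (zw w v).
pose E := kap * (B2 * B2).
have E00 : 0 <= E by apply: Rmult_le_pos => //; nra.
have S20 : 0 <= S2 by apply: rsum_ge0.
have pinv := sym_moment_perm v.
pose S0 := S2 + N0 * E.
have S00 : 0 <= S0 by apply: Rplus_le_le_0_compat => //; apply: Rmult_le_pos.
have RB p' y : (p'.*2 + size y = s.*2)%N -> Rabs (diag_sum (sym_moment v) p' y) <= S0.
  move=> h; apply: Rle_trans (Rsq_bound v s B2 nv H2 p' y h) _.
  apply: Rplus_le_compat_l; apply: Rmult_le_compat_r => //.
  apply: (rsum_mem_le _ (fun p' => INR (size (words T p')))) => [x|]; first exact: pos_INR.
  by rewrite mem_iota; lia.
have PL := moment_sum_lower v s B2 nv H2 q kq wq qpos; rewrite -/kap -/E -/M in PL.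
pose D := 2 * INR p + 1.
have asy z : z \in q -> - (c * Rabs (kq z) * (G * e0) * (S0 / D))
    <= G * e0 * (kq z * diag_sum (sym_moment v) p (wq z)) - kq z * moment_sum (sym_moment v) (wq z) s.*2 [::].
  move=> zq; have sz : (m.*2 + p.*2 + size ([::] : seq T) = s.*2)%N by rewrite /s /=; lia.
  have := Hc (sym_moment v) S0 s pinv RB (wq z) p [::] (qsz z zq) sz.
  have -> : (m.*2 + p.*2 = s.*2)%N by rewrite /s; lia.
  rewrite cats0 -/G -/e0 -/D; set x := moment_sum _ _ _ _; set r := diag_sum _ _ _; set kz := kq z => h.
  have -> : G * e0 * (kz * r) - kz * x = - (kz * (x - G * e0 * r)) by ring.
  apply: Ropp_le_contravar; apply: Rle_trans (Rle_abs _) _; rewrite Rabs_mult.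
  apply: Rle_trans (Rmult_le_compat_l _ _ _ (Rabs_pos _) h) _; right; rewrite /Rdiv; ring.
have asyS : - (Cq * (G * e0) * (S0 / D)) <= G * e0 * \rsum_(z <- q) (kq z * diag_sum (sym_moment v) p (wq z))
     - \rsum_(z <- q) (kq z * moment_sum (sym_moment v) (wq z) s.*2 [::]).
  rewrite -rsum_distl rsum_minus; apply: Rle_trans (rsum_le_in _ _ _ asy).
  rewrite rsum_opp; apply: Ropp_le_contravar; rewrite /Cq !rsum_distr rsum_distl.
  exact: Rle_refl.
have low : - (Cq * (S0 / D)) - M / (G * e0) * E <= \rsum_(z <- q) (kq z * diag_sum (sym_moment v) p (wq z)).
  apply: (Rmult_le_reg_l (G * e0)) => //.
  have -> : G * e0 * (- (Cq * (S0 / D)) - M / (G * e0) * E) = - (Cq * (G * e0) * (S0 / D)) - M * E.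
    have aux (g x y z : R) : g <> 0 -> g * (- x - y / g * z) = - (g * x) - y * z by move=> *; field.
    by rewrite aux; [congr (- _ - _); ring | apply: Rgt_not_eq].
  by move: asyS PL; set x := \rsum_(z <- q) _; set y := \rsum_(z <- q) _; lra.
have up := symbol_upper v s B2 nv H2 Z kp wd m p (erefl _) sZ.
have sq := square_lower v s B2 nv H2 m p (erefl _).
rewrite -/kap -/E -/N1 -/N2 -/M2 -/S2 in up sq.
rewrite (qE (diag_sum (sym_moment v) p)) in low.
have P1 : \rsum_(y <- words T p) nrm2 (lsum Z kp (fun z => zw (wd z) (zw y v))) <= N1 * (B1 * B1).
  rewrite -rsum_const; apply: rsum_le_in => y; rewrite mem_words => /eqP sy.
  rewrite -nrm_sq; last by apply: nice_lsum => z; do 2 apply: nice_zw.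
  by apply: Rmult_le_compat; try exact: nrm_ge0; apply: H1.
have Cseries : Cq * (S0 / D) <= delta / 2 * S0.
  have -> : Cq * (S0 / D) = Cq / D * S0 by rewrite /Rdiv; ring.
  by apply: Rmult_le_compat_r.
(* Absorption: the square part contributes delta S2, and the Stein error takes back at most half of
   it. *)
have main : delta / 2 * S2 <= N1 * (B1 * B1) + A * (B2 * B2).
  have -> : A * (B2 * B2) = (N1 * M2 + delta * (N1 * N2) + delta / 2 * N0 + M / (G * e0)) * E by rewrite /A /E; ring.
  have := Rmult_le_compat_l _ _ _ (Rlt_le _ _ d0) sq.
  move: low up P1 Cseries; rewrite /S0.
  set a1 := \rsum_(z <- Z) _; set a2 := \rsum_(w <- words T m) _; set a3 := \rsum_(y <- words T p) _.
  by move=> *; lra.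
have fin : nrm2 (zw w v) <= K * ((B1 + B2) * (B1 + B2)).
  apply: (Rle_trans _ S2).
    by apply: (rsum_mem_le _ (fun w => nrm2 (zw w v))) => //; rewrite mem_words sw.
  have : delta / 2 * S2 <= (N1 + A) * ((B1 + B2) * (B1 + B2)).
    apply: Rle_trans main _.
    have b1 : B1 * B1 <= (B1 + B2) * (B1 + B2) by nra.
    have b2 : B2 * B2 <= (B1 + B2) * (B1 + B2) by nra.
    by have := Rmult_le_compat_l _ _ _ N10 b1; have := Rmult_le_compat_l _ _ _ A0 b2; lra.
  move=> h; apply: (Rmult_le_reg_l (delta / 2)); first lra.
  apply: Rle_trans h _; right; rewrite /K; field; lra.
rewrite /nrm -(sqrt_square (B1 + B2)); last lra.
by rewrite -sqrt_mult //; [apply: sqrt_le_1_alt | nra].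
Qed.
End Elliptic.

(** * Normal ordering and the operator P *)

Section NormalOrder.
Context {n : nat}.
Local Notation F := (Pt n -> C).
Implicit Types (u b : seq 'I_n) (g : F) (w : seq 'I_(n + n)).

(** Normally ordered words: coordinates to the left of derivatives, which is the form in which the
    seminorms of the function spaces are given. *)
Definition mono u b g : F := fun x => Cmult (RtoC (amon u x)) (dw b g x).

Lemma smooth_mono u b g : smooth g -> smooth (mono u b g).
Proof. by move=> sg; apply: smooth_mult; [exact: smooth_amon | exact: smooth_dw]. Qed.
Lemma Zop_l_mono j u b g : Zop (lshift n j) (mono u b g) = mono (j :: u) b g.
Proof. by rewrite Zop_l; apply: fext => x; rewrite /mono /= RtoC_mult; ring. Qed.
Lemma Zop_r_mono j u b g : smooth g -> Zop (rshift n j) (mono u b g) =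
  cplus (cscal (Cmult (Copp Ci) (RtoC (INR (count_mem j u)))) (mono (rem j u) b g))
        (cscal (Copp Ci) (mono u (j :: b) g)).
Proof.
move=> sg; rewrite Zop_r /mono pd_mult; [|exact: smooth_amon|exact: smooth_dw].
by rewrite pd_amon; apply: fext => x; rewrite /cplus /cscal /= RtoC_mult; ring.
Qed.

Lemma mono_nice g : smooth g -> (forall u b, cbounded (mono u b g)) -> nice g.
Proof.
move=> sg H; apply: (lin_nice (fun f => exists u b, f = mono u b g)).
  move=> f [u [b ->]]; split; first exact: smooth_mono.
  split=> //; elim/(@letterP n) => j.
    by apply: lin_base; exists (j :: u), b; rewrite Zop_l_mono.
  rewrite Zop_r_mono //; apply: lin_plus; apply: lin_scal; apply: lin_base; by do 2 eexists.
apply: lin_base; exists [::], [::]; apply: fext => x; rewrite /mono /=; ring.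
Qed.

(* Multiplying [x^u d^b g] by one letter either lengthens [u] or [b], or removes a letter of [u]
   by a commutator, with a factor at most the number of letters. *)
Fixpoint qiter (q : nat -> R) (l N : nat) : R :=
  if l is l'.+1 then qiter q l' N.+1 + INR N * qiter q l' N.-1 else q N.
Lemma zw_mono_bound (q : nat -> R) g x0 : smooth g ->
  (forall u b, Cmod (mono u b g x0) <= q (size u + size b)%N) -> (forall N, 0 <= q N) ->
  forall w u b, Cmod (zw w (mono u b g) x0) <= qiter q (size w) (size u + size b).
Proof.
move=> sg H q0.
have p0 l : forall N, 0 <= qiter q l N.
  elim: l => [//|l IH] N /=; apply: Rplus_le_le_0_compat => //.
  by apply: Rmult_le_pos => //; apply: pos_INR.
move=> w; elim/last_ind: w => [|w i IH] u b; first exact: H.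
rewrite zw_rcons size_rcons [qiter _ _ _]/=.
elim/(@letterP n): i => j.
  rewrite Zop_l_mono; apply: Rle_trans (IH (j :: u) b) _; rewrite /= addSn.
  have : 0 <= INR (size u + size b) * qiter q (size w) (size u + size b).-1.
    by apply: Rmult_le_pos => //; apply: pos_INR.
  lra.
rewrite Zop_r_mono // zw_plus; try by apply: smooth_cscal; apply: smooth_mono.
rewrite !zw_scal; try exact: smooth_mono.
apply: Rle_trans (Cmod_triangle _ _) _; rewrite /cscal !Cmod_mult Cmod_opp Cmod_Ci !Rmult_1_l.
have h1 := IH u (j :: b); rewrite /= addnS in h1.
rewrite Rplus_comm; apply: Rplus_le_compat => //.
rewrite Cmod_R (Rabs_pos_eq (INR _)); last exact: pos_INR.
case: (boolP (j \in u)) => ju; last first.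
  rewrite (count_memPn ju) Rmult_0_l; apply: Rmult_le_pos => //; exact: pos_INR.
apply: Rmult_le_compat; [exact: pos_INR | exact: Cmod_ge_0 | |].
  by apply: le_INR; apply/leP; apply: leq_trans (count_size _ _) (leq_addr _ _).
have h2 := IH (rem j u) b; rewrite size_rem // in h2.
suff <- : ((size u).-1 + size b = (size u + size b).-1)%N by [].
by case: u ju {h1 h2}.
Qed.

Definition exps {k} (a : mindex k) : seq 'I_k := flatten [seq nseq (a i) i | i <- enum 'I_k].
Lemma size_exps {k} (a : mindex k) : size (exps a) = mlen a.
Proof.
rewrite /exps /mlen size_flatten /shape -map_comp; congr sumn.
by apply: eq_map => i; rewrite /= size_nseq.
Qed.
Lemma amon_exps {k} (a : mindex k) (x : Pt k) : amon (exps a) x = xpow x a.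
Proof.
rewrite /exps /xpow; elim: (enum 'I_k) => [//|i l IH] /=.
rewrite amon_cat IH; congr Rmult.
by elim: (a i) => [//|j IHj] /=; rewrite IHj.
Qed.
Lemma dmi_exps (a : mindex n) g : dmi a g = dw (exps a) g. Proof. by []. Qed.
Lemma dw_exps u g : smooth g -> dw u g = dmi (fun i => count_mem i u) g.
Proof. exact: dw_dmi. Qed.
Lemma amon_counts u (x : Pt n) : amon u x = xpow x (fun i => count_mem i u).
Proof. by rewrite -amon_exps; apply: amon_perm; rewrite perm_sym; apply: perm_flatten_count. Qed.
Lemma mlen_counts u : mlen (fun i => count_mem i u) = size u.
Proof. by rewrite -size_exps; apply: perm_size; apply: perm_flatten_count. Qed.

Lemma schwartz_nice g : schwartz g -> nice g.
Proof.
move=> [sg H]; apply: mono_nice => // u b.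
have [K HK] := H (fun i => count_mem i u) (fun i => count_mem i b).
by exists K => x; rewrite /mono dw_exps // amon_counts.
Qed.

Lemma zw_xletters u g : zw (map (lshift n) u) g = fun x => Cmult (RtoC (amon u x)) (g x).
Proof.
elim: u => [|j u IH] /=; first by apply: fext => x; ring.
by rewrite IH Zop_l; apply: fext => x; rewrite RtoC_mult; ring.
Qed.
Lemma zw_dletters b g : smooth g ->
  zw (map (@rshift n n) b) g = cscal (Cpow (Copp Ci) (size b)) (dw b g).
Proof.
move=> sg; elim: b => [|j b IH] /=; first by apply: fext => x; rewrite /cscal; ring.
rewrite IH Zop_scal; last exact: smooth_dw.
by rewrite Zop_r; apply: fext => x; rewrite /cscal; ring.
Qed.

Lemma nice_schwartz g : nice g -> schwartz g.
Proof.
move=> [sg H]; split=> // a b.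
have [K HK] := H (map (lshift n) (exps a) ++ map (@rshift n n) (exps b)).
exists K => x; apply: Rle_trans (HK x); rewrite zw_cat zw_xletters zw_dletters // /cscal !Cmod_mult amon_exps.
rewrite (_ : Cmod (Cpow (Copp Ci) (size (exps b))) = 1) ?Rmult_1_l; first exact: Rle_refl.
by rewrite Cmod_pow Cmod_opp Cmod_Ci pow1.
Qed.

Variables (c : mindex n -> mindex n -> R) (m : nat).
Definition mi (a : {ffun 'I_n -> 'I_m.+1}) : mindex n := fun i => nat_of_ord (a i).
Definition pidx := ({ffun 'I_n -> 'I_m.+1} * {ffun 'I_n -> 'I_m.+1})%type.
Definition pall : seq pidx := [seq (z1, z2) | z1 <- enum {ffun 'I_n -> 'I_m.+1}, z2 <- enum {ffun 'I_n -> 'I_m.+1}].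
Definition pdeg (z : pidx) : nat := (mlen (mi z.1) + mlen (mi z.2))%N.
(** Since d_j = i D_j, the term c x^beta d^alpha has coefficient c i^|alpha| in the letters D_j;
    this is also its coefficient in the symbol, so operator and symbol share [pcoef] and [pword]. *)
Definition pcoef (z : pidx) : C := Cmult (RtoC (c (mi z.1) (mi z.2))) (Cpow Ci (mlen (mi z.1))).
Definition pword (z : pidx) : seq 'I_(n + n) :=
  map (lshift n) (exps (mi z.2)) ++ map (@rshift n n) (exps (mi z.1)).
Definition ple : seq pidx := [seq z <- pall | (pdeg z <= m)%N].
Definition ptop : seq pidx := [seq z <- pall | pdeg z == m].
Definition plow : seq pidx := [seq z <- pall | (pdeg z < m)%N].

Lemma size_pword z : size (pword z) = pdeg z.
Proof. by rewrite size_cat !size_map !size_exps addnC. Qed.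
Lemma zw_pword z g : smooth g -> forall x,
  Cmult (pcoef z) (zw (pword z) g x) = Cmult (RtoC (c (mi z.1) (mi z.2) * xpow x (mi z.2))) (dmi (mi z.1) g x).
Proof.
move=> sg x; rewrite zw_cat zw_xletters zw_dletters // /cscal amon_exps size_exps /pcoef RtoC_mult.
have E : Cmult (Cpow Ci (mlen (mi z.1))) (Cpow (Copp Ci) (mlen (mi z.1))) = RtoC 1.
  elim: (mlen _) => [|j IH] /=; first ring.
  transitivity (Cmult (Cmult Ci (Copp Ci)) (Cmult (Cpow Ci j) (Cpow (Copp Ci) j))); first ring.
  by rewrite IH; apply: C_ext; rewrite /= /Re /Im; ring.
transitivity (Cmult (Cmult (Cpow Ci (mlen (mi z.1))) (Cpow (Copp Ci) (mlen (mi z.1))))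
   (Cmult (Cmult (RtoC (c (mi z.1) (mi z.2))) (RtoC (xpow x (mi z.2)))) (dmi (mi z.1) g x))); first by rewrite dmi_exps; ring.
by rewrite E; ring.
Qed.
Lemma csum_filter {Z} (l : seq Z) (p : pred Z) (f : Z -> C) :
  \csum_(z <- l) (if p z then f z else RtoC 0) = \csum_(z <- [seq z <- l | p z]) f z.
Proof.
elim: l => [|z l IH] /=; first by rewrite !big_nil.
by rewrite big_cons IH; case: (p z); rewrite ?big_cons //; ring.
Qed.
Lemma Pop_lsum g : smooth g -> Pop c m g = lsum ple pcoef (fun z => zw (pword z) g).
Proof.
move=> sg; apply: fext => x; rewrite lsumE /Pop Csum_big /mindices big_map.
rewrite /ple -csum_filter /pall big_allpairs_dep; apply: eq_bigr => a _.
rewrite Csum_big big_map; apply: eq_bigr => b _.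
by rewrite -(zw_pword (a, b)).
Qed.
Lemma lsum_split g x : lsum ple pcoef (fun z => zw (pword z) g) x =
  Cplus (lsum ptop pcoef (fun z => zw (pword z) g) x) (lsum plow pcoef (fun z => zw (pword z) g) x).
Proof.
rewrite !lsumE /ple /ptop /plow -!csum_filter -big_split; apply: eq_bigr => z _ /=.
by case: (ltngtP (pdeg z) m) => _; ring.
Qed.
Lemma psymbol_sum (a : Pt (n + n)) :
  psymbol c m (fun j => a (lshift n j)) (fun j => a (rshift n j)) =
  \csum_(z <- ptop) Cmult (pcoef z) (RtoC (amon (pword z) a)).
Proof.
rewrite /psymbol Csum_big /mindices big_map /ptop -csum_filter /pall big_allpairs_dep.
apply: eq_bigr => al _; rewrite Csum_big big_map; apply: eq_bigr => be _.
rewrite -/(mi al) -/(mi be) -/(pdeg (al, be)); case: (_ == _) => //.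
have L (k : nat) (u : seq 'I_n) (f : 'I_n -> 'I_(n + n)) : amon (map f u) a = amon u (fun j => a (f j)).
  by elim: u => [//|i u IH] /=; rewrite IH.
rewrite amon_cat !L // !amon_exps /pcoef /= !RtoC_mult; ring.
Qed.

(** Compactness of the cube [-1, 1]^(2n), by freeing one coordinate at a time with the compactness
    of [-1, 1]. A single number serves as radius and as lower bound, so that only one quantity is
    propagated through the induction. *)
Lemma tube (f : Pt (n + n) -> R) :
  (forall a, (forall i, Rabs (a i) <= 1) -> exists2 e, 0 < e &
     forall a', (forall i, Rabs (a' i - a i) < e) -> e < f a') ->
  exists2 e, 0 < e & forall a, (forall i, Rabs (a i) <= 1) -> e < f a.
Proof.
move=> H.
suff S (l : seq 'I_(n + n)) : forall a, (forall i, Rabs (a i) <= 1) -> exists2 e, 0 < e &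
    forall a', (forall i, Rabs (a' i) <= 1) -> (forall i, i \notin l -> Rabs (a' i - a i) < e) -> e < f a'.
  have [|e e0 He] := S (enum 'I_(n + n)) (fun _ => 0); first by move=> i; rewrite Rabs_R0; lra.
  by exists e => // a ha; apply: He => // i; rewrite mem_enum.
elim: l => [|i l IH] a ha.
  have [e e0 He] := H a ha; exists e => // a' _ h; by apply: He => i; exact: h.
have ex t : exists d : posreal, Rabs t <= 1 -> forall a', (forall i, Rabs (a' i) <= 1) ->
    (forall j, j \notin l -> Rabs (a' j - upd a i t j) < d) -> d < f a'.
  case: (Rle_dec (Rabs t) 1) => ht; last by exists (mkposreal 1 Rlt_0_1).
  have [|e e0 He] := IH (upd a i t); last by exists (mkposreal e e0).
  by move=> j; rewrite /upd; case: (j == i).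
pose dl t := proj1_sig (constructive_indefinite_description _ (ex t)).
have Hdl t := proj2_sig (constructive_indefinite_description _ (ex t)).
have [d Hd] := compactness_value_1d (-1) 1 dl.
exists d; first exact: cond_pos.
move=> a' ha' near.
have /NNPP[t [ht [h1 h2]]] := Hd (a' i) (proj1 (Rabs_le_between _ _) (ha' i)).
have t1 : Rabs t <= 1 by apply/Rabs_le_between.
apply: (Rle_lt_trans _ _ _ h2); apply: (Hdl t t1) => // j jl.
rewrite /upd; case: (j =P i) => [->|/eqP ji]; first exact: h1.
apply: Rlt_le_trans h2; apply: near; by rewrite inE negb_or ji jl.
Qed.

Lemma words_sq r (a : Pt (n + n)) : \rsum_(w <- words 'I_(n + n) r) (amon w a * amon w a)
  = (\rsum_(i <- enum 'I_(n + n)) (a i * a i)) ^ r.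
Proof.
elim: r => [|r IH]; first by rewrite rsum_words_0 /=; ring.
rewrite rsum_words_S /= -IH -rsum_distr; apply: eq_bigr => i _; rewrite -rsum_distl.
by apply: eq_bigr => w _; rewrite /=; ring.
Qed.
Lemma amon_scale r w (a : Pt (n + n)) : amon w (fun i => r * a i) = r ^ size w * amon w a.
Proof. by elim: w => [|i w IH] /=; rewrite ?IH; ring. Qed.

Lemma symbol_lower : (0 < m)%N -> globally_elliptic c m -> exists2 delta, 0 < delta &
  forall a : Pt (n + n), delta * \rsum_(w <- words 'I_(n + n) m) (amon w a * amon w a)
     <= Cmod (\csum_(z <- ptop) Cmult (pcoef z) (RtoC (amon (pword z) a)))
        * Cmod (\csum_(z <- ptop) Cmult (pcoef z) (RtoC (amon (pword z) a))).
Proof.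
move=> m0 ell.
pose p (a : Pt (n + n)) := \csum_(z <- ptop) Cmult (pcoef z) (RtoC (amon (pword z) a)).
pose sq (a : Pt (n + n)) := \rsum_(i <- enum 'I_(n + n)) (a i * a i).
have sq_le i a : a i * a i <= sq a.
  apply: (rsum_mem_le _ (fun i => a i * a i)) => [x|]; [nra | by rewrite mem_enum].
have p_ne a : 0 < sq a -> p a <> RtoC 0.
  move=> sa; rewrite /p -psymbol_sum; apply: ell; apply: NNPP => N.
  suff : sq a = 0 by lra.
  rewrite /sq big1_seq // => i _; suff -> : a i = 0 by ring.
  apply: NNPP => ai; apply: N.
  elim/(@letterP n): i ai => j aj; exists j; tauto.
have sp : smooth p.
  rewrite /p; elim: ptop => [|z l IH].
    have -> : (fun a : Pt (n + n) => \csum_(z <- [::]) Cmult (pcoef z) (RtoC (amon (pword z) a))) = fun _ => RtoC 0.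
      by apply: fext => a; rewrite big_nil.
    exact: smooth_const.
  have -> : (fun a : Pt (n + n) => \csum_(z <- z :: l) Cmult (pcoef z) (RtoC (amon (pword z) a))) =
     fun a => Cplus (Cmult (pcoef z) (RtoC (amon (pword z) a))) (\csum_(z <- l) Cmult (pcoef z) (RtoC (amon (pword z) a))).
    by apply: fext => a; rewrite big_cons.
  by apply: smooth_plus => //; apply: smooth_mult; [exact: smooth_const | exact: smooth_amon].
have ssq : smooth (fun a : Pt (n + n) => RtoC (sq a)).
  rewrite /sq; elim: (enum 'I_(n + n)) => [|i l IH].
    have -> : (fun a : Pt (n + n) => RtoC (\rsum_(i <- [::]) (a i * a i))) = fun _ => RtoC 0.
      by apply: fext => a; rewrite big_nil.
    exact: smooth_const.
  have -> : (fun a : Pt (n + n) => RtoC (\rsum_(j <- i :: l) (a j * a j))) =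
     fun a => Cplus (Cmult (RtoC (a i)) (RtoC (a i))) (RtoC (\rsum_(j <- l) (a j * a j))).
    by apply: fext => a; rewrite big_cons RtoC_plus RtoC_mult.
  by apply: smooth_plus => //; apply: smooth_mult; exact: smooth_coord.
(* |p|^2 + (1 - |a|^2)^2 is positive on the whole cube: off the unit sphere by its second term, on
   the sphere by ellipticity. Compactness of the cube thus yields a lower bound for |p| on the
   sphere, and homogeneity extends it. *)
pose h a := Cplus (Cmult (p a) (Cconj (p a))) (Cmult (Cminus (RtoC 1) (RtoC (sq a))) (Cminus (RtoC 1) (RtoC (sq a)))).
have ch : contC h.
  apply: smooth_cont; apply: smooth_plus; first by apply: smooth_mult => //; apply: smooth_conj.
  have s1 : smooth (fun a : Pt (n + n) => Cminus (RtoC 1) (RtoC (sq a))).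
    have -> : (fun a : Pt (n + n) => Cminus (RtoC 1) (RtoC (sq a))) = fun a => Cplus (RtoC 1) (Cmult (RtoC (-1)) (RtoC (sq a))).
      by apply: fext => a; rewrite -RtoC_mult -RtoC_minus -RtoC_plus; congr RtoC; ring.
    apply: smooth_plus; first exact: smooth_const.
    by apply: smooth_mult => //; exact: smooth_const.
  exact: smooth_mult.
have hE a : Re (h a) = Cmod (p a) * Cmod (p a) + (1 - sq a) * (1 - sq a).
  by rewrite /Cmod sqrt_sqrt; [rewrite /h /= /Re /Im; ring | nra].
have [|e e0 He] := tube (fun a => Re (h a)).
  move=> a _.
  have pos : 0 < Re (h a).
    rewrite hE; case: (Req_dec (sq a) 1) => [e|ne].
      have : 0 < Cmod (p a) by apply/Cmod_gt_0/p_ne; lra.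
      by nra.
    have := Cmod_ge_0 (p a); have : 0 < (1 - sq a) * (1 - sq a).
      by case: (Rtotal_order (sq a) 1) => [?|[?|?]]; nra.
    by nra.
  have [d [d0 Hd]] := ch a (Re (h a) / 2) (ltac:(lra)).
  exists (Rmin d (Re (h a) / 2)); first by apply: Rmin_glb_lt; lra.
  move=> a' ha'; have := Hd a' (fun i => Rlt_le_trans _ _ _ (ha' i) (Rmin_l _ _)).
  move=> hm; have := Re_le_Cmod (Cminus (h a') (h a)).
  rewrite (_ : Re (Cminus (h a') (h a)) = Re (h a') - Re (h a)) // => /Rabs_le_between.
  by have := Rmin_r d (Re (h a) / 2); lra.
exists e => // a; rewrite words_sq -/(p a) -/(sq a).
have sq0 : 0 <= sq a by apply: rsum_ge0 => i; nra.
case: (Req_dec (sq a) 0) => [->|sne].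
  by rewrite pow_i; [rewrite Rmult_0_r; have := Cmod_ge_0 (p a); nra | apply/ltP].
set r := sqrt (sq a); have r0 : 0 < r by apply: sqrt_lt_R0; lra.
have rr : r * r = sq a by apply: sqrt_sqrt.
pose b : Pt (n + n) := fun i => / r * a i.
have sb : sq b = 1.
  have -> : sq b = / r * / r * sq a by rewrite /sq -rsum_distl; apply: eq_bigr => i _; rewrite /b; ring.
  by rewrite -rr; field; lra.
have bi i : Rabs (b i) <= 1.
  have := sq_le i b; rewrite sb -(Rabs_pos_eq (b i * b i)) ?Rabs_mult; last nra.
  by have := Rabs_pos (b i); nra.
have := He b bi; rewrite hE sb Rminus_diag Rmult_0_l Rplus_0_r => hb.
have ab : a = fun i => r * b i by apply: fext => i; rewrite /b; field; lra.
have pa : p a = Cmult (RtoC (r ^ m)) (p b).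
  rewrite {1}ab /p -csum_distl big_seq [RHS]big_seq; apply: eq_bigr => z.
  rewrite mem_filter => /andP[/eqP dz _]; rewrite amon_scale size_pword dz RtoC_mult; ring.
rewrite pa Cmod_mult Cmod_R Rabs_pos_eq; last by apply: pow_le; lra.
have rm : 0 < r ^ m by apply: pow_lt.
rewrite -rr Rpow_mult_distr.
have : 0 < r ^ m * r ^ m by apply: Rmult_lt_0_compat.
move=> r2; have := Rmult_le_compat_l _ _ _ (Rlt_le _ _ r2) (Rlt_le _ _ hb); lra.
Qed.
End NormalOrder.

(** * Eigenfunctions *)

Section Eigen.
Context {n : nat}.
Local Notation T := 'I_(n + n).
Local Notation F := (Pt n -> C).
Implicit Types (w y : seq T) (v g : F).

Definition cminus (g h : F) : F := cplus g (cscal (RtoC (-1)) h).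
Lemma nice_minus g h : nice g -> nice h -> nice (cminus g h).
Proof. by move=> ng nh; apply: nice_plus => //; apply: nice_scal. Qed.
Lemma nrm_minus_tri f g h : nice f -> nice g -> nice h ->
  nrm (cminus f h) <= nrm (cminus f g) + nrm (cminus g h).
Proof.
move=> nf ng nh; have -> : cminus f h = cplus (cminus f g) (cminus g h).
  by apply: fext => x; rewrite /cminus /cplus /cscal; ring.
by apply: nrm_plus; apply: nice_minus.
Qed.
Lemma nrm_cminus0 g : nice g -> nrm (cminus g g) = 0.
Proof.
move=> ng; have -> : cminus g g = cscal (RtoC 0) g by apply: fext => x; rewrite /cminus /cplus /cscal; ring.
by rewrite nrm_scal // Cmod_0 Rmult_0_l.
Qed.
Section Commutator.
Variables (v : F) (N : R).
Hypothesis nv : nice v.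

Lemma swap_letter p i j q : nrm (zw (p ++ q) v) <= N ->
  nrm (cminus (zw (p ++ i :: j :: q) v) (zw (p ++ j :: i :: q) v)) <= N.
Proof.
move=> H; have [c c1 E] := Zop_comm (k := n) i j.
have nq := nice_zw q _ nv; have sq := nice_smooth _ nq.
have -> : cminus (zw (p ++ i :: j :: q) v) (zw (p ++ j :: i :: q) v) = cscal c (zw (p ++ q) v).
  rewrite !zw_cat /= E // zw_plus ?zw_scal //; last exact: smooth_cscal.
    by apply: fext => x; rewrite /cminus /cplus /cscal; ring.
  by do 2 apply: smooth_Z.
rewrite nrm_scal; last exact: nice_zw.
rewrite -(Rmult_1_l N); apply: Rmult_le_compat => //; [exact: Cmod_ge_0 | exact: nrm_ge0].
Qed.
Lemma move_letter p i y q : (forall x, size x = (size p + size y + size q).-1 -> nrm (zw x v) <= N) ->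
  nrm (cminus (zw (p ++ i :: y ++ q) v) (zw (p ++ y ++ i :: q) v)) <= INR (size y) * N.
Proof.
elim: y p => [|j y IH] p H; first by rewrite nrm_cminus0 /=; [lra | exact: nice_zw].
apply: Rle_trans (nrm_minus_tri _ (zw (p ++ j :: i :: y ++ q) v) _ _ _ _) _; try exact: nice_zw.
have h1 : nrm (cminus (zw (p ++ i :: j :: y ++ q) v) (zw (p ++ j :: i :: y ++ q) v)) <= N.
  by apply: swap_letter; apply: H; rewrite !size_cat /=; lia.
have h2 : nrm (cminus (zw (p ++ j :: i :: y ++ q) v) (zw (p ++ j :: y ++ i :: q) v)) <= INR (size y) * N.
  rewrite -!(cat_rcons j p); apply: IH => x hx; apply: H; rewrite hx size_rcons /=; lia.
rewrite (_ : size (j :: y) = (size y).+1) // S_INR; rewrite /= in h1 h2 *; lra.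
Qed.
(** Every letter of w crosses every letter of y once, and each crossing costs the norm of a word two
    letters shorter. *)
Lemma move_word w y q : (forall x, size x = (size w + size y + size q).-2 -> nrm (zw x v) <= N) ->
  nrm (cminus (zw (w ++ y ++ q) v) (zw (y ++ w ++ q) v)) <= INR (size w) * INR (size y) * N.
Proof.
elim/last_ind: w q => [|w i IH] q H; first by rewrite nrm_cminus0 /=; [lra | exact: nice_zw].
rewrite !cat_rcons.
apply: Rle_trans (nrm_minus_tri _ (zw (w ++ y ++ i :: q) v) _ _ _ _) _; try exact: nice_zw.
have h1 : nrm (cminus (zw (w ++ i :: y ++ q) v) (zw (w ++ y ++ i :: q) v)) <= INR (size y) * N.
  by apply: move_letter => x hx; apply: H; rewrite hx size_rcons; lia.
have h2 : nrm (cminus (zw (w ++ y ++ i :: q) v) (zw (y ++ w ++ i :: q) v)) <= INR (size w) * INR (size y) * N.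
  by apply: IH => x hx; apply: H; rewrite hx size_rcons /=; lia.
by rewrite size_rcons S_INR; lra.
Qed.
End Commutator.

Lemma zw_lsum {Z} (l : seq Z) ka f w : (forall z, smooth (f z)) ->
  zw w (lsum l ka f) = lsum l ka (fun z => zw w (f z)).
Proof.
move=> sf.
have sm (l' : seq Z) : smooth (lsum l' ka f).
  elim: l' => [|z l' IH]; first exact: smooth_const.
  by apply: smooth_plus => //; apply: smooth_cscal.
elim: l => [|z l IH].
  rewrite /= (_ : (fun _ : Pt n => RtoC 0) = cscal (RtoC 0) (fun _ => RtoC 0)).
    rewrite zw_scal; last exact: smooth_const.
    by apply: fext => x; rewrite /cscal; ring.
  by apply: fext => x; rewrite /cscal; ring.
rewrite /= (zw_plus _ _ _ (smooth_cscal _ _ (sf z)) (sm l)) zw_scal //.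
by congr cplus; exact: IH.
Qed.

Variables (c : mindex n -> mindex n -> R) (m : nat).
Hypothesis m2 : (2 <= m)%N.
Let k1 : R := \rsum_(z <- ple m) Cmod (pcoef c m z).
Let k2 : R := \rsum_(z <- plow m) Cmod (pcoef c m z).
Let k10 : 0 <= k1. Proof. by apply: rsum_ge0 => z; apply: Cmod_ge_0. Qed.
Let k20 : 0 <= k2. Proof. by apply: rsum_ge0 => z; apply: Cmod_ge_0. Qed.

(** The principal part applied to [zw y phi] is y P phi, plus the commutator of P with y, minus the
    lower order terms. The commutator carries the factor |y| but has lost two letters, hence the
    separate bound [N2]; the lower order terms have lost one letter only, hence [N1]. *)
Lemma top_bound (phi : F) (lam : R) y N1 N2 : nice phi -> Pop c m phi = cscal (RtoC lam) phi ->
  0 <= N1 -> 0 <= N2 ->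
  (forall x, (size x + 2 <= size y + m)%N -> nrm (zw x phi) <= N2) ->
  (forall x, (size x < size y + m)%N -> nrm (zw x phi) <= N1) ->
  nrm (lsum (ptop m) (pcoef c m) (fun z => zw (pword m z) (zw y phi)))
  <= Rabs lam * nrm (zw y phi) + INR m * INR (size y) * k1 * N2 + k2 * N1.
Proof.
move=> nphi eig N10 N20 H2 H1.
have ny := nice_zw y _ nphi.
pose top := lsum (ptop m) (pcoef c m) (fun z => zw (pword m z) (zw y phi)).
pose low := lsum (plow m) (pcoef c m) (fun z => zw (pword m z) (zw y phi)).
pose all := lsum (ple m) (pcoef c m) (fun z => zw (pword m z) (zw y phi)).
have nz x z : nice x -> nice (zw (pword m z) x) by apply: nice_zw.
have ntop : nice top by apply: nice_lsum => z; exact: nz.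
have nlow : nice low by apply: nice_lsum => z; exact: nz.
have nall : nice all by apply: nice_lsum => z; exact: nz.
have E1 : top = cminus all low.
  apply: fext => x; rewrite /cminus /cplus /cscal /all lsum_split; rewrite -/top -/low.
  by rewrite /top /low; ring.
pose com := lsum (ple m) (pcoef c m) (fun z => cminus (zw (pword m z ++ y) phi) (zw (y ++ pword m z) phi)).
have E2 : all = cplus (cscal (RtoC lam) (zw y phi)) com.
  rewrite -zw_scal; last exact: nice_smooth.
  rewrite -eig Pop_lsum; last exact: nice_smooth.
  rewrite zw_lsum; last by move=> z; apply/nice_smooth/nice_zw.
  apply: fext => x; rewrite /all /com /cplus !lsumE -big_split; apply: eq_bigr => z _ /=.
  by rewrite /cminus /cplus /cscal !zw_cat; ring.
have b1 : nrm low <= k2 * N1.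
  apply: Rle_trans (nrm_lsum_le _ _ _ _) _; first by move=> z; exact: nz.
  rewrite /k2 -rsum_distr !big_seq; rewrite -!big_seq; apply: rsum_le_in => z; rewrite mem_filter => /andP[dz _].
  apply: Rmult_le_compat_l; first exact: Cmod_ge_0.
  by rewrite -zw_cat; apply: H1; rewrite size_cat size_pword; lia.
have b2 : nrm com <= INR m * INR (size y) * k1 * N2.
  apply: Rle_trans (nrm_lsum_le _ _ _ _) _; first by move=> z; apply: nice_minus; apply: nice_zw.
  have -> : INR m * INR (size y) * k1 * N2 = k1 * (INR m * INR (size y) * N2) by ring.
  rewrite /k1 -rsum_distr; apply: rsum_le_in => z; rewrite mem_filter => /andP[dz _].
  apply: Rmult_le_compat_l; first exact: Cmod_ge_0.
  have mw : nrm (cminus (zw (pword m z ++ y ++ [::]) phi) (zw (y ++ pword m z ++ [::]) phi))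
     <= INR (size (pword m z)) * INR (size y) * N2.
    (* With fewer than two letters in all the predecessor [.-2] is truncated and the hypothesis on
       [N2] does not apply; one of the two words is then empty and the commutator is zero. *)
    case: (posnP (size (pword m z) + size y)%N) => sz.
      have -> : pword m z = [::] by apply: size0nil; lia.
      have -> : y = [::] by apply: size0nil; lia.
      by rewrite nrm_cminus0 //=; lra.
    case: (leqP 2 (size (pword m z) + size y)) => s2.
      by apply: move_word => // x hx; apply: H2; rewrite hx size_pword /=; lia.
    have [->|->] : pword m z = [::] \/ y = [::].
    - by case: (pword m z) s2 sz => [|? []]; case: (y) => [|? []] //=; auto.
    - by rewrite nrm_cminus0 /=; [lra | apply: nice_zw].
    - by rewrite cats0 nrm_cminus0 /=; [lra | apply: nice_zw].
  rewrite !cats0 in mw; apply: Rle_trans mw _; apply: Rmult_le_compat_r => //.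
  apply: Rmult_le_compat_r; first exact: pos_INR.
  by apply: le_INR; apply/leP; rewrite size_pword.
rewrite -/top E1; apply: Rle_trans (nrm_plus _ _ nall (nice_scal _ _ nlow)) _.
rewrite nrm_scal // Cmod_R Rabs_Ropp Rabs_R1 Rmult_1_l E2.
have ncom : nice com by apply: nice_lsum => z; apply: nice_minus; apply: nice_zw.
have := nrm_plus _ _ (nice_scal (RtoC lam) _ ny) ncom.
by rewrite nrm_scal // Cmod_R; lra.
Qed.

Definition words_le k : seq (seq T) := flatten [seq words T j | j <- iota 0 k.+1].
Lemma mem_words_le k w : (w \in words_le k) = (size w <= k)%N.
Proof.
apply/flatten_mapP/idP => [[j]|h].
  by rewrite mem_iota mem_words => /andP[_ jk] /eqP ->; lia.
by exists (size w); [rewrite mem_iota; lia | rewrite mem_words].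
Qed.
Definition word_nrm_max (phi : F) k : R := foldr (fun w r => Rmax (nrm (zw w phi)) r) 0 (words_le k).
Lemma word_nrm_max_ge phi k w : (size w <= k)%N -> nrm (zw w phi) <= word_nrm_max phi k.
Proof.
rewrite -mem_words_le /word_nrm_max; elim: (words_le k) => [//|y l IH]; rewrite inE => /orP[/eqP ->|/IH h] /=.
  exact: Rmax_l.
exact: Rle_trans h (Rmax_r _ _).
Qed.
Lemma word_nrm_max_le phi k M : 0 <= M -> (forall w, (size w <= k)%N -> nrm (zw w phi) <= M) -> word_nrm_max phi k <= M.
Proof.
move=> M0 H; rewrite /word_nrm_max; have : {subset words_le k <= words_le k} by [].
elim: {1 3}(words_le k) => [//|y l IH] sub /=.
apply: Rmax_lub; first by apply: H; rewrite -mem_words_le; apply: sub; rewrite mem_head.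
by apply: IH => w wl; apply: sub; rewrite inE wl orbT.
Qed.
Lemma word_nrm_max_mono phi k k' : (k <= k')%N -> word_nrm_max phi k <= word_nrm_max phi k'.
Proof.
move=> kk; apply: word_nrm_max_le; first exact: Rle_trans (nrm_ge0 _) (word_nrm_max_ge phi k' [::] isT).
by move=> w hw; apply: word_nrm_max_ge; apply: leq_trans hw kk.
Qed.
(* Interpolation reaches the orders below [m], where the recursion has no starting value. *)
Lemma word_nrm_max_convex phi k : nice phi -> word_nrm_max phi k.+1 * word_nrm_max phi k.+1 <= word_nrm_max phi k * word_nrm_max phi k.+2.
Proof.
move=> np; have X0 j : 0 <= word_nrm_max phi j by exact: Rle_trans (nrm_ge0 _) (word_nrm_max_ge phi j [::] isT).
have P0 : 0 <= word_nrm_max phi k * word_nrm_max phi k.+2 by apply: Rmult_le_pos.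
rewrite -(sqrt_sqrt (word_nrm_max phi k * word_nrm_max phi k.+2)) //.
suff h : word_nrm_max phi k.+1 <= sqrt (word_nrm_max phi k * word_nrm_max phi k.+2) by apply: Rmult_le_compat.
apply: word_nrm_max_le; first exact: sqrt_pos.
move=> w hw; rewrite /nrm; apply: sqrt_le_1_alt.
case: w hw => [_|i w hw].
  rewrite -nrm_sq //; apply: Rmult_le_compat; try exact: nrm_ge0; exact: word_nrm_max_ge.
have nw := nice_zw w _ np.
have := inner_self _ (nice_zw (i :: w) _ np); rewrite /= Zop_sym //; last exact: nice_Z.
move=> E; have := cauchy_schwarz _ _ nw (nice_Z i _ (nice_Z i _ nw)); rewrite E Cmod_R => cs.
apply: Rle_trans (Rle_abs _) _; apply: Rle_trans cs _.
apply: Rmult_le_compat; try exact: nrm_ge0; first exact: word_nrm_max_ge.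
by apply: (word_nrm_max_ge _ _ [:: i, i & w]).
Qed.
Lemma word_nrm_max_0 phi : word_nrm_max phi 0 = nrm phi.
Proof. by rewrite /word_nrm_max /= Rmax_left //; apply: nrm_ge0. Qed.
(** Log-convexity together with value 1 at order 0: the k-th root of the k-th term is nondecreasing
    in k. *)
Lemma word_nrm_max_interp phi k : nice phi -> nrm phi = 1 -> word_nrm_max phi k ^ k.+1 <= word_nrm_max phi k.+1 ^ k.
Proof.
move=> np n1; have X1 j : 1 <= word_nrm_max phi j by rewrite -n1 -word_nrm_max_0; apply: word_nrm_max_mono.
elim: k => [|k IH]; first by rewrite word_nrm_max_0 n1 /=; lra.
have h := word_nrm_max_convex phi k np.
have a0 := X1 k; have a1 := X1 k.+1; have a2 := X1 k.+2.
have p1 : 0 < word_nrm_max phi k.+1 ^ k by apply: pow_lt; lra.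
apply: (Rmult_le_reg_l (word_nrm_max phi k.+1 ^ k)) => //.
have -> : word_nrm_max phi k.+1 ^ k * word_nrm_max phi k.+1 ^ k.+2 = (word_nrm_max phi k.+1 * word_nrm_max phi k.+1) ^ k.+1.
  by rewrite Rpow_mult_distr /=; ring.
apply: Rle_trans (pow_incr _ _ k.+1 (conj _ h)) _; first nra.
rewrite Rpow_mult_distr; apply: Rmult_le_compat_r => //; by apply: pow_le; lra.
Qed.

(** The form (Lam + sqrt l)^l is the one for which the recursion closes: an eigenvalue, at most
    Lam^m, is paid by the m letters that P replaces, and a commutator factor l by the two letters
    that it removes. *)
Lemma eig_bound_nrm : globally_elliptic c m -> exists A K q, 1 <= A /\ 0 <= K /\
  forall (phi : F) (lam Lam : R), nice phi -> Pop c m phi = cscal (RtoC lam) phi -> nrm phi = 1 ->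
    1 <= Lam -> Rabs lam <= Lam ^ m ->
    forall w, nrm (zw w phi) <= K * Lam ^ q * A ^ size w * (Lam + sqrt (INR (size w))) ^ size w.
Proof.
move=> ell.
have m0 : (0 < m)%N by lia.
have [delta d0 Hd] := symbol_lower c m m0 ell.
have sZ (z : @pidx n m) : z \in ptop m -> size (pword m z) = m by rewrite mem_filter size_pword => /andP[/eqP].
have [p [C0 [C00 HC]]] := elliptic_estimate (ptop m) (pcoef c m) (pword m) m delta m0 d0 sZ Hd.
set s := (p + m)%N.
have k10' := k10; have k20' := k20.
have mR := pos_INR m; have pR := pos_INR p.
have mk : 0 <= INR m * k1 by apply: Rmult_le_pos.
have mpk : 0 <= INR m * INR p * k1 by apply: Rmult_le_pos => //; apply: Rmult_le_pos.
pose C1 := 1 + C0 * (1 + INR m * INR p * k1 + k2 + 1).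
have C11 : 1 <= C1 by rewrite /C1; have : 0 <= C0 * (1 + INR m * INR p * k1 + k2 + 1); [apply: Rmult_le_pos; lra | lra].
(* The cost of one more letter: in the order of the sum, eigenvalue, commutator (its length factor
   is absorbed in [D2]), lower order terms and shorter words, all measured by the same quantity
   [D]. *)
pose A := 1 + C0 * (1 + INR m * k1 + k2 + 1).
have A1 : 1 <= A by rewrite /A; have : 0 <= C0 * (1 + INR m * k1 + k2 + 1); [apply: Rmult_le_pos; lra | lra].
exists A, (C1 ^ s), (m * s)%N; split=> //; split; first by apply: pow_le; lra.
move=> phi lam Lam np eig n1 L1 lamL.
have X1 j : 1 <= word_nrm_max phi j by rewrite -n1 -word_nrm_max_0; apply: word_nrm_max_mono.
have Lm1 : 1 <= Lam ^ m by apply: pow_R1_Rle.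
(* For lengths up to s the norms X_j at order j satisfy X_s <= C1 Lam^m X_(s-1) by the elliptic
   estimate and X_(s-1)^s <= X_s^(s-1) by interpolation; raising the first to the power s and
   cancelling gives X_s <= (C1 Lam^m)^s. *)
have base w : (size w <= s)%N -> nrm (zw w phi) <= C1 ^ s * Lam ^ (m * s).
  move=> hw; apply: Rle_trans (word_nrm_max_ge phi s w hw) _.
  have Xs : word_nrm_max phi s <= C1 * Lam ^ m * word_nrm_max phi s.-1.
    have Xp := X1 s.-1.
    have CL : 1 <= C1 * Lam ^ m by nra.
    apply: word_nrm_max_le => [|x]; first by apply: Rmult_le_pos; lra.
    rewrite leq_eqVlt => /orP[/eqP sx|sx]; last first.
      apply: Rle_trans (word_nrm_max_ge phi s.-1 x _) _; first lia.
      by have : 0 <= (C1 * Lam ^ m - 1) * word_nrm_max phi s.-1; [apply: Rmult_le_pos; lra | lra].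
    have := HC phi np (Lam ^ m * (1 + INR m * INR p * k1 + k2) * word_nrm_max phi s.-1) (word_nrm_max phi s.-1).
    have L0 : C0 * (Lam ^ m * (1 + INR m * INR p * k1 + k2) * word_nrm_max phi s.-1 + word_nrm_max phi s.-1) <= C1 * Lam ^ m * word_nrm_max phi s.-1.
      have : word_nrm_max phi s.-1 <= Lam ^ m * word_nrm_max phi s.-1 by rewrite -{1}(Rmult_1_l (word_nrm_max phi s.-1)); apply: Rmult_le_compat_r; lra.
      move=> h; have := Rmult_le_compat_l _ _ _ C00 h; rewrite /C1.
      have : 0 <= Lam ^ m * word_nrm_max phi s.-1 by apply: Rmult_le_pos; lra.
      by move=> h1 h2; lra.
    move=> H; apply: Rle_trans (H _ _ x sx) L0.
    - move=> y sy; have := top_bound phi lam y (word_nrm_max phi s.-1) (word_nrm_max phi s.-1) np eig.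
      rewrite sy => tb; apply: Rle_trans (tb _ _ _ _) _; try lra.
      + by move=> z hz; apply: word_nrm_max_ge; rewrite /s; lia.
      + by move=> z hz; apply: word_nrm_max_ge; rewrite /s; lia.
      have h1 : nrm (zw y phi) <= word_nrm_max phi s.-1 by apply: word_nrm_max_ge; rewrite sy /s; lia.
      have h2 : Rabs lam * nrm (zw y phi) <= Lam ^ m * word_nrm_max phi s.-1.
        by apply: Rmult_le_compat => //; [exact: Rabs_pos | exact: nrm_ge0].
      have h3 : INR m * INR p * k1 * word_nrm_max phi s.-1 <= Lam ^ m * (INR m * INR p * k1 * word_nrm_max phi s.-1).
        rewrite -{1}(Rmult_1_l (_ * word_nrm_max phi s.-1)); apply: Rmult_le_compat_r => //.
        by apply: Rmult_le_pos; lra.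
      have h4 : k2 * word_nrm_max phi s.-1 <= Lam ^ m * (k2 * word_nrm_max phi s.-1).
        rewrite -{1}(Rmult_1_l (k2 * _)); apply: Rmult_le_compat_r => //.
        by apply: Rmult_le_pos; lra.
      lra.
    - by move=> y hy; apply: word_nrm_max_ge; rewrite /s; lia.
  have int := word_nrm_max_interp phi s.-1 np n1.
  have ss : s.-1.+1 = s by rewrite /s; lia.
  rewrite ss in int.
  have xs := X1 s; have xs1 := X1 s.-1.
  apply: (Rmult_le_reg_l (word_nrm_max phi s ^ s.-1)); first by apply: pow_lt; lra.
  have rs (r : R) : r ^ s.-1 * r = r ^ s by rewrite -{2}ss /=; ring.
  rewrite rs.
  have -> : Lam ^ (m * s) = (Lam ^ m) ^ s by rewrite -pow_mult multE.
  rewrite -Rpow_mult_distr.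
  apply: Rle_trans (pow_incr _ _ s (conj _ Xs)) _; first lra.
  rewrite Rpow_mult_distr Rmult_comm; apply: Rmult_le_compat_r => //.
  by apply: pow_le; apply: Rmult_le_pos; lra.
set K := C1 ^ s * Lam ^ (m * s) in base *.
have K0 : 0 <= K by apply: Rle_trans (nrm_ge0 _) (base [::] isT).
pose Qb l := K * A ^ l * (Lam + sqrt (INR l)) ^ l.
have Qj l j : (j <= l)%N -> Qb (l - j)%N <= K * A ^ (l - j) * (Lam + sqrt (INR l)) ^ (l - j).
  move=> jl; rewrite /Qb; apply: Rmult_le_compat_l; first by apply: Rmult_le_pos => //; apply: pow_le; lra.
  apply: pow_incr; split; first by have := sqrt_pos (INR (l - j)); lra.
  by apply: Rplus_le_compat_l; apply: sqrt_le_1_alt; apply: le_INR; lia.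
have Q0 l : 0 <= Qb l.
  apply: Rmult_le_pos; first by apply: Rmult_le_pos => //; apply: pow_le; lra.
  by apply: pow_le; have := sqrt_pos (INR l); lra.
have QS l : Qb l <= Qb l.+1.
  have := Qj l.+1 1%N isT; rewrite subSS subn0 => h; apply: Rle_trans h _; rewrite /Qb.
  set Y := Lam + _; have Y1 : 1 <= Y by rewrite /Y; have := sqrt_pos (INR l.+1); lra.
  apply: Rmult_le_compat; [by apply: Rmult_le_pos => //; apply: pow_le; lra|by apply: pow_le; lra| |].
    by apply: Rmult_le_compat_l => //; apply: Rle_pow => //; lia.
  by apply: Rle_pow => //; lia.
have Qmono l l' : (l <= l')%N -> Qb l <= Qb l'.
  move=> h; rewrite -(subnKC h); elim: (l' - l)%N => [|j IH]; first by rewrite addn0; lra.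
  by rewrite addnS; apply: Rle_trans IH (QS _).
suff Hall l : forall w, (size w <= l)%N -> nrm (zw w phi) <= Qb (size w).
  by move=> w; apply: (Hall (size w)).
elim: l => [|l IH] w hw.
  apply: Rle_trans (base w _) _; first by lia.
  have -> : w = [::] by apply: size0nil; lia.
  by rewrite /Qb /=; lra.
move: hw; rewrite leq_eqVlt => /orP[/eqP sw|]; last by rewrite ltnS; exact: IH.
case: (leqP (size w) s) => sl.
  apply: Rle_trans (base w sl) _; rewrite /Qb Rmult_assoc -{1}(Rmult_1_r K); apply: Rmult_le_compat_l => //.
  rewrite -{1}(Rmult_1_l 1); apply: Rmult_le_compat; try lra; apply: pow_R1_Rle => //.
  by have := sqrt_pos (INR (size w)); lra.
(* The elliptic estimate is applied to [zw y0 phi] in place of v; its constants ignore the length of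
   [y0], which is what allows the induction on the length of w. *)
pose w1 := take s w; pose y0 := drop s w.
have s1 : size w1 = s by rewrite size_takel //; lia.
have s0 : size y0 = (l.+1 - s)%N by rewrite size_drop sw.
have Hle x : (size x <= l)%N -> nrm (zw x phi) <= Qb l by move=> hx; apply: Rle_trans (IH x hx) (Qmono _ _ hx).
set Y := Lam + sqrt (INR l.+1).
have Y1 : 1 <= Y by rewrite /Y; have := sqrt_pos (INR l.+1); lra.
set D := K * A ^ l * Y ^ l.+1.
(* A factor bounded by Y^j is compensated by j missing letters: j = 1, 2 and m below correspond to
   lower order terms, commutators and the eigenvalue. *)
have AY j : (0 < j)%N -> (j <= l.+1)%N -> forall e, 0 <= e -> e <= Y ^ j -> e * Qb (l.+1 - j)%N <= D.
  move=> j0 jl e e0 ej.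
  apply: Rle_trans (Rmult_le_compat_l _ _ _ e0 (Qj _ _ jl)) _; rewrite -/Y /D.
  have -> : K * A ^ l * Y ^ l.+1 = K * A ^ l * (Y ^ j * Y ^ (l.+1 - j)) by rewrite -pow_add; congr (_ * _ ^ _); lia.
  have -> : e * (K * A ^ (l.+1 - j) * Y ^ (l.+1 - j)) = K * A ^ (l.+1 - j) * (e * Y ^ (l.+1 - j)) by ring.
  apply: Rmult_le_compat.
  - by apply: Rmult_le_pos => //; apply: pow_le; lra.
  - by apply: Rmult_le_pos => //; apply: pow_le; lra.
  - by apply: Rmult_le_compat_l => //; apply: Rle_pow => //; lia.
  - by apply: Rmult_le_compat_r => //; apply: pow_le; lra.
have D1 : Qb l <= D.
  have := AY 1%N isT isT 1 Rle_0_1; rewrite subSS subn0 Rmult_1_l pow_1; exact.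
have D2 : INR l.+1 * Qb (l.+1 - 2)%N <= D.
  apply: AY => //; [lia|exact: pos_INR|].
  have := sqrt_sqrt _ (pos_INR l.+1); have := sqrt_pos (INR l.+1); rewrite /Y /=; nra.
have D3 : Lam ^ m * Qb (l.+1 - m)%N <= D.
  apply: AY => //; [lia | by apply: pow_le; lra |].
  by apply: pow_incr; split; [lra | rewrite /Y; have := sqrt_pos (INR l.+1); lra].
have D0 : 0 <= D by apply: Rle_trans (Q0 l) D1.
rewrite -(cat_take_drop s w) zw_cat.
have ny0 := nice_zw y0 _ np.
apply: Rle_trans (HC (zw y0 phi) ny0 ((1 + INR m * k1 + k2) * D) D _ _ w1 s1) _.
- move=> y sy.
  have -> : lsum (ptop m) (pcoef c m) (fun z => zw (pword m z) (zw y (zw y0 phi))) =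
     lsum (ptop m) (pcoef c m) (fun z => zw (pword m z) (zw (y ++ y0) phi)).
    by congr lsum; apply: fext => z; rewrite !zw_cat.
  have syy : size (y ++ y0) = (l.+1 - m)%N by rewrite size_cat sy s0; rewrite /s in sl *; lia.
  apply: Rle_trans (top_bound phi lam (y ++ y0) (Qb l) (Qb (l.+1 - 2)%N) np eig _ _ _ _) _ => //.
  + move=> x hx; rewrite syy in hx; apply: Rle_trans (IH x _) _; first lia.
    by apply: Qmono; lia.
  + by move=> x hx; rewrite syy in hx; apply: Hle; lia.
  have h1 : nrm (zw (y ++ y0) phi) <= Qb (l.+1 - m)%N by rewrite -syy; apply: IH; rewrite syy; lia.
  have h2 : Rabs lam * nrm (zw (y ++ y0) phi) <= D.
    by apply: Rle_trans D3; apply: Rmult_le_compat => //; [exact: Rabs_pos | exact: nrm_ge0].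
  have h3 : INR m * INR (size (y ++ y0)) * k1 * Qb (l.+1 - 2)%N <= INR m * k1 * D.
    have -> : INR m * INR (size (y ++ y0)) * k1 * Qb (l.+1 - 2)%N = INR m * k1 * (INR (size (y ++ y0)) * Qb (l.+1 - 2)%N) by ring.
    apply: Rmult_le_compat_l => //; apply: Rle_trans D2; apply: Rmult_le_compat_r => //.
    by apply: le_INR; rewrite syy; lia.
  have h4 : k2 * Qb l <= k2 * D by apply: Rmult_le_compat_l.
  lra.
- move=> y sy; rewrite -zw_cat; apply: Rle_trans (Hle _ _) D1.
  by rewrite size_cat s0; rewrite /s in sl sy *; lia.
rewrite cat_take_drop sw -/Y /Qb -/Y.
have -> : K * A ^ l.+1 * Y ^ l.+1 = A * D by rewrite /D /=; ring.
by have : 0 <= D := D0; rewrite /A; nra.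
Qed.

(** From norms to pointwise bounds: Sobolev's inequality costs n more letters. *)
Lemma eig_bound : globally_elliptic c m -> exists A K q, 1 <= A /\ 0 <= K /\
  forall (phi : F) (lam Lam : R), nice phi -> Pop c m phi = cscal (RtoC lam) phi -> nrm phi = 1 ->
    1 <= Lam -> Rabs lam <= Lam ^ m ->
    forall w x, Cmod (zw w phi x) <= K * Lam ^ q * A ^ (size w + n) * (Lam + sqrt (INR (size w + n))) ^ (size w + n).
Proof.
move=> ell; have [A [K [q [A1 [K0 H]]]]] := eig_bound_nrm ell.
exists A, (2 ^ n * K), q; split=> //; split; first by apply: Rmult_le_pos => //; apply: pow_le; lra.
move=> phi lam Lam np eig n1 L1 lL w x.
rewrite !Rmult_assoc -!(Rmult_assoc K).
apply: sobolev => [|w' hw']; first exact: nice_zw.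
rewrite -zw_cat; apply: Rle_trans (H phi lam Lam np eig n1 L1 lL _) _; rewrite -!Rmult_assoc.
set l := size _; set l' := (size w + n)%N.
have ll : (l <= l')%N by rewrite /l /l' size_cat; lia.
have L0 : 0 <= K * Lam ^ q by apply: Rmult_le_pos => //; apply: pow_le; lra.
have s0 := sqrt_pos (INR l'); have s1 := sqrt_pos (INR l).
apply: Rmult_le_compat.
- by apply: Rmult_le_pos => //; apply: pow_le; lra.
- by apply: pow_le; lra.
- by apply: Rmult_le_compat_l => //; apply: Rle_pow => //; lia.
- apply: Rle_trans (_ : (Lam + sqrt (INR l')) ^ l <= _).
    apply: pow_incr; split; first lra.
    by apply: Rplus_le_compat_l; apply: sqrt_le_1_alt; apply: le_INR; lia.
  by apply: Rle_pow; [lra | lia].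
Qed.
End Eigen.

(** * Factorial and exponential growth *)

Definition fpow (k : nat) (s : R) : R := Rpower (INR (fact k)) s.

Lemma fact_ge1 k : 1 <= INR (fact k).
Proof. by have := le_INR 1 (fact k) (lt_O_fact k). Qed.
Lemma Rpower_pos x s : 0 < Rpower x s. Proof. exact: exp_pos. Qed.
Lemma Rpower_ge1 x s : 1 <= x -> 0 <= s -> 1 <= Rpower x s.
Proof.
move=> x1 s0; rewrite -(Rpower_O x); last lra.
exact: Rle_Rpower.
Qed.
Lemma Rpower_le_base x y s : 0 < x -> x <= y -> 0 <= s -> Rpower x s <= Rpower y s.
Proof. by move=> x0 xy s0; apply: Rle_Rpower_l. Qed.
Lemma pow_Rpower x s k : 0 < x -> Rpower (x ^ k) s = Rpower x s ^ k.
Proof.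
move=> x0; rewrite -!Rpower_pow //; last exact: Rpower_pos.
by rewrite !Rpower_mult Rmult_comm.
Qed.
Lemma Rpower_exp x s : Rpower (exp x) s = exp (s * x).
Proof. by rewrite /Rpower ln_exp. Qed.
Lemma exp_ge1 x : 0 <= x -> 1 <= exp x.
Proof. by move=> x0; have := exp_ineq1_le x; lra. Qed.
Lemma exp_incr x y : x <= y -> exp x <= exp y.
Proof. by case=> [h|->]; [left; exact: exp_increasing | right]. Qed.
Lemma fpow_pos k s : 0 < fpow k s. Proof. exact: Rpower_pos. Qed.
Lemma fpow_ge1 k s : 0 <= s -> 1 <= fpow k s.
Proof. by move=> s0; apply: Rpower_ge1 => //; apply: fact_ge1. Qed.
Lemma fpow_exp_le k s s' : s <= s' -> fpow k s <= fpow k s'.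
Proof.
by move=> ss; apply: Rle_Rpower => //; exact: fact_ge1.
Qed.

Lemma fact_mul_le a b : (fact a * fact b <= fact (a + b))%coq_nat.
Proof.
elim: b => [|b IH]; first by rewrite addn0 /=; lia.
rewrite addnS /=; nia.
Qed.
(** A binomial coefficient is at most 2^(a+b); Pascal's rule is hidden in the split of a + b + 2
    into two positive parts. *)
Lemma fact_add_le a b : INR (fact (a + b)) <= 2 ^ (a + b) * (INR (fact a) * INR (fact b)).
Proof.
have [N E] : exists N, (a + b)%N = N by exists (a + b)%N.
elim/ltn_ind: N a b E => N IH a b E.
case: a E => [|a] E.
  rewrite add0n (_ : INR (fact 0) = 1) // Rmult_1_l -{1}(Rmult_1_l (INR (fact b))).
  by apply: Rmult_le_compat_r; [exact: pos_INR | apply: pow_R1_Rle; lra].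
case: b E => [|b] E.
  rewrite addn0 (_ : INR (fact 0) = 1) // Rmult_1_r -{1}(Rmult_1_l (INR (fact a.+1))).
  by apply: Rmult_le_compat_r; [exact: pos_INR | apply: pow_R1_Rle; lra].
have h1 := IH (a + b.+1)%N (ltac:(lia)) a b.+1 (erefl _).
have h2 := IH (a.+1 + b)%N (ltac:(lia)) a.+1 b (erefl _).
have e : (a + b.+1 = a.+1 + b)%N by lia.
rewrite e in h1.
have fS j : INR (fact j.+1) = (INR j + 1) * INR (fact j) by rewrite -S_INR -mult_INR.
have -> : (a.+1 + b.+1 = (a.+1 + b).+1)%N by lia.
rewrite (fS (a.+1 + b)%N) (_ : INR (a.+1 + b) + 1 = (INR a + 1) + (INR b + 1)); last by rewrite plus_INR S_INR; ring.
have a0 := pos_INR a; have b0 := pos_INR b.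
move: (INR (fact (a.+1 + b))) h1 h2 => f h1 h2.
rewrite !fS in h1 h2 *; rewrite (_ : 2 ^ (a.+1 + b).+1 = 2 * 2 ^ (a.+1 + b)) //.
set P := 2 ^ _ in h1 h2 *.
set fa := INR (fact a) in h1 h2 *; set fb := INR (fact b) in h1 h2 *.
have g1 : (INR a + 1) * f <= (INR a + 1) * (P * (fa * ((INR b + 1) * fb))) by apply: Rmult_le_compat_l; lra.
have g2 : (INR b + 1) * f <= (INR b + 1) * (P * ((INR a + 1) * fa * fb)) by apply: Rmult_le_compat_l; lra.
lra.
Qed.
Lemma fpow_mul_le a b s : 0 <= s -> fpow a s * fpow b s <= fpow (a + b) s.
Proof.
move=> s0; rewrite /fpow Rpower_mult_distr; try exact: INR_fact_lt_0.
apply: Rpower_le_base => //; first by apply: Rmult_lt_0_compat; exact: INR_fact_lt_0.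
by rewrite -mult_INR; apply: le_INR; apply: fact_mul_le.
Qed.
Lemma fpow_add_le a b s : 0 <= s -> fpow (a + b) s <= Rpower 2 s ^ (a + b) * (fpow a s * fpow b s).
Proof.
move=> s0; have pa := INR_fact_lt_0 a; have pb := INR_fact_lt_0 b.
rewrite -pow_Rpower; last lra.
rewrite /fpow (Rpower_mult_distr (INR (fact a))) // Rpower_mult_distr; last first.
- exact: Rmult_lt_0_compat.
- by apply: pow_lt; lra.
by apply: Rpower_le_base => //; [exact: INR_fact_lt_0 | exact: fact_add_le].
Qed.
Lemma pow_self_fact N : INR N ^ N <= INR (fact N) * exp (INR N).
Proof. by apply: pow_le_fact_exp; apply: pos_INR. Qed.
Lemma exp_INR N : exp (INR N) = exp 1 ^ N.
Proof. by elim: N => [|N IH]; rewrite ?exp_0 // S_INR exp_plus IH /=; ring. Qed.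
Lemma fact_le_pow N : INR (fact N) <= INR N ^ N.
Proof.
elim: N => [|N IH]; first by rewrite /=; lra.
rewrite (_ : fact N.+1 = (N.+1 * fact N)%coq_nat) // mult_INR.
rewrite (_ : INR N.+1 ^ N.+1 = INR N.+1 * INR N.+1 ^ N) //.
apply: Rmult_le_compat_l; first exact: pos_INR.
apply: Rle_trans IH _; apply: pow_incr; split; [exact: pos_INR | rewrite S_INR; lra].
Qed.

(** The basic exchange of a power of L for a factorial. It is y^a <= a! exp y at y = (eps / mu)
    L^(1/mu), raised to the power mu; [eps] is arbitrary and only the geometric constant [K] depends
    on it. *)
Lemma lam_growth mu eps : 0 < mu -> 0 < eps -> exists2 K, 1 <= K & forall L a, 1 <= L ->
  L ^ a <= K ^ a * fpow a mu * exp (eps * Rpower L (/ mu)).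
Proof.
move=> m0 e0; exists (Rmax 1 (Rpower (mu / eps) mu)); first exact: Rmax_l.
move=> L a L1; set Y := Rpower L (/ mu); have Y0 : 0 < Y := Rpower_pos _ _.
have me : 0 < mu / eps by apply: Rdiv_lt_0_compat.
have em : 0 < eps / mu by apply: Rdiv_lt_0_compat.
have fa := INR_fact_lt_0 a.
have YL : Rpower Y mu = L by rewrite /Y Rpower_mult Rinv_l ?Rpower_1; lra.
have h : Y ^ a <= (mu / eps) ^ a * (INR (fact a) * exp (eps / mu * Y)).
  have {1}-> : Y = (mu / eps) * (eps / mu * Y) by field; lra.
  rewrite Rpow_mult_distr; apply: Rmult_le_compat_l; first by apply: pow_le; lra.
  by apply: pow_le_fact_exp; apply: Rmult_le_pos; lra.
have h2 := Rpower_le_base _ _ mu (pow_lt _ a Y0) h (Rlt_le _ _ m0).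
rewrite pow_Rpower // YL in h2.
rewrite -!Rpower_mult_distr ?Rpower_exp ?pow_Rpower // in h2; last first.
- by apply: Rmult_lt_0_compat => //; apply: exp_pos.
- exact: pow_lt.
- exact: exp_pos.
apply: Rle_trans h2 _; rewrite (_ : mu * (eps / mu * Y) = eps * Y); last by field; lra.
rewrite -!Rmult_assoc; apply: Rmult_le_compat_r; first by left; apply: exp_pos.
apply: Rmult_le_compat_r; first by left; apply: fpow_pos.
by apply: pow_incr; split; [left; exact: Rpower_pos | exact: Rmax_r].
Qed.

(** N^N <= N! e^N, followed by a square root: the half factorial produced by commutators fits into
    N!^mu precisely because mu >= 1/2. *)
Lemma sqrt_self_pow mu N : 1 / 2 <= mu -> sqrt (INR N) ^ N <= exp 1 ^ N * fpow N mu.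
Proof.
move=> hm; have e1 : 1 <= exp 1 by have := exp_ineq1_le 1; lra.
have p1 : 1 <= exp 1 ^ N by apply: pow_R1_Rle.
have f0 := fpow_pos N mu.
apply: Rsqr_incr_0_var; last by apply: Rmult_le_pos; lra.
rewrite /Rsqr -Rpow_mult_distr sqrt_sqrt; last exact: pos_INR.
apply: Rle_trans (pow_self_fact N) _; rewrite exp_INR.
have -> : exp 1 ^ N * fpow N mu * (exp 1 ^ N * fpow N mu) = fpow N mu * fpow N mu * (exp 1 ^ N * exp 1 ^ N) by ring.
apply: Rmult_le_compat; [exact: pos_INR | lra | | nra].
rewrite /fpow -Rpower_plus -{1}(Rpower_1 (INR (fact N))); last exact: INR_fact_lt_0.
by apply: fpow_exp_le; lra.
Qed.

Lemma fpow_shift_growth r s : 0 <= s -> exists K D, 0 <= K /\ 1 <= D /\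
  forall l, fpow (l + r) s <= K * D ^ l * fpow l s.
Proof.
move=> s0; exists (Rpower 2 s ^ r * fpow r s), (Rpower 2 s); split.
  by apply: Rmult_le_pos; [apply: pow_le; left; exact: Rpower_pos | left; exact: fpow_pos].
split; first by apply: Rpower_ge1; lra.
by move=> l; apply: Rle_trans (fpow_add_le l r s s0) _; rewrite pow_add; right; ring.
Qed.

(** Turns the bound of [eig_bound] into the seminorms of the target space: the maximum of L and sqrt
    replaces their sum, L is exchanged by [lam_growth] and sqrt by [sqrt_self_pow]. The fixed shifts
    n and q only change the constants. *)
Lemma synth_growth mu eps A q n : 1 / 2 <= mu -> 0 < eps -> 1 <= A -> exists K D, 0 <= K /\ 1 <= D /\
  forall L l, 1 <= L -> L ^ q * A ^ (l + n) * (L + sqrt (INR (l + n))) ^ (l + n)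
     <= K * D ^ l * fpow l mu * exp (eps * Rpower L (/ mu)).
Proof.
move=> hm e0 A1; have m0 : 0 < mu by lra.
have [C0 C01 HC] := lam_growth mu eps m0 e0.
have [K1 [D1 [K10 [D11 H1]]]] := fpow_shift_growth (n + q) mu (Rlt_le _ _ m0).
have e1 : 1 <= exp 1 by have := exp_ineq1_le 1; lra.
pose C1 := C0 * exp 1.
have C11 : 1 <= C1 by rewrite /C1; nra.
exists (A ^ n * 2 ^ n * 2 * C1 ^ (n + q) * K1), (A * 2 * C1 * D1); split.
  have a1 := pow_le A n (ltac:(lra)); have a2 := pow_le 2 n (ltac:(lra)).
  have a3 := pow_le C1 (n + q) (ltac:(lra)).
  by repeat apply: Rmult_le_pos => //; lra.
split.
  have x1 : 1 <= A * 2 by lra.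
  have x2 : 1 <= A * 2 * C1 by nra.
  nra.
move=> L l L1; set N := (l + n)%N; set E := exp _.
have E1 : 1 <= E.
  by apply: exp_ge1; apply: Rmult_le_pos; [lra | left; exact: Rpower_pos].
have s0 := sqrt_pos (INR N).
have b1 : (L + sqrt (INR N)) ^ N <= 2 ^ N * (L ^ N + sqrt (INR N) ^ N).
  have pL := pow_le L N (ltac:(lra)); have ps := pow_le _ N s0.
  apply: Rle_trans (_ : (2 * Rmax L (sqrt (INR N))) ^ N <= _).
    by apply: pow_incr; split; [lra | have := Rmax_l L (sqrt (INR N)); have := Rmax_r L (sqrt (INR N)); lra].
  rewrite Rpow_mult_distr; apply: Rmult_le_compat_l; first by apply: pow_le; lra.
  by rewrite /Rmax; case: Rle_dec => _; lra.
pose Z := C1 ^ (N + q) * fpow (N + q) mu * E.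
have b2 : L ^ q * L ^ N <= Z.
  rewrite -pow_add (_ : (q + N)%coq_nat = (N + q)%N); last lia.
  apply: Rle_trans (HC L (N + q)%N L1) _; apply: Rmult_le_compat_r; first by left; exact: exp_pos.
  apply: Rmult_le_compat_r; first by left; exact: fpow_pos.
  by apply: pow_incr; split; [lra | rewrite /C1; nra].
have b3 : L ^ q * sqrt (INR N) ^ N <= Z.
  apply: Rle_trans (Rmult_le_compat _ _ _ _ _ _ (HC L q L1) (sqrt_self_pow mu N hm)) _.
  - by apply: pow_le; lra.
  - exact: pow_le.
  rewrite -/E /Z; have f1 := fpow_mul_le N q mu (Rlt_le _ _ m0).
  have c1 : C0 ^ q * exp 1 ^ N <= C1 ^ (N + q).
    have -> : C1 ^ (N + q) = C1 ^ q * C1 ^ N by rewrite -pow_add; congr (_ ^ _); lia.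
    apply: Rmult_le_compat; try by apply: pow_le; lra.
      by apply: pow_incr; split; [lra | rewrite /C1; nra].
    by apply: pow_incr; split; [lra | rewrite /C1; nra].
  have -> : C0 ^ q * fpow q mu * E * (exp 1 ^ N * fpow N mu) = (C0 ^ q * exp 1 ^ N) * (fpow N mu * fpow q mu) * E by ring.
  apply: Rmult_le_compat_r; first lra.
  apply: Rmult_le_compat => //.
    by apply: Rmult_le_pos; apply: pow_le; lra.
  by apply: Rmult_le_pos; left; exact: fpow_pos.
have Lq := pow_le L q (ltac:(lra)).
have AN := pow_le A N (ltac:(lra)).
have c : L ^ q * A ^ N * (L + sqrt (INR N)) ^ N <= A ^ N * 2 ^ N * (2 * Z).
  have h := Rmult_le_compat_l _ _ _ (Rmult_le_pos _ _ Lq AN) b1.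
  apply: Rle_trans h _.
  have -> : L ^ q * A ^ N * (2 ^ N * (L ^ N + sqrt (INR N) ^ N)) = A ^ N * 2 ^ N * (L ^ q * L ^ N + L ^ q * sqrt (INR N) ^ N) by ring.
  apply: Rmult_le_compat_l; last lra.
  by apply: Rmult_le_pos => //; apply: pow_le; lra.
apply: Rle_trans c _; rewrite /Z /N (_ : (l + n + q)%N = (l + (n + q))%N); last lia.
clearbody C1; have h1 := H1 l; rewrite !pow_add !Rpow_mult_distr.
set x := fpow (l + (n + q)) mu in h1 *.
set cf := A ^ l * A ^ n * (2 ^ l * 2 ^ n) * 2 * (C1 ^ l * (C1 ^ n * C1 ^ q)) * E.
have q0 (y : R) (j : nat) : 1 <= y -> 0 <= y ^ j by move=> ?; apply: pow_le; lra.
have two1 : 1 <= 2 by lra.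
have cf0 : 0 <= cf.
  rewrite /cf; have A_l := q0 A l A1; have A_n := q0 A n A1; have t_l := q0 2 l two1; have t_n := q0 2 n two1.
  have c_l := q0 C1 l C11; have c_n := q0 C1 n C11; have c_q := q0 C1 q C11.
  by repeat apply: Rmult_le_pos => //; lra.
apply: Rle_trans (_ : cf * x <= _); first by right; rewrite /cf; ring.
by apply: Rle_trans (Rmult_le_compat_l _ _ _ cf0 h1) _; right; rewrite /cf; ring.
Qed.

(** At y / 2 the exponential series is dominated term by term by B 2^(-M); halving the argument is
    the price of convergence. *)
Lemma exp_half_le y B : 0 <= y -> (forall M, y ^ M <= B * INR (fact M)) -> exp (y / 2) <= 2 * B.
Proof.
move=> y0 H.
have S : is_series (fun M => / INR (fact M) * (y / 2) ^ M) (exp (y / 2)).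
  by apply: is_series_ext (is_exp_Reals (y / 2)) => M; rewrite pow_n_pow /scal /= /mult /=; ring.
have G : is_series (fun M => (/ 2) ^ M) (/ (1 - / 2)) by apply: is_series_geom; rewrite Rabs_pos_eq; lra.
have G2 := is_series_scal_r B _ _ G.
rewrite (_ : 2 * B = / (1 - / 2) * B); last by field.
have := is_lim_seq_le (sum_n (fun M => / INR (fact M) * (y / 2) ^ M)) (sum_n (fun M => (/ 2) ^ M * B))
   (Rbar.Finite (exp (y / 2))) (Rbar.Finite (/ (1 - / 2) * B)) _ S G2.
apply=> M; elim: M => [|M IH].
  rewrite !sum_O; have := H 0%N; rewrite /=; lra.
rewrite !sum_Sn; apply: Rplus_le_compat => //.
have f0 := INR_fact_lt_0 M.+1.
rewrite /Rdiv Rpow_mult_distr.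
have h : / INR (fact M.+1) * y ^ M.+1 <= B.
  apply: (Rmult_le_reg_l (INR (fact M.+1))) => //.
  rewrite -Rmult_assoc Rinv_r ?Rmult_1_l; [have := H M.+1; lra | lra].
have p0 : 0 <= (/ 2) ^ M.+1 by apply: pow_le; lra.
have := Rmult_le_compat_l _ _ _ p0 h; lra.
Qed.

(** Raised to the power 1/kap, the hypothesis bounds y^M by (B/z)^(1/kap) M! with y = (X/D)^(1/kap);
    summing over M replaces the optimisation in M. Returning to the power kap gives the rate (kap/2)
    D^(-1/kap) and the constant 2^kap. *)
Lemma decay_from_moments kap D : 0 < kap -> 1 <= D -> exists eps K, 0 < eps /\ 0 <= K /\
  forall X z B, 1 <= X -> 0 <= z -> 0 <= B -> (forall M, X ^ M * z <= B * D ^ M * fpow M kap) ->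
    z <= K * B * exp (- eps * Rpower X (/ kap)).
Proof.
move=> k0 D1; have ik : 0 < / kap by apply: Rinv_0_lt_compat.
exists (kap * Rpower (/ D) (/ kap) / 2), (Rpower 2 kap); split.
  by have := Rpower_pos (/ D) (/ kap); nra.
split; first by left; exact: Rpower_pos.
move=> X z B X1 z0 B0 H.
case: (Req_dec z 0) => [->|zn].
  by apply: Rmult_le_pos; [apply: Rmult_le_pos => //; left; exact: Rpower_pos | left; exact: exp_pos].
have zp : 0 < z by lra.
have primitive : 0 < B.
  have := H 0%N; rewrite /= Rmult_1_l Rmult_1_r /fpow /= /Rpower ln_1 Rmult_0_r exp_0; lra.
have Dp : 0 < / D by apply: Rinv_0_lt_compat; lra.
set Q := Rpower (B / z) (/ kap).
pose y := Rpower (X * / D) (/ kap).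
have XD : 0 < X * / D by apply: Rmult_lt_0_compat; lra.
have y0 : 0 < y := Rpower_pos _ _.
have bz : 0 < B / z by apply: Rdiv_lt_0_compat.
have e : exp (y / 2) <= 2 * Q.
  apply: exp_half_le => [|M]; first lra.
  have fM := INR_fact_lt_0 M.
  have h : (X * / D) ^ M <= B / z * fpow M kap.
    rewrite Rpow_mult_distr pow_inv.
    have DM : 0 < D ^ M by apply: pow_lt; lra.
    apply: (Rmult_le_reg_r (D ^ M * z)); first exact: Rmult_lt_0_compat.
    have -> : X ^ M * / D ^ M * (D ^ M * z) = X ^ M * z by field; lra.
    have -> : B / z * fpow M kap * (D ^ M * z) = B * D ^ M * fpow M kap by field; lra.
    exact: H.
  have := Rpower_le_base _ _ (/ kap) (pow_lt _ M XD) h (Rlt_le _ _ ik).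
  rewrite pow_Rpower // -/y -Rpower_mult_distr //; last exact: fpow_pos.
  by rewrite -/Q /fpow Rpower_mult Rinv_r ?Rpower_1 //; lra.
have h2 := Rpower_le_base _ _ kap (exp_pos _) e (Rlt_le _ _ k0).
rewrite Rpower_exp -Rpower_mult_distr in h2; [|lra|exact: Rpower_pos].
rewrite /Q Rpower_mult Rinv_l ?Rpower_1 // in h2; last lra.
have yE : y = Rpower (/ D) (/ kap) * Rpower X (/ kap) by rewrite /y Rmult_comm Rpower_mult_distr //; lra.
set g := exp (- _ * _).
have gE : g * exp (kap * (y / 2)) = 1.
  rewrite /g -exp_plus -exp_0; congr exp; rewrite yE; field.
have g0 : 0 < g := exp_pos _.
have h3 : exp (kap * (y / 2)) * z <= Rpower 2 kap * B.
  have := Rmult_le_compat_r _ _ _ z0 h2.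
  by rewrite (_ : Rpower 2 kap * (B / z) * z = Rpower 2 kap * B) //; field.
have := Rmult_le_compat_l _ _ _ (Rlt_le _ _ g0) h3.
by rewrite -Rmult_assoc gE Rmult_1_l; lra.
Qed.

(** P^M has words of length up to m M, and (m M)!^mu is comparable to M!^(m mu), through (m M)^(m M)
    and M^M <= e^M M!. This is the origin of the exponent 1/(m mu) in the decay of coefficients. *)
Lemma fact_mult_growth m r mu : 0 <= mu -> exists K D, 0 <= K /\ 1 <= D /\
  forall M, fpow (m * M + r) mu <= K * D ^ M * fpow M (INR m * mu).
Proof.
move=> mu0; have [K1 [D1 [K10 [D11 H1]]]] := fpow_shift_growth r mu mu0.
have e1 : 1 <= exp 1 by have := exp_ineq1_le 1; lra.
pose B := (INR m * exp 1 + 1) ^ m.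
have B1 : 1 <= B by apply: pow_R1_Rle; have := pos_INR m; nra.
have D1m : 1 <= D1 ^ m by apply: pow_R1_Rle.
have RB : 1 <= Rpower B mu by apply: Rpower_ge1.
exists K1, (D1 ^ m * Rpower B mu); split=> //; split; first nra.
move=> M; apply: Rle_trans (H1 (m * M)%N) _.
have -> : K1 * (D1 ^ m * Rpower B mu) ^ M * fpow M (INR m * mu) = K1 * D1 ^ (m * M) * (Rpower B mu ^ M * fpow M (INR m * mu)).
  by rewrite Rpow_mult_distr -pow_mult multE; ring.
apply: Rmult_le_compat_l; first by apply: Rmult_le_pos => //; apply: pow_le; lra.
have fM := INR_fact_lt_0 M.
rewrite -pow_Rpower; last lra.
rewrite /fpow -(Rpower_mult _ (INR m)) Rpower_pow // Rpower_mult_distr; [|by apply: pow_lt; lra|exact: pow_lt].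
apply: Rpower_le_base => //; first exact: INR_fact_lt_0.
apply: Rle_trans (fact_le_pow _) _; rewrite -multE mult_INR Rpow_mult_distr !(pow_mult _ m M).
rewrite -!Rpow_mult_distr -(pow_mult _ m M) multE mulnC -multE pow_mult -pow_mult.
have -> : (INR m * INR M) ^ (M * m)%coq_nat = ((INR m * INR M) ^ M) ^ m by rewrite pow_mult.
have -> : B ^ M * INR (fact M) ^ m = ((INR m * exp 1 + 1) ^ M * INR (fact M)) ^ m.
  by rewrite Rpow_mult_distr /B -!pow_mult (Nat.mul_comm m M).
have m0 := pos_INR m; have M0 := pos_INR M.
apply: pow_incr; split; first by apply: pow_le; apply: Rmult_le_pos.
rewrite Rpow_mult_distr.
have h := pow_self_fact M; rewrite exp_INR in h.
apply: Rle_trans (Rmult_le_compat_l _ _ _ (pow_le _ M m0) h) _.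
have -> : INR m ^ M * (INR (fact M) * exp 1 ^ M) = (INR m * exp 1) ^ M * INR (fact M) by rewrite Rpow_mult_distr; ring.
apply: Rmult_le_compat_r; first lra.
by apply: pow_incr; split; [apply: Rmult_le_pos; lra | lra].
Qed.

(** A commutator multiplies by N but leaves the degree two below that of the other branch; the gap
    between the factorials is ((k+2)(k+1))^mu, at least k + 1 because mu >= 1/2, so commutators cost
    no more than ordinary letters. *)
Lemma qiter_bound K D mu : 0 <= K -> 1 <= D -> 1 / 2 <= mu -> forall l N,
  qiter (fun N => K * D ^ N * fpow N mu) l N <= K * (D + 1) ^ l * D ^ N * fpow (N + l) mu.
Proof.
move=> K0 D1 hm; elim=> [|l IH] N /=; first by rewrite addn0; lra.
have h1 := IH N.+1; have h2 := IH N.-1.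
have nat1 : (N.+1 + l = N + l.+1)%N by lia.
rewrite nat1 in h1.
set f := fpow (N + l.+1) mu in h1 *.
have f0 : 0 < f := fpow_pos _ _.
have P0 : 0 <= K * (D + 1) ^ l by apply: Rmult_le_pos => //; apply: pow_le; lra.
have DN : 0 <= D ^ N by apply: pow_le; lra.
have h3 : INR N * (K * (D + 1) ^ l * D ^ N.-1 * fpow (N.-1 + l) mu) <= K * (D + 1) ^ l * D ^ N * f.
  case: N nat1 @f f0 h1 h2 DN => [|N] nat1 f f0 h1 h2 DN.
    by rewrite Rmult_0_l; apply: Rmult_le_pos; [apply: Rmult_le_pos | lra].
  rewrite [N.+1.-1]/=; have DN' : 0 <= D ^ N by apply: pow_le; lra.
  have fl : INR N.+1 * fpow (N + l) mu <= f.
    rewrite /f (_ : (N.+1 + l.+1 = (N + l).+2)%N); last lia.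
    set k := (N + l)%N.
    have k1 : INR N.+1 <= INR k.+1 by apply: le_INR; rewrite /k; lia.
    have fk := INR_fact_lt_0 k; have kp := pos_INR k.
    have -> : fpow k.+2 mu = Rpower (INR k.+2 * INR k.+1) mu * fpow k mu.
      rewrite /fpow Rpower_mult_distr //; last by rewrite !S_INR; nra.
      congr Rpower; rewrite (_ : fact k.+2 = (k.+2 * (k.+1 * fact k))%coq_nat) // !mult_INR; ring.
    apply: Rmult_le_compat_r; first by left; exact: fpow_pos.
    apply: Rle_trans k1 _.
    apply: Rle_trans (_ : Rpower (INR k.+1 * INR k.+1) (/ 2) <= _).
      rewrite Rpower_sqrt; last by rewrite S_INR; nra.
      by rewrite sqrt_square; [lra | exact: pos_INR].
    apply: Rle_trans (_ : Rpower (INR k.+1 * INR k.+1) mu <= _).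
      have : 1 <= INR k.+1 * INR k.+1 by rewrite S_INR; nra.
      by move=> h; apply: Rle_Rpower; lra.
    apply: Rpower_le_base; [by rewrite S_INR; nra | | lra].
    by apply: Rmult_le_compat_r; [exact: pos_INR | rewrite !S_INR; lra].
  have -> : INR N.+1 * (K * (D + 1) ^ l * D ^ N * fpow (N + l) mu) = K * (D + 1) ^ l * D ^ N * (INR N.+1 * fpow (N + l) mu) by ring.
  apply: Rmult_le_compat => //.
  - exact: Rmult_le_pos.
  - by apply: Rmult_le_pos; [exact: pos_INR | left; exact: fpow_pos].
  - by apply: Rmult_le_compat_l => //; rewrite /=; nra.
have h4 := Rmult_le_compat_l _ _ _ (pos_INR N) h2.
rewrite /= in h1; lra.
Qed.

(** * Decay of the coefficients *)

Section Slices.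
Context {n : nat}.
Local Notation F := (Pt n -> C).
Implicit Types (x : Pt n) (G : Pt n.+1 -> C).

Lemma tx_0 t x : tx t x ord0 = t.
Proof. by rewrite /tx unlift_none. Qed.
Lemma tx_lift t x i : tx t x (lift ord0 i) = x i.
Proof. by rewrite /tx liftK. Qed.
Lemma tx_eta (y : Pt n.+1) : tx (y ord0) (fun i => y (lift ord0 i)) = y.
Proof. by apply: fext => j; rewrite /tx; case: unliftP => [i ->|->]. Qed.
Lemma upd_tx_lift t x i s : upd (tx t x) (lift ord0 i) s = tx t (upd x i s).
Proof.
apply: fext => j; rewrite /upd; case: (unliftP ord0 j) => [j' ->|->].
  by rewrite !tx_lift (inj_eq (@lift_inj _ ord0)).
by rewrite !tx_0.
Qed.
Lemma upd_tx_0 t x s : upd (tx t x) ord0 s = tx s x.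
Proof.
apply: fext => j; rewrite /upd; case: (unliftP ord0 j) => [j' ->|->]; last by rewrite eqxx tx_0.
by rewrite !tx_lift.
Qed.
Lemma flat_tx (u : R -> F) t x : flat u (tx t x) = u t x.
Proof. by rewrite /flat tx_0; congr u; apply: fext => i; rewrite tx_lift. Qed.

Definition slice G (t : R) : F := fun x => G (tx t x).
Lemma pd_slice G t i : pd i (slice G t) = slice (pd (lift ord0 i) G) t.
Proof.
apply: fext => x; rewrite /pd /slice tx_lift.
by congr pair; apply: Derive_ext => s; rewrite upd_tx_lift.
Qed.
Lemma dw_slice G t w : dw w (slice G t) = slice (dw (map (lift ord0) w) G) t.
Proof. by elim: w => [//|i w IH] /=; rewrite IH pd_slice. Qed.
Lemma smooth_slice G t : smooth G -> smooth (slice G t).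
Proof.
move=> sG w; rewrite dw_slice; set H := dw _ G.
have sH : smooth H by apply: smooth_dw.
split.
  move=> x e he; have [d [dp Hd]] := smooth_cont _ sH (tx t x) e he.
  exists d; split=> // y hy; apply: Hd => j; case: (unliftP ord0 j) => [i ->|->].
    by rewrite !tx_lift.
  by rewrite !tx_0 Rminus_diag Rabs_R0.
move=> i x; have [a b] := smooth_has_pd H (lift ord0 i) (tx t x) sH.
rewrite tx_lift in a b; split; [apply: ex_derive_ext a | apply: ex_derive_ext b] => s;
  by rewrite /slice upd_tx_lift.
Qed.
Lemma slice_deriv G x t : smooth G ->
  is_derive (fun t => Re (G (tx t x))) t (Re (pd ord0 G (tx t x))) /\
  is_derive (fun t => Im (G (tx t x))) t (Im (pd ord0 G (tx t x))).
Proof.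
move=> sG; have [a b] := smooth_section G ord0 (tx t x) sG t.
rewrite upd_tx_0 in a b.
by split; [apply: is_derive_ext a | apply: is_derive_ext b] => s; rewrite upd_tx_0.
Qed.

Definition tder (g : nat) (u : R -> F) (t : R) : F := slice (dw (nseq g ord0) (flat u)) t.
Lemma tder0 u t : tder 0 u t = u t.
Proof. by apply: fext => x; rewrite /tder /slice /= flat_tx. Qed.
Lemma smooth_tder g u t : smooth (flat u) -> smooth (tder g u t).
Proof. by move=> su; apply: smooth_slice; apply: smooth_dw. Qed.

Lemma exps_txindex g (b : mindex n) : exps (txindex g b) = nseq g ord0 ++ map (lift ord0) (exps b).
Proof.
rewrite /exps enum_ordSl /= /txindex unlift_none; congr cat.
rewrite -map_comp map_flatten -map_comp; congr flatten; apply: eq_map => i /=.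
by rewrite liftK map_nseq.
Qed.
Lemma dw_tder g u t w x : smooth (flat u) ->
  dw w (tder g u t) x = dw (nseq g ord0 ++ map (lift ord0) w) (flat u) (tx t x).
Proof.
move=> su; rewrite /tder dw_slice /slice -dw_cat; congr (_ (tx t x)).
by apply: dw_perm => //; rewrite perm_catC.
Qed.

Lemma mfact_le {k} (a : mindex k) : (mfact a <= fact (mlen a))%coq_nat.
Proof.
rewrite /mfact /mlen; elim: (enum 'I_k) => [|i l IH] /=; first exact: le_n.
apply: Nat.le_trans (fact_mul_le _ _); exact: Nat.mul_le_mono_l.
Qed.
Lemma mfact_pos {k} (a : mindex k) : (0 < mfact a)%coq_nat.
Proof.
rewrite /mfact; elim: (enum 'I_k) => [|i l IH] /=; first exact: le_n.
by apply: Nat.mul_pos_pos => //; exact: lt_O_fact.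
Qed.

(** The seminorms, which have separate factorials and normally ordered words, become bounds on
    arbitrary words: the product of the factorials is at most the factorial of the total length, and
    reordering is paid by [qiter_bound]. *)
Lemma F_words u sigma mu : 1 / 2 <= mu -> @S_sm n sigma mu u -> exists K D, 0 <= K /\ 1 <= D /\
  forall g t w x, Cmod (zw w (tder g u t) x) <= K * (D ^ g * fpow g sigma) * (D ^ size w * fpow (size w) mu).
Proof.
move=> hm [su [_ [Cc [K0 [C0 H]]]]].
pose D0 := Rmax 1 Cc; pose K := Rmax 0 K0.
have D01 : 1 <= D0 by apply: Rmax_l.
have KK : 0 <= K by apply: Rmax_l.
have m0 : 0 <= mu by lra.
exists K, (D0 + 1); split=> //; split; first lra.
move=> g t w x.
pose Kg := K * (D0 ^ g * fpow g sigma).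
have Kg0 : 0 <= Kg.
  by apply: Rmult_le_pos => //; apply: Rmult_le_pos; [apply: pow_le; lra | left; exact: fpow_pos].
have st := smooth_tder g u t su.
have mb u' b : Cmod (mono u' b (tder g u t) x) <= Kg * D0 ^ (size u' + size b) * fpow (size u' + size b) mu.
  pose a := (fun i => count_mem i u') : mindex n; pose b' := (fun i => count_mem i b) : mindex n.
  have := H a b' g t x; rewrite dmi_exps exps_txindex -dw_tder //.
  rewrite /mono (dw_exps b) // amon_counts => h; apply: Rle_trans h _.
  rewrite /a /b' !mlen_counts -/a -/b'.
  have p1 : Cc ^ (size u' + size b + g) <= D0 ^ (size u' + size b) * D0 ^ g.
    by rewrite -pow_add; apply: pow_incr; split; [lra | exact: Rmax_r].
  have p2 : Rpower (INR (mfact a * mfact b')) mu <= fpow (size u' + size b) mu.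
    apply: Rpower_le_base => //.
      by apply: lt_0_INR; apply: Nat.mul_pos_pos; exact: mfact_pos.
    apply: le_INR; apply: Nat.le_trans (fact_mul_le _ _).
    rewrite -(mlen_counts u') -(mlen_counts b).
    by apply: Nat.mul_le_mono; exact: mfact_le.
  have q1 : 0 <= Cc ^ (size u' + size b + g) by apply: pow_le; lra.
  have q2 : 0 < Rpower (INR (mfact a * mfact b')) mu := Rpower_pos _ _.
  have q3 : 0 < fpow g sigma := fpow_pos _ _.
  have q4 : K0 <= K by apply: Rmax_r.
  rewrite -/(fpow g sigma).
  have r1 : K0 * Cc ^ (size u' + size b + g) <= K * (D0 ^ (size u' + size b) * D0 ^ g).
    apply: Rle_trans (Rmult_le_compat_r _ _ _ q1 q4) _.
    by apply: Rmult_le_compat_l.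
  have r2 := Rmult_le_compat_r _ _ _ (Rlt_le _ _ q3) r1.
  have r3 := Rmult_le_compat_r _ _ _ (Rlt_le _ _ q2) r2.
  apply: Rle_trans r3 _.
  have z0 : 0 <= K * (D0 ^ (size u' + size b) * D0 ^ g) * fpow g sigma.
    by repeat apply: Rmult_le_pos => //; try (by apply: pow_le; lra); lra.
  apply: Rle_trans (Rmult_le_compat_l _ _ _ z0 p2) _.
  by right; rewrite /Kg; ring.
have q0 N : 0 <= Kg * D0 ^ N * fpow N mu.
  by apply: Rmult_le_pos; [apply: Rmult_le_pos => //; apply: pow_le; lra | left; exact: fpow_pos].
have := zw_mono_bound (fun N => Kg * D0 ^ N * fpow N mu) _ x st mb q0 w [::] [::].
have -> : mono [::] [::] (tder g u t) = tder g u t by apply: fext => y; rewrite /mono /= Cmult_1l.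
move=> h; apply: Rle_trans h _; apply: Rle_trans (qiter_bound Kg D0 mu Kg0 D01 hm _ _) _.
rewrite /= add0n Rmult_1_r Rmult_assoc; apply: Rmult_le_compat_r.
  by apply: Rmult_le_pos; [apply: pow_le; lra | left; exact: fpow_pos].
apply: Rmult_le_compat_l => //; apply: Rmult_le_compat_r; first by left; exact: fpow_pos.
by apply: pow_incr; lra.
Qed.

Lemma nice_tder u sigma mu g t : 1 / 2 <= mu -> @S_sm n sigma mu u -> nice (tder g u t).
Proof.
move=> hm S; have [K [D [_ [_ H]]]] := F_words u sigma mu hm S.
split; first by apply: smooth_tder; case: S.
by move=> w; eexists => x; exact: H.
Qed.

Definition is_dC (f : R -> C) t (l : C) : Prop :=
  is_derive (fun t => Re (f t)) t (Re l) /\ is_derive (fun t => Im (f t)) t (Im l).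

(** Differentiation under the integral: the second order Taylor remainder in t is bounded uniformly
    in x, and integrating it against the decaying [phi] keeps it quadratic. *)
Lemma coef_deriv u sigma mu phi : 1 / 2 <= mu -> @S_sm n sigma mu u -> nice phi -> forall g t,
  is_dC (fun t => inner (tder g u t) phi) t (inner (tder g.+1 u t) phi).
Proof.
move=> hm S np g t.
have [K [D [K0 [D1 HK]]]] := F_words u sigma mu hm S.
have nt g t := nice_tder u sigma mu g t hm S.
have su : smooth (flat u) by case: S.
have [K1 K10 H1] := nice_decay _ np.
pose M := 2 * (K * (D ^ g.+2 * fpow g.+2 sigma)).
have M0 : 0 <= M.
  apply: Rmult_le_pos; [lra|apply: Rmult_le_pos => //; apply: Rmult_le_pos]; [by apply: pow_le; lra | left; exact: fpow_pos].
have T tau : Cmod (Cminus (Cminus (inner (tder g u (t + tau)) phi) (inner (tder g u t) phi))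
    (Cmult (RtoC tau) (inner (tder g.+1 u t) phi))) <= 2 * (M * K1 * PI ^ n) * tau ^ 2.
  pose h := cplus (cplus (tder g u (t + tau)) (cscal (RtoC (-1)) (tder g u t))) (cscal (RtoC (- tau)) (tder g.+1 u t)).
  have n1 : nice (cplus (tder g u (t + tau)) (cscal (RtoC (-1)) (tder g u t))).
    by apply: nice_plus => //; apply: nice_scal.
  have nh : nice h by apply: nice_plus => //; apply: nice_scal.
  have -> : Cminus (Cminus (inner (tder g u (t + tau)) phi) (inner (tder g u t) phi))
    (Cmult (RtoC tau) (inner (tder g.+1 u t) phi)) = inner h phi.
    rewrite (inner_plusl _ _ _ n1 (nice_scal _ _ (nt _ _)) np) (inner_plusl _ _ _ (nt _ _) (nice_scal _ _ (nt _ _)) np).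
    have m1 : RtoC (-1) = Copp (RtoC 1) by rewrite -RtoC_opp.
    by rewrite !inner_scall // m1 RtoC_opp /Cminus; ring.
  have hb x : Cmod (h x) <= M * tau ^ 2.
    set G := dw (nseq g ord0) (flat u).
    have sG : smooth G by apply: smooth_dw.
    have B s : Rabs (s - t) <= Rabs tau -> Cmod (pd ord0 (pd ord0 G) (tx s x)) <= M / 2.
      move=> _; have := HK g.+2 s [::] x; rewrite /fpow /= /Rpower ln_1 Rmult_0_r exp_0 => b.
      by apply: Rle_trans b _; rewrite /M /fpow /Rpower /=; right; field.
    have t1 := taylor_le _ _ _ t tau (M / 2) (fun s => proj1 (slice_deriv G x s sG))
      (fun s => proj1 (slice_deriv _ x s (smooth_pd _ _ sG))) (fun s hs => Rle_trans _ _ _ (Re_le_Cmod _) (B s hs)).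
    have t2 := taylor_le _ _ _ t tau (M / 2) (fun s => proj2 (slice_deriv G x s sG))
      (fun s => proj2 (slice_deriv _ x s (smooth_pd _ _ sG))) (fun s hs => Rle_trans _ _ _ (Im_le_Cmod _) (B s hs)).
    apply: Rle_trans (Cmod_le_abs _) _.
    have hx : h x = Cplus (Cplus (G (tx (t + tau) x)) (Cmult (RtoC (-1)) (G (tx t x))))
      (Cmult (RtoC (- tau)) (pd ord0 G (tx t x))) by [].
    have e1 : Re (h x) = Re (G (tx (t + tau) x)) - Re (G (tx t x)) - tau * Re (pd ord0 G (tx t x)).
      rewrite hx; move: (G (tx (t + tau) x)) (G (tx t x)) (pd ord0 G (tx t x)) => z1 z2 z3.
      by rewrite /= /Re /Im; ring.
    have e2 : Im (h x) = Im (G (tx (t + tau) x)) - Im (G (tx t x)) - tau * Im (pd ord0 G (tx t x)).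
      rewrite hx; move: (G (tx (t + tau) x)) (G (tx t x)) (pd ord0 G (tx t x)) => z1 z2 z3.
      by rewrite /= /Re /Im; ring.
    by rewrite e1 e2; lra.
  apply: Rle_trans (intC_abs _ (M * tau ^ 2 * K1) (nice_inner _ _ nh np) _) _; last by right; ring.
  move=> x; rewrite /cmul /cconj Cmod_mult Cmod_conj Rmult_assoc.
  by apply: Rmult_le_compat => //; exact: Cmod_ge_0.
split; apply: (derive_quadratic _ _ _ (2 * (M * K1 * PI ^ n))) => tau _; apply: Rle_trans (T tau).
  apply: Rle_trans (Re_le_Cmod _); right; congr Rabs.
  by move: (inner (tder g.+1 u t) phi) => z; rewrite /= /Re /Im; ring.
apply: Rle_trans (Im_le_Cmod _); right; congr Rabs.
by move: (inner (tder g.+1 u t) phi) => z; rewrite /= /Re /Im; ring.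
Qed.

(** Each factor 1 + x_i^2 taken out of the weight consumes two letters and doubles the bound. The
    point x is fixed, so the bounds on words need only hold there. *)
Lemma Wt_words (l : seq 'I_n) (h : F) B x : nice h ->
  (forall w, (size w <= (size l).*2)%N -> Cmod (zw w h x) <= B) -> Cmod (h x) <= 2 ^ size l * B * Wt l x.
Proof.
elim: l h B => [|i l IH] h B nh H; first by have := H [::] isT; rewrite /=; lra.
pose h' := cplus h (Zop (lshift n i) (Zop (lshift n i) h)).
have nz := nice_Z (lshift n i) _ (nice_Z (lshift n i) _ nh).
have nh' : nice h' by apply: nice_plus.
have B' w : (size w <= (size l).*2)%N -> Cmod (zw w h' x) <= 2 * B.
  move=> hw; rewrite zw_plus; [|exact: nice_smooth|exact: nice_smooth].
  apply: Rle_trans (Cmod_triangle _ _) _.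
  have b1 := H w (ltac:(by rewrite /=; lia)).
  have b2 := H (w ++ [:: lshift n i; lshift n i]) (ltac:(by rewrite size_cat /=; lia)).
  by rewrite zw_cat /= in b2; lra.
have := IH h' (2 * B) nh' B'.
have -> : h' x = Cmult (RtoC (1 + x i * x i)) (h x).
  by rewrite /h' /cplus !Zop_l RtoC_plus RtoC_mult; ring.
rewrite Cmod_mult Cmod_R Rabs_pos_eq; last nra.
have w0 := w1_pos (x i); have ww : w1 (x i) * (1 + x i * x i) = 1.
  by rewrite /w1 /Rsqr; field; have := Rle_0_sqr (x i); rewrite /Rsqr; lra.
move=> h1; have := Rmult_le_compat_l _ _ _ (Rlt_le _ _ w0) h1.
by rewrite -Rmult_assoc ww Rmult_1_l /=; lra.
Qed.
Lemma nrm_words (h : F) B : nice h -> 0 <= B ->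
  (forall w x, (size w <= n.*2)%N -> Cmod (zw w h x) <= B) -> nrm h <= 2 ^ n * B * sqrt (PI ^ n).
Proof.
move=> nh B0 H; apply: nrm_decay => //.
  by apply: Rmult_le_pos => //; apply: pow_le; lra.
have sz : size (catrev (enum 'I_n) [::]) = n by rewrite catrevE cats0 size_rev size_enum_ord.
move=> x; have := Wt_words (catrev (enum 'I_n) [::]) h B x nh; rewrite sz; apply=> w hw.
exact: H.
Qed.

Variables (c : mindex n -> mindex n -> R) (m : nat).
Definition Pit (M : nat) (g : F) : F := iter M (Pop c m) g.
Lemma nice_Pop g : nice g -> nice (Pop c m g).
Proof.
move=> ng; rewrite Pop_lsum; last exact: nice_smooth.
by apply: nice_lsum => z; apply: nice_zw.
Qed.
Lemma nice_Pit M g : nice g -> nice (Pit M g).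
Proof. by move=> ng; elim: M => [//|M IH]; apply: nice_Pop. Qed.
Lemma Pit_words (b : nat -> R) g x : nice g -> (forall N N', (N <= N')%N -> b N <= b N') ->
  (forall w, Cmod (zw w g x) <= b (size w)) -> forall M w,
  Cmod (zw w (Pit M g) x) <= (\rsum_(z <- ple m) Cmod (pcoef c m z)) ^ M * b (size w + m * M)%N.
Proof.
move=> ng bm H; set k1 := \rsum_(z <- ple m) _.
have k10 : 0 <= k1 by apply: rsum_ge0 => z; exact: Cmod_ge_0.
elim=> [|M IH] w; first by rewrite muln0 addn0 /= Rmult_1_l.
have nM := nice_Pit M g ng.
rewrite /Pit iterS -/(Pit M g) Pop_lsum; last exact: nice_smooth.
rewrite zw_lsum; last by move=> z; apply/nice_smooth/nice_zw.
rewrite lsumE; apply: Rle_trans (csum_mod _ _) _.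
have -> : k1 ^ M.+1 * b (size w + m * M.+1)%N = k1 * (k1 ^ M * b (size w + m * M.+1)%N) by rewrite /=; ring.
rewrite /k1 -rsum_distr; apply: rsum_le_in => z; rewrite mem_filter => /andP[dz _].
rewrite Cmod_mult; apply: Rmult_le_compat_l; first exact: Cmod_ge_0.
rewrite -zw_cat; apply: Rle_trans (IH _) _; apply: Rmult_le_compat_l; first exact: pow_le.
by apply: bm; rewrite size_cat size_pword; lia.
Qed.

Lemma coef_decay u sigma mu : (0 < m)%N -> 1 / 2 <= mu -> self_adjoint c m -> @S_sm n sigma mu u ->
  exists eps K D, 0 < eps /\ 0 <= K /\ 1 <= D /\
  forall (phi : F) (lam : R), nice phi -> Pop c m phi = cscal (RtoC lam) phi -> nrm phi = 1 ->
    forall g t, Cmod (inner (tder g u t) phi)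
      <= K * (D ^ g * fpow g sigma) * exp (- eps * Rpower (1 + Rabs lam) (/ (INR m * mu))).
Proof.
move=> m0 hm sa S; have [K0 [D0 [K00 [D01 HK]]]] := F_words u sigma mu hm S.
set k1 := \rsum_(z <- ple m) Cmod (pcoef c m z).
have k10 : 0 <= k1 by apply: rsum_ge0 => z; exact: Cmod_ge_0.
have mp : 0 <= mu by lra.
have [K1 [D1 [K10 [D11 H1]]]] := fact_mult_growth m n.*2 mu mp.
(* The factor 2, here and in [Kc], comes from (1 + |lam|)^M <= 2^M (1 + |lam|^M): moments are
   computed with |lam|, but the decay is expressed in 1 + |lam|, which stays away from 0. *)
pose D2 := 2 * ((k1 + 1) * D0 ^ m * D1).
have Dm1 : 1 <= D0 ^ m by apply: pow_R1_Rle.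
have x1 : 1 <= (k1 + 1) * D0 ^ m by nra.
have x2 : 1 <= (k1 + 1) * D0 ^ m * D1 by nra.
have D21 : 1 <= D2 by rewrite /D2; lra.
have mR : 0 < INR m by apply: lt_0_INR; apply/ltP.
have kap0 : 0 < INR m * mu by apply: Rmult_lt_0_compat; lra.
have [eps [K2 [e0 [K20 HD]]]] := decay_from_moments (INR m * mu) D2 kap0 D21.
pose Kc := 2 * (2 ^ n * (D0 ^ n.*2 * K1) * sqrt (PI ^ n)).
have Kc0 : 0 <= Kc.
  apply: Rmult_le_pos; first lra; apply: Rmult_le_pos; last exact: sqrt_pos.
  by apply: Rmult_le_pos; [apply: pow_le; lra | apply: Rmult_le_pos => //; apply: pow_le; lra].
exists eps, (K2 * Kc * K0), D0; split=> //; split.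
  by apply: Rmult_le_pos => //; apply: Rmult_le_pos.
split=> //; move=> phi lam np eig n1 g t.
pose Kg := K0 * (D0 ^ g * fpow g sigma).
have Kg0 : 0 <= Kg.
  by apply: Rmult_le_pos => //; apply: Rmult_le_pos; [apply: pow_le; lra | left; exact: fpow_pos].
have nt : nice (tder g u t) := nice_tder u sigma mu g t hm S.
set z := inner _ _.
have Pz M : Cmult (RtoC (lam ^ M)) z = inner (Pit M (tder g u t)) phi.
  elim: M => [|M IH]; first by rewrite /= Cmult_1l.
  have nM := nice_Pit M _ nt.
  rewrite /Pit iterS -/(Pit M (tder g u t)) sa; [|exact: nice_schwartz|exact: nice_schwartz].
  rewrite eig inner_scalr // -IH Cconj_R /= RtoC_mult; ring.
have bnd M : Rabs lam ^ M * Cmod z <= Kc / 2 * Kg * (D2 / 2) ^ M * fpow M (INR m * mu).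
  have -> : Rabs lam ^ M * Cmod z = Cmod (inner (Pit M (tder g u t)) phi).
    by rewrite -Pz Cmod_mult Cmod_R RPow_abs.
  have nM := nice_Pit M _ nt.
  apply: Rle_trans (cauchy_schwarz _ _ nM np) _; rewrite n1 Rmult_1_r.
  pose bb N := Kg * (D0 ^ N * fpow N mu).
  have bb0 N : 0 <= D0 ^ N * fpow N mu by apply: Rmult_le_pos; [apply: pow_le; lra | left; exact: fpow_pos].
  have bbm N N' : (N <= N')%N -> bb N <= bb N'.
    move=> NN; apply: Rmult_le_compat_l => //; apply: Rmult_le_compat.
    - by apply: pow_le; lra.
    - by left; exact: fpow_pos.
    - by apply: Rle_pow => //; lia.
    apply: Rpower_le_base => //; first exact: INR_fact_lt_0.
    by apply: le_INR; apply: fact_le; lia.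
  have W := Pit_words bb (tder g u t) _ nt bbm (fun w => HK g t w _) M.
  have B0 : 0 <= k1 ^ M * bb (n.*2 + m * M)%N.
    by apply: Rmult_le_pos; [exact: pow_le | apply: Rmult_le_pos].
  apply: Rle_trans (nrm_words _ _ nM B0 _) _.
    move=> w x hw; apply: Rle_trans (W x w) _; rewrite -/k1; apply: Rmult_le_compat_l; first exact: pow_le.
    by apply: bbm; lia.
  have F1 := H1 M; rewrite addnC in F1.
  set f := fpow (n.*2 + m * M) mu in F1.
  have -> : D2 / 2 = (k1 + 1) * D0 ^ m * D1 by rewrite /D2; field.
  have -> : Kc / 2 = 2 ^ n * (D0 ^ n.*2 * K1) * sqrt (PI ^ n) by rewrite /Kc; field.
  have Dp : D0 ^ (n.*2 + m * M) = D0 ^ n.*2 * (D0 ^ m) ^ M by rewrite -pow_mult -pow_add.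
  rewrite /bb Dp -/f.
  have c1 : k1 ^ M <= (k1 + 1) ^ M by apply: pow_incr; lra.
  set s := sqrt _; have s0 : 0 <= s by exact: sqrt_pos.
  have t0 : 0 <= 2 ^ n by apply: pow_le; lra.
  have d0 : 0 <= D0 ^ n.*2 by apply: pow_le; lra.
  have d1 : 0 <= (D0 ^ m) ^ M by apply: pow_le; lra.
  have f0 : 0 <= f by left; exact: fpow_pos.
  have k0 : 0 <= k1 ^ M by exact: pow_le.
  have cc : k1 ^ M * f <= (k1 + 1) ^ M * (K1 * D1 ^ M * fpow M (INR m * mu)) by apply: Rmult_le_compat.
  have A0 : 0 <= 2 ^ n * s * Kg * D0 ^ n.*2 * (D0 ^ m) ^ M by do 4 (apply: Rmult_le_pos => //).
  have := Rmult_le_compat_l _ _ _ A0 cc; rewrite !Rpow_mult_distr => h.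
  by apply: Rle_trans (Rle_trans _ _ _ _ h) _; right; ring.
have X1 : 1 <= 1 + Rabs lam by have := Rabs_pos lam; lra.
have := HD (1 + Rabs lam) (Cmod z) (Kc * Kg) X1 (Cmod_ge_0 _) (Rmult_le_pos _ _ Kc0 Kg0).
move=> h; apply: Rle_trans (h _) _; last by right; rewrite /Kg; ring.
move=> M; have z0 := Cmod_ge_0 z.
have a0 := Rabs_pos lam.
have e1 : (1 + Rabs lam) ^ M <= 2 ^ M * (1 + Rabs lam ^ M).
  apply: Rle_trans (_ : (2 * Rmax 1 (Rabs lam)) ^ M <= _).
    by apply: pow_incr; split; [lra | have := Rmax_l 1 (Rabs lam); have := Rmax_r 1 (Rabs lam); lra].
  rewrite Rpow_mult_distr; apply: Rmult_le_compat_l; first by apply: pow_le; lra.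
  have pa := pow_le _ M a0.
  by rewrite /Rmax; case: Rle_dec => _; rewrite ?pow1; lra.
have b0 := bnd 0%N; have bM := bnd M.
rewrite /fpow /= /Rpower ln_1 Rmult_0_r exp_0 !Rmult_1_r Rmult_1_l in b0.
have -> : D2 ^ M = 2 ^ M * (D2 / 2) ^ M by rewrite -Rpow_mult_distr; congr (_ ^ _); field.
have d2 : 1 <= (D2 / 2) ^ M by apply: pow_R1_Rle; rewrite /D2; lra.
have fM : 1 <= fpow M (INR m * mu) by apply: fpow_ge1; lra.
have KK : 0 <= Kc / 2 * Kg by apply: Rmult_le_pos => //; lra.
have df : 1 <= (D2 / 2) ^ M * fpow M (INR m * mu) by nra.
have b0' : Cmod z <= Kc / 2 * Kg * ((D2 / 2) ^ M * fpow M (INR m * mu)).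
  by apply: Rle_trans b0 _; rewrite -{1}(Rmult_1_r (Kc / 2 * Kg)); apply: Rmult_le_compat_l.
have p2 : 0 <= 2 ^ M by apply: pow_le; lra.
apply: Rle_trans (Rmult_le_compat_r _ _ _ z0 e1) _.
have -> : 2 ^ M * (1 + Rabs lam ^ M) * Cmod z = 2 ^ M * (Cmod z + Rabs lam ^ M * Cmod z) by ring.
apply: Rle_trans (Rmult_le_compat_l _ _ _ p2 (Rplus_le_compat _ _ _ _ b0' bM)) _.
by right; field.
Qed.
End Slices.

(** * The scalar equations *)

Lemma is_dC_const c t : is_dC (fun _ => c) t (RtoC 0).
Proof. by split; apply: is_derive_const. Qed.
Lemma is_dC_plus f g t lf lg : is_dC f t lf -> is_dC g t lg -> is_dC (fun t => Cplus (f t) (g t)) t (Cplus lf lg).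
Proof.
case=> a1 a2 [b1 b2]; split.
  exact: (is_derive_plus (V := R_NormedModule) _ _ _ _ _ a1 b1).
exact: (is_derive_plus (V := R_NormedModule) _ _ _ _ _ a2 b2).
Qed.
Lemma is_dC_mult f g t lf lg : is_dC f t lf -> is_dC g t lg ->
  is_dC (fun t => Cmult (f t) (g t)) t (Cplus (Cmult lf (g t)) (Cmult (f t) lg)).
Proof.
case=> a1 a2 [b1 b2]; split; rewrite /=.
  have H := is_derive_minus (V := R_NormedModule) _ _ _ _ _
    (is_derive_mult _ _ _ _ _ a1 b1 Rmult_comm) (is_derive_mult _ _ _ _ _ a2 b2 Rmult_comm).
  evar_last; first exact: H.
  by rewrite /minus /plus /opp /mult /= /Re /Im; ring.
have H := is_derive_plus (V := R_NormedModule) _ _ _ _ _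
  (is_derive_mult _ _ _ _ _ a1 b2 Rmult_comm) (is_derive_mult _ _ _ _ _ a2 b1 Rmult_comm).
evar_last; first exact: H.
by rewrite /plus /mult /= /Re /Im; ring.
Qed.
Lemma is_dC_scal c f t l : is_dC f t l -> is_dC (fun t => Cmult c (f t)) t (Cmult c l).
Proof.
move=> h; have := is_dC_mult _ _ _ _ _ (is_dC_const c t) h.
by rewrite (_ : Cplus _ _ = Cmult c l) //; ring.
Qed.
Lemma is_dC_eq f t l l' : l = l' -> is_dC f t l -> is_dC f t l'. Proof. by move=> ->. Qed.
Lemma is_dC_shift f t l a : is_dC f (t + a) l -> is_dC (fun t => f (t + a)) t l.
Proof.
have H (g : R -> R) d : is_derive g (t + a) d -> is_derive (fun t => g (t + a)) t d.
  move=> h; have := is_derive_comp g (fun t => t + a) t d 1 h.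
  rewrite /scal /= /mult /= Rmult_1_l; apply.
  by auto_derive=> //; ring.
by case=> h1 h2; split; apply: (H (fun t => _ (f t))).
Qed.
Lemma mvt_seg (f df : R -> R) (s t M : R) : (forall r, is_derive f r (df r)) ->
  (forall r, Rmin s t <= r <= Rmax s t -> Rabs (df r) <= M) -> Rabs (f t - f s) <= M * Rabs (t - s).
Proof.
move=> H B.
have [c [hc ->]] : exists c, Rmin s t <= c <= Rmax s t /\ f t - f s = df c * (t - s).
  apply: MVT_gen => [x _|x _]; first exact: H.
  by apply/continuity_pt_filterlim/(ex_derive_continuous (V := R_NormedModule)); exists (df x).
by rewrite Rabs_mult; apply: Rmult_le_compat_r; [exact: Rabs_pos | exact: B].
Qed.
Lemma mvt_segC (f df : R -> C) (s t M : R) : (forall r, is_dC f r (df r)) ->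
  (forall r, Rmin s t <= r <= Rmax s t -> Cmod (df r) <= M) -> Cmod (Cminus (f t) (f s)) <= 2 * M * Rabs (t - s).
Proof.
move=> H B; apply: Rle_trans (Cmod_le_abs _) _.
have h1 := mvt_seg _ _ s t M (fun r => proj1 (H r)) (fun r hr => Rle_trans _ _ _ (Re_le_Cmod _) (B r hr)).
have h2 := mvt_seg _ _ s t M (fun r => proj2 (H r)) (fun r hr => Rle_trans _ _ _ (Im_le_Cmod _) (B r hr)).
by rewrite (_ : Re (Cminus (f t) (f s)) = Re (f t) - Re (f s)) // (_ : Im (Cminus (f t) (f s)) = Im (f t) - Im (f s)) //; lra.
Qed.
Lemma is_dC0_const (f : R -> C) s t : (forall r, is_dC f r (RtoC 0)) -> f t = f s.
Proof.
move=> H; have := mvt_segC f _ s t 0 H (fun r _ => ltac:(rewrite Cmod_0; lra)).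
rewrite Rmult_0_r Rmult_0_l => h.
have E : Cminus (f t) (f s) = RtoC 0 by apply: Cmod_eq_0; have := Cmod_ge_0 (Cminus (f t) (f s)); lra.
have -> : f t = Cplus (Cminus (f t) (f s)) (f s) by rewrite /Cminus; ring.
by rewrite E; ring.
Qed.

Lemma cexp_deriv (x y : R -> R) t dx dy : is_derive x t dx -> is_derive y t dy ->
  is_dC (fun t => cexp (x t, y t)) t (Cmult (dx, dy) (cexp (x t, y t))).
Proof.
move=> hx hy.
have ex := is_derive_comp exp x t _ _ (is_derive_exp (x t)) hx.
have cy := is_derive_comp cos y t _ _ (is_derive_cos (y t)) hy.
have sy := is_derive_comp sin y t _ _ (is_derive_sin (y t)) hy.
split; rewrite /cexp /=.
  evar_last; first exact: (is_derive_mult _ _ _ _ _ ex cy Rmult_comm).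
  by rewrite /plus /scal /= /mult /= /Re /Im /=; ring.
evar_last; first exact: (is_derive_mult _ _ _ _ _ ex sy Rmult_comm).
by rewrite /plus /scal /= /mult /= /Re /Im /=; ring.
Qed.
Lemma cexp_mod z : Cmod (cexp z) = exp (Re z).
Proof.
rewrite /Cmod /cexp /=.
have -> : exp (Re z) * cos (Im z) * (exp (Re z) * cos (Im z) * 1) + exp (Re z) * sin (Im z) * (exp (Re z) * sin (Im z) * 1)
  = exp (Re z) * exp (Re z).
  have := sin2_cos2 (Im z); rewrite /Rsqr => E.
  transitivity (exp (Re z) * exp (Re z) * (sin (Im z) * sin (Im z) + cos (Im z) * cos (Im z))); first ring.
  by rewrite E; ring.
by rewrite sqrt_square //; left; exact: exp_pos.
Qed.
Lemma cexp_inv z : Cmult (cexp (Copp z)) (cexp z) = RtoC 1.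
Proof.
have E : exp (- Re z) * exp (Re z) = 1 by rewrite -exp_plus -exp_0; congr exp; ring.
have T := sin2_cos2 (Im z); rewrite /Rsqr in T.
apply: C_ext; rewrite /cexp /= cos_neg sin_neg.
  transitivity ((exp (- Re z) * exp (Re z)) * (sin (Im z) * sin (Im z) + cos (Im z) * cos (Im z))); last by rewrite E T; ring.
  by rewrite /Re /Im; ring.
by rewrite /Re /Im; ring.
Qed.

Section ODE.
Variables (lam a0 : R) (b : R -> R) (f : R -> C).
Hypotheses (cb : forall t, continuous b t) (pb : forall t, b (t + 2 * PI) = b t).
Hypotheses (cf1 : forall t, continuous (fun t => Re (f t)) t) (cf2 : forall t, continuous (fun t => Im (f t)) t).
Hypothesis (pf : forall t, f (t + 2 * PI) = f t).

Definition primitive t := RInt b 0 t.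
Definition int_factor t : C := cexp (Cmult (Cmult Ci (RtoC lam)) (a0 * t, primitive t)).
Definition int_factor_inv t : C := cexp (Copp (Cmult (Cmult Ci (RtoC lam)) (a0 * t, primitive t))).
Definition coefG t : C := Cmult (Cmult Ci (RtoC lam)) (a0, b t).
Definition solves (U : R -> C) := forall t, is_dC U t (Cminus (Cmult Ci (f t)) (Cmult (coefG t) (U t))).

Lemma RInt_deriv (g : R -> R) t : (forall t, continuous g t) -> is_derive (fun t => RInt g 0 t) t (g t).
Proof.
move=> cg; apply: (is_derive_RInt g _ 0 t (filter_forall _ _)) => // x.
by apply: (RInt_correct (V := R_CompleteNormedModule)); apply: cont_ex_RInt.
Qed.
Lemma primitive_deriv t : is_derive primitive t (b t). Proof. exact: RInt_deriv. Qed.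
Lemma int_factorE t : int_factor t = cexp (- lam * primitive t, lam * a0 * t).
Proof. by rewrite /int_factor; congr cexp; apply: C_ext; rewrite /= /Re /Im /=; ring. Qed.
Lemma int_factor_invE t : int_factor_inv t = cexp (lam * primitive t, - lam * a0 * t).
Proof. by rewrite /int_factor_inv; congr cexp; apply: C_ext; rewrite /= /Re /Im /=; ring. Qed.
Lemma int_factor_mod t : Cmod (int_factor t) = exp (- lam * primitive t).
Proof. by rewrite int_factorE cexp_mod. Qed.
Lemma int_factor_inv_mod t : Cmod (int_factor_inv t) = exp (lam * primitive t).
Proof. by rewrite int_factor_invE cexp_mod. Qed.
Lemma int_factorK t : Cmult (int_factor_inv t) (int_factor t) = RtoC 1. Proof. exact: cexp_inv. Qed.
Lemma lin_deriv c t : is_derive (fun t => c * t) t c.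
Proof. by auto_derive => //; ring. Qed.
Lemma int_factor_deriv t : is_dC int_factor t (Cmult (coefG t) (int_factor t)).
Proof.
have := cexp_deriv (fun t => - lam * primitive t) (fun t => lam * a0 * t) t _ _
   (is_derive_scal _ _ (- lam) _ (primitive_deriv t)) (lin_deriv (lam * a0) t).
have -> : int_factor = fun t => cexp (- lam * primitive t, lam * a0 * t) by apply: fext => s; exact: int_factorE.
apply: is_dC_eq; congr Cmult; apply: C_ext; rewrite /coefG /scal /= /mult /= /Re /Im /=; ring.
Qed.
Lemma int_factor_inv_deriv t : is_dC int_factor_inv t (Cmult (Copp (coefG t)) (int_factor_inv t)).
Proof.
have := cexp_deriv (fun t => lam * primitive t) (fun t => - lam * a0 * t) t _ _
   (is_derive_scal _ _ lam _ (primitive_deriv t)) (lin_deriv (- lam * a0) t).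
have -> : int_factor_inv = fun t => cexp (lam * primitive t, - lam * a0 * t) by apply: fext => s; exact: int_factor_invE.
apply: is_dC_eq; congr Cmult; apply: C_ext; rewrite /coefG /scal /= /mult /= /Re /Im /=; ring.
Qed.
Lemma dC_cont (g : R -> C) t l : is_dC g t l -> continuous (fun t => Re (g t)) t /\ continuous (fun t => Im (g t)) t.
Proof. by case=> h1 h2; split; apply: (ex_derive_continuous (V := R_NormedModule)); eexists; eassumption. Qed.

(** Its value at 2 PI is the integral that the admissibility condition sets to zero for resonant
    indices. *)
Definition weighted_primitive t : C := (RInt (fun t => Re (Cmult (int_factor t) (f t))) 0 t, RInt (fun t => Im (Cmult (int_factor t) (f t))) 0 t).
Lemma weighted_primitive_deriv t : is_dC weighted_primitive t (Cmult (int_factor t) (f t)).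
Proof.
have c1 s := proj1 (dC_cont _ _ _ (int_factor_deriv s)); have c2 s := proj2 (dC_cont _ _ _ (int_factor_deriv s)).
split.
  apply: RInt_deriv => s; apply: (continuous_minus (V := R_NormedModule)).
    exact: (continuous_mult (K := R_AbsRing) _ _ _ (c1 s) (cf1 s)).
  exact: (continuous_mult (K := R_AbsRing) _ _ _ (c2 s) (cf2 s)).
apply: RInt_deriv => s; apply: (continuous_plus (V := R_NormedModule)).
  exact: (continuous_mult (K := R_AbsRing) _ _ _ (c1 s) (cf2 s)).
exact: (continuous_mult (K := R_AbsRing) _ _ _ (c2 s) (cf1 s)).
Qed.
Lemma solution kap : solves (fun t => Cmult (int_factor_inv t) (Cplus (Cmult Ci (weighted_primitive t)) kap)).
Proof.
move=> t.
have d1 := is_dC_plus _ _ _ _ _ (is_dC_scal Ci _ _ _ (weighted_primitive_deriv t)) (is_dC_const kap t).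
apply: is_dC_eq (is_dC_mult _ _ _ _ _ (int_factor_inv_deriv t) d1).
transitivity (Cminus (Cmult (Cmult (int_factor_inv t) (int_factor t)) (Cmult Ci (f t))) (Cmult (coefG t) (Cmult (int_factor_inv t) (Cplus (Cmult Ci (weighted_primitive t)) kap)))).
  by rewrite /Cminus; ring.
by rewrite int_factorK Cmult_1l.
Qed.
Lemma coefG_per t : coefG (t + 2 * PI) = coefG t.
Proof. by rewrite /coefG pb. Qed.
(** The difference of U and its translate solves the homogeneous equation and vanishes at 0;
    multiplied by the integrating factor it is constant, hence zero. *)
Lemma solves_periodic U : solves U -> U (2 * PI) = U 0 -> forall t, U (t + 2 * PI) = U t.
Proof.
move=> sU U0 t; pose D t := Cplus (U (t + 2 * PI)) (Cmult (RtoC (-1)) (U t)).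
have dD s : is_dC (fun t => Cmult (int_factor t) (D t)) s (RtoC 0).
  have h1 := is_dC_shift _ _ _ _ (sU (s + 2 * PI)).
  have h2 := is_dC_plus _ _ _ _ _ h1 (is_dC_scal (RtoC (-1)) _ _ _ (sU s)).
  apply: is_dC_eq (is_dC_mult _ _ _ _ _ (int_factor_deriv s) h2).
  by rewrite coefG_per pf /D; apply: C_ext; rewrite /= /Re /Im; ring.
have := is_dC0_const _ 0 t dD; rewrite {2}/D Rplus_0_l U0 => E.
have : Cmult (int_factor_inv t) (Cmult (int_factor t) (D t)) = RtoC 0.
  by rewrite E (_ : Cplus (U 0) _ = RtoC 0) ?Cmult_0_r //; apply: C_ext; rewrite /= /Re /Im; ring.
rewrite Cmult_assoc int_factorK Cmult_1l /D => h.
have -> : U (t + 2 * PI) = Cplus (Cplus (U (t + 2 * PI)) (Cmult (RtoC (-1)) (U t))) (U t).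
  by apply: C_ext; rewrite /= /Re /Im; ring.
by rewrite h; ring.
Qed.
Lemma weighted_primitive_0 : weighted_primitive 0 = RtoC 0.
Proof. by rewrite /weighted_primitive !RInt_point. Qed.
Lemma int_factor_0 : int_factor 0 = RtoC 1 /\ int_factor_inv 0 = RtoC 1.
Proof.
have B0 : primitive 0 = 0 by rewrite /primitive RInt_point.
by rewrite int_factorE int_factor_invE B0 !Rmult_0_r /cexp /= exp_0 cos_0 sin_0; split; apply: C_ext; rewrite /=; ring.
Qed.
Lemma ode_nonres : int_factor (2 * PI) <> RtoC 1 -> exists2 U, solves U & forall t, U (t + 2 * PI) = U t.
Proof.
move=> ne; set q := int_factor (2 * PI) in ne *.
have qn : Cminus q (RtoC 1) <> RtoC 0.
  by move=> h; apply: ne; have -> : q = Cplus (Cminus q (RtoC 1)) (RtoC 1) by [rewrite /Cminus; ring]; rewrite h; ring.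
(* Solves the closing condition U(2 PI) = U(0), that is i H + kap = q kap with H the weighted
   primitive at 2 PI. *)
pose kap := Cdiv (Cmult Ci (weighted_primitive (2 * PI))) (Cminus q (RtoC 1)).
have sol := solution kap; eexists; first exact: sol.
apply: solves_periodic => //.
rewrite weighted_primitive_0 (proj2 int_factor_0); set h := weighted_primitive _.
have k1 : Cplus (Cmult Ci h) kap = Cmult q kap.
  rewrite /kap -/h; field; exact: qn.
rewrite k1 Cmult_assoc int_factorK; ring.
Qed.
(** In the resonant case every constant [kap] gives a periodic solution; the freedom is used to make
    U vanish at a chosen point, from which it will be estimated. *)
Lemma ode_res t0 : int_factor (2 * PI) = RtoC 1 -> weighted_primitive (2 * PI) = RtoC 0 ->
  exists2 U, solves U & (forall t, U (t + 2 * PI) = U t) /\ U t0 = RtoC 0.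
Proof.
move=> q1 h0; pose kap := Copp (Cmult Ci (weighted_primitive t0)).
have sol := solution kap; eexists; first exact: sol; split; last first.
  by rewrite /kap; ring.
apply: solves_periodic => //.
have := int_factorK (2 * PI); rewrite q1 weighted_primitive_0 h0 (proj2 int_factor_0) => e.
have -> : int_factor_inv (2 * PI) = RtoC 1 by rewrite -e; ring.
ring.
Qed.
(** The modulus of the inverse factor at t times the factor at r is exp(lam (B t - B r)), the only
    source of growth. It is controlled between s and t in either order, so the equation may be
    integrated forwards or backwards. *)
Lemma ode_var U s t M S : solves U -> (forall r, Cmod (f r) <= M) -> 
  (forall r, Rmin s t <= r <= Rmax s t -> exp (lam * (primitive t - primitive r)) <= S) ->
  Cmod (Cminus (U t) (Cmult (Cmult (int_factor_inv t) (int_factor s)) (U s))) <= 2 * (S * M) * Rabs (t - s).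
Proof.
move=> sU fM HS.
have M0 : 0 <= M := Rle_trans _ _ _ (Cmod_ge_0 _) (fM 0).
pose V r := Cmult (int_factor_inv t) (Cmult (int_factor r) (U r)).
have dV r : is_dC V r (Cmult (Cmult (int_factor_inv t) (int_factor r)) (Cmult Ci (f r))).
  apply: is_dC_eq (is_dC_scal (int_factor_inv t) _ _ _ (is_dC_mult _ _ _ _ _ (int_factor_deriv r) (sU r))).
  by rewrite /Cminus; ring.
have -> : Cminus (U t) (Cmult (Cmult (int_factor_inv t) (int_factor s)) (U s)) = Cminus (V t) (V s).
  have -> : U t = V t by rewrite /V Cmult_assoc int_factorK Cmult_1l.
  by rewrite /V /Cminus; ring.
apply: (mvt_segC V _ s t _ dV) => r hr; rewrite !Cmod_mult Cmod_Ci Rmult_1_l int_factor_inv_mod int_factor_mod -exp_plus.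
apply: Rmult_le_compat => //; [by left; exact: exp_pos | exact: Cmod_ge_0 |].
by apply: Rle_trans (HS r hr); right; congr exp; ring.
Qed.
Lemma primitive_period t : primitive (t + 2 * PI) = primitive t + primitive (2 * PI).
Proof.
have d r : is_derive (fun t => primitive (t + 2 * PI) - primitive t) r 0.
  have h1 := is_derive_comp primitive (fun t => t + 2 * PI) r _ 1 (primitive_deriv (r + 2 * PI)).
  evar_last; first apply: (is_derive_minus (V := R_NormedModule)); first apply: h1.
  - by auto_derive => //; ring.
  - exact: primitive_deriv.
  by rewrite pb /minus /plus /opp /scal /= /mult /=; ring.
have := mvt_seg _ _ 0 t 0 d (fun r _ => ltac:(rewrite Rabs_R0; lra)).
rewrite Rmult_0_l Rplus_0_l (_ : primitive 0 = 0); last by rewrite /primitive RInt_point.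
by move=> h; have := Rabs_pos (primitive (t + 2 * PI) - primitive t - (primitive (2 * PI) - 0)) => h2;
   have : Rabs (primitive (t + 2 * PI) - primitive t - (primitive (2 * PI) - 0)) = 0; [lra | move/Rabs_eq_0; lra].
Qed.
End ODE.

(** * Leibniz formula and Gevrey bounds for the time derivatives *)

Section Leibniz.
Fixpoint pascal (n k : nat) : R :=
  match n, k with _, 0%N => 1 | 0%N, _.+1 => 0 | n'.+1, k'.+1 => pascal n' k' + pascal n' k'.+1 end.
Lemma bn0 n : pascal n 0 = 1. Proof. by case: n. Qed.
Lemma bn_ge0 n k : 0 <= pascal n k.
Proof. by elim: n k => [|n IH] [|k] /=; try lra; have := IH k; have := IH k.+1; lra. Qed.
Lemma bn_big n k : (n < k)%N -> pascal n k = 0.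
Proof. by elim: n k => [|n IH] [|k] //= h; rewrite !IH //; try lia; ring. Qed.
Lemma bn_fact n k : (k <= n)%N -> pascal n k * (INR (fact k) * INR (fact (n - k))) = INR (fact n).
Proof.
have f0 : INR (fact 0) = 1 by [].
elim: n k => [|n IH] [|k] h //; try by rewrite bn0 subn0 f0 !Rmult_1_l.
have fS j : INR (fact j.+1) = INR j.+1 * INR (fact j) by rewrite -mult_INR.
rewrite (_ : pascal n.+1 k.+1 = pascal n k + pascal n k.+1) // subSS.
have h1 := IH k (ltac:(lia)).
have e1 : pascal n k * (INR (fact k.+1) * INR (fact (n - k))) = INR k.+1 * INR (fact n).
  by rewrite -h1 (fS k); move: (INR k.+1) (INR (fact k)) (INR (fact (n - k))) (pascal n k) => *; ring.
rewrite Rmult_plus_distr_r e1 (fS n).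
case: (ltnP k n) => kn; last first.
  by rewrite bn_big ?ltnS // (_ : k = n) ?Rmult_0_l ?Rplus_0_r //; lia.
have h2 := IH k.+1 kn.
have -> : (n - k = (n - k.+1).+1)%N by lia.
rewrite (fS (n - k.+1)%N).
have -> : INR n.+1 = INR k.+1 + INR (n - k.+1).+1 by rewrite -plus_INR; congr INR; lia.
rewrite Rmult_plus_distr_r -h2; congr Rplus.
by move: (INR (n - k.+1).+1) (INR (fact k.+1)) (INR (fact (n - k.+1))) => *; ring.
Qed.
Lemma bn_ge1 n k : (k <= n)%N -> 1 <= pascal n k.
Proof.
elim: n k => [|n IH] [|k] h //=; try lra.
by have := IH k h; have := bn_ge0 n k.+1; lra.
Qed.
(** For s >= 1 the binomial coefficient is at most its power s, and that power completes the two
    factorials to n!^s: Gevrey sequences are stable under the Leibniz formula. *)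
Lemma bn_fpow n k s : 1 <= s -> (k <= n)%N -> pascal n k * (fpow k s * fpow (n - k) s) <= fpow n s.
Proof.
move=> s1 kn; have b1 := bn_ge1 n k kn.
rewrite /fpow -(bn_fact n k kn) Rpower_mult_distr; try exact: INR_fact_lt_0.
have p : 0 < INR (fact k) * INR (fact (n - k)) by apply: Rmult_lt_0_compat; exact: INR_fact_lt_0.
rewrite -(Rpower_mult_distr (pascal n k)); [|lra|exact: p].
apply: Rmult_le_compat_r; first by left; exact: Rpower_pos.
by rewrite -{1}(Rpower_1 (pascal n k)); [apply: Rle_Rpower | lra].
Qed.

Definition leib (n : nat) (A B : nat -> C) : C :=
  \csum_(k <- iota 0 n.+1) Cmult (RtoC (pascal n k)) (Cmult (A k) (B (n - k)%N)).
Lemma iotaS_csum n (F : nat -> C) :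
  \csum_(k <- iota 0 n.+1) F k = Cplus (F 0%N) (\csum_(k <- iota 0 n) F k.+1).
Proof. by rewrite /= big_cons -(addn0 1%N) iotaDl big_map. Qed.
Lemma csum_last n (F : nat -> C) :
  \csum_(k <- iota 0 n.+1) F k = Cplus (\csum_(k <- iota 0 n) F k) (F n).
Proof. by rewrite -addn1 iotaD big_cat add0n big_seq1. Qed.
Lemma leib_S n A B : leib n.+1 A B = Cplus (leib n (fun k => A k.+1) B) (leib n A (fun k => B k.+1)).
Proof.
rewrite {1}/leib iotaS_csum bn0 subn0.
have -> : leib n A (fun k => B k.+1) = Cplus (Cmult (RtoC 1) (Cmult (A 0%N) (B n.+1)))
   (\csum_(k <- iota 0 n.+1) Cmult (RtoC (pascal n k.+1)) (Cmult (A k.+1) (B (n - k)%N))).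
  rewrite /leib iotaS_csum bn0 subn0; congr Cplus.
  rewrite csum_last bn_big // Cmult_0_l (_ : forall z, Cplus z (RtoC 0) = z); last by move=> z; ring.
  rewrite big_seq [RHS]big_seq; apply: eq_bigr => k; rewrite mem_iota => /andP[_ kn].
  by congr Cmult; congr Cmult; congr B; lia.
have -> : \csum_(i <- iota 0 n.+1) Cmult (RtoC (pascal n.+1 i.+1)) (Cmult (A i.+1) (B (n.+1 - i.+1)%N)) =
   Cplus (leib n (fun k => A k.+1) B) (\csum_(k <- iota 0 n.+1) Cmult (RtoC (pascal n k.+1)) (Cmult (A k.+1) (B (n - k)%N))).
  rewrite /leib -big_split; apply: eq_bigr => k _ /=; rewrite subSS RtoC_plus; ring.
ring.
Qed.
Lemma leib_deriv n (A B : nat -> R -> C) t :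
  (forall k, (k <= n)%N -> is_dC (A k) t (A k.+1 t)) -> (forall k, (k <= n)%N -> is_dC (B k) t (B k.+1 t)) ->
  is_dC (fun t => leib n (A^~ t) (B^~ t)) t (leib n.+1 (A^~ t) (B^~ t)).
Proof.
move=> HA HB; rewrite leib_S /leib.
have H (l : seq nat) : all (fun k => (k <= n)%N) l ->
   is_dC (fun t => \csum_(k <- l) Cmult (RtoC (pascal n k)) (Cmult (A k t) (B (n - k)%N t))) t
     (Cplus (\csum_(k <- l) Cmult (RtoC (pascal n k)) (Cmult (A k.+1 t) (B (n - k)%N t)))
            (\csum_(k <- l) Cmult (RtoC (pascal n k)) (Cmult (A k t) (B (n - k).+1 t)))).
  elim: l => [_|k l IH /= /andP[kn /IH h]].
    rewrite !big_nil; apply: (eq_ind _ (fun f => is_dC f t _) (is_dC_eq _ _ _ _ _ (is_dC_const (RtoC 0) t))); first ring.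
    by apply: fext => s; rewrite big_nil.
  have d := is_dC_scal (RtoC (pascal n k)) _ _ _ (is_dC_mult _ _ _ _ _ (HA k kn) (HB (n - k)%N (leq_subr _ _))).
  rewrite !big_cons; apply: (eq_ind _ (fun f => is_dC f t _) (is_dC_eq _ _ _ _ _ (is_dC_plus _ _ _ _ _ d h))); first ring.
  by apply: fext => s; rewrite big_cons.
by apply: H; apply/allP => k; rewrite mem_iota; lia.
Qed.

Variables (lam : R) (Gd F : nat -> R -> C) (U : R -> C).
Hypotheses (HG : forall k t, is_dC (Gd k) t (Gd k.+1 t)) (HF : forall k t, is_dC (F k) t (F k.+1 t)).
Hypothesis HU : forall t, is_dC U t (Cminus (Cmult Ci (F 0%N t)) (Cmult (Cmult (Cmult Ci (RtoC lam)) (Gd 0%N t)) (U t))).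

Definition dC (f : R -> C) (t : R) : C := (Derive (fun t => Re (f t)) t, Derive (fun t => Im (f t)) t).
Lemma dC_unique f t l : is_dC f t l -> dC f t = l.
Proof. by case=> h1 h2; apply: C_ext; apply: is_derive_unique. Qed.
Definition dC_iter (k : nat) : R -> C := iter k dC U.

(** Formula and differentiability are proved together: the next derivative is computed from the
    formula, a Leibniz sum involving only derivatives already known to be differentiable. *)
Lemma dC_iter_chain k : forall j, (j <= k)%N ->
  (forall t, dC_iter j.+1 t = Cminus (Cmult Ci (F j t)) (Cmult (Cmult Ci (RtoC lam)) (leib j (Gd^~ t) (dC_iter^~ t)))) /\
  (forall t, is_dC (dC_iter j) t (dC_iter j.+1 t)).
Proof.
have base t : is_dC (dC_iter 0) t (dC_iter 1 t) /\ dC_iter 1 t = Cminus (Cmult Ci (F 0%N t)) (Cmult (Cmult Ci (RtoC lam)) (leib 0 (Gd^~ t) (dC_iter^~ t))).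
  have E := dC_unique _ _ _ (HU t).
  rewrite /dC_iter /= E; split; first exact: HU.
  by rewrite /leib /= big_seq1 /=; rewrite /Cminus; ring.
elim: k => [|k IH] j jk.
  by move: jk; rewrite leqn0 => /eqP ->; split=> t; case: (base t).
case: (leqP j k) => [/IH //|kj].
have -> : j = k.+1 by lia.
have [E1 D1] := IH k (leqnn k).
have D2 t : is_dC (dC_iter k.+1) t (Cminus (Cmult Ci (F k.+1 t)) (Cmult (Cmult Ci (RtoC lam)) (leib k.+1 (Gd^~ t) (dC_iter^~ t)))).
  have -> : dC_iter k.+1 = fun t => Cplus (Cmult Ci (F k t)) (Cmult (Copp (Cmult Ci (RtoC lam))) (leib k (Gd^~ t) (dC_iter^~ t))).
    by apply: fext => s; rewrite E1 /Cminus; ring.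
  have dl : is_dC (fun t => leib k (Gd^~ t) (dC_iter^~ t)) t (leib k.+1 (Gd^~ t) (dC_iter^~ t)).
    by apply: leib_deriv => i ik; [exact: HG | case: (IH i ik) => _; apply].
  apply: is_dC_eq (is_dC_plus _ _ _ _ _ (is_dC_scal Ci _ _ _ (HF k t)) (is_dC_scal _ _ _ _ dl)).
  by rewrite /Cminus; ring.
have E2 t : dC_iter k.+2 t = Cminus (Cmult Ci (F k.+1 t)) (Cmult (Cmult Ci (RtoC lam)) (leib k.+1 (Gd^~ t) (dC_iter^~ t))).
  exact: dC_unique (D2 t).
by split=> t //; rewrite E2.
Qed.
Lemma dC_iter_deriv k t : is_dC (dC_iter k) t (dC_iter k.+1 t).
Proof. by case: (dC_iter_chain k k (leqnn k)) => _; apply. Qed.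
Lemma dC_iter_eq k t : dC_iter k.+1 t = Cminus (Cmult Ci (F k t)) (Cmult (Cmult Ci (RtoC lam)) (leib k (Gd^~ t) (dC_iter^~ t))).
Proof. by case: (dC_iter_chain k k (leqnn k)). Qed.

Variables (s c Kg D B : R).
Hypotheses (s1 : 1 <= s) (c1 : 1 <= c) (Kg0 : 0 <= Kg) (Dc : 2 * c <= D) (DK : 1 + 2 * Kg <= D) (B0 : 0 <= B).
Hypotheses (bG : forall k t, Cmod (Gd k t) <= Kg * (c ^ k * fpow k s)) (bF : forall k t, Cmod (F k t) <= B * (c ^ k * fpow k s)).
Hypothesis bU : forall t, Cmod (U t) <= B.
Let X := 1 + Rabs lam.
(* Differentiating the equation [k] times produces the powers [X ^ i], [i <= k]. *)
Definition gevrey_sum (k : nat) : R := \rsum_(i <- iota 0 k.+1) (X ^ i / fpow i s).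
Lemma gevrey_sum_ge1 k : 1 <= gevrey_sum k.
Proof.
have X0 : 0 <= X by rewrite /X; have := Rabs_pos lam; lra.
rewrite /gevrey_sum /= big_cons {1}/fpow /= /Rpower ln_1 Rmult_0_r exp_0.
have : 0 <= \rsum_(j <- iota 1 k) (X ^ j / fpow j s).
  by apply: rsum_ge0 => i; apply: Rmult_le_pos; [exact: pow_le | left; apply: Rinv_0_lt_compat; exact: fpow_pos].
by move=> h; rewrite /Rdiv Rinv_1 Rmult_1_r; lra.
Qed.
Lemma gevrey_sum_mono k k' : (k <= k')%N -> gevrey_sum k <= gevrey_sum k'.
Proof.
have X0 : 0 <= X by rewrite /X; have := Rabs_pos lam; lra.
move=> h; rewrite /gevrey_sum (_ : k'.+1 = k.+1 + (k' - k))%N; last lia.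
rewrite iotaD big_cat /=; set a := \big[_/_]_(i <- _ :: _) _.
have : 0 <= \rsum_(i <- iota (0 + k.+1) (k' - k)) (X ^ i / fpow i s).
  by apply: rsum_ge0 => i; apply: Rmult_le_pos; [exact: pow_le | left; apply: Rinv_0_lt_compat; exact: fpow_pos].
by lra.
Qed.
(** One factor X shifts the index i to i + 1; the denominator then grows by (i+1)^s, which is at
    most the (k+1)^s gained in front. *)
Lemma gevrey_sum_step k : X * (fpow k s * gevrey_sum k) <= fpow k.+1 s * gevrey_sum k.+1.
Proof.
have X0 : 0 <= X by rewrite /X; have := Rabs_pos lam; lra.
have h : X * (fpow k s * gevrey_sum k) <= fpow k.+1 s * \rsum_(i <- iota 0 k.+1) (X ^ i.+1 / fpow i.+1 s).
  rewrite /gevrey_sum -!rsum_distl; apply: rsum_le_in => i; rewrite mem_iota => /andP[_ ik].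
  have fS j : fpow j.+1 s = Rpower (INR j.+1) s * fpow j s.
    have E : INR (fact j.+1) = INR j.+1 * INR (fact j) by rewrite -mult_INR.
    rewrite /fpow E Rpower_mult_distr //; last exact: INR_fact_lt_0.
    by apply: lt_0_INR; lia.
  have p1 := fpow_pos k s; have p2 := fpow_pos i s; have p3 := Rpower_pos (INR k.+1) s; have p4 := Rpower_pos (INR i.+1) s.
  rewrite !fS /Rdiv.
  have -> : X * (fpow k s * (X ^ i * / fpow i s)) = fpow k s * X ^ i.+1 * / fpow i s by rewrite /=; ring.
  have -> : Rpower (INR k.+1) s * fpow k s * (X ^ i.+1 * / (Rpower (INR i.+1) s * fpow i s)) =
    fpow k s * X ^ i.+1 * / fpow i s * (Rpower (INR k.+1) s / Rpower (INR i.+1) s) by field; lra.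
  rewrite -{1}(Rmult_1_r (fpow k s * X ^ i.+1 * / fpow i s)); apply: Rmult_le_compat_l.
    apply: Rmult_le_pos; last by left; apply: Rinv_0_lt_compat.
    by apply: Rmult_le_pos; [lra | exact: pow_le].
  apply: (Rmult_le_reg_r (Rpower (INR i.+1) s)) => //.
  rewrite /Rdiv Rmult_assoc Rinv_l ?Rmult_1_r ?Rmult_1_l; last lra.
  apply: Rpower_le_base; [by apply: lt_0_INR; lia | by apply: le_INR; lia | lra].
apply: Rle_trans h _; apply: Rmult_le_compat_l; first by left; exact: fpow_pos.
have E : gevrey_sum k.+1 = X ^ 0 / fpow 0 s + \rsum_(i <- iota 0 k.+1) (X ^ i.+1 / fpow i.+1 s).
  by rewrite {1}/gevrey_sum (_ : iota 0 k.+2 = 0%N :: iota 1 k.+1) // big_cons -(addn0 1%N) iotaDl big_map.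
rewrite E; have : 0 < X ^ 0 / fpow 0 s by apply: Rdiv_lt_0_compat; [rewrite /=; lra | exact: fpow_pos].
lra.
Qed.
(** The subtracted c^g is the slack that absorbs the new term c^(g+1), thanks to 2 c <= D. *)
Lemma geom_sum g : \rsum_(k <- iota 0 g.+1) (c ^ k * D ^ (g - k)) <= 2 * D ^ g - c ^ g.
Proof.
elim: g => [|g IH]; first by rewrite /= big_seq1 /=; lra.
rewrite -(addn1 g.+1) iotaD big_cat big_seq1 add0n subnn Rmult_1_r.
have -> : \big[Rplus/0]_(i <- iota 0 g.+1) (c ^ i * D ^ (g.+1 - i)) = D * \rsum_(k <- iota 0 g.+1) (c ^ k * D ^ (g - k)).
  rewrite -rsum_distl big_seq [RHS]big_seq; apply: eq_bigr => i; rewrite mem_iota => /andP[_ ig].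
  by rewrite (_ : (g.+1 - i = (g - i).+1)%N) /=; [ring | lia].
have Dp : 0 <= D by lra.
have cg : 0 <= c ^ g by apply: pow_le; lra.
have h := Rmult_le_compat_l _ _ _ Dp IH.
have -> : c ^ g.+1 = c * c ^ g by [].
have -> : D ^ g.+1 = D * D ^ g by [].
have : c * c ^ g <= (D - c) * c ^ g by apply: Rmult_le_compat_r; lra.
move=> h2; set S := \rsum_(k <- _) _ in h *; change (D * S + c * c ^ g <= 2 * (D * D ^ g) - c * c ^ g); lra.
Qed.
(** Strong induction through the differentiated equation. The source contributes 1 and the Leibniz
    sum 2 Kg, where 2 is a geometric series of ratio at most 1/2; hence the lower bound 1 + 2 Kg
    imposed on D. *)
Lemma dC_iter_bound g t : Cmod (dC_iter g t) <= B * D ^ g * (fpow g s * gevrey_sum g).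
Proof.
have D1 : 1 <= D by lra.
have W g' : 0 <= fpow g' s * gevrey_sum g'.
  by apply: Rmult_le_pos; [left; exact: fpow_pos | have := gevrey_sum_ge1 g'; lra].
elim/ltn_ind: g t => [[_|g IH]] t.
  rewrite /dC_iter /=; apply: Rle_trans (bU t) _.
  rewrite /gevrey_sum /= big_seq1 /fpow /= /Rpower ln_1 Rmult_0_r exp_0; right; field.
rewrite dC_iter_eq; apply: Rle_trans (Cmod_triangle _ _) _; rewrite Cmod_opp !Cmod_mult Cmod_Ci !Rmult_1_l Cmod_R.
have X0 : 0 <= X by rewrite /X; have := Rabs_pos lam; lra.
have L : Cmod (leib g (Gd^~ t) (dC_iter^~ t)) <= B * Kg * (2 * D ^ g) * (fpow g s * gevrey_sum g).
  rewrite /leib; apply: Rle_trans (csum_mod _ _) _.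
  have T k : k \in iota 0 g.+1 -> Cmod (Cmult (RtoC (pascal g k)) (Cmult (Gd k t) (dC_iter (g - k) t)))
      <= B * Kg * (fpow g s * gevrey_sum g) * (c ^ k * D ^ (g - k)).
    rewrite mem_iota => /andP[_ kg]; have kg' : (k <= g)%N by lia.
    rewrite !Cmod_mult Cmod_R Rabs_pos_eq; last exact: bn_ge0.
    have h1 := bG k t; have h2 := IH (g - k)%N (ltac:(lia)) t.
    have h3 := bn_fpow g k s s1 kg'.
    have h4 := gevrey_sum_mono (g - k) g (leq_subr _ _).
    have f1 := fpow_pos k s; have f2 := fpow_pos (g - k) s; have f3 := fpow_pos g s.
    have w1 := gevrey_sum_ge1 (g - k); have bn0 := bn_ge0 g k.
    have cp : 0 <= c ^ k by apply: pow_le; lra.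
    have Dp : 0 <= D ^ (g - k) by apply: pow_le; lra.
    apply: Rle_trans (Rmult_le_compat_l _ _ _ bn0 (Rmult_le_compat _ _ _ _ (Cmod_ge_0 _) (Cmod_ge_0 _) h1 h2)) _.
    have -> : pascal g k * (Kg * (c ^ k * fpow k s) * (B * D ^ (g - k) * (fpow (g - k) s * gevrey_sum (g - k))))
      = B * Kg * (c ^ k * D ^ (g - k)) * ((pascal g k * (fpow k s * fpow (g - k) s)) * gevrey_sum (g - k)) by ring.
    have -> : B * Kg * (fpow g s * gevrey_sum g) * (c ^ k * D ^ (g - k)) = B * Kg * (c ^ k * D ^ (g - k)) * (fpow g s * gevrey_sum g) by ring.
    apply: Rmult_le_compat_l; first by apply: Rmult_le_pos; apply: Rmult_le_pos.
    apply: Rmult_le_compat => //; last lra.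
    by apply: Rmult_le_pos => //; apply: Rmult_le_pos; lra.
  apply: Rle_trans (rsum_le_in _ _ _ T) _; rewrite rsum_distl.
  have G : \rsum_(k <- iota 0 g.+1) (c ^ k * D ^ (g - k)) <= 2 * D ^ g.
    by have := geom_sum g; have : 0 <= c ^ g by [apply: pow_le; lra]; lra.
  have P0 : 0 <= B * Kg * (fpow g s * gevrey_sum g) by apply: Rmult_le_pos => //; apply: Rmult_le_pos.
  by apply: Rle_trans (Rmult_le_compat_l _ _ _ P0 G) _; right; ring.
have st := gevrey_sum_step g; have Dg : 1 <= D ^ g by apply: pow_R1_Rle.
have lX : Rabs lam <= X by rewrite /X; lra.
have BK : 0 <= B * Kg * (2 * D ^ g) by apply: Rmult_le_pos; [exact: Rmult_le_pos | lra].
have t2 : Rabs lam * Cmod (leib g (Gd^~ t) (dC_iter^~ t)) <= B * Kg * (2 * D ^ g) * (fpow g.+1 s * gevrey_sum g.+1).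
  apply: Rle_trans (Rmult_le_compat _ _ _ _ (Rabs_pos _) (Cmod_ge_0 _) lX L) _.
  have -> : X * (B * Kg * (2 * D ^ g) * (fpow g s * gevrey_sum g)) = B * Kg * (2 * D ^ g) * (X * (fpow g s * gevrey_sum g)) by ring.
  exact: Rmult_le_compat_l.
have t1 : Cmod (F g t) <= B * D ^ g * (fpow g.+1 s * gevrey_sum g.+1).
  apply: Rle_trans (bF g t) _; rewrite Rmult_assoc; apply: Rmult_le_compat_l => //.
  apply: Rmult_le_compat; [by apply: pow_le; lra | by left; exact: fpow_pos | by apply: pow_incr; lra |].
  have f1 : fpow g s <= fpow g.+1 s.
    apply: Rpower_le_base; [exact: INR_fact_lt_0 | | lra].
    by apply: le_INR; apply: fact_le; lia.
  by have := gevrey_sum_ge1 g.+1; have := fpow_pos g.+1 s; nra.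
have -> : B * D ^ g.+1 * (fpow g.+1 s * gevrey_sum g.+1) = B * D ^ g * D * (fpow g.+1 s * gevrey_sum g.+1) by rewrite /=; ring.
have : B * D ^ g * (1 + 2 * Kg) * (fpow g.+1 s * gevrey_sum g.+1) <= B * D ^ g * D * (fpow g.+1 s * gevrey_sum g.+1).
  apply: Rmult_le_compat_r => //; apply: Rmult_le_compat_l => //.
  by apply: Rmult_le_pos => //; lra.
lra.
Qed.
End Leibniz.

(** * Periodic solutions with uniform bounds *)

Lemma periodic_Z {T} (g : R -> T) : (forall t, g (t + 2 * PI) = g t) -> forall k t, g (t + 2 * PI * IZR k) = g t.
Proof.
move=> pg k t.
have nat_p j x : g (x + 2 * PI * INR j) = g x.
  elim: j => [|j IH]; first by congr g; rewrite /=; ring.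
  by rewrite S_INR -IH -(pg (x + 2 * PI * INR j)); congr g; ring.
case: (Z_le_gt_dec 0 k) => hk.
  by rewrite -(Z2Nat.id k hk) -INR_IZR_INZ nat_p.
rewrite -(nat_p (Z.to_nat (- k)) (t + _)) INR_IZR_INZ Z2Nat.id; last lia.
by congr g; rewrite opp_IZR; ring.
Qed.
Lemma floor_shift t0 t : exists k : Z, t0 <= t + 2 * PI * IZR k < t0 + 2 * PI.
Proof.
have p := PI_RGT_0; pose y := (t0 - t) / (2 * PI).
have [h1 h2] := archimed (- y); exists (1 - up (- y))%Z.
have e : t0 - t = 2 * PI * y by rewrite /y; field; lra.
rewrite minus_IZR.
have l1 : y <= 1 - IZR (up (- y)) by lra.
have l2 : 1 - IZR (up (- y)) < y + 1 by lra.
have := Rmult_le_compat_l (2 * PI) _ _ (ltac:(lra)) l1.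
have := Rmult_lt_compat_l (2 * PI) _ _ (ltac:(lra)) l2.
lra.
Qed.
Lemma periodic_bound (g : R -> R) t0 M : (forall t, g (t + 2 * PI) = g t) ->
  (forall t, t0 <= t <= t0 + 2 * PI -> g t <= M) -> forall t, g t <= M.
Proof.
by move=> pg H t; have [k hk] := floor_shift t0 t; rewrite -(periodic_Z g pg k); apply: H; lra.
Qed.

(** A bound valid from J on is extended downwards one index at a time, so finitely many indices need
    no quantitative control. *)
Lemma unif_finite (P : nat -> R -> Prop) J : (forall j, exists K, P j K) ->
  (forall j K K', K <= K' -> P j K -> P j K') -> (exists K, forall j, (J <= j)%N -> P j K) ->
  exists2 K, 0 <= K & forall j, P j K.
Proof.
move=> H mono [K HK].
elim: J K HK => [|J IH] K HK.
  exists (Rmax 0 K); first exact: Rmax_l.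
  by move=> j; apply: mono (Rmax_r 0 K) (HK j _).
have [K' H'] := H J; apply: (IH (Rmax K K')) => j; rewrite leq_eqVlt => /orP[/eqP <-|h].
  exact: mono (Rmax_r _ _) H'.
exact: mono (Rmax_l _ _) (HK j h).
Qed.

(** * Connected subsets of the circle *)

Section Connected.
Variable A : R -> Prop.
Hypothesis pA : forall t, A (t + 2 * PI) <-> A t.
Let pAZ k t : A (t + 2 * PI * IZR k) <-> A t.
Proof.
have pA' t' : A (t' + 2 * PI) = A t' by apply: propositional_extensionality; exact: pA.
by rewrite (periodic_Z A pA' k t).
Qed.
Definition arcs (p q : R) (x : R) : Prop := exists k : Z, p < x + 2 * PI * IZR k < q.
Lemma arcs_open p q : openR (arcs p q).
Proof.
move=> t [k [h1 h2]]; exists (Rmin (t + 2 * PI * IZR k - p) (q - (t + 2 * PI * IZR k))); split.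
  by apply: Rmin_glb_lt; lra.
move=> s hs; exists k.
have := Rmin_l (t + 2 * PI * IZR k - p) (q - (t + 2 * PI * IZR k)).
have := Rmin_r (t + 2 * PI * IZR k - p) (q - (t + 2 * PI * IZR k)).
have /Rabs_def2 [] := hs; lra.
Qed.
Lemma arcs_periodic p q : periodicP (arcs p q).
Proof.
move=> t; split=> -[k hk]; [exists (k + 1)%Z | exists (k - 1)%Z].
  by rewrite plus_IZR; lra.
by rewrite minus_IZR; lra.
Qed.
(** Two points outside A cut the circle into two open arcs; if A meets both, they disconnect it. *)
Lemma separated p q x y : ~ A p -> ~ A q -> p < x < q -> q < y < p + 2 * PI -> A x -> A y -> ~ connectedT A.
Proof.
move=> np nq hx hy ax ay; apply; exists (arcs p q), (arcs q (p + 2 * PI)).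
have p0 := PI_RGT_0.
split; first exact: arcs_open.
split; first exact: arcs_open.
split; first exact: arcs_periodic.
split; first exact: arcs_periodic.
split; first by exists x; split=> //; exists 0%Z; lra.
split; first by exists y; split=> //; exists 0%Z; lra.
split=> t at_.
  have [k hk] := floor_shift p t; have at' := proj2 (pAZ k t) at_.
  set z := t + _ in hk at'.
  have zp : z <> p by move=> e; apply: np; rewrite -e.
  have zq : z <> q by move=> e; apply: nq; rewrite -e.
  case: (Rtotal_order z q) => [h|[h|h]] //; [left|right]; exists k; rewrite -/z; lra.
case=> -[k hk] [k' hk'].
have h : 0 < IZR (k' - k) < 1.
  by rewrite minus_IZR; split; apply: (Rmult_lt_reg_l (2 * PI)); lra.
have [] : (0 < k' - k)%Z /\ (k' - k < 1)%Z by split; apply: lt_IZR; lra.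
lia.
Qed.
End Connected.

(** From sin y = 2 sin(y/2) cos(y/2): both the cosine and the slope of the sine on [0, PI/4] are at
    least cos(PI/4), whose square is 1/2. *)
Lemma sin_half_bound y : 0 <= y <= PI / 2 -> y / 2 <= sin y.
Proof.
move=> [y0 y1]; have p0 := PI_RGT_0; have p4 := PI_4.
have e : sin y = 2 * sin (y / 2) * cos (y / 2) by rewrite -sin_2a; congr sin; field.
have c4 : cos (PI / 4) * cos (PI / 4) = / 2.
  by rewrite cos_PI4 /Rdiv !Rmult_1_l -Rinv_mult sqrt_sqrt; lra.
have cp : 0 < cos (PI / 4) by apply: cos_gt_0; lra.
have cge z : 0 <= z <= PI / 4 -> cos (PI / 4) <= cos z.
  by move=> hz; apply: cos_decr_1; lra.
have sge : cos (PI / 4) * (y / 2) <= sin (y / 2).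
  have [c [hc E]] : exists c, Rmin 0 (y / 2) <= c <= Rmax 0 (y / 2) /\ sin (y / 2) - sin 0 = cos c * (y / 2 - 0).
    apply: MVT_gen => [x _|x _]; first exact: is_derive_sin.
    by apply/continuity_pt_filterlim; apply: (ex_derive_continuous (V := R_NormedModule)); exists (cos x); exact: is_derive_sin.
  rewrite Rmin_left in hc; last lra.
  rewrite Rmax_right in hc; last lra.
  rewrite sin_0 !Rminus_0_r in E; rewrite E; apply: Rmult_le_compat_r; first lra.
  by apply: cge; lra.
have ch := cge (y / 2) (ltac:(lra)).
rewrite e; have : cos (PI / 4) * (y / 2) * cos (PI / 4) <= sin (y / 2) * cos (y / 2).
  by apply: Rmult_le_compat => //; [apply: Rmult_le_pos; lra | lra].
have -> : cos (PI / 4) * (y / 2) * cos (PI / 4) = cos (PI / 4) * cos (PI / 4) * (y / 2) by ring.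
rewrite c4; lra.
Qed.
Lemma sin_abs_bound y : Rabs y <= PI / 2 -> Rabs y / 2 <= Rabs (sin y).
Proof.
move=> h; case: (Rle_dec 0 y) => hy.
  rewrite Rabs_pos_eq // in h *; have := sin_half_bound y (conj hy h).
  by move=> b; apply: Rle_trans b (Rle_abs _).
have ay : Rabs y = - y by apply: Rabs_left; lra.
rewrite ay in h *.
have := sin_half_bound (- y) (ltac:(lra)).
by rewrite sin_neg -(Rabs_Ropp (sin y)) => b; apply: Rle_trans b (Rle_abs _).
Qed.
Lemma sin_Z k : sin (IZR k * PI) = 0.
Proof. by apply: sin_eq_0_1; exists k. Qed.

Section Bound.
Variables (lam a0 : R) (b : R -> R).
Hypotheses (cb : forall t, continuous b t) (pb : forall t, b (t + 2 * PI) = b t).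
Let Q := int_factor lam a0 b (2 * PI).
Let B := primitive b.

Lemma int_factor_shift t : Cmult (int_factor_inv lam a0 b t) (int_factor lam a0 b (t + 2 * PI)) = Q.
Proof.
have d r : is_dC (fun t => Cmult (int_factor_inv lam a0 b t) (int_factor lam a0 b (t + 2 * PI))) r (RtoC 0).
  have h := is_dC_shift _ _ _ _ (int_factor_deriv lam a0 b cb (r + 2 * PI)).
  apply: is_dC_eq (is_dC_mult _ _ _ _ _ (int_factor_inv_deriv lam a0 b cb r) h).
  by rewrite coefG_per //; ring.
rewrite (is_dC0_const _ 0 t d) (proj2 (int_factor_0 lam a0 b)) Rplus_0_l Cmult_1l //.
Qed.
Lemma Q_mod : Cmod Q = exp (- lam * B (2 * PI)). Proof. exact: int_factor_mod. Qed.
Lemma Q_res (k : Z) : lam * a0 = IZR k -> lam * B (2 * PI) = 0 -> Q = RtoC 1.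
Proof.
move=> e1 e2; rewrite /Q int_factorE (_ : - lam * primitive b (2 * PI) = 0); last by rewrite -/B; lra.
rewrite e1 /cexp /= exp_0 (_ : IZR k * (2 * PI) = 2 * (IZR k * PI)); last ring.
by rewrite cos_2a_sin sin_2a sin_Z; apply: C_ext; rewrite /=; ring.
Qed.
Lemma Q_nonres : Q = RtoC 1 -> lam * B (2 * PI) = 0 /\ exists k : Z, lam * a0 = IZR k.
Proof.
move=> e; have := Q_mod; rewrite e Cmod_1 -exp_0 => /exp_inv h.
split; first lra.
have := f_equal Re e; rewrite /Q int_factorE (_ : - lam * primitive b (2 * PI) = 0); last by rewrite -/B; lra.
rewrite /cexp /= exp_0 Rmult_1_l (_ : lam * a0 * (2 * PI) = 2 * (lam * a0 * PI)); last ring.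
rewrite cos_2a_sin => hs.
have : sin (lam * a0 * PI) = 0 by nra.
move=> /sin_eq_0_0[k hk]; exists k; have := PI_RGT_0 => p.
by apply: (Rmult_eq_reg_r PI); lra.
Qed.

Variables (f : R -> C) (M : R) (U : R -> C).
Hypotheses (fM : forall t, Cmod (f t) <= M) (sU : solves lam a0 b f U) (pU : forall t, U (t + 2 * PI) = U t).
(** U is transported backwards from t + 2 PI to t. By periodicity both ends carry U(t), so the
    variation formula bounds (1 - Q) U(t), with growth measured only at the points r between t and t
    + 2 PI. *)
Lemma bound_nonres S : (forall t r, t <= r <= t + 2 * PI -> exp (lam * (B t - B r)) <= S) ->
  forall t, Cmod (U t) * Cmod (Cminus (RtoC 1) Q) <= 4 * PI * (S * M).
Proof.
move=> HS t; have p := PI_RGT_0.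
have := ode_var lam a0 b f cb U (t + 2 * PI) t M S sU fM.
rewrite int_factor_shift pU => h; rewrite -Cmod_mult.
have -> : Cmult (U t) (Cminus (RtoC 1) Q) = Cminus (U t) (Cmult Q (U t)) by rewrite /Cminus; ring.
apply: Rle_trans (h _) _.
  move=> r hr; apply: HS; move: hr; rewrite Rmin_right ?Rmax_left; lra.
rewrite (_ : t - (t + 2 * PI) = - (2 * PI)) ?Rabs_Ropp ?Rabs_pos_eq; [right; ring|lra|ring].
Qed.
Lemma bound_path t0 t : U t0 = RtoC 0 -> Rabs (t - t0) <= 2 * PI ->
  (forall r, Rmin t0 t <= r <= Rmax t0 t -> lam * (B t - B r) <= 0) -> Cmod (U t) <= 4 * PI * M.
Proof.
move=> u0 ht Hr; have M0 : 0 <= M := Rle_trans _ _ _ (Cmod_ge_0 _) (fM 0).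
have := ode_var lam a0 b f cb U t0 t M 1 sU fM.
rewrite u0 Cmult_0_r (_ : Cminus (U t) (RtoC 0) = U t); last by rewrite /Cminus; ring.
move=> h; apply: Rle_trans (h _) _.
  by move=> r hr; rewrite -exp_0; apply: exp_incr; exact: Hr.
rewrite Rmult_1_l; have := Rmult_le_compat_l (2 * M) _ _ (ltac:(lra)) ht; lra.
Qed.
End Bound.

Section Unimodal.
Variables (b : R -> R).
Hypotheses (cb : forall t, continuous b t) (pb : forall t, b (t + 2 * PI) = b t).
Let B := primitive b.
Hypothesis B0 : B (2 * PI) = 0.
Lemma B_periodic t : B (t + 2 * PI) = B t.
Proof. by rewrite /B primitive_period // -/B B0 Rplus_0_r. Qed.
(** [Omega] integrates up to the representative of t in [0, 2 PI); zero mean makes the primitive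
    periodic, and the set becomes a superlevel set of B. *)
Lemma Omega_B r t : Omega b r t <-> B t > r.
Proof.
rewrite /Omega /rep.
have -> : t - 2 * PI * IZR (Int_part (t / (2 * PI))) = t + 2 * PI * IZR (- Int_part (t / (2 * PI))).
  by rewrite opp_IZR; ring.
by rewrite -/(primitive b _) -/B (periodic_Z B B_periodic).
Qed.
Lemma B_cont t : continuity_pt B t.
Proof.
apply/continuity_pt_filterlim; apply: (ex_derive_continuous (V := R_NormedModule)).
by exists (b t); exact: primitive_deriv.
Qed.
Lemma B_max : exists tm, forall t, B t <= B tm.
Proof.
have p := PI_RGT_0.
have [tm [H _]] := continuity_ab_maj B 0 (2 * PI) (ltac:(lra)) (fun c _ => B_cont c).
exists tm; apply: (periodic_bound B 0); first exact: B_periodic.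
by move=> t ht; apply: H; lra.
Qed.
Lemma B_min : exists tm, forall t, B tm <= B t.
Proof.
have p := PI_RGT_0.
have [tm [H _]] := continuity_ab_min B 0 (2 * PI) (ltac:(lra)) (fun c _ => B_cont c).
exists tm => t; suff : - B t <= - B tm by lra.
apply: (periodic_bound (fun t => - B t) 0) => [s|s hs]; first by rewrite B_periodic.
by have := H s (ltac:(lra)); lra.
Qed.
Hypothesis conn : forall r, connectedT (Omega b r).
Let pO r t : Omega b r (t + 2 * PI) <-> Omega b r t.
Proof. by rewrite !Omega_B B_periodic. Qed.
(** If both arcs from t to the maximum dipped below B t, at s1 and s2, then at the level max(B s1, B
    s2) these points would separate t from the maximum inside the superlevel set. *)
Lemma path_max tm t : (forall t, B t <= B tm) -> tm <= t <= tm + 2 * PI ->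
  (forall r, tm <= r <= t -> B t <= B r) \/ (forall r, t <= r <= tm + 2 * PI -> B t <= B r).
Proof.
move=> Hm ht; apply: NNPP => N.
have [s1 [h1 b1]] : exists s1, tm <= s1 <= t /\ B s1 < B t.
  apply: NNPP => K; apply: N; left => r hr; case: (Rle_lt_dec (B t) (B r)) => // h.
  by case: K; exists r.
have [s2 [h2 b2]] : exists s2, t <= s2 <= tm + 2 * PI /\ B s2 < B t.
  apply: NNPP => K; apply: N; right => r hr; case: (Rle_lt_dec (B t) (B r)) => // h.
  by case: K; exists r.
have p := PI_RGT_0.
set r := Rmax (B s1) (B s2).
have rt : r < B t by apply: Rmax_lub_lt.
have r1 : B s1 <= r by apply: Rmax_l.
have r2 : B s2 <= r by apply: Rmax_r.
have s1t : s1 <> t by move=> e; move: b1; rewrite e; lra.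
have s2t : s2 <> t by move=> e; move: b2; rewrite e; lra.
have tmt := Hm t; have pm := B_periodic tm.
have s1m : s1 <> tm by move=> e; rewrite e in b1; lra.
have s2m : s2 <> tm + 2 * PI by move=> e; rewrite e pm in b2; lra.
apply: (separated (Omega b r) (pO r) s1 s2 t (tm + 2 * PI) _ _ _ _ _ _ (conn r)); rewrite ?Omega_B ?pm; lra.
Qed.
(** If both arcs rose above B t, the two higher points would be separated by the minimum and by t
    itself, both excluded from the strict superlevel set at the level B t. Sublevel sets are thus
    handled by the same hypothesis. *)
Lemma path_min tm t : (forall t, B tm <= B t) -> tm <= t <= tm + 2 * PI ->
  (forall r, tm <= r <= t -> B r <= B t) \/ (forall r, t <= r <= tm + 2 * PI -> B r <= B t).
Proof.
move=> Hm ht; apply: NNPP => N.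
have [s1 [h1 b1]] : exists s1, tm <= s1 <= t /\ B t < B s1.
  apply: NNPP => K; apply: N; left => r hr; case: (Rle_lt_dec (B r) (B t)) => // h.
  by case: K; exists r.
have [s2 [h2 b2]] : exists s2, t <= s2 <= tm + 2 * PI /\ B t < B s2.
  apply: NNPP => K; apply: N; right => r hr; case: (Rle_lt_dec (B r) (B t)) => // h.
  by case: K; exists r.
have tmt := Hm t; have pm := B_periodic tm.
have s1t : s1 <> t by move=> e; move: b1; rewrite e; lra.
have s2t : s2 <> t by move=> e; move: b2; rewrite e; lra.
have s1m : s1 <> tm by move=> e; rewrite e in b1; lra.
have s2m : s2 <> tm + 2 * PI by move=> e; rewrite e pm in b2; lra.
apply: (separated (Omega b (B t)) (pO (B t)) tm t s1 s2 _ _ _ _ _ _ (conn (B t))); rewrite ?Omega_B; lra.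
Qed.
End Unimodal.

(** * Solvability of the scalar equations in the three cases *)

Section Cases.
Variables (n m : nat) (mu a0 : R) (b : R -> R) (lam : nat -> R).
Hypotheses (n1 : (1 <= n)%N) (hm : 1 / 2 <= mu) (m2 : (2 <= m)%N).
Hypothesis weyl : exists rho, 0 < rho /\
  is_lim_seq (fun j => Rabs (lam j) / (rho * Rpower (INR j.+1) (INR m / (2 * INR n)))) 1.
Hypotheses (cb : forall t, continuous b t) (pb : forall t, b (t + 2 * PI) = b t).
Hypothesis bb : exists bM, forall t, Rabs (b t) <= bM.
(* Weyl's law bounds [(j + 1) ^ (1 / (2 n mu))] by a multiple of this quantity, in which all
   the decay of coefficients is expressed. *)
Definition decay_rate (j : nat) : R := Rpower (1 + Rabs (lam j)) (/ (INR m * mu)).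

Let nR : 0 < INR n. Proof. by apply: lt_0_INR; lia. Qed.
Let mR : 0 < INR m. Proof. by apply: lt_0_INR; lia. Qed.
Lemma decay_rate_ge1 j : 1 <= decay_rate j.
Proof.
apply: Rpower_ge1; first by have := Rabs_pos (lam j); lra.
by left; apply: Rinv_0_lt_compat; apply: Rmult_lt_0_compat; lra.
Qed.
Lemma lam_lower : exists rho J, 0 < rho /\ forall j, (J <= j)%N ->
  rho * Rpower (INR j.+1) (INR m / (2 * INR n)) <= Rabs (lam j).
Proof.
have [rho [r0 L]] := weyl.
have e0 : 0 < / 2 by lra.
have /is_lim_seq_spec /= H := L.
have [J HJ] := H (mkposreal _ e0).
exists (rho / 2), J; split; first lra.
move=> j /leP hj; have := HJ j hj; rewrite /=.
set R0 := Rpower _ _; have R00 : 0 < R0 := Rpower_pos _ _.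
move=> /Rabs_def2 [_ h].
have : / 2 * (rho * R0) <= Rabs (lam j) / (rho * R0) * (rho * R0).
  by apply: Rmult_le_compat_r; [left; exact: Rmult_lt_0_compat | lra].
by rewrite /Rdiv Rmult_assoc Rinv_l; [lra | apply: Rgt_not_eq; exact: Rmult_lt_0_compat].
Qed.
Lemma index_le_decay_rate : exists2 K, 0 <= K & forall j, Rpower (INR j.+1) (/ (2 * INR n * mu)) <= K * decay_rate j.
Proof.
have [rho [J [r0 HJ]]] := lam_lower.
apply: (unif_finite _ J).
- move=> j; exists (Rpower (INR j.+1) (/ (2 * INR n * mu))).
  have := decay_rate_ge1 j; have := Rpower_pos (INR j.+1) (/ (2 * INR n * mu)); nra.
- move=> j K K' KK h; apply: Rle_trans h _; apply: Rmult_le_compat_r => //.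
  by have := decay_rate_ge1 j; lra.
exists (Rpower (/ rho) (/ (INR m * mu))) => j jJ.
have jp : 0 < INR j.+1 by apply: lt_0_INR; lia.
have mm : 0 < INR m * mu by apply: Rmult_lt_0_compat; lra.
have h : Rpower (INR j.+1) (INR m / (2 * INR n)) <= / rho * (1 + Rabs (lam j)).
  have := HJ j jJ; set x := Rpower _ _ => hx.
  apply: (Rmult_le_reg_l rho) => //; rewrite -Rmult_assoc Rinv_r ?Rmult_1_l; lra.
have im : 0 <= / (INR m * mu) by left; apply: Rinv_0_lt_compat.
have := Rpower_le_base _ _ _ (Rpower_pos _ _) h im.
rewrite Rpower_mult -Rpower_mult_distr; [|by apply: Rinv_0_lt_compat|by have := Rabs_pos (lam j); lra].
by rewrite -/(decay_rate j) (_ : INR m / (2 * INR n) * / (INR m * mu) = / (2 * INR n * mu)) //; field; lra.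
Qed.
Lemma lam_large X : exists J, forall j, (J <= j)%N -> X <= Rabs (lam j).
Proof.
have [rho [J [r0 HJ]]] := lam_lower.
have kap : 0 < INR m / (2 * INR n) by apply: Rdiv_lt_0_compat; lra.
set Z := Rpower (Rmax 1 (X / rho)) (/ (INR m / (2 * INR n))).
have [N hN] := INR_unbounded Z.
exists (maxn J N) => j; rewrite geq_max => /andP[jJ jN].
apply: Rle_trans (HJ j jJ).
have zj : Z <= INR j.+1 by apply: Rle_trans (Rlt_le _ _ hN) _; apply: le_INR; lia.
have := Rpower_le_base _ _ _ (Rpower_pos _ _) zj (Rlt_le _ _ kap).
rewrite /Z Rpower_mult Rinv_l ?Rpower_1; [|by have := Rmax_l 1 (X / rho); lra|lra].
move=> h; have : X / rho <= Rpower (INR j.+1) (INR m / (2 * INR n)) by apply: Rle_trans (Rmax_r 1 _) h.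
move=> h2; have := Rmult_le_compat_l rho _ _ (Rlt_le _ _ r0) h2.
by rewrite (_ : rho * (X / rho) = X) //; field; lra.
Qed.

Let Bf := primitive b.
Lemma mean_B : Bf (2 * PI) = 2 * PI * mean b.
Proof.
rewrite /mean /Bf /primitive; set I := RInt b 0 (2 * PI); move: (I : R) => {}I.
by change (I = 2 * PI * (/ (2 * PI) * I)); field; have := PI_RGT_0; lra.
Qed.
Lemma inZ_res j : inZset lam a0 b j -> int_factor (lam j) a0 b (2 * PI) = RtoC 1 /\ lam j * Bf (2 * PI) = 0.
Proof.
move=> [k hk]; have h1 := f_equal Re hk; have h2 := f_equal Im hk; rewrite /= in h1 h2.
have e2 : lam j * Bf (2 * PI) = 0 by rewrite mean_B (_ : _ * _ = 2 * PI * (lam j * mean b + 0 * a0)); [rewrite h2|]; ring.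
by split=> //; apply: (Q_res _ _ _ k) => //; lra.
Qed.
Lemma notinZ_nonres j : ~ inZset lam a0 b j -> int_factor (lam j) a0 b (2 * PI) <> RtoC 1.
Proof.
move=> N /Q_nonres [h1 [k hk]]; apply: N; exists k.
rewrite -/Bf mean_B in h1; have p := PI_RGT_0.
have h3 : lam j * mean b = 0.
  by apply: (Rmult_eq_reg_l (2 * PI)); lra.
by apply: C_ext; rewrite /=; lra.
Qed.

Definition good_source (j : nat) (f : R -> C) (M : R) : Prop :=
  (forall t, continuous (fun t => Re (f t)) t) /\ (forall t, continuous (fun t => Im (f t)) t) /\
  (forall t, f (t + 2 * PI) = f t) /\ (forall t, Cmod (f t) <= M) /\
  (inZset lam a0 b j -> weighted_primitive (lam j) a0 b f (2 * PI) = RtoC 0).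
(** K bounds a right inverse of the j-th equation in the sup norm, on sources satisfying the
    compatibility condition. The three cases of the theorem are three ways to control K as j
    varies. *)
Definition ode_ok (j : nat) (K : R) : Prop := forall f M, good_source j f M ->
  exists U, solves (lam j) a0 b f U /\ (forall t, U (t + 2 * PI) = U t) /\ forall t, Cmod (U t) <= K * M.

Lemma good_M0 j f M : good_source j f M -> 0 <= M.
Proof. by case=> _ [_ [_ [H _]]]; apply: Rle_trans (Cmod_ge_0 _) (H 0). Qed.
Lemma ode_ok_mono j K K' : K <= K' -> ode_ok j K -> ode_ok j K'.
Proof.
move=> KK H f M gs; have [U [h1 [h2 h3]]] := H f M gs; exists U; do 2 split=> //.
move=> t; apply: Rle_trans (h3 t) _; apply: Rmult_le_compat_r => //; exact: good_M0 gs.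
Qed.
Lemma ode_ok_nonres j S d : ~ inZset lam a0 b j -> 0 < d ->
  (forall t r, t <= r <= t + 2 * PI -> exp (lam j * (Bf t - Bf r)) <= S) ->
  d <= Cmod (Cminus (RtoC 1) (int_factor (lam j) a0 b (2 * PI))) -> ode_ok j (4 * PI * S / d).
Proof.
move=> nz d0 HS Hd f M gs; have M0 := good_M0 _ _ _ gs.
case: gs => c1 [c2 [pf [fM _]]].
have [U sU pU] := ode_nonres (lam j) a0 b f cb pb c1 c2 pf (notinZ_nonres j nz).
exists U; do 2 split=> //; move=> t.
have h := bound_nonres (lam j) a0 b cb pb f M U fM sU pU S HS t.
have h2 := Rmult_le_compat_l _ _ _ (Cmod_ge_0 (U t)) Hd.
apply: (Rmult_le_reg_r d) => //.
rewrite (_ : 4 * PI * S / d * M * d = 4 * PI * (S * M)); [lra | field; lra].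
Qed.
(** A bound for one index, with no uniformity in j; it disposes of the finitely many indices to
    which the asymptotic arguments do not apply. *)
Lemma ode_ok_nonres_ex j : ~ inZset lam a0 b j -> exists K, ode_ok j K.
Proof.
move=> nz; have [bM HbM] := bb.
have q1 := notinZ_nonres j nz.
eexists; apply: (ode_ok_nonres j (exp (Rabs (lam j) * (bM * (2 * PI)))) _ nz _ _ (Rle_refl _)).
  apply/Cmod_gt_0 => e; apply: q1.
  have -> : int_factor (lam j) a0 b (2 * PI) = Cminus (RtoC 1) (Cminus (RtoC 1) (int_factor (lam j) a0 b (2 * PI))) by rewrite /Cminus; ring.
  by rewrite e /Cminus; ring.
move=> t r hr; apply: exp_incr; apply: Rle_trans (Rle_abs _) _; rewrite Rabs_mult.
apply: Rmult_le_compat_l; first exact: Rabs_pos.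
have := mvt_seg Bf b r t bM (primitive_deriv b cb) (fun x _ => HbM x).
have bM0 : 0 <= bM := Rle_trans _ _ _ (Rabs_pos _) (HbM 0).
move=> h; apply: Rle_trans h _; apply: Rmult_le_compat_l => //.
by apply: Rabs_le; lra.
Qed.
Lemma ode_ok_flat j : inZset lam a0 b j -> (forall t r, lam j * (Bf t - Bf r) <= 0) -> ode_ok j (4 * PI).
Proof.
move=> z Hf f M gs; case: (gs) => c1 [c2 [pf [fM /(_ z) H0]]].
have [U sU [pU u0]] := ode_res (lam j) a0 b f cb pb c1 c2 pf 0 (proj1 (inZ_res j z)) H0.
have p := PI_RGT_0.
exists U; do 2 split=> //; apply: (periodic_bound (fun t => Cmod (U t)) 0) => [t|t ht]; first by rewrite pU.
apply: (bound_path (lam j) a0 b cb f M U fM sU 0 t u0) => [|r _]; last exact: Hf.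
by rewrite Rminus_0_r Rabs_pos_eq; lra.
Qed.
Lemma ode_ok_conn j : Bf (2 * PI) = 0 -> (forall r, connectedT (Omega b r)) -> inZset lam a0 b j -> ode_ok j (4 * PI).
Proof.
move=> B0 conn z f M gs; case: (gs) => c1 [c2 [pf [fM /(_ z) H0]]].
have p := PI_RGT_0.
have core tm : (forall t, tm <= t <= tm + 2 * PI ->
     (forall r, tm <= r <= t -> lam j * (Bf t - Bf r) <= 0) \/
     (forall r, t <= r <= tm + 2 * PI -> lam j * (Bf t - Bf r) <= 0)) ->
   exists U, solves (lam j) a0 b f U /\ (forall t, U (t + 2 * PI) = U t) /\ forall t, Cmod (U t) <= 4 * PI * M.
  move=> path.
  have [U sU [pU u0]] := ode_res (lam j) a0 b f cb pb c1 c2 pf tm (proj1 (inZ_res j z)) H0.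
  exists U; do 2 split=> //; apply: (periodic_bound (fun t => Cmod (U t)) tm) => [t|t ht]; first by rewrite pU.
  case: (path t ht) => Hr.
    apply: (bound_path (lam j) a0 b cb f M U fM sU tm t u0) => [|r]; first by rewrite Rabs_pos_eq; lra.
    by rewrite Rmin_left ?Rmax_right; [exact: Hr | lra | lra].
  apply: (bound_path (lam j) a0 b cb f M U fM sU (tm + 2 * PI) t) => [|| r]; first by rewrite pU.
    by apply: Rabs_le; lra.
  by rewrite Rmin_right ?Rmax_left; [exact: Hr | lra | lra].
case: (Rle_lt_dec 0 (lam j)) => hl.
  have [tm Hm] := B_max b cb pb B0; apply: (core tm) => t ht.
  have [h|h] := path_max b cb pb B0 conn tm t Hm ht; [left|right] => r hr; have := h r hr; rewrite -/Bf; nra.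
have [tm Hm] := B_min b cb pb B0; apply: (core tm) => t ht.
have [h|h] := path_min b cb pb B0 conn tm t Hm ht; [left|right] => r hr; have := h r hr; rewrite -/Bf; nra.
Qed.

Lemma case_a : (forall t, b t = 0) -> condA n mu lam (RtoC a0) -> forall eps, 0 < eps ->
  exists2 K, 0 <= K & forall j, ode_ok j (K * exp (eps * decay_rate j)).
Proof.
move=> bz cA eps e0.
have Bz t : Bf t = 0.
  by rewrite /Bf /primitive (RInt_ext _ (fun _ => 0)) ?RInt_const ?/scal /= ?/mult /=; [ring | move=> x _; exact: bz].
have [K1 K10 HK1] := index_le_decay_rate.
(* Condition (A) is expressed with (j+1)^(1/(2 n mu)), which is at most K1 times [decay_rate j];
   dividing by K1 + 1 restores the prescribed [eps]. *)
have e1 : 0 < eps / (K1 + 1) by apply: Rdiv_lt_0_compat; lra.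
have [Ce [C0 HC]] := cA _ e1.
have p := PI_RGT_0.
have K0 : 0 <= 4 * PI * (1 + / Ce).
  by have : 0 < / Ce by [apply: Rinv_0_lt_compat]; move=> h; apply: Rmult_le_pos; lra.
exists (4 * PI * (1 + / Ce)) => // j.
have ey : 1 <= exp (eps * decay_rate j) by apply: exp_ge1; apply: Rmult_le_pos; [lra | have := decay_rate_ge1 j; lra].
case: (classic (inZset lam a0 b j)) => z.
  apply: ode_ok_mono (ode_ok_flat j z _); last by move=> t r; rewrite !Bz; lra.
  have : 0 < / Ce by apply: Rinv_0_lt_compat.
  move=> h; have := Rmult_le_compat _ _ _ _ K0 (Rle_0_1) (Rle_refl _) ey.
  by have := Rmult_lt_0_compat _ _ (_ : 0 < 4 * PI) h; lra.
set d := Ce * exp (- eps * decay_rate j).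
have d0 : 0 < d by apply: Rmult_lt_0_compat => //; exact: exp_pos.
apply: (ode_ok_mono _ _ _ _ (ode_ok_nonres j 1 d z d0 _ _)).
- rewrite /d; have -> : 4 * PI * 1 / (Ce * exp (- eps * decay_rate j)) = 4 * PI * / Ce * exp (eps * decay_rate j).
    rewrite (_ : - eps * decay_rate j = - (eps * decay_rate j)) ?exp_Ropp; last ring.
    by field; split; [have := exp_pos (eps * decay_rate j); lra | lra].
  apply: Rmult_le_compat_r; first lra.
  by apply: Rmult_le_compat_l; lra.
- by move=> t r _; rewrite !Bz Rminus_0_r Rmult_0_r exp_0; lra.
set th := lam j * a0.
(* The nearest integer to lam j a0: then (th - k) PI lies in [- PI/2, PI/2], where the sine is
   bounded below linearly. *)
have [k hk] : exists k : Z, Rabs (th - IZR k) <= / 2.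
  have [h1 h2] := archimed (th - / 2); exists (up (th - / 2)); apply: Rabs_le; lra.
have nz : Cminus (RtoC (IZR k)) (Cmult (RtoC a0) (RtoC (lam j))) <> RtoC 0.
  move=> e; apply: z; exists k; have mb : mean b = 0 by have := mean_B; rewrite Bz; nra.
  have := f_equal Re e; rewrite /= => e'; apply: C_ext; rewrite /= ?mb; lra.
have := HC k j nz.
rewrite -RtoC_mult -RtoC_minus Cmod_R => low.
have dl : d <= Rabs (th - IZR k).
  rewrite Rabs_minus_sym (_ : th = a0 * lam j); last by rewrite /th; ring.
  apply: Rle_trans (Rge_le _ _ low); rewrite /d; apply: Rmult_le_compat_l; first lra.
  apply: exp_incr.
  have : eps / (K1 + 1) * Rpower (INR j.+1) (/ (2 * INR n * mu)) <= eps * decay_rate j; last lra.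
  apply: Rle_trans (Rmult_le_compat_l _ _ _ (Rlt_le _ _ e1) (HK1 j)) _.
  have y1 := decay_rate_ge1 j.
  have -> : eps / (K1 + 1) * (K1 * decay_rate j) = eps * decay_rate j * (K1 / (K1 + 1)) by field; lra.
  rewrite -{2}(Rmult_1_r (eps * decay_rate j)); apply: Rmult_le_compat_l; first by apply: Rmult_le_pos; lra.
  by apply: (Rmult_le_reg_r (K1 + 1)); [lra | rewrite /Rdiv Rmult_assoc Rinv_l; lra].
apply: Rle_trans dl _.
set y := th * PI.
(* 1 - exp(2 i y) = -2 i sin(y) exp(i y), with y = PI lam j a0. *)
have QE : Cminus (RtoC 1) (int_factor (lam j) a0 b (2 * PI)) = (2 * sin y * sin y, - (2 * sin y * cos y)).
  rewrite int_factorE -/Bf Bz Rmult_0_r -/th (_ : th * (2 * PI) = 2 * y); last by rewrite /y; ring.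
  by rewrite /cexp /= exp_0 cos_2a_sin sin_2a; apply: C_ext; rewrite /=; ring.
have modE : Cmod (Cminus (RtoC 1) (int_factor (lam j) a0 b (2 * PI))) = 2 * Rabs (sin y).
  rewrite QE /Cmod /=; have sc := sin2_cos2 y; rewrite /Rsqr in sc.
  rewrite (_ : _ + _ = (2 * sin y) * (2 * sin y)).
    by rewrite sqrt_Rsqr_abs Rabs_mult Rabs_pos_eq; lra.
  transitivity (4 * (sin y * sin y) * (sin y * sin y + cos y * cos y)); first ring.
  by rewrite sc; ring.
rewrite modE.
have sy : Rabs (sin y) = Rabs (sin ((th - IZR k) * PI)).
  have -> : (th - IZR k) * PI = y - IZR k * PI by rewrite /y; ring.
  rewrite sin_minus sin_Z Rmult_0_r Rminus_0_r Rabs_mult.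
  have c2 := sin2_cos2 (IZR k * PI); rewrite sin_Z /Rsqr in c2.
  have -> : Rabs (cos (IZR k * PI)) = 1; last ring.
  have cc : Rabs (cos (IZR k * PI)) * Rabs (cos (IZR k * PI)) = 1 by rewrite -Rabs_mult Rabs_pos_eq; nra.
  by have := Rabs_pos (cos (IZR k * PI)); nra.
rewrite sy; have := sin_abs_bound ((th - IZR k) * PI); rewrite Rabs_mult (Rabs_pos_eq PI); last lra.
have := Rabs_pos (th - IZR k) => d00 h.
have p2 : 2 <= PI by have := PI2_1; lra.
have := h (ltac:(nra)); nra.
Qed.

Lemma case_b : (exists t, b t <> 0) -> ((forall t, 0 <= b t) \/ (forall t, b t <= 0)) ->
  exists2 K, 0 <= K & forall j, ode_ok j K.
Proof.
move=> [t1 bt1] sgn; have p := PI_RGT_0.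
set P0 := Bf (2 * PI).
have dB := primitive_deriv b cb.
have mono t r : t <= r -> r <= t + 2 * PI -> (0 <= Bf r - Bf t <= P0) \/ (P0 <= Bf r - Bf t <= 0).
  move=> tr rt.
  have inc x y : x <= y -> (forall t, 0 <= b t) -> Bf x <= Bf y.
    move=> xy pos; have [c [_ E]] : exists c, Rmin x y <= c <= Rmax x y /\ Bf y - Bf x = b c * (y - x).
      apply: MVT_gen => [z _|z _]; first exact: dB.
      by apply/continuity_pt_filterlim; apply: (ex_derive_continuous (V := R_NormedModule)); exists (b z); exact: dB.
    by have := pos c; nra.
  have dcr x y : x <= y -> (forall t, b t <= 0) -> Bf y <= Bf x.
    move=> xy pos; have [c [_ E]] : exists c, Rmin x y <= c <= Rmax x y /\ Bf y - Bf x = b c * (y - x).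
      apply: MVT_gen => [z _|z _]; first exact: dB.
      by apply/continuity_pt_filterlim; apply: (ex_derive_continuous (V := R_NormedModule)); exists (b z); exact: dB.
    by have := pos c; nra.
  have per := primitive_period b cb pb t; rewrite -/Bf -/P0 in per.
  case: sgn => h; [left|right].
    by have := inc t r tr h; have := inc r (t + 2 * PI) rt h; lra.
  by have := dcr t r tr h; have := dcr r (t + 2 * PI) rt h; lra.
(* For b of constant sign, B is monotone; a zero increment over a period would make it constant
   around [t1], contradicting b(t1) <> 0. *)
have Pn : P0 <> 0.
  move=> e; apply: bt1.
  have cst r : t1 <= r -> r <= t1 + 2 * PI -> Bf r = Bf t1 by move=> h1 h2; have := mono t1 r h1 h2; lra.
  have cst2 r : t1 - 2 * PI <= r -> r <= t1 -> Bf r = Bf t1.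
    by move=> h1 h2; have := mono r t1 h2 (ltac:(lra)); lra.
  have d0 : is_derive Bf t1 0.
    apply: (is_derive_ext_loc (fun _ => Bf t1)); last exact: is_derive_const.
    exists (mkposreal 1 Rlt_0_1) => r hr; have /Rabs_def2 [h1 h2] : Rabs (r - t1) < 1 by exact: hr.
    have := PI2_1 => pi1; case: (Rle_dec t1 r) => h; symmetry; [apply: cst | apply: cst2]; lra.
  by rewrite -(is_derive_unique _ _ _ (dB t1)) (is_derive_unique _ _ _ d0).
have base j : inZset lam a0 b j -> ode_ok j (4 * PI).
  move=> z; apply: ode_ok_flat => // t r.
  have [_ h] := inZ_res j z; have -> : lam j = 0; last lra.
  by have := Rmult_integral _ _ h; rewrite -/P0 => -[].
have [J HJ] := lam_large 1.
apply: (unif_finite _ J).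
- move=> j; case: (classic (inZset lam a0 b j)) => z; first by exists (4 * PI); exact: base.
  exact: ode_ok_nonres_ex.
- by move=> j K K'; exact: ode_ok_mono.
have x0 : 0 < 1 - exp (- Rabs P0).
  have : exp (- Rabs P0) < exp 0 by apply: exp_increasing; have := Rabs_pos_lt _ Pn; lra.
  by rewrite exp_0; lra.
(* The first term serves resonant indices. In the second, the growth factor S has cancelled against
   the S contained in the lower bound of |1 - Q|. *)
exists (4 * PI + 4 * PI / (1 - exp (- Rabs P0))) => j jJ.
have pos2 : 0 < 4 * PI / (1 - exp (- Rabs P0)) by apply: Rdiv_lt_0_compat; lra.
case: (classic (inZset lam a0 b j)) => z; first by apply: ode_ok_mono (base j z); lra.
have l1 := HJ j jJ.
set x := exp (- lam j * P0); have xp : 0 < x := exp_pos _.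
(* x is |Q|. By monotonicity B t - B r lies between 0 and -P0, so the growth over one period is at
   most max(1, |Q|); and |1 - |Q|| is at least the same maximum times 1 - exp(-|P0|), as |lam j| >=
   1. *)
set S := Rmax 1 x.
have S1 : 1 <= S by apply: Rmax_l.
have dS : S * (1 - exp (- Rabs P0)) <= Rabs (1 - x).
  have lp : Rabs P0 <= Rabs (lam j * P0) by rewrite Rabs_mult; have := Rabs_pos P0; nra.
  case: (Rle_dec 0 (lam j * P0)) => sg.
    have xle : x <= exp (- Rabs P0).
      by apply: exp_incr; rewrite (Rabs_pos_eq (lam j * P0)) // in lp; lra.
    rewrite /S Rmax_left; last lra.
    by rewrite (Rabs_pos_eq (1 - x)); lra.
  have xge : exp (Rabs P0) <= x.
    by apply: exp_incr; rewrite (Rabs_left (lam j * P0)) in lp; lra.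
  have e1 : 1 <= exp (Rabs P0) by apply: exp_ge1; exact: Rabs_pos.
  rewrite /S Rmax_right; last lra.
  rewrite (Rabs_left1 (1 - x)); last lra.
  have : exp (- Rabs P0) * exp (Rabs P0) = 1 by rewrite -exp_plus -exp_0; congr exp; ring.
  by have := exp_pos (- Rabs P0); nra.
have Sp : 0 < S * (1 - exp (- Rabs P0)) by apply: Rmult_lt_0_compat; lra.
apply: (ode_ok_mono _ _ _ _ (ode_ok_nonres j S (S * (1 - exp (- Rabs P0))) z Sp _ _)).
- rewrite (_ : 4 * PI * S / (S * (1 - exp (- Rabs P0))) = 4 * PI / (1 - exp (- Rabs P0))); first lra.
  by field; split; lra.
- move=> t r [h1 h2].
  have e : lam j * (Bf t - Bf r) <= 0 \/ lam j * (Bf t - Bf r) <= - lam j * P0.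
    by case: (mono t r h1 h2) => h; case: (Rle_dec 0 (lam j)) => hl; [left|right|right|left]; nra.
  case: e => h; [apply: Rle_trans (Rmax_l _ _) | apply: Rle_trans (Rmax_r _ _)]; rewrite -?exp_0; exact: exp_incr.
apply: Rle_trans dS _.
have := Cmod_triangle (Cminus (RtoC 1) (int_factor (lam j) a0 b (2 * PI))) (int_factor (lam j) a0 b (2 * PI)).
have := Cmod_triangle (Copp (Cminus (RtoC 1) (int_factor (lam j) a0 b (2 * PI)))) (RtoC 1).
rewrite (_ : Cplus (Cminus _ _) _ = RtoC 1); last by rewrite /Cminus; ring.
rewrite (_ : Cplus (Copp _) _ = int_factor (lam j) a0 b (2 * PI)); last by rewrite /Cminus; ring.
rewrite Cmod_opp int_factor_mod Cmod_1 -/Bf -/P0 -/x => h1 h2.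
by apply: Rabs_le; lra.
Qed.

Lemma case_c : (exists N, forall j, ~ inZset lam a0 b j -> (j < N)%N) -> (forall r, connectedT (Omega b r)) ->
  exists2 K, 0 <= K & forall j, ode_ok j K.
Proof.
move=> [N HN] conn; have p := PI_RGT_0.
have [J HJ] := lam_large 1.
(* All but finitely many indices are resonant, hence some resonant j has lam j <> 0, and the
   imaginary part of lam j c_0 being zero forces b to have mean zero. *)
have B0 : Bf (2 * PI) = 0.
  pose j := maxn J N.
  have z : inZset lam a0 b j by apply: NNPP => z; have := HN j z; rewrite /j; lia.
  have l1 := HJ j (leq_maxl _ _).
  have [_ /Rmult_integral [h|//]] := inZ_res j z.
  by move: l1; rewrite h Rabs_R0; lra.
apply: (unif_finite _ N).
- move=> j; case: (classic (inZset lam a0 b j)) => z; first by exists (4 * PI); exact: ode_ok_conn.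
  exact: ode_ok_nonres_ex.
- by move=> j K K'; exact: ode_ok_mono.
exists (4 * PI) => j jN; apply: ode_ok_conn => //.
by apply: NNPP => z; have := HN j z; lia.
Qed.
End Cases.

(** * Eigenfunction series *)

Definition Cseries (F : nat -> C) : C := (Series (fun j => Re (F j)), Series (fun j => Im (F j))).

Section ComplexSeries.
Variable q : nat -> R.
Hypothesis qs : ex_series q.

Lemma ex_series_dom (f : nat -> R) M : (forall j, Rabs (f j) <= M * q j) -> ex_series f.
Proof.
move=> h; apply: (ex_series_le (V := R_CompleteNormedModule) f (fun j => M * q j)) => [j|]; first exact: h.
exact: (ex_series_scal_l (V := R_NormedModule) M q qs).
Qed.
Lemma Series_dom (f : nat -> R) M : (forall j, Rabs (f j) <= M * q j) -> Rabs (Series f) <= M * Series q.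
Proof.
move=> h; rewrite -Series_scal_l.
have e1 : ex_series (fun j => Rabs (f j)).
  by apply: (ex_series_dom _ M) => j; rewrite Rabs_Rabsolu.
apply: Rle_trans (Series_Rabs _ e1) _; apply: Series_le => [j|]; first by split; [exact: Rabs_pos | exact: h].
exact: (ex_series_scal_l (V := R_NormedModule) M q qs).
Qed.
Lemma ex_Cseries F M : (forall j, Cmod (F j) <= M * q j) ->
  ex_series (fun j => Re (F j)) /\ ex_series (fun j => Im (F j)).
Proof.
move=> h; split; apply: (ex_series_dom _ M) => j; apply: Rle_trans (h j); [exact: Re_le_Cmod | exact: Im_le_Cmod].
Qed.
Lemma Cseries_bound F M : (forall j, Cmod (F j) <= M * q j) -> Cmod (Cseries F) <= 2 * M * Series q.
Proof.
move=> h; apply: Rle_trans (Cmod_le_abs _) _; rewrite /Cseries.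
have h1 := Series_dom (fun j => Re (F j)) M (fun j => Rle_trans _ _ _ (Re_le_Cmod _) (h j)).
have h2 := Series_dom (fun j => Im (F j)) M (fun j => Rle_trans _ _ _ (Im_le_Cmod _) (h j)).
by move: h1 h2; simpl; lra.
Qed.
Lemma Cseries_plus F G M : (forall j, Cmod (F j) <= M * q j) -> (forall j, Cmod (G j) <= M * q j) ->
  Cseries (fun j => Cplus (F j) (G j)) = Cplus (Cseries F) (Cseries G).
Proof.
move=> hF hG; have [f1 f2] := ex_Cseries F M hF; have [g1 g2] := ex_Cseries G M hG.
by apply: C_ext; [exact: Series_plus f1 g1 | exact: Series_plus f2 g2].
Qed.
Lemma Cseries_scal c F M : (forall j, Cmod (F j) <= M * q j) -> Cseries (fun j => Cmult c (F j)) = Cmult c (Cseries F).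
Proof.
move=> hF; have [f1 f2] := ex_Cseries F M hF.
have s a (f : nat -> R) : ex_series f -> ex_series (fun j => a * f j).
  by move=> h; exact: (ex_series_scal_l (V := R_NormedModule) a f h).
apply: C_ext; rewrite /Cseries /=.
  by rewrite (Series_minus _ _ (s _ _ f1) (s _ _ f2)) !Series_scal_l.
by rewrite (Series_plus _ _ (s _ _ f2) (s _ _ f1)) !Series_scal_l.
Qed.
Lemma Cseries_zero : Cseries (fun _ => RtoC 0) = RtoC 0.
Proof.
have z j : Cmod ((fun _ : nat => RtoC 0) j) <= 0 * q j by rewrite /= Cmod_0; lra.
transitivity (Cmult (RtoC 0) (Cseries (fun _ => RtoC 0))); last by rewrite Cmult_0_l.
rewrite -(Cseries_scal (RtoC 0) _ _ z); congr Cseries; apply: fext => j; ring.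
Qed.
Lemma Cseries_csum {Z} (l : seq Z) (F : Z -> nat -> C) : (forall z, exists M, forall j, Cmod (F z j) <= M * q j) ->
  Cseries (fun j => \csum_(z <- l) F z j) = \csum_(z <- l) Cseries (F z).
Proof.
move=> H.
suff [E _] : Cseries (fun j => \csum_(z <- l) F z j) = \csum_(z <- l) Cseries (F z) /\
    exists M, forall j, Cmod (\csum_(z <- l) F z j) <= M * q j by [].
elim: l => [|z l [IH [M HM]]].
  split; last by exists 0 => j; rewrite big_nil Cmod_0; lra.
  rewrite [RHS]big_nil; transitivity (Cseries (fun _ => RtoC 0)); last exact: Cseries_zero.
  by congr Cseries; apply: fext => j; rewrite big_nil.
have [M' HM'] := H z.
have e : (fun j => \csum_(z <- z :: l) F z j) = (fun j => Cplus (F z j) (\csum_(z <- l) F z j)).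
  by apply: fext => j; rewrite big_cons.
split.
  have [f1 f2] := ex_Cseries _ _ HM'; have [g1 g2] := ex_Cseries _ _ HM.
  rewrite e big_cons -IH.
  by apply: C_ext; [exact: Series_plus f1 g1 | exact: Series_plus f2 g2].
exists (M' + M) => j; rewrite big_cons; apply: Rle_trans (Cmod_triangle _ _) _.
by have := HM j; have := HM' j; lra.
Qed.
Lemma Cseries_split F M N : (forall j, Cmod (F j) <= M * q j) ->
  Cseries F = Cplus (\csum_(j <- iota 0 N) F j) (Cseries (fun j => F (N + j)%N)).
Proof.
move=> hF; have [f1 f2] := ex_Cseries F M hF.
elim: N => [|N IH]; first by rewrite big_nil Cplus_0_l.
rewrite csum_last {}IH -Cplus_assoc; congr Cplus.
have s (f : nat -> R) : ex_series f -> Series (fun j => f (N + j)%N) = f N + Series (fun j => f (N.+1 + j)%N).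
  move=> h; rewrite Series_incr_1 ?addn0; last exact: (proj1 (ex_series_incr_n (V := R_NormedModule) f N)).
  by congr (_ + _); apply: Series_ext => j; congr f; lia.
by apply: C_ext; [exact: s f1 | exact: s f2].
Qed.
Lemma tail_small eps : 0 < eps -> exists N0, forall N, (N0 <= N)%N -> Series (fun j => q (N + j)%N) < eps.
Proof.
move=> e0.
have H := Series_correct q qs.
have /is_lim_seq_spec /= L : is_lim_seq (sum_n q) (Series q) by exact: H.
have [N0 HN0] := L (mkposreal eps e0).
exists N0.+1 => N hN.
have hN1 : (N0 <= N.-1)%coq_nat by lia.
have := HN0 _ hN1; rewrite sum_n_Reals /=.
have Np : (0 < N)%coq_nat by lia.
rewrite (Series_incr_n q N Np qs).
rewrite (Series_ext (fun j => q (N + j)%N) (fun k => q (N + k)%coq_nat)) // => /Rabs_def2 [_].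
lra.
Qed.

(** Termwise differentiation from a common summable majorant of the second derivatives: the
    quadratic Taylor remainders are summed and [derive_quadratic] concludes. *)
Lemma Cseries_deriv (f d e : nat -> R -> C) M : 
  (forall j s, is_dC (f j) s (d j s)) -> (forall j s, is_dC (d j) s (e j s)) ->
  (forall j s, Cmod (f j s) <= M * q j) -> (forall j s, Cmod (d j s) <= M * q j) ->
  (forall j s, Cmod (e j s) <= M * q j) ->
  forall s, is_dC (fun s => Cseries (f^~ s)) s (Cseries (d^~ s)).
Proof.
move=> Hf Hd bf bd be s.
have core (f1 d1 e1 : nat -> R -> R) : (forall j s, is_derive (f1 j) s (d1 j s)) ->
    (forall j s, is_derive (d1 j) s (e1 j s)) -> (forall j s, Rabs (f1 j s) <= M * q j) ->
    (forall j s, Rabs (d1 j s) <= M * q j) -> (forall j s, Rabs (e1 j s) <= M * q j) ->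
    is_derive (fun s => Series (f1^~ s)) s (Series (d1^~ s)).
  move=> h1 h2 b1 b2 b3.
  have ef r := ex_series_dom (f1^~ r) M (b1^~ r).
  have ed := ex_series_dom (d1^~ s) M (b2^~ s).
  apply: (derive_quadratic _ _ _ (M * Series q)) => t _.
  have et : ex_series (fun j => t * d1 j s) by exact: (ex_series_scal_l (V := R_NormedModule) t _ ed).
  have em : ex_series (fun j => f1 j (s + t) - f1 j s).
    exact: (ex_series_minus (V := R_NormedModule) _ _ (ef (s + t)) (ef s)).
  rewrite -Series_scal_l -Series_minus // -Series_minus //.
  rewrite (_ : M * Series q * t ^ 2 = (M * t ^ 2) * Series q); last ring.
  apply: Series_dom => j.
  have := taylor_le (f1 j) (d1 j) (e1 j) s t (M * q j) (h1 j) (h2 j) (fun r _ => b3 j r); lra.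
split; [apply: (core (fun j s => Re (f j s)) (fun j s => Re (d j s)) (fun j s => Re (e j s)))
  | apply: (core (fun j s => Im (f j s)) (fun j s => Im (d j s)) (fun j s => Im (e j s)))] => j r.
- exact: proj1 (Hf j r). - exact: proj1 (Hd j r).
- exact: Rle_trans (Re_le_Cmod _) (bf j r). - exact: Rle_trans (Re_le_Cmod _) (bd j r).
- exact: Rle_trans (Re_le_Cmod _) (be j r).
- exact: proj2 (Hf j r). - exact: proj2 (Hd j r).
- exact: Rle_trans (Im_le_Cmod _) (bf j r). - exact: Rle_trans (Im_le_Cmod _) (bd j r).
- exact: Rle_trans (Im_le_Cmod _) (be j r).
Qed.
End ComplexSeries.

(** Joint continuity from bounded partial derivatives, replacing the coordinates of x by those of y
    one at a time. *)
Lemma lipschitz_contC {k} (g : Pt k -> C) (dg : 'I_k -> Pt k -> C) :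
  (forall i x, is_pd i g x (dg i x)) -> (forall i, exists M, forall x, Cmod (dg i x) <= M) -> contC g.
Proof.
move=> Hg Hb' x eps e0.
have [M Hb] : exists M, forall i x, Cmod (dg i x) <= M.
  suff [M HM] : exists M, forall i, i \in enum 'I_k -> forall x, Cmod (dg i x) <= M.
    by exists M => i; apply: HM; rewrite mem_enum.
  elim: (enum 'I_k) => [|i l [M HM]]; first by exists 0.
  have [M' HM'] := Hb' i; exists (Rmax M M') => i'; rewrite inE => /orP[/eqP -> {}x|il {}x].
    exact: Rle_trans (HM' x) (Rmax_r _ _).
  exact: Rle_trans (HM _ il x) (Rmax_l _ _).
pose M' := Rmax 0 M; have M0 : 0 <= M' := Rmax_l _ _; have MM : M <= M' := Rmax_r _ _.
have kp : 0 <= INR k by apply: pos_INR.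
pose dl := eps / (2 * M' * INR k + 1).
have den : 0 < 2 * M' * INR k + 1 by have : 0 <= 2 * M' * INR k by [apply: Rmult_le_pos => //; lra]; lra.
have d0 : 0 < dl by apply: Rdiv_lt_0_compat.
exists dl; split=> // y Hy.
pose z (l : seq 'I_k) : Pt k := foldr (fun i z => upd z i (y i)) x l.
have zc l i : z l i = y i \/ z l i = x i.
  elim: l => [|j l IH] /=; first by right.
  by rewrite /upd; case: eqP => [->|_]; [left|].
have ze l i : i \in l -> z l i = y i.
  elim: l => [//|j l IH]; rewrite inE /= /upd; case: eqP => [->|_] //=.
have zy : z (enum 'I_k) = y by apply: fext => i; apply: ze; rewrite mem_enum.
have step l : Cmod (Cminus (g (z l)) (g x)) <= 2 * M' * dl * INR (size l).
  elim: l => [|i l IH].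
    by rewrite /= (_ : Cminus _ _ = RtoC 0) ?Cmod_0 /Cminus; [lra|ring].
  have s1 r : is_dC (fun s => g (upd (z l) i s)) r (dg i (upd (z l) i r)).
    have [h1 h2] := Hg i (upd (z l) i r); rewrite upd_same in h1 h2.
    by split; [apply: is_derive_ext h1 | apply: is_derive_ext h2] => s /=; rewrite upd_upd.
  have := mvt_segC _ _ (z l i) (y i) M' s1 (fun r _ => Rle_trans _ _ _ (Hb i _) MM).
  rewrite upd_id => st.
  have -> : Cminus (g (z (i :: l))) (g x) =
      Cplus (Cminus (g (upd (z l) i (y i))) (g (z l))) (Cminus (g (z l)) (g x)) by rewrite /= /Cminus; ring.
  apply: Rle_trans (Cmod_triangle _ _) _; rewrite [size _]/= S_INR.
  have : Rabs (y i - z l i) <= dl.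
    by case: (zc l i) => ->; [rewrite Rminus_diag Rabs_R0; lra | left; exact: Hy].
  move=> h; have := Rmult_le_compat_l (2 * M') _ _ (ltac:(lra)) h; lra.
have := step (enum 'I_k); rewrite zy size_enum_ord => h; apply: Rle_lt_trans h _.
have e : dl * (2 * M' * INR k + 1) = eps by rewrite /dl; field; lra.
lra.
Qed.

(** * Termwise calculus for eigenfunction series *)

Section Synthesis.
Variable n : nat.
Notation F := (Pt n -> C).
Variables (V : nat -> nat -> R -> C) (q : nat -> R).
Hypotheses (q0 : forall j, 0 <= q j) (qs : ex_series q).
Hypothesis HV : forall j g t, is_dC (V j g) t (V j g.+1 t).
(** Every time derivative and every word has, uniformly in t and x, a majorant proportional to one
    summable sequence [q]. The class is stable under words and linear combinations, which justifies
    every termwise operation. *)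
Definition dominated (psi : nat -> F) : Prop := (forall j, nice (psi j)) /\
  forall g w, exists M, forall j t x, Cmod (V j g t) * Cmod (zw w (psi j) x) <= M * q j.
Definition eigsum (g : nat) (psi : nat -> F) (t : R) : F := fun x => Cseries (fun j => Cmult (V j g t) (psi j x)).

Lemma dominated_zw psi w : dominated psi -> dominated (fun j => zw w (psi j)).
Proof.
case=> h1 h2; split=> [j|g w']; first exact: nice_zw.
have [M HM] := h2 g (w' ++ w); exists M => j t x; rewrite -zw_cat; exact: HM.
Qed.
Lemma dominated_pd psi i : dominated psi -> dominated (fun j => pd i (psi j)).
Proof.
case=> h1 h2; split=> [j|g w]; first exact: nice_pd.
have [M HM] := h2 g (rcons w (rshift n i)); exists M => j t x.
rewrite pd_Z zw_scal; last by apply: smooth_Z; exact: nice_smooth.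
by rewrite /cscal Cmod_mult Cmod_Ci Rmult_1_l -zw_rcons; exact: HM.
Qed.
Lemma dominated_scal psi a : dominated psi -> dominated (fun j => cscal a (psi j)).
Proof.
case=> h1 h2; split=> [j|g w]; first exact: nice_scal.
have [M HM] := h2 g w; exists (Cmod a * M) => j t x; rewrite zw_scal; last exact: nice_smooth.
rewrite /cscal Cmod_mult; have := Rmult_le_compat_l _ _ _ (Cmod_ge_0 a) (HM j t x); lra.
Qed.
Lemma dominated_plus psi psi' : dominated psi -> dominated psi' -> dominated (fun j => cplus (psi j) (psi' j)).
Proof.
move=> [h1 h2] [h1' h2']; split=> [j|g w]; first exact: nice_plus.
have [M HM] := h2 g w; have [M' HM'] := h2' g w; exists (M + M') => j t x.
rewrite zw_plus; [|exact: nice_smooth|exact: nice_smooth].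
have := HM j t x; have := HM' j t x.
have := Rmult_le_compat_l _ _ _ (Cmod_ge_0 (V j g t)) (Cmod_triangle (zw w (psi j) x) (zw w (psi' j) x)).
rewrite /cplus; lra.
Qed.
Lemma dominated_lsum {Z} (l : seq Z) (ka : Z -> C) (W : Z -> seq 'I_(n + n)) psi : dominated psi ->
  dominated (fun j => lsum l ka (fun z => zw (W z) (psi j))).
Proof.
move=> fP; elim: l => [|z l IH] /=.
  have -> : (fun _ : nat => fun _ : Pt n => RtoC 0) = (fun j => cscal (RtoC 0) (psi j)).
    by apply: fext => j; apply: fext => x; rewrite /cscal; ring.
  exact: dominated_scal.
apply: dominated_plus IH; apply: (dominated_scal (fun j => zw (W z) (psi j))); exact: dominated_zw.
Qed.
Lemma dominated_bound psi g : dominated psi -> exists M, forall j t x, Cmod (Cmult (V j g t) (psi j x)) <= M * q j.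
Proof. by case=> _ /(_ g [::]) [M HM]; exists M => j t x; rewrite Cmod_mult; exact: HM. Qed.
Lemma dominated_bound3 psi g psi' g' psi'' g'' : dominated psi -> dominated psi' -> dominated psi'' ->
  exists M, [/\ forall j t x, Cmod (Cmult (V j g t) (psi j x)) <= M * q j,
    forall j t x, Cmod (Cmult (V j g' t) (psi' j x)) <= M * q j &
    forall j t x, Cmod (Cmult (V j g'' t) (psi'' j x)) <= M * q j].
Proof.
move=> f1 f2 f3; have [M1 h1] := dominated_bound _ g f1; have [M2 h2] := dominated_bound _ g' f2; have [M3 h3] := dominated_bound _ g'' f3.
exists (Rmax M1 (Rmax M2 M3)).
have b1 := Rmax_l M1 (Rmax M2 M3); have b2 := Rmax_r M1 (Rmax M2 M3).
have b3 := Rmax_l M2 M3; have b4 := Rmax_r M2 M3.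
by split=> j t x; [apply: Rle_trans (h1 j t x) _ | apply: Rle_trans (h2 j t x) _ | apply: Rle_trans (h3 j t x) _];
  apply: Rmult_le_compat_r => //; lra.
Qed.
Lemma eigsum_dt g psi x t : dominated psi -> is_dC (fun t => eigsum g psi t x) t (eigsum g.+1 psi t x).
Proof.
move=> fP; have [M [h1 h2 h3]] := dominated_bound3 psi g psi g.+1 psi g.+2 fP fP fP.
have d g' j s : is_dC (fun t => Cmult (V j g' t) (psi j x)) s (Cmult (V j g'.+1 s) (psi j x)).
  apply: is_dC_eq (is_dC_mult _ _ _ _ _ (HV j g' s) (is_dC_const (psi j x) s)); ring.
exact: (Cseries_deriv q qs _ _ _ M (d g) (d g.+1)).
Qed.
Lemma eigsum_dx g psi t i x : dominated psi -> is_pd i (eigsum g psi t) x (eigsum g (fun j => pd i (psi j)) t x).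
Proof.
move=> fP; have f1 := dominated_pd _ i fP; have f2 := dominated_pd _ i f1.
have [M [h1 h2 h3]] := dominated_bound3 psi g _ g _ g fP f1 f2.
have d (Q : nat -> F) : dominated Q -> forall j s,
    is_dC (fun s => Cmult (V j g t) (Q j (upd x i s))) s (Cmult (V j g t) (pd i (Q j) (upd x i s))).
  move=> fQ j s; apply: is_dC_scal; exact: (smooth_section _ i x (nice_smooth _ (proj1 fQ j)) s).
have := Cseries_deriv q qs _ _ _ M (d _ fP) (d _ f1) (fun j s => h1 j t _) (fun j s => h2 j t _) (fun j s => h3 j t _) (x i).
by rewrite upd_id.
Qed.
Lemma is_pd_flat_t g psi y : dominated psi -> is_pd ord0 (flat (eigsum g psi)) y (flat (eigsum g.+1 psi) y).
Proof.
move=> fP; rewrite -(tx_eta y); set t := y ord0; set x := fun i => _.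
have [h1 h2] := eigsum_dt g psi x t fP.
rewrite /is_pd tx_0 (flat_tx (eigsum g.+1 psi)); split; [apply: is_derive_ext h1 | apply: is_derive_ext h2] => s; cbv beta;
  by rewrite upd_tx_0 flat_tx.
Qed.
Lemma is_pd_flat_x g psi y i : dominated psi ->
  is_pd (lift ord0 i) (flat (eigsum g psi)) y (flat (eigsum g (fun j => pd i (psi j))) y).
Proof.
move=> fP; rewrite -(tx_eta y); set t := y ord0; set x := fun i => _.
have [h1 h2] := eigsum_dx g psi t i x fP.
rewrite /is_pd tx_lift (flat_tx (eigsum g (fun j => pd i (psi j)))); split; [apply: is_derive_ext h1 | apply: is_derive_ext h2] => s; cbv beta;
  by rewrite upd_tx_lift flat_tx.
Qed.
Lemma eigsum_bound g psi t x M : (forall j t x, Cmod (Cmult (V j g t) (psi j x)) <= M * q j) ->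
  Cmod (eigsum g psi t x) <= 2 * M * Series q.
Proof. by move=> H; apply: (Cseries_bound q qs) => j; exact: H. Qed.
(** The coinduction runs over all series at once: a derivative in t raises [g], a derivative in x
    changes [psi]. Continuity comes from the bounded partial derivatives. *)
Lemma smooth_eigsum g psi : dominated psi -> smooth (flat (eigsum g psi)).
Proof.
move=> fP; apply: (smooth_coind (fun G => exists g psi, dominated psi /\ G = flat (eigsum g psi))); last by exists g, psi.
move=> _ [{}g [{}psi [{}fP ->]]]; split.
  apply: (lipschitz_contC _ (fun i y => pd i (flat (eigsum g psi)) y)) => i; case: (unliftP ord0 i) => [j|] ->.
  - by move=> y; rewrite (is_pd_unique _ _ _ _ (is_pd_flat_x g psi y j fP)); exact: is_pd_flat_x.
  - by move=> y; rewrite (is_pd_unique _ _ _ _ (is_pd_flat_t g psi y fP)); exact: is_pd_flat_t.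
  - have [M HM] := dominated_bound _ g (dominated_pd _ j fP); exists (2 * M * Series q) => y.
    rewrite (is_pd_unique _ _ _ _ (is_pd_flat_x g psi y j fP)); exact: eigsum_bound.
  have [M HM] := dominated_bound _ g.+1 fP; exists (2 * M * Series q) => y.
  rewrite (is_pd_unique _ _ _ _ (is_pd_flat_t g psi y fP)); exact: eigsum_bound.
move=> i; case: (unliftP ord0 i) => [j|] ->.
  split=> [y|]; first exact: is_pd_has _ _ _ _ (is_pd_flat_x g psi y j fP).
  exists g, (fun l => pd j (psi l)); split; first exact: dominated_pd.
  by apply: fext => y; exact: is_pd_unique _ _ _ _ (is_pd_flat_x g psi y j fP).
split=> [y|]; first exact: is_pd_has _ _ _ _ (is_pd_flat_t g psi y fP).
exists g.+1, psi; split=> //; apply: fext => y; exact: is_pd_unique _ _ _ _ (is_pd_flat_t g psi y fP).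
Qed.
Lemma eigsum_pd g psi t i : dominated psi -> pd i (eigsum g psi t) = eigsum g (fun j => pd i (psi j)) t.
Proof. by move=> fP; apply: fext => x; exact: is_pd_unique _ _ _ _ (eigsum_dx g psi t i x fP). Qed.
Lemma dominated_dw psi w : dominated psi -> dominated (fun j => dw w (psi j)).
Proof. by move=> fP; elim: w => //= i w IH; exact: dominated_pd. Qed.
Lemma dw_flat_eigsum g psi w : dominated psi ->
  dw (nseq g ord0 ++ map (lift ord0) w) (flat (eigsum 0 psi)) = flat (eigsum g (fun j => dw w (psi j))).
Proof.
move=> fP.
have e : dw (map (lift ord0) w) (flat (eigsum 0 psi)) = flat (eigsum 0 (fun j => dw w (psi j))).
  elim: w => //= i w ->; apply: fext => y.
  exact: is_pd_unique _ _ _ _ (is_pd_flat_x 0 _ y i (dominated_dw psi w fP)).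
rewrite dw_cat e; elim: g => //= g ->; apply: fext => y.
exact: is_pd_unique _ _ _ _ (is_pd_flat_t g _ y (dominated_dw psi w fP)).
Qed.
Lemma eigsum_zw g psi t w : dominated psi -> zw w (eigsum g psi t) = eigsum g (fun j => zw w (psi j)) t.
Proof.
move=> fP; elim: w => [//|i w IH]; rewrite /= {}IH.
have fw := dominated_zw psi w fP.
elim/(@letterP n): i => i.
  rewrite Zop_l; apply: fext => x; have [M HM] := dominated_bound _ g fw.
  rewrite /eigsum -(Cseries_scal q qs _ _ M) => [|j]; last exact: HM.
  by congr Cseries; apply: fext => j; rewrite Zop_l; ring.
rewrite Zop_r eigsum_pd //; apply: fext => x; have [M HM] := dominated_bound _ g (dominated_pd _ i fw).
rewrite /eigsum -(Cseries_scal q qs _ _ M) => [|j]; last exact: HM.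
by congr Cseries; apply: fext => j; rewrite Zop_r; ring.
Qed.
Lemma nice_eigsum g psi t : dominated psi -> nice (eigsum g psi t).
Proof.
move=> fP; split.
  have -> : eigsum g psi t = slice (flat (eigsum g psi)) t by apply: fext => x; rewrite /slice flat_tx.
  exact: smooth_slice (smooth_eigsum g psi fP).
move=> w; rewrite eigsum_zw //; have [M HM] := dominated_bound _ g (dominated_zw psi w fP).
by exists (2 * M * Series q) => x; apply: eigsum_bound.
Qed.
Lemma eigsum_lsum {Z} (l : seq Z) (ka : Z -> C) (W : Z -> seq 'I_(n + n)) g psi t : dominated psi ->
  lsum l ka (fun z => zw (W z) (eigsum g psi t)) = eigsum g (fun j => lsum l ka (fun z => zw (W z) (psi j))) t.
Proof.
move=> fP; apply: fext => x; rewrite lsumE.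
have H z : exists M, forall j, Cmod (Cmult (ka z) (Cmult (V j g t) (zw (W z) (psi j) x))) <= M * q j.
  have [M HM] := dominated_bound _ g (dominated_zw psi (W z) fP); exists (Cmod (ka z) * M) => j.
  by rewrite Cmod_mult Rmult_assoc; apply: Rmult_le_compat_l; [exact: Cmod_ge_0 | exact: HM].
transitivity (\csum_(z <- l) Cseries (fun j => Cmult (ka z) (Cmult (V j g t) (zw (W z) (psi j) x)))).
  apply: eq_bigr => z _; have [M HM] := dominated_bound _ g (dominated_zw psi (W z) fP).
  by rewrite eigsum_zw // (Cseries_scal q qs _ _ M).
rewrite -(Cseries_csum q qs l _ H); congr Cseries; apply: fext => j.
by rewrite lsumE -csum_distl; apply: eq_bigr => z _; ring.
Qed.
Lemma eigsum_Pop c m g psi t : dominated psi -> Pop c m (eigsum g psi t) = eigsum g (fun j => Pop c m (psi j)) t.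
Proof.
move=> fP; rewrite Pop_lsum; last exact: nice_smooth (nice_eigsum g psi t fP).
rewrite eigsum_lsum //; congr (eigsum g _ t); apply: fext => j.
by rewrite Pop_lsum //; exact: nice_smooth (proj1 fP j).
Qed.
End Synthesis.
Arguments dominated {n}.
Arguments eigsum {n}.

(** A multinomial coefficient with k parts is at most 2^(k |a|), one binomial bound per
    coordinate. *)
Lemma fact_mlen_le {k} (a : mindex k) : INR (fact (mlen a)) <= (2 ^ k) ^ mlen a * INR (mfact a).
Proof.
have e : 2 ^ k = 2 ^ size (enum 'I_k) by rewrite size_enum_ord.
rewrite /mfact /mlen e; elim: (enum 'I_k) => [|i l IH]; first by rewrite /=; lra.
set s := sumn _ in IH; set P := foldr _ _ _ in IH.
have -> : sumn [seq a i | i <- i :: l] = (a i + s)%N by [].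
have -> : foldr Nat.mul 1%N [seq fact (a i) | i <- i :: l] = (fact (a i) * P)%coq_nat by [].
rewrite mult_INR; apply: Rle_trans (fact_add_le (a i) s) _.
have -> : size (i :: l) = (size l).+1 by [].
have e2 : (2 ^ (size l).+1) ^ (a i + s) = 2 ^ (a i + s) * (2 ^ size l) ^ (a i + s) by rewrite -Rpow_mult_distr.
have p2 := fact_ge1 (a i); have p3 : 0 <= INR P by apply: pos_INR.
have p4 : 1 <= 2 ^ size l by apply: pow_R1_Rle; lra.
rewrite e2 (Rmult_assoc (2 ^ _)); apply: Rmult_le_compat_l; first by apply: pow_le; lra.
have h : (2 ^ size l) ^ s * INR P <= (2 ^ size l) ^ (a i + s) * INR P.
  by apply: Rmult_le_compat_r => //; apply: Rle_pow => //; lia.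
have := Rmult_le_compat_l (INR (fact (a i))) _ _ (ltac:(lra)) (Rle_trans _ _ _ IH h); lra.
Qed.
Lemma fpow_mlen_le k mu : 0 <= mu -> exists2 D, 1 <= D & forall a b : mindex k,
  fpow (mlen a + mlen b) mu <= D ^ (mlen a + mlen b) * Rpower (INR (mfact a * mfact b)) mu.
Proof.
move=> m0.
have k1 : 1 <= 2 ^ k by apply: pow_R1_Rle; lra.
exists (Rpower (2 * 2 ^ k) mu); first by apply: Rpower_ge1 => //; lra.
move=> a b; set l := (_ + _)%N.
have ma : 0 < INR (mfact a) by apply: lt_0_INR; exact: mfact_pos.
have mb : 0 < INR (mfact b) by apply: lt_0_INR; exact: mfact_pos.
have mm : INR (mfact a * mfact b) = INR (mfact a) * INR (mfact b) by rewrite -mult_INR.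
rewrite -pow_Rpower; last by apply: Rmult_lt_0_compat; lra.
rewrite Rpower_mult_distr; [|by apply: pow_lt; lra | by rewrite mm; exact: Rmult_lt_0_compat].
apply: Rpower_le_base => //; first by have := fact_ge1 l; lra.
apply: Rle_trans (fact_add_le _ _) _; rewrite -/l Rpow_mult_distr mm Rmult_assoc.
apply: Rmult_le_compat_l; first by apply: pow_le; lra.
apply: Rle_trans (Rmult_le_compat _ _ _ _ _ _ (fact_mlen_le a) (fact_mlen_le b)) _; try exact: pos_INR.
by rewrite /l pow_add; right; ring.
Qed.
Lemma Cmod_zw_letters {k} u b (g : Pt k -> C) x : smooth g ->
  Cmod (zw (map (lshift k) u ++ map (@rshift k k) b) g x) = Cmod (Cmult (RtoC (amon u x)) (dw b g x)).
Proof.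
move=> sg; rewrite zw_cat zw_xletters zw_dletters // /cscal !Cmod_mult Cmod_pow Cmod_opp Cmod_Ci pow1; ring.
Qed.

(** * Orthonormal expansions *)

Section Orthonormal.
Variables (n : nat) (V : nat -> nat -> R -> C) (q : nat -> R) (phi : nat -> Pt n -> C).
Hypotheses (q0 : forall j, 0 <= q j) (qs : ex_series q).
Hypothesis HV : forall j g t, is_dC (V j g) t (V j g.+1 t).
Hypothesis nphi : forall j, nice (phi j).
Variables (K D s mu : R).
Hypotheses (K0 : 0 <= K) (D1 : 1 <= D) (mu0 : 0 <= mu) (s0 : 0 <= s).
Hypothesis HB : forall j g t w x, Cmod (V j g t) * Cmod (zw w (phi j) x)
  <= K * (D ^ g * fpow g s) * (D ^ size w * fpow (size w) mu) * q j.

Lemma dominated_eigenfunctions : dominated V q phi.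
Proof. by split=> // g w; exists (K * (D ^ g * fpow g s) * (D ^ size w * fpow (size w) mu)) => j t x; exact: HB. Qed.

Lemma eigsum_S_sm : (forall j t, V j 0 (t + 2 * PI) = V j 0 t) -> S_sm s mu (eigsum V 0 phi).
Proof.
move=> pV; split; first exact: smooth_eigsum dominated_eigenfunctions.
split; first by move=> t x; congr Cseries; apply: fext => j; rewrite pV.
have [E E1 HE] := fpow_mlen_le n mu mu0.
exists (D * E), (2 * K * Series q); split; first by apply: Rmult_lt_0_compat; lra.
move=> a b g t x.
rewrite dmi_exps exps_txindex (dw_flat_eigsum n V q q0 qs HV g phi _ dominated_eigenfunctions).
rewrite flat_tx; set l := (mlen a + mlen b)%N.
pose M := K * (D ^ g * fpow g s) * (D ^ l * fpow l mu).
have Q0 : 0 <= Series q.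
  rewrite -(Rmult_0_l (Series q)) -Series_scal_l; apply: Series_le => // j.
  by have := q0 j; lra.
have HM j : Cmod (Cmult (RtoC (xpow x a)) (Cmult (V j g t) (dw (exps b) (phi j) x))) <= M * q j.
  have := HB j g t (map (lshift n) (exps a) ++ map (@rshift n n) (exps b)) x.
  rewrite Cmod_zw_letters ?amon_exps; last exact: nice_smooth.
  rewrite size_cat !size_map !size_exps -/l -/M => h; apply: Rle_trans h; right.
  by rewrite !Cmod_mult; ring.
have [MT HT] := dominated_bound _ _ _ _ g (dominated_dw _ _ _ phi (exps b) dominated_eigenfunctions).
rewrite /eigsum -(Cseries_scal q qs _ _ MT) //.
apply: Rle_trans (Cseries_bound q qs _ _ HM) _.
rewrite /M -/l -/(fpow g s) Rpow_mult_distr (pow_add D l g) (pow_add E l g).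
have fg := fpow_pos g s.
have El : 1 <= E ^ l by apply: pow_R1_Rle.
have Eg1 : 1 <= E ^ g by apply: pow_R1_Rle.
have Dl : 0 < D ^ l by apply: pow_lt; lra.
have Dg : 0 < D ^ g by apply: pow_lt; lra.
have h := HE a b; rewrite -/l in h; set X := Rpower _ mu in h *.
have X0 : 0 < X := Rpower_pos _ _.
have c0 : 0 <= 2 * K * Series q * (D ^ g * fpow g s * D ^ l).
  apply: Rmult_le_pos; first by apply: Rmult_le_pos => //; lra.
  by apply: Rmult_le_pos; [apply: Rmult_le_pos|]; lra.
have h2 : fpow l mu <= E ^ l * X * E ^ g.
  apply: Rle_trans h _; rewrite -{1}(Rmult_1_r (E ^ l * X)); apply: Rmult_le_compat_l => //.
  by apply: Rmult_le_pos; lra.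
have := Rmult_le_compat_l _ _ _ c0 h2; lra.
Qed.

Hypothesis on : forall j k, inner (phi j) (phi k) = RtoC (if j == k then 1 else 0).
Lemma delta_sum (v : nat -> C) k N :
  \csum_(j <- iota 0 N) Cmult (v j) (RtoC (if j == k then 1 else 0)) = if (k < N)%N then v k else RtoC 0.
Proof.
elim: N => [|N IH]; first by rewrite big_nil.
rewrite csum_last IH ltnS; by case: (ltngtP N k) => h; rewrite ?h /=; ring.
Qed.
Lemma nrm_phi k : nrm (phi k) = 1.
Proof.
have := inner_self (phi k) (nphi k); rewrite on eqxx => /(f_equal Re) /= e.
by rewrite /nrm -e sqrt_1.
Qed.
End Orthonormal.

Lemma le0_all_eps x c : 0 <= c -> (forall eps, 0 < eps -> x <= c * eps) -> x <= 0.
Proof.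
move=> c0 H; apply: le_epsilon => e e0; rewrite Rplus_0_l.
have c1 : 0 < c + 1 by lra.
have := H (e / (c + 1)) (Rdiv_lt_0_compat _ _ e0 c1) => h; apply: Rle_trans h _.
rewrite (_ : c * (e / (c + 1)) = e * (c / (c + 1))); last by field; lra.
rewrite -{2}(Rmult_1_r e); apply: Rmult_le_compat_l; first lra.
by apply: (Rmult_le_reg_r (c + 1)); [lra | rewrite /Rdiv Rmult_assoc Rinv_l; lra].
Qed.
(** The integral and the series are never exchanged: the series is cut at N, the finite part is
    evaluated by orthonormality, and the tail is small in norm because it is again a dominated
    series. *)
Lemma inner_eigsum n V q (phi : nat -> Pt n -> C) K D s mu :
  (forall j, 0 <= q j) -> ex_series q -> (forall j g t, is_dC (V j g) t (V j g.+1 t)) ->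
  (forall j, nice (phi j)) -> 0 <= K -> 1 <= D -> 0 <= mu ->
  (forall j g t w x, Cmod (V j g t) * Cmod (zw w (phi j) x)
     <= K * (D ^ g * fpow g s) * (D ^ size w * fpow (size w) mu) * q j) ->
  (forall j k, inner (phi j) (phi k) = RtoC (if j == k then 1 else 0)) ->
  forall t k, inner (eigsum V 0 phi t) (phi k) = V k 0%N t.
Proof.
move=> q0 qs HV nphi K0 D1 mu0 HB on t k.
pose M := K * (D ^ 0 * fpow 0 s) * (D ^ n.*2 * fpow n.*2 mu).
have M0 : 0 <= M.
  apply: Rmult_le_pos; first apply: Rmult_le_pos => //.
    by apply: Rmult_le_pos; [apply: pow_le; lra | left; exact: fpow_pos].
  by apply: Rmult_le_pos; [apply: pow_le; lra | left; exact: fpow_pos].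
pose c0 := 2 ^ n * sqrt (PI ^ n) * (2 * M).
have c00 : 0 <= c0.
  apply: Rmult_le_pos; last lra.
  by apply: Rmult_le_pos; [apply: pow_le; lra | exact: sqrt_pos].
suff H eps : 0 < eps -> Cmod (Cminus (inner (eigsum V 0 phi t) (phi k)) (V k 0%N t)) <= c0 * eps.
  have z : Cmod (Cminus (inner (eigsum V 0 phi t) (phi k)) (V k 0%N t)) = 0.
    apply: Rle_antisym; last exact: Cmod_ge_0.
    exact: le0_all_eps c00 H.
  have := Cmod_eq_0 _ z => e.
  have -> : inner (eigsum V 0 phi t) (phi k) =
    Cplus (Cminus (inner (eigsum V 0 phi t) (phi k)) (V k 0%N t)) (V k 0%N t) by rewrite /Cminus; ring.
  by rewrite e; ring.
move=> e0; have [N0 HN0] := tail_small q qs eps e0.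
pose N := maxn N0 k.+1.
have tl := HN0 N (leq_maxl _ _).
pose V' j := V (N + j)%N; pose q' j := q (N + j)%N; pose phi' j := phi (N + j)%N.
have qs' : ex_series q' := proj1 (ex_series_incr_n (V := R_NormedModule) q N) qs.
have HV' j g r : is_dC (V' j g) r (V' j g.+1 r) by exact: HV.
have fP := dominated_eigenfunctions n V q phi nphi K D s mu HB.
have fP' : dominated V' q' phi' by apply: (dominated_eigenfunctions n V' q' phi' (fun j => nphi _) K D s mu) => j; exact: HB.
have nT := nice_eigsum n V' q' (fun j => q0 _) qs' HV' 0 phi' t fP'.
have [MT HT] := dominated_bound _ _ _ _ 0%N fP.
have E : eigsum V 0 phi t = cplus (lsum (iota 0 N) (fun j => V j 0%N t) phi) (eigsum V' 0 phi' t).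
  by apply: fext => x; rewrite /cplus lsumE /eigsum (Cseries_split q qs _ MT N).
have nL : nice (lsum (iota 0 N) (fun j => V j 0%N t) phi) by apply: nice_lsum.
rewrite E inner_plusl // inner_lsuml //.
have -> : \csum_(z <- iota 0 N) Cmult (V z 0%N t) (inner (phi z) (phi k)) = V k 0%N t.
  transitivity (\csum_(z <- iota 0 N) Cmult (V z 0%N t) (RtoC (if z == k then 1 else 0))).
    by apply: eq_bigr => z _; rewrite on.
  by rewrite (delta_sum (fun j => V j 0%N t)) /N leq_max ltnSn orbT.
rewrite (_ : Cminus (Cplus _ _) _ = inner (eigsum V' 0 phi' t) (phi k)); last by rewrite /Cminus; ring.
apply: Rle_trans (cauchy_schwarz _ _ nT (nphi k)) _; rewrite (nrm_phi n phi nphi on) Rmult_1_r.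
have Q0 : 0 <= Series q'.
  rewrite -(Rmult_0_l (Series q')) -Series_scal_l; apply: Series_le => // j.
  by have := q0 (N + j)%N; rewrite /q'; lra.
have B0 : 0 <= 2 * M * Series q' by apply: Rmult_le_pos => //; lra.
apply: (Rle_trans _ (2 ^ n * (2 * M * Series q') * sqrt (PI ^ n))).
  apply: nrm_words => //; move=> w x hw; rewrite (eigsum_zw n V' q' (fun j => q0 _) qs' 0 phi' t w fP').
  apply: (Cseries_bound q' qs') => j; rewrite Cmod_mult.
  apply: Rle_trans (HB (N + j)%N 0%N t w x) _; apply: Rmult_le_compat_r; first exact: q0.
  rewrite /M; apply: Rmult_le_compat_l.
    by apply: Rmult_le_pos => //; apply: Rmult_le_pos; [apply: pow_le; lra | left; exact: fpow_pos].
  apply: Rmult_le_compat; try (by apply: pow_le; lra); try (by left; exact: fpow_pos).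
    by apply: Rle_pow => //; lia.
  by apply: Rpower_le_base => //; [have := fact_ge1 (size w); lra | apply: le_INR; apply: fact_le; lia].
rewrite /c0; have : Series q' <= eps by left.
move=> h; have := Rmult_le_compat_l _ _ _ c00 h; rewrite /c0; lra.
Qed.
(** The difference between h and its series is a Schwartz function with vanishing coefficients, so
    completeness makes it zero everywhere. *)
Lemma expansion n V q (phi : nat -> Pt n -> C) K D s mu :
  (forall j, 0 <= q j) -> ex_series q -> (forall j g t, is_dC (V j g) t (V j g.+1 t)) ->
  (forall j, nice (phi j)) -> 0 <= K -> 1 <= D -> 0 <= mu ->
  (forall j g t w x, Cmod (V j g t) * Cmod (zw w (phi j) x)
     <= K * (D ^ g * fpow g s) * (D ^ size w * fpow (size w) mu) * q j) ->
  (forall j k, inner (phi j) (phi k) = RtoC (if j == k then 1 else 0)) ->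
  (forall g, schwartz g -> (forall j, inner g (phi j) = RtoC 0) -> forall x, g x = RtoC 0) ->
  forall t (h : Pt n -> C), nice h -> (forall k, inner h (phi k) = V k 0%N t) ->
  forall x, eigsum V 0 phi t x = h x.
Proof.
move=> q0 qs HV nphi K0 D1 mu0 HB on compl t h nh Hh x.
have fP := dominated_eigenfunctions n V q phi nphi K D s mu HB.
have nT := nice_eigsum n V q q0 qs HV 0 phi t fP.
have nN := nice_scal (RtoC (-1)) _ nT.
have e : cplus h (cscal (RtoC (-1)) (eigsum V 0 phi t)) x = RtoC 0.
  apply: (compl _ (nice_schwartz _ (nice_plus _ _ nh nN))) => k.
  rewrite inner_plusl // inner_scall // (inner_eigsum n V q phi K D s mu) // Hh.
  by apply: C_ext; rewrite /=; ring.
rewrite /cplus /cscal in e.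
have e1 := f_equal Re e; have e2 := f_equal Im e; move: (eigsum V 0 phi t x) (h x) e1 e2 => [z1 z2] [z1' z2'] e1 e2.
by apply: C_ext; move: e1 e2; rewrite /=; lra.
Qed.

(** * Assembling the solution *)

Lemma ex_series_inv_sq : ex_series (fun j => / INR j.+1 ^ 2).
Proof.
have pos j : 0 < / INR j.+1 ^ 2 by apply: Rinv_0_lt_compat; apply: pow_lt; apply: lt_0_INR; lia.
(* Telescoping comparison: 1/(x+1)^2 <= 1/x - 1/(x+1). *)
have bd j : sum_n (fun j => / INR j.+1 ^ 2) j <= 2 - / INR j.+1.
  elim: j => [|j IH]; first by rewrite sum_O /=; lra.
  rewrite sum_Sn /plus /=; apply: Rle_trans (Rplus_le_compat_r _ _ _ IH) _.
  have p1 : 0 < INR j.+1 by apply: lt_0_INR; lia.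
  change (2 - / INR j.+1 + / INR j.+2 ^ 2 <= 2 - / INR j.+2); rewrite (S_INR j.+1).
  set x := INR j.+1 in p1 *.
  have -> : / (x + 1) ^ 2 = / x - / (x + 1) - / (x * (x + 1) ^ 2) by field; lra.
  have : 0 < / (x * (x + 1) ^ 2).
    by apply: Rinv_0_lt_compat; apply: Rmult_lt_0_compat => //; apply: pow_lt; lra.
  lra.
have [l Hl] : ex_finite_lim_seq (sum_n (fun j => / INR j.+1 ^ 2)).
  apply: (ex_finite_lim_seq_incr _ 2) => j.
    by rewrite sum_Sn /plus /=; have := pos j.+1; rewrite /=; lra.
  have := bd j; have : 0 < / INR j.+1 by apply: Rinv_0_lt_compat; apply: lt_0_INR; lia.
  lra.
by exists l.
Qed.

(** Each term is bounded by [lam_growth], which asks that the Gevrey order s be at least kap = m mu;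
    the number of terms is at most 2^g. *)
Lemma gevrey_sum_growth kap e : 0 < kap -> 0 < e -> exists2 D, 1 <= D & forall lam s g, kap <= s ->
  gevrey_sum lam s g <= D ^ g * exp (e * Rpower (1 + Rabs lam) (/ kap)).
Proof.
move=> k0 e0; have [K K1 HK] := lam_growth kap e k0 e0.
exists (2 * K); first lra.
move=> lam s g ks; rewrite /gevrey_sum; set X := 1 + Rabs lam.
have X1 : 1 <= X by rewrite /X; have := Rabs_pos lam; lra.
set E := exp _; have int_factor_0 : 0 < E := exp_pos _.
apply: Rle_trans (_ : _ <= \rsum_(i <- iota 0 g.+1) (K ^ g * E)) _.
  apply: rsum_le_in => i; rewrite mem_iota => hi.
  have fs := fpow_pos i s.
  apply: (Rmult_le_reg_r (fpow i s)) => //; rewrite /Rdiv Rmult_assoc Rinv_l; last lra.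
  rewrite Rmult_1_r; apply: Rle_trans (HK X i X1) _; rewrite -/E.
  have h1 : K ^ i <= K ^ g by apply: Rle_pow => //; lia.
  have h2 := fpow_exp_le i _ _ ks; have h3 := fpow_pos i kap.
  have h4 : K ^ i * fpow i kap <= K ^ g * fpow i s.
    by apply: Rmult_le_compat => //; [apply: pow_le; lra | lra].
  have := Rmult_le_compat_r _ _ _ (Rlt_le _ _ int_factor_0) h4; lra.
rewrite rsum_const size_iota Rpow_mult_distr.
have g2 : INR g.+1 <= 2 ^ g.
  elim: g {HK} => [|g IH]; first by rewrite /=; lra.
  by rewrite S_INR [2 ^ _]/=; have : 1 <= 2 ^ g by [apply: pow_R1_Rle; lra]; lra.
have h : 0 <= K ^ g * E by apply: Rmult_le_pos; [apply: pow_le; lra | lra].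
have := Rmult_le_compat_r _ _ _ h g2; lra.
Qed.

Section Main.
Variables (n m : nat) (c : mindex n -> mindex n -> R) (mu a0 : R).
Variables (b : R -> R) (lam : nat -> R) (phi : nat -> Pt n -> C).
Hypotheses (n1 : (1 <= n)%N) (hm : 1 / 2 <= mu) (m2 : (2 <= m)%N).
Hypotheses (ell : globally_elliptic c m) (sa : self_adjoint c m).
Hypothesis sphi : forall j, schwartz (phi j).
Hypothesis eig : forall j x, Pop c m (phi j) x = Cmult (RtoC (lam j)) (phi j x).
Hypothesis on : forall j k, inner (phi j) (phi k) = RtoC (if j == k then 1 else 0).
Hypothesis compl : forall g, schwartz g -> (forall j, inner g (phi j) = RtoC 0) -> forall x, g x = RtoC 0.
Hypothesis weyl : exists rho, 0 < rho /\
  is_lim_seq (fun j => Rabs (lam j) / (rho * Rpower (INR j.+1) (INR m / (2 * INR n)))) 1.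
Hypothesis gb : gevrey_T b.
Let Y j := decay_rate m mu lam j.

Let nphi j : nice (phi j). Proof. exact: schwartz_nice. Qed.
Let Peig j : Pop c m (phi j) = cscal (RtoC (lam j)) (phi j).
Proof. by apply: fext => x; exact: eig. Qed.
Let nrm1 j : nrm (phi j) = 1. Proof. exact: nrm_phi. Qed.
Let mR : 0 < INR m. Proof. by apply: lt_0_INR; lia. Qed.
Let nR : 0 < INR n. Proof. by apply: lt_0_INR; lia. Qed.
Let mmu : 0 < INR m * mu. Proof. by apply: Rmult_lt_0_compat; lra. Qed.
Let Y1 j : 1 <= Y j. Proof. exact: (decay_rate_ge1 n). Qed.

(** Weyl's law makes exp(-e Y j) smaller than any power of j; the exchange [lam_growth] at exponent
    2 compares it with 1/(j+1)^2. *)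
Lemma ex_series_exp_Y e : 0 < e -> ex_series (fun j => exp (- e * Y j)).
Proof.
move=> e0; have [K1 K10 HK1] := index_le_decay_rate n m mu lam n1 hm m2 weyl.
have kap : 0 < 2 * INR n * mu by apply: Rmult_lt_0_compat; lra.
have e1 : 0 < e / (K1 + 1) by apply: Rdiv_lt_0_compat; lra.
have [K K2 HK] := lam_growth _ _ kap e1.
apply: (ex_series_dom _ ex_series_inv_sq _ (K ^ 2 * fpow 2 (2 * INR n * mu))) => j.
rewrite Rabs_pos_eq; last by left; exact: exp_pos.
have j1 : 1 <= INR j.+1 by rewrite S_INR; have := pos_INR j; lra.
have h := HK _ 2%N j1; set A := K ^ 2 * _ in h *.
have A0 : 0 <= A by apply: Rmult_le_pos; [apply: pow_le; lra | left; exact: fpow_pos].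
have ey : e / (K1 + 1) * Rpower (INR j.+1) (/ (2 * INR n * mu)) <= e * Y j.
  apply: Rle_trans (Rmult_le_compat_l _ _ _ (Rlt_le _ _ e1) (HK1 j)) _; have y1 := Y1 j; rewrite -/(Y j).
  have -> : e / (K1 + 1) * (K1 * Y j) = e * Y j * (K1 / (K1 + 1)) by field; lra.
  rewrite -{2}(Rmult_1_r (e * Y j)); apply: Rmult_le_compat_l; first by apply: Rmult_le_pos; lra.
  by apply: (Rmult_le_reg_r (K1 + 1)); [lra | rewrite /Rdiv Rmult_assoc Rinv_l; lra].
have h2 := Rle_trans _ _ _ h (Rmult_le_compat_l _ _ _ A0 (exp_incr _ _ ey)).
have p2 : 0 < INR j.+1 ^ 2 by apply: pow_lt; lra.
apply: (Rmult_le_reg_r (INR j.+1 ^ 2)) => //; rewrite Rmult_assoc Rinv_l; last lra.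
have -> : - e * Y j = - (e * Y j) by ring.
rewrite exp_Ropp; have ep := exp_pos (e * Y j).
apply: (Rmult_le_reg_l (exp (e * Y j))) => //; rewrite -Rmult_assoc Rinv_r; lra.
Qed.

Lemma phi_words e : 0 < e -> exists K D, 0 <= K /\ 1 <= D /\ forall j w x,
  Cmod (zw w (phi j) x) <= K * (D ^ size w * fpow (size w) mu) * exp (e * Y j).
Proof.
move=> e0; have [A [K [q [A1 [K0 H]]]]] := eig_bound c m m2 ell.
have [K' [D [K'0 [D1 HD]]]] := synth_growth mu e A q n hm e0 A1.
exists (K * K'), D; split; first exact: Rmult_le_pos.
split=> // j w x.
have x1 : 1 <= 1 + Rabs (lam j) by have := Rabs_pos (lam j); lra.
(* The scale on which one letter weighs one power: |lam j| <= L^m, and L^(1/mu) is exactly [Y j]. *)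
set L := Rpower (1 + Rabs (lam j)) (/ INR m).
have L1 : 1 <= L by apply: Rpower_ge1 => //; left; exact: Rinv_0_lt_compat.
have Lm : Rabs (lam j) <= L ^ m.
  rewrite -Rpower_pow; last lra.
  by rewrite /L Rpower_mult Rinv_l ?Rpower_1; lra.
have LY : Rpower L (/ mu) = Y j by rewrite /L Rpower_mult -Rinv_mult.
apply: Rle_trans (H _ _ L (nphi j) (Peig j) (nrm1 j) L1 Lm w x) _.
have := Rmult_le_compat_l _ _ _ K0 (HD L (size w) L1); rewrite LY; lra.
Qed.

(** Half of the decay of the coefficients is spent on the growth of the eigenfunctions, the other
    half keeps the series summable. *)
Lemma source_words e (V : nat -> nat -> R -> C) KV DV s : 0 < e -> 0 <= KV -> 1 <= DV ->
  (forall j g t, Cmod (V j g t) <= KV * (DV ^ g * fpow g s) * exp (- e * Y j)) ->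
  exists K D, 0 <= K /\ 1 <= D /\ forall j g t w x, Cmod (V j g t) * Cmod (zw w (phi j) x)
     <= K * (D ^ g * fpow g s) * (D ^ size w * fpow (size w) mu) * exp (- (e / 2) * Y j).
Proof.
move=> e0 KV0 DV1 HV; have [K [D [K0 [D1 H]]]] := phi_words (e / 2) (ltac:(lra)).
exists (KV * K), (Rmax DV D); split; first exact: Rmult_le_pos.
have m1 := Rmax_l DV D; have m3 := Rmax_r DV D; set E := Rmax DV D in m1 m3 *.
split; first lra.
move=> j g t w x.
apply: Rle_trans (Rmult_le_compat _ _ _ _ (Cmod_ge_0 _) (Cmod_ge_0 _) (HV j g t) (H j w x)) _.
have -> : exp (- (e / 2) * Y j) = exp (- e * Y j) * exp (e / 2 * Y j).
  by rewrite -exp_plus; congr exp; field.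
have fg := fpow_pos g s; have fw := fpow_pos (size w) mu.
have g1 : DV ^ g * fpow g s <= E ^ g * fpow g s.
  by apply: Rmult_le_compat_r; [lra | apply: pow_incr; lra].
have w1 : D ^ size w * fpow (size w) mu <= E ^ size w * fpow (size w) mu.
  by apply: Rmult_le_compat_r; [lra | apply: pow_incr; lra].
have p1 : 0 <= DV ^ g * fpow g s by apply: Rmult_le_pos; [apply: pow_le; lra | lra].
have p2 : 0 <= D ^ size w * fpow (size w) mu by apply: Rmult_le_pos; [apply: pow_le; lra | lra].
have := Rmult_le_compat _ _ _ _ p1 p2 g1 w1.
have pe : 0 <= KV * K * (exp (- e * Y j) * exp (e / 2 * Y j)).
  apply: Rmult_le_pos; first exact: Rmult_le_pos.
  by left; apply: Rmult_lt_0_compat; exact: exp_pos.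
move=> h; have := Rmult_le_compat_l _ _ _ pe h; lra.
Qed.

(** The successive time derivatives of a0 + i b, in the form required by the Leibniz section. *)
Definition Gd (k : nat) (t : R) : C := if k is 0%N then (a0, b t) else (0, Derive_n b k t).
Lemma Gd_deriv k t : is_dC (Gd k) t (Gd k.+1 t).
Proof.
have [db _] := gb; case: k => [|k]; split=> /=; try exact: (is_derive_const (V := R_NormedModule)).
  exact: Derive_correct (db 0%N t).
exact: Derive_correct (db k.+1 t).
Qed.
Lemma b_cont t : continuous b t.
Proof. by have [db _] := gb; exact: (ex_derive_continuous (V := R_NormedModule) _ _ (db 0%N t)). Qed.
Lemma b_per t : b (t + 2 * PI) = b t. Proof. by have [_ [pb _]] := gb. Qed.
Lemma b_bounded : exists bM, forall t, Rabs (b t) <= bM.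
Proof.
have [_ [_ [s [Cc [K [_ [_ H]]]]]]] := gb; exists (K * Cc ^ 0 * fpow 0 s) => t; exact: H 0%N t.
Qed.
Lemma Gd_bound : exists s Cc K, 1 <= s /\ 1 <= Cc /\ 0 <= K /\
  forall k t, Cmod (Gd k t) <= K * (Cc ^ k * fpow k s).
Proof.
have [_ [_ [s [Cc [K [s1 [C0 H]]]]]]] := gb.
exists s, (Rmax 1 Cc), (Rabs a0 + Rabs K); split=> //.
have c1 := Rmax_l 1 Cc; have c2 := Rmax_r 1 Cc; set E := Rmax 1 Cc in c1 c2 *.
split=> //; split; first by have := Rabs_pos a0; have := Rabs_pos K; lra.
move=> k t.
have E1 : 1 <= E ^ k by apply: pow_R1_Rle.
have f1 : 1 <= fpow k s by apply: fpow_ge1; lra.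
have Ef : 1 <= E ^ k * fpow k s by nra.
have hb : Rabs (Derive_n b k t) <= Rabs K * (E ^ k * fpow k s).
  apply: Rle_trans (H k t) _; rewrite -/(fpow k s) Rmult_assoc.
  apply: Rle_trans (Rle_abs _) _; rewrite Rabs_mult; apply: Rmult_le_compat_l; first exact: Rabs_pos.
  rewrite Rabs_pos_eq; last by apply: Rmult_le_pos; [apply: pow_le; lra | lra].
  by apply: Rmult_le_compat_r; [lra | apply: pow_incr; lra].
apply: Rle_trans (Cmod_le_abs _) _.
have A0 := Rabs_pos a0.
have aW := Rmult_le_pos _ _ A0 (Rle_trans _ _ _ Rle_0_1 Ef).
case: k hb Ef aW {E1 f1} => [|k] hb Ef aW.
  change (Rabs a0 + Rabs (Derive_n b 0 t) <= (Rabs a0 + Rabs K) * (E ^ 0 * fpow 0 s)).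
  by have := Rmult_le_compat_l _ _ _ A0 Ef; lra.
change (Rabs 0 + Rabs (Derive_n b k.+1 t) <= (Rabs a0 + Rabs K) * (E ^ k.+1 * fpow k.+1 s)).
rewrite Rabs_R0; lra.
Qed.

Lemma solvable_of_ode : (forall e, 0 < e -> exists2 K, 0 <= K & forall j, ode_ok a0 b lam j (K * exp (e * Y j))) ->
  globally_solvable c m mu lam phi a0 b.
Proof.
move=> ODE f [[sigma [sg1 Sf]] adm].
have pf : periodicT f by case: Sf => _ [].
have [e [KF [DF [e0 [KF0 [DF1 HF]]]]]] := coef_decay c m f sigma mu (ltac:(lia)) hm sa Sf.
pose Fc j g t := inner (tder g f t) (phi j).
have bF j g t : Cmod (Fc j g t) <= KF * (DF ^ g * fpow g sigma) * exp (- e * Y j) by exact: HF.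
have dF j g t : is_dC (Fc j g) t (Fc j g.+1 t) by apply: (coef_deriv f sigma mu).
have F0 j t : Fc j 0%N t = coef phi f j t by rewrite /Fc tder0.
(* Budget of the decay rate [e] of f: half is left to the scalar equations, a quarter to the time
   derivatives, an eighth to the eigenfunctions, and the last eighth makes the series converge. *)
have [KO KO0 HO] := ODE (e / 2) (ltac:(lra)).
have src j : good_source a0 b lam j (Fc j 0%N) (KF * exp (- e * Y j)).
  split; first by move=> t; exact: proj1 (dC_cont _ _ _ (dF j 0%N t)).
  split; first by move=> t; exact: proj2 (dC_cont _ _ _ (dF j 0%N t)).
  split; first by move=> t; rewrite !F0 /coef; congr inner; apply: fext => x; exact: pf.
  split; first by move=> t; have := bF j 0%N t; rewrite /fpow /Rpower [INR _]/= ln_1 Rmult_0_r exp_0 [_ ^ 0]/=; lra.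
  move=> z; have := adm j z; rewrite /weighted_primitive.
  by rewrite (_ : Fc j 0%N = coef phi f j) //; apply: fext => t; exact: F0.
have /choice [U HU] : forall j, exists U, solves (lam j) a0 b (Fc j 0%N) U /\
   (forall t, U (t + 2 * PI) = U t) /\ forall t, Cmod (U t) <= KO * KF * exp (- (e / 2) * Y j).
  move=> j; have [U [h1 [h2 h3]]] := HO j _ _ (src j); exists U; do 2 split=> //.
  move=> t; apply: Rle_trans (h3 t) _; right.
  have -> : exp (- (e / 2) * Y j) = exp (e / 2 * Y j) * exp (- e * Y j) by rewrite -exp_plus; congr exp; field.
  ring.
pose V j g := dC_iter (U j) g.
have sU j t : is_dC (U j) t (Cminus (Cmult Ci (Fc j 0%N t)) (Cmult (Cmult (Cmult Ci (RtoC (lam j))) (Gd 0 t)) (U j t))).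
  exact: proj1 (HU j) t.
have dV j g t : is_dC (V j g) t (V j g.+1 t).
  exact: (dC_iter_deriv (lam j) Gd (Fc j) (U j) Gd_deriv (dF j) (sU j)).
have [sb [Cb [Kb [sb1 [Cb1 [Kb0 HG]]]]]] := Gd_bound.
(* The Gevrey order of the solution: that of f, that of b, and m mu for the powers of lam j produced
   by differentiating the equation. *)
pose s := Rmax sigma (Rmax sb (INR m * mu)).
have ss : sigma <= s by apply: Rmax_l.
have sbs : sb <= s by apply: Rle_trans (Rmax_r _ _); apply: Rmax_l.
have ms : INR m * mu <= s by apply: Rle_trans (Rmax_r _ _); apply: Rmax_r.
pose cc := Rmax DF Cb.
have cF : DF <= cc by apply: Rmax_l.
have cb : Cb <= cc by apply: Rmax_r.
have up X k s' : 1 <= X -> X <= cc -> s' <= s -> X ^ k * fpow k s' <= cc ^ k * fpow k s.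
  move=> x1 xc hs; apply: Rmult_le_compat; [by apply: pow_le; lra | by left; exact: fpow_pos | by apply: pow_incr; lra |].
  exact: fpow_exp_le.
have [DW DW1 HW] := gevrey_sum_growth (INR m * mu) (e / 4) mmu (ltac:(lra)).
pose D' := 2 * cc + 2 * Kb + 1.
have D'1 : 1 <= D' by rewrite /D'; lra.
have bV j g t : Cmod (V j g t) <= KF * (1 + KO) * ((D' * DW) ^ g * fpow g s) * exp (- (e / 4) * Y j).
  set B := KF * (1 + KO) * exp (- (e / 2) * Y j).
  have ep := exp_pos (- (e / 2) * Y j).
  have KK : 0 <= KF * (1 + KO) by apply: Rmult_le_pos; lra.
  have KK2 : 0 <= KF * KO by apply: Rmult_le_pos; lra.
  have B0 : 0 <= B by apply: Rmult_le_pos; lra.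
  have y1 := Y1 j.
  have h := dC_iter_bound (lam j) Gd (Fc j) (U j) Gd_deriv (dF j) (sU j) s cc Kb D' B.
  have {}h : Cmod (dC_iter (U j) g t) <= B * D' ^ g * (fpow g s * gevrey_sum (lam j) s g).
    apply: h; try lra; try by rewrite /D'; lra.
    - by move=> k r; apply: Rle_trans (HG k r) _; apply: Rmult_le_compat_l => //; apply: up.
    - move=> k r; apply: Rle_trans (bF j k r) _.
      have ee : exp (- e * Y j) <= exp (- (e / 2) * Y j) by apply: exp_incr; nra.
      have u1 := up DF k sigma DF1 cF ss.
      have q0 : 0 <= DF ^ k * fpow k sigma by apply: Rmult_le_pos; [apply: pow_le; lra | left; exact: fpow_pos].
      have KFle : KF <= KF * (1 + KO) by lra.
      rewrite /B; apply: Rle_trans (_ : _ <= KF * (1 + KO) * (cc ^ k * fpow k s) * exp (- (e / 2) * Y j)) _; last lra.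
      apply: Rmult_le_compat => //; [exact: Rmult_le_pos | by left; exact: exp_pos |].
      exact: Rmult_le_compat.
    move=> r; apply: Rle_trans (proj2 (proj2 (HU j)) r) _; rewrite /B; apply: Rmult_le_compat_r; lra.
  apply: Rle_trans h _.
  have w := HW (lam j) s g ms; rewrite -/(decay_rate m mu lam j) -/(Y j) in w.
  rewrite Rpow_mult_distr.
  have -> : exp (- (e / 4) * Y j) = exp (- (e / 2) * Y j) * exp (e / 4 * Y j) by rewrite -exp_plus; congr exp; field.
  have q0 : 0 <= B * D' ^ g * fpow g s.
    by apply: Rmult_le_pos; [apply: Rmult_le_pos => //; apply: pow_le; lra | left; exact: fpow_pos].
  have := Rmult_le_compat_l _ _ _ q0 w; rewrite /B; lra.
have KV0 : 0 <= KF * (1 + KO) by apply: Rmult_le_pos; lra.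
have DV1 : 1 <= D' * DW by rewrite -(Rmult_1_l 1); apply: Rmult_le_compat; lra.
have mu0 : 0 <= mu by lra.
have [K1 [D1 [K10 [D11 HV]]]] := source_words (e / 4) V _ _ s (ltac:(lra)) KV0 DV1 bV.
have [K2 [D2 [K20 [D21 HFw]]]] := source_words e Fc _ _ sigma e0 KF0 DF1 bF.
pose q e' j := exp (- (e' / 2) * Y j).
have q0 e' j : 0 <= q e' j by left; exact: exp_pos.
have qs e' : 0 < e' -> ex_series (q e') by move=> e'0; apply: ex_series_exp_Y; lra.
have qs1 := qs (e / 4) (ltac:(lra)); have qs2 := qs e e0.
have fam1 : dominated V (q (e / 4)) phi := dominated_eigenfunctions n V _ phi nphi K1 D1 s mu HV.
exists (eigsum V 0 phi); split.
  exists s; split; first lra.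
  exact: (eigsum_S_sm n V (q (e / 4)) phi (q0 _) qs1 dV nphi K1 D1 s mu K10 D11 mu0 HV (fun j => proj1 (proj2 (HU j)))).
move=> t x.
(* The equation holds coefficient by coefficient, so f itself has to be replaced by its
   expansion. *)
have ex : eigsum Fc 0 phi t x = f t x.
  have nf : nice (f t) by rewrite -(tder0 f t); apply: (nice_tder f sigma mu).
  exact: (expansion n Fc (q e) phi K2 D2 sigma mu (q0 _) qs2 dF nphi K20 D21 mu0 HFw on compl t (f t) nf
    (fun k => esym (F0 k t))).
rewrite -ex /Lop (is_pd_unique _ _ _ _ (is_pd_flat_t n V _ (q0 _) qs1 dV 0 phi _ fam1)) flat_tx.
rewrite (eigsum_Pop n V _ (q0 _) qs1 dV) //.
(* The unbounded factor lam j is harmless: lam j phi_j is P phi_j, a fixed combination of words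
   applied to phi_j. *)
have fam2 : dominated V (q (e / 4)) (fun j => cscal (RtoC (lam j)) (phi j)).
  have e1 : (fun j => cscal (RtoC (lam j)) (phi j)) = (fun j => Pop c m (phi j)) by apply: fext => j; rewrite Peig.
  have e2 : (fun j => Pop c m (phi j)) = (fun j => lsum (ple m) (pcoef c m) (fun z => zw (pword m z) (phi j))).
    by apply: fext => j; rewrite Pop_lsum //; exact: nice_smooth.
  rewrite e1 e2; exact: (dominated_lsum n).
have -> : (fun j => Pop c m (phi j)) = (fun j => cscal (RtoC (lam j)) (phi j)) by apply: fext => j; rewrite Peig.
have [M1 HM1] := dominated_bound n V _ phi 1 fam1; have [M2 HM2] := dominated_bound n V _ _ 0 fam2.
rewrite /eigsum -(Cseries_scal _ qs1 _ _ M1) // -(Cseries_scal _ qs1 _ _ M2) //.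
rewrite -(Cseries_plus _ qs1 _ _ (Rmax (Cmod (Copp Ci) * M1) (Cmod (a0, b t) * M2))).
- congr Cseries; apply: fext => j.
  have -> : V j 1%N t = Cminus (Cmult Ci (Fc j 0%N t)) (Cmult (Cmult (Cmult Ci (RtoC (lam j))) (Gd 0 t)) (U j t)).
    exact: dC_unique (sU j t).
  rewrite /cscal /V /= /Gd; move: (Fc j 0%N t) (phi j x) (U j t) (RtoC (lam j)) (a0, b t) => F p u l g.
  (* Once U' is replaced by its equation, the terms containing a0 + i b carry the factor 1 + i^2 and
     cancel, leaving - i^2 times the source. *)
  have i2 := Ci2; transitivity (Cplus (Cmult (Copp (Cmult Ci Ci)) (Cmult F p)) (Cmult (Cplus (RtoC 1) (Cmult Ci Ci)) (Cmult g (Cmult u (Cmult l p))))).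
    ring.
  by rewrite i2; apply: C_ext; rewrite /=; ring.
- move=> j; rewrite Cmod_mult; apply: Rle_trans (_ : _ <= Cmod (Copp Ci) * (M1 * q (e / 4) j)) _.
    by apply: Rmult_le_compat_l; [exact: Cmod_ge_0 | exact: HM1].
  by rewrite -Rmult_assoc; apply: Rmult_le_compat_r; [exact: q0 | exact: Rmax_l].
move=> j; rewrite Cmod_mult; apply: Rle_trans (_ : _ <= Cmod (a0, b t) * (M2 * q (e / 4) j)) _.
  by apply: Rmult_le_compat_l; [exact: Cmod_ge_0 | exact: HM2].
by rewrite -Rmult_assoc; apply: Rmult_le_compat_r; [exact: q0 | exact: Rmax_r].
Qed.

Lemma ode_uniform K : 0 <= K -> (forall j, ode_ok a0 b lam j K) ->
  forall e, 0 < e -> exists2 K, 0 <= K & forall j, ode_ok a0 b lam j (K * exp (e * Y j)).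
Proof.
move=> K0 H e e0; exists K => // j; apply: ode_ok_mono (H j); rewrite -{1}(Rmult_1_r K).
apply: Rmult_le_compat_l => //; apply: exp_ge1; apply: Rmult_le_pos; [lra | have := Y1 j; lra].
Qed.
End Main.

Theorem theorem4p1 (n m : nat) (c : mindex n -> mindex n -> R) (mu a0 : R)
  (b : R -> R) (lam : nat -> R) (phi : nat -> Pt n -> C) :
  (1 <= n)%N -> 1 / 2 <= mu -> (2 <= m)%N ->
  globally_elliptic c m -> self_adjoint c m ->
  (* (lam j, phi j), j : nat standing for the paper's index j+1, is the complete
     orthonormal system of eigenpairs of P *)
  (forall j, schwartz (phi j)) ->
  (forall j x, Pop c m (phi j) x = Cmult (RtoC (lam j)) (phi j x)) ->
  (forall j k, inner (phi j) (phi k) = RtoC (if j == k then 1 else 0)) ->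
  (forall g, schwartz g -> (forall j, inner g (phi j) = RtoC 0) ->
     forall x, g x = RtoC 0) ->
  (exists rho, 0 < rho /\
     is_lim_seq (fun j => Rabs (lam j) / (rho * Rpower (INR j.+1) (INR m / (2 * INR n)))) 1) ->
  gevrey_T b ->
  (* (a) *)
  ((forall t, b t = 0) /\ condA n mu lam (RtoC a0)) \/
  (* (b) *)
  ((exists t, b t <> 0) /\ ((forall t, 0 <= b t) \/ (forall t, b t <= 0))) \/
  (* (c) *)
  ((exists t1 t2, b t1 < 0 /\ 0 < b t2) /\
   (exists N, forall j, ~ inZset lam a0 b j -> (j < N)%N) /\
   (forall r, connectedT (Omega b r))) ->
  globally_solvable c m mu lam phi a0 b.
Proof.
move=> n1 hm m2 ell sa sphi eig on compl weyl gb cases.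
apply: (solvable_of_ode n m c mu a0 b lam phi n1 hm m2 ell sa sphi eig on compl weyl gb).
have cb := b_cont b gb; have pb := b_per b gb; have bb := b_bounded b gb.
case: cases => [[b0 cA]|[[b1 sgn]|[_ [fin conn]]]].
- exact: (case_a n m mu a0 b lam n1 hm m2 weyl cb pb b0 cA).
- have [K K0 HK] := case_b n m a0 b lam n1 m2 weyl cb pb bb b1 sgn.
  exact: (ode_uniform n m mu a0 b lam n1 hm m2 K K0 HK).
have [K K0 HK] := case_c n m a0 b lam n1 m2 weyl cb pb bb fin conn.
exact: (ode_uniform n m mu a0 b lam n1 hm m2 K K0 HK).
Qed.
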